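(* Assume: (1) $x_{10},\dots,x_{N0}$ are mutually independent with common mean $\bar x_0$, $\max_{1\le i\le N}\mathbb E\|x_{i0}\|^2<C_0$ with $C_0$ independent of $N$, and $\{x_{i0}\}$, $\{W_i\}$ are independent of each other; (2) $(A-\frac\rho2I,B)$ and $(A+G-\frac\rho2I,B)$ are stabilizable; (3) $Q\ge0$, $(A-\frac\rho2I,\sqrt Q)$ is observable and $(A+G-\frac\rho2I,\sqrt Q(I-\Gamma))$ is observable; (4) $A-BR^{-1}B^TP+G-\frac\rho2I$ is Hurwitz, where $P$ is the positive definite solution of $\rho P=A^TP+PA-PBR^{-1}B^TP+Q$. Then the set of decentralized control laws $\hat u=(\hat u_1,\dots,\hat u_N)$, $$\hat u_i(t)=-R^{-1}B^T[P\hat x_i(t)+(\Pi-P)\bar x(t)+s(t)],\quad t\ge0,$$ (with $\Pi,s,\bar x,\hat x_i$ as defined in the context) has asymptotic social optimality, i.e., as $N\to\infty$, $$\Big|\frac1NJ_{\rm soc}(\hat u)-\frac1N\inf_{u\in\mathcal U_c}J_{\rm soc}(u)\Big|=O\Big(\frac1{\sqrt N}\Big).$$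
   Context: $N$ is the number of agents, $\rho>0$ a discount constant. $A,G,\Gamma,Q\in\mathbb R^{n\times n}$, $B\in\mathbb R^{n\times r}$, $R\in\mathbb R^{r\times r}$, $\eta\in\mathbb R^n$ are constant (independent of $N$), $Q,R$ symmetric, $R>0$. $C_{\rho/2}([0,\infty),\mathbb R^n)$ is the set of continuous $g:[0,\infty)\to\mathbb R^n$ with $\int_0^\infty e^{-\rho t}\|g(t)\|^2dt<\infty$; $f,\sigma\in C_{\rho/2}([0,\infty),\mathbb R^n)$. $W_1,W_2,\dots$ are independent one-dimensional Brownian motions. Agent $i$: $dx_i=[Ax_i+Bu_i+Gx^{(N)}+f]dt+\sigma dW_i$, $x_i(0)=x_{i0}$, $x^{(N)}=\frac1N\sum_{j=1}^Nx_j$. Costs (with $\|z\|_M^2=z^TMz$): $J_i(u)=\mathbb E\int_0^\infty e^{-\rho t}\{\|x_i-\Gamma x^{(N)}-\eta\|_Q^2+\|u_i\|_R^2\}dt$, $J_{\rm soc}(u)=\sum_{i=1}^NJ_i(u)$. $\mathcal F_t=\sigma\big(\bigcup_{i=1}^N\mathcal F^i_t\big)$, $\mathcal F^i_t=\sigma(x_{i0},W_i(s),0\le s\le t)$; $\mathcal U_{c}$ is the set of $u=(u_1,\dots,u_N)$ such that each $u_i$ is $\mathcal F_t$-adapted, $\mathbb R^r$-valued, with $\mathbb E\int_0^\infty e^{-\rho t}\|u_i(t)\|^2dt<\infty$. $\Pi$ is the positive definite solution of $\rho\Pi=(A+G)^T\Pi+\Pi(A+G)-\Pi BR^{-1}B^T\Pi+\hat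 Q$ with $\hat Q=(I-\Gamma)^TQ(I-\Gamma)$; $s,\bar x\in C_{\rho/2}([0,\infty),\mathbb R^n)$ are determined by $$\rho s=\dot s+[A+G-BR^{-1}B^T\Pi]^Ts+\Pi f-\bar\eta,\qquad \frac{d\bar x}{dt}=(A+G)\bar x-BR^{-1}B^T(\Pi\bar x+s)+f,\quad \bar x(0)=\bar x_0,$$ with $\bar\eta=Q\eta-\Gamma^TQ\eta$; $\hat x_i$ are the closed-loop states: $d\hat x_i=[A\hat x_i+B\hat u_i+G\hat x^{(N)}+f]dt+\sigma dW_i$, $\hat x_i(0)=x_{i0}$, $\hat x^{(N)}=\frac1N\sum_j\hat x_j$. Hurwitz means all eigenvalues have negative real part. *)

(* Defs.v *)
From HB Require Import structures.
From mathcomp Require Import all_boot all_order all_algebra.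
From mathcomp Require Import all_classical all_reals all_analysis.
From mathcomp Require Import complex.

Set Implicit Arguments.
Unset Strict Implicit.
Unset Printing Implicit Defensive.

Import Order.TTheory GRing.Theory Num.Theory numFieldNormedType.Exports.

Local Open Scope classical_set_scope.
Local Open Scope ring_scope.

Section Matrices.
Context {K : realType}.

(* [qform M z] is z^T M z; the library norm on matrices is the sup norm, so the
   squared Euclidean norm is written [sqn]. *)
Definition qform n (M : 'M[K]_n) (z : 'cV[K]_n) : K := (z^T *m M *m z) 0 0.

Definition sqn n (z : 'cV[K]_n) : K := \sum_(k < n) z k 0 ^+ 2.

Definition posdefmx n (M : 'M[K]_n) : Prop :=
  M^T = M /\ forall z : 'cV[K]_n, z != 0 -> 0 < qform M z.

Definition possemidefmx n (M : 'M[K]_n) : Prop :=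
  M^T = M /\ forall z : 'cV[K]_n, 0 <= qform M z.

Definition is_sqrtmx n (Q S : 'M[K]_n) : Prop :=
  possemidefmx S /\ S *m S = Q.

Definition hurwitz n (M : 'M[K]_n) : Prop :=
  forall z : K[i], eigenvalue (map_mx (real_complex K) M) z ->
    complex.Re z < 0.

Definition stabilizable n r (F : 'M[K]_n) (B : 'M[K]_(n, r)) : Prop :=
  exists L : 'M[K]_(r, n), hurwitz (F + B *m L).

(* The system z' = F z with output y = H z: on some bounded time interval the
   output determines the initial state. *)
Definition observable n p (F : 'M[K]_n) (H : 'M[K]_(p, n)) : Prop :=
  exists2 T : K, 0 < T &
    forall z1 z2 : K -> 'cV[K]_n,
      (forall t : K, is_derive t 1 z1 (F *m z1 t)) ->
      (forall t : K, is_derive t 1 z2 (F *m z2 t)) ->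
      (forall t, 0 <= t <= T -> H *m z1 t = H *m z2 t) ->
      z1 0 = z2 0.

(* rho P = F^T P + P F - P B R^-1 B^T P + M. *)
Definition riccati n r (rho : K) (F : 'M[K]_n) (B : 'M[K]_(n, r))
    (R : 'M[K]_r) (M P : 'M[K]_n) : Prop :=
  rho *: P = F^T *m P + P *m F - P *m B *m invmx R *m B^T *m P + M.

(* C_{rho/2}([0,oo), R^n); values at negative times are irrelevant. *)
Definition Crho2 n (rho : K) (g : K -> 'cV[K]_n) : Prop :=
  {within `[0, +oo[, continuous g} /\
  (\int[lebesgue_measure]_(t in `[0%R, +oo[)
     (expR (- (rho * t)) * sqn (g t))%:E < +oo)%E.

End Matrices.

Section Probability.
Context {K : realType} {d : measure_display} {T : measurableType d}.
Variable P : probability T K.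

Definition sigma_rv (J : Type) (D : set J) (X : J -> T -> K) : set_system T :=
  <<s \bigcup_(j in D) preimage_set_system setT (X j) measurable >>.

Definition mutually_independent (I : eqType) (F : I -> set_system T) : Prop :=
  forall (s : seq I) (E : I -> set T), uniq s ->
    (forall i, i \in s -> F i (E i)) ->
    P (\bigcap_(i in [set` s]) E i) = (\prod_(i <- s) P (E i))%E.

Definition independent2 (F G : set_system T) : Prop :=
  forall E1 E2 : set T, F E1 -> G E2 -> P (E1 `&` E2) = (P E1 * P E2)%E.

(* Second argument of [normal_prob]: the standard deviation. *)
Definition brownian_motion (W : K -> T -> K) : Prop :=
  [/\ forall t, 0 <= t -> measurable_fun setT (W t),
      {ae P, forall w, W 0 w = 0},
      forall w, {within `[0, +oo[, continuous (fun t => W t w)},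
      forall s t, 0 <= s < t -> forall E : set K, measurable E ->
        P ((fun w => W t w - W s w) @^-1` E)
        = normal_prob 0 (Num.sqrt (t - s)) E &
      forall (m : nat) (tau : nat -> K), 0 <= tau 0%N ->
        (forall j, (j < m)%N -> tau j <= tau j.+1) ->
        mutually_independent (fun j : 'I_m =>
          sigma_rv [set: unit] (fun _ w => W (tau j.+1) w - W (tau j) w))].

Definition measurable_process n (X : K -> T -> 'cV[K]_n) : Prop :=
  forall k : 'I_n, measurable_fun (`[(0 : K), +oo[ `*` [set: T])
    (fun p : K * T => X p.1 p.2 k 0).

(* A list of triples (a, b, c) encodes the step function
   \sum 1_{]a, b]} c; its integral against W is \sum (W b - W a) c. *)
Definition step_fun n (phi : seq (K * K * 'cV[K]_n)) (s : K) : 'cV[K]_n :=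
  \sum_(p <- phi) (\1_(`]p.1.1, p.1.2]) s : K) *: p.2.

Definition step_integral n (W : K -> T -> K) (phi : seq (K * K * 'cV[K]_n))
    (w : T) : 'cV[K]_n :=
  \sum_(p <- phi) (W p.1.2 w - W p.1.1 w) *: p.2.

(* [Y] is (a version of) the Ito integral of the deterministic function sigma
   against W over [0, t]: the L^2(P)-limit of the integrals of any step
   functions which converge to sigma in L^2([0, t]). As sigma is
   deterministic, deterministic step functions suffice. *)
Definition ito_integral n (W : K -> T -> K) (sigma : K -> 'cV[K]_n) (t : K)
    (Y : T -> 'cV[K]_n) : Prop :=
  forall phi : nat -> seq (K * K * 'cV[K]_n),
    (forall m p, p \in phi m -> 0 <= p.1.1 <= p.1.2 /\ p.1.2 <= t) ->
    ((fun m => \int[lebesgue_measure]_(s in `[0%R, t])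
                 (sqn (sigma s - step_fun (phi m) s))%:E)%E
       @ \oo --> 0%E) ->
    ((fun m => \int[P]_w (sqn (Y w - step_integral W (phi m) w))%:E)%E
       @ \oo --> 0%E).

End Probability.

(* Agents 1, ..., N are indexed by i : 'I_N, i.e. from 0; their initial states
   and Brownian motions are the first N terms of the sequences x0 and W. *)
Section Agents.
Context {K : realType} {d : measure_display} {T : measurableType d}.
Variable P : probability T K.
Context {n r : nat}.
Variables (x0 : nat -> T -> 'cV[K]_n) (W : nat -> K -> T -> K).

Definition sigma_init (i : nat) : set_system T :=
  sigma_rv [set: 'I_n] (fun k w => x0 i w k 0).

Definition agent_filtration (i : nat) (t : K) : set_system T :=
  <<s sigma_init i `|` sigma_rv `[0, t] (W i) >>.

Definition filtration (N : nat) (t : K) : set_system T :=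
  <<s \bigcup_(i in `I_N) agent_filtration i t >>.

Definition mean_state N (x : 'I_N -> K -> T -> 'cV[K]_n) (t : K) (w : T) :
    'cV[K]_n := N%:R^-1 *: \sum_(j < N) x j t w.

(* The class U_c. Besides adaptedness, u_i is jointly measurable in (t, w), as
   the double integral requires. *)
Definition admissible (rho : K) N (u : 'I_N -> K -> T -> 'cV[K]_r) : Prop :=
  forall i : 'I_N,
  [/\ measurable_process (u i),
      forall t, 0 <= t -> forall (k : 'I_r) (E : set K), measurable E ->
        filtration N t ((fun w => u i t w k 0) @^-1` E) &
      (\int[P]_w \int[lebesgue_measure]_(t in `[0%R, +oo[)
         (expR (- (rho * t)) * sqn (u i t w))%:E < +oo)%E].

Definition drift (A G : 'M[K]_n) (B : 'M[K]_(n, r)) (f : K -> 'cV[K]_n) N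
    (u : 'I_N -> K -> T -> 'cV[K]_r) (x : 'I_N -> K -> T -> 'cV[K]_n)
    (i : 'I_N) (t : K) (w : T) : 'cV[K]_n :=
  A *m x i t w + B *m u i t w + G *m mean_state x t w + f t.

(* x solves dx_i = [A x_i + B u_i + G x^(N) + f] dt + sigma dW_i,
   x_i(0) = x_i0, in integrated form: a.s. for every t,
   x_i(t) - x_i0 - \int_0^t drift ds = \int_0^t sigma dW_i.
   At t = 0 this gives x_i(0) = x_i0 a.s. *)
Definition state_process (A G : 'M[K]_n) (B : 'M[K]_(n, r))
    (f sigma : K -> 'cV[K]_n) N
    (u : 'I_N -> K -> T -> 'cV[K]_r) (x : 'I_N -> K -> T -> 'cV[K]_n) : Prop :=
  [/\ forall i, measurable_process (x i),
      {ae P, forall w, forall i : 'I_N,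
        {within `[0, +oo[, continuous (fun t => x i t w)}},
      {ae P, forall w, forall (i : 'I_N) (t : K) (k : 'I_n), 0 <= t ->
        lebesgue_measure.-integrable `[0, t]
          (fun s => (drift A G B f u x i s w k 0)%:E)} &
      forall (i : 'I_N) (t : K), 0 <= t ->
        ito_integral P (W i) sigma t (fun w =>
          x i t w - x0 i w -
          \col_k (\int[lebesgue_measure]_(s in `[0, t])
                    drift A G B f u x i s w k 0))].

Definition agent_cost (rho : K) (Q Gam : 'M[K]_n) (R : 'M[K]_r)
    (eta : 'cV[K]_n) N (u : 'I_N -> K -> T -> 'cV[K]_r)
    (x : 'I_N -> K -> T -> 'cV[K]_n) (i : 'I_N) : \bar K :=
  (\int[P]_w \int[lebesgue_measure]_(t in `[0%R, +oo[)
    (expR (- (rho * t)) *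
       (qform Q (x i t w - Gam *m mean_state x t w - eta)
        + qform R (u i t w)))%:E)%E.

Definition social_cost (rho : K) (Q Gam : 'M[K]_n) (R : 'M[K]_r)
    (eta : 'cV[K]_n) N (u : 'I_N -> K -> T -> 'cV[K]_r)
    (x : 'I_N -> K -> T -> 'cV[K]_n) : \bar K :=
  (\sum_(i < N) agent_cost rho Q Gam R eta u x i)%E.

(* inf over U_c of J_soc. The state driven by a given control is unique up to
   indistinguishability, so the cost depends on u only. *)
Definition inf_social_cost (rho : K) (A G Gam Q : 'M[K]_n) (B : 'M[K]_(n, r))
    (R : 'M[K]_r) (eta : 'cV[K]_n) (f sigma : K -> 'cV[K]_n) (N : nat) :
    \bar K :=
  ereal_inf [set c | exists (u : 'I_N -> K -> T -> 'cV[K]_r)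
                            (x : 'I_N -> K -> T -> 'cV[K]_n),
    [/\ admissible rho u, state_process A G B f sigma u x &
        c = social_cost rho Q Gam R eta u x]].

Definition decentralized_law (B : 'M[K]_(n, r)) (R : 'M[K]_r)
    (Pm Pi : 'M[K]_n) (xbar s : K -> 'cV[K]_n) N
    (x : 'I_N -> K -> T -> 'cV[K]_n) (i : 'I_N) (t : K) (w : T) : 'cV[K]_r :=
  - (invmx R *m B^T *m (Pm *m x i t w + (Pi - Pm) *m xbar t + s t)).

End Agents.

(* Main.v *)
Require Import Defs.
From HB Require Import structures.
From mathcomp Require Import all_boot all_order all_algebra.
From mathcomp Require Import all_classical all_reals all_analysis.
From mathcomp Require Import complex.
From mathcomp Require Import measurable_realfun spectral ring lra.

Set Implicit Arguments.
Unset Strict Implicit.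
Unset Printing Implicit Defensive.

Import Order.TTheory GRing.Theory Num.Theory numFieldNormedType.Exports.

Local Open Scope classical_set_scope.
Local Open Scope ring_scope.

(** Every admissible control [u] is compared with the decentralized one by duality. Let
    del_i = x_i - xhat_i and p_i = P xhat_i + (Pi - P) xbar + s. Then J_soc(u) - J_soc(uhat)
    is a nonnegative quadratic functional of (del_i, u_i - uhat_i), plus
    2 N E int e^(-rho t) <M e, del^(N)> with e = xhat^(N) - xbar and M = Qhat - Q + P G + G^T P,
    minus twice the integrated rates of change of e^(-rho t) E <p_i, del_i>, which sum to zero
    because del_i starts at 0 and carries no noise. By independence of the agents and the
    Hurwitz condition, E int e^(-rho t) |e|^2 = O(1/N), and detectability bounds del^(N) by the
    quadratic functional, so that J_soc(u) >= J_soc(uhat) - O(1): this even gives the rate 1/N.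

    No Ito formula is needed: sigma is deterministic, so a state is an absolutely continuous
    process plus a noise whose covariance is explicit, and second moments of such sums are
    computed by Fubini and the orthogonality of drifts to later increments of the Brownian motions.

    The given uhat is only equal almost surely to an adapted control. An adapted version of xhat is
    obtained as an almost sure limit of Euler schemes, then made progressive by piecewise constant
    interpolation from the left. *)

(** * Integrals and inner products of real functions *)

(** The obstacle is that Q is only semidefinite, so a finite cost does not by itself bound the
    states of a competing control, while the duality identity passes to an infinite horizon only if
    every factor lies in the discounted L2 space. Integrability is therefore gained in a fixed
    order, each time from a Lyapunov form and Fatou's lemma: the error e (Hurwitz condition), then
    each xhat_i with e as an input, then del^(N), whose averaged equation is closed and whose output
    sqrt(Q) (I - Gamma) del^(N) has finite energy, and last each del_i. The Lyapunov forms come from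
    a weighted Schur basis for a Hurwitz matrix, from a Lyapunov equation with a shifted matrix for
    an observable pair, and, for A - B R^-1 B^T P, from such a form plus a large multiple of P. That
    del_i carries no noise rests on uniqueness: the noise of every state is a version of the same
    Ito integral. In the cross term N <M e, del^(N)>, Young's inequality charges a small multiple of
    N |del^(N)|^2 to the quadratic functional, and what remains is N times O(1/N). *)

Section RealIntegral.
Context {d : measure_display} {T : measurableType d} {R : realType}.
Variable mu : {measure set T -> \bar R}.
Implicit Types f g : T -> R.

Definition intg f := mu.-integrable setT (EFin \o f).

Lemma intg_meas f : intg f -> measurable_fun setT f.
Proof. by move=> /measurable_int/measurable_EFinP. Qed.

Lemma intgD f g : intg f -> intg g -> intg (fun x => f x + g x).
Proof. by move=> hf hg; apply: eq_integrable (integrableD measurableT hf hg). Qed.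

Lemma intgZ c f : intg f -> intg (fun x => c * f x).
Proof. by move=> hf; apply: eq_integrable (integrableZl measurableT c hf). Qed.

Lemma intgN f : intg f -> intg (fun x => - f x).
Proof. by move=> hf; apply: eq_integrable (integrableN hf). Qed.

Lemma intgB f g : intg f -> intg g -> intg (fun x => f x - g x).
Proof. by move=> hf /intgN; exact: intgD. Qed.

Lemma intg0 : intg (fun=> 0).
Proof. exact: integrable0. Qed.

Lemma intg_sum (I : Type) (s : seq I) (Q : pred I) (h : I -> T -> R) :
  (forall i, Q i -> intg (h i)) -> intg (fun x => \sum_(i <- s | Q i) h i x).
Proof.
move=> H; apply: eq_integrable (integrable_sum measurableT s H) => //.
by move=> x _; rewrite /= sumEFin.
Qed.

Lemma intg_le f g : measurable_fun setT f -> (forall x, `|f x| <= g x) ->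
  intg g -> intg f.
Proof.
move=> mf fg; apply: le_integrable => //; first exact/measurable_EFinP.
by move=> x _ /=; rewrite lee_fin (le_trans (fg x))// ler_norm.
Qed.

Lemma intg_abs f : intg f -> intg (fun x => `|f x|).
Proof. by move=> hf; apply: eq_integrable (integrable_abse hf). Qed.

Lemma intg_ae f g : measurable_fun setT g -> {ae mu, forall x, f x = g x} ->
  intg f -> intg g.
Proof.
move=> mg fg hf; apply/integrableP; split; first exact/measurable_EFinP.
move/integrableP: (hf) => [mf]; apply: le_lt_trans.
rewrite (@ae_eq_integral _ _ _ _ _ (abse \o (EFin \o f)) (abse \o (EFin \o g)))//.
- by apply: measurableT_comp => //; exact/measurable_EFinP.
- by apply: measurableT_comp.
- by apply: filterS fg => x /= -> _.
Qed.

(** The truncation of [f] to [- g, g] is dominated by [|g|] everywhere, also on the null set where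
    [g] is negative, and equals [f] almost everywhere. *)
Lemma intg_le_ae f g : measurable_fun setT f -> {ae mu, forall x, `|f x| <= g x} ->
  intg g -> intg f.
Proof.
move=> mf fg hg; have mg := intg_meas hg; apply: (@intg_ae (fun x => Num.min (Num.max (- g x) (f x)) (g x))) => //.
- apply: filterS fg => x; rewrite ler_norml => /andP[h1 h2].
  by rewrite max_r// min_l.
- apply: (@intg_le _ (fun x => `|g x|)).
  + by apply: measurable_minr => //; apply: measurable_maxr => //; exact: measurable_funN.
  + move=> x; case: (lerP 0 (g x)) => g0.
      rewrite (ger0_norm g0) ler_norml; apply/andP; split; last by rewrite ge_min lexx orbT.
      by rewrite le_min le_max lexx/= (le_trans _ g0)// oppr_le0.
    rewrite min_r// le_max; apply/orP; left; lra.
  + by apply: eq_integrable (integrable_abse hg).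
Qed.

Lemma intE_D f g : intg f -> intg g ->
  \int[mu]_x (f x + g x) = \int[mu]_x f x + \int[mu]_x g x.
Proof. exact: RintegralD. Qed.

Lemma intE_Z c f : intg f -> \int[mu]_x (c * f x) = c * \int[mu]_x f x.
Proof. exact: RintegralZl. Qed.

Lemma intE_B f g : intg f -> intg g ->
  \int[mu]_x (f x - g x) = \int[mu]_x f x - \int[mu]_x g x.
Proof. exact: RintegralB. Qed.

Lemma intE_0 : \int[mu]_x (0 : R) = 0.
Proof. by rewrite /Rintegral integral0. Qed.

Lemma intE_sum (I : Type) (s : seq I) (h : I -> T -> R) :
  (forall i, intg (h i)) ->
  \int[mu]_x (\sum_(i <- s) h i x) = \sum_(i <- s) \int[mu]_x h i x.
Proof.
move=> H; elim: s => [|i s IH].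
  by rewrite big_nil -[RHS]intE_0; apply: eq_Rintegral => x _; rewrite big_nil.
rewrite big_cons -IH -intE_D//; last exact: intg_sum.
by apply: eq_Rintegral => x _; rewrite big_cons.
Qed.

Lemma intE_le f g : intg f -> intg g -> (forall x, f x <= g x) ->
  \int[mu]_x f x <= \int[mu]_x g x.
Proof. by move=> hf hg fg; apply: le_Rintegral. Qed.

Lemma intE_ae f g : measurable_fun setT f -> measurable_fun setT g ->
  {ae mu, forall x, f x = g x} -> \int[mu]_x f x = \int[mu]_x g x.
Proof.
move=> mf mg fg; congr fine; apply: ae_eq_integral => //;
  [exact/measurable_EFinP|exact/measurable_EFinP|].
by apply: filterS fg => x /= -> _.
Qed.

Lemma intE_EFin f : intg f -> (\int[mu]_x (f x)%:E)%E = (\int[mu]_x f x)%:E.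
Proof. by move=> hf; rewrite /Rintegral fineK//; apply: integrable_fin_num. Qed.

Lemma intE_ge0 f : (forall x, 0 <= f x) -> 0 <= \int[mu]_x f x.
Proof. by move=> hf; exact: Rintegral_ge0. Qed.

Lemma intE_abs f : intg f -> `|\int[mu]_x f x| <= \int[mu]_x `|f x|.
Proof. by move=> hf; exact: le_normr_Rintegral. Qed.

Lemma intg_ge0P f : measurable_fun setT f -> (forall x, 0 <= f x) ->
  (\int[mu]_x (f x)%:E < +oo)%E -> intg f.
Proof.
move=> mf f0 fi; apply/integrableP; split; first exact/measurable_EFinP.
rewrite (eq_integral (fun x => (f x)%:E))// => x _ /=.
by rewrite ger0_norm.
Qed.

Lemma intE_eq0 f : intg f -> (forall x, 0 <= f x) -> \int[mu]_x f x = 0 ->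
  {ae mu, forall x, f x = 0}.
Proof.
move=> hf f0 h0.
have mf : measurable_fun setT (EFin \o f) by exact/measurable_EFinP/intg_meas.
have := @ae_eq_integral_abs _ _ _ mu setT measurableT _ mf.
have -> : (\int[mu]_x `|(EFin \o f) x|)%E = 0%E.
  rewrite -[RHS]/(0%R%:E) -h0 -intE_EFin//; apply: eq_integral => x _ /=.
  by rewrite ger0_norm.
move=> [+ _] => /(_ erefl); apply: filterS => x /= /(_ I) [].
by [].
Qed.

Definition L2 f := measurable_fun setT f /\ intg (fun x => f x ^+ 2).

Lemma L2M f g : L2 f -> L2 g -> intg (fun x => f x * g x).
Proof.
move=> [mf hf] [mg hg]; apply: (@intg_le _ (fun x => f x ^+ 2 + g x ^+ 2)).
- exact: measurable_funM.
- move=> x; rewrite normrM -[f x ^+ 2]real_normK ?num_real//.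
  rewrite -[g x ^+ 2]real_normK ?num_real//; nra.
- exact: intgD.
Qed.

Lemma L2P f : measurable_fun setT f -> (\int[mu]_x (f x ^+ 2)%:E < +oo)%E -> L2 f.
Proof.
move=> mf hf; split=> //; apply: intg_ge0P => //; first exact: measurable_funX.
by move=> x; exact: sqr_ge0.
Qed.

Lemma L2_le f g : measurable_fun setT f -> (forall x, `|f x| <= g x) -> L2 g -> L2 f.
Proof.
move=> mf fg [mg hg]; split=> //; apply: intg_le hg; first exact: measurable_funX.
move=> x; rewrite normrX lerXn2r ?nnegrE//.
by rewrite (le_trans _ (fg x)).
Qed.

Lemma L2D f g : L2 f -> L2 g -> L2 (fun x => f x + g x).
Proof.
move=> [mf hf] [mg hg]; split; first exact: measurable_funD.
apply: (@intg_le _ (fun x => 2 * (f x ^+ 2 + g x ^+ 2))).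
- by apply: measurable_funX; exact: measurable_funD.
- move=> x; rewrite ger0_norm ?sqr_ge0//.
  have := sqr_ge0 (f x - g x); rewrite !expr2; nra.
- by apply: intgZ; exact: intgD.
Qed.

Lemma L2Z c f : L2 f -> L2 (fun x => c * f x).
Proof.
move=> [mf hf]; split; first exact: measurable_funM.
under eq_fun do rewrite exprMn; exact: intgZ.
Qed.

Lemma L2N f : L2 f -> L2 (fun x => - f x).
Proof. by move=> /(L2Z (-1)); under eq_fun do rewrite mulN1r. Qed.

Lemma L2B f g : L2 f -> L2 g -> L2 (fun x => f x - g x).
Proof. by move=> hf /L2N; exact: L2D. Qed.

Lemma L2_0 : L2 (fun=> 0).
Proof. split => //; under eq_fun do rewrite expr0n/=; exact: intg0. Qed.

Lemma L2_sum (I : Type) (s : seq I) (Q : pred I) (h : I -> T -> R) :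
  (forall i, Q i -> L2 (h i)) -> L2 (fun x => \sum_(i <- s | Q i) h i x).
Proof.
move=> H; elim: s => [|i s IH].
  by under eq_fun do rewrite big_nil; exact: L2_0.
case Qi: (Q i); last by under eq_fun do rewrite big_cons Qi.
by under eq_fun do rewrite big_cons Qi; apply: L2D => //; exact: H.
Qed.

Lemma L2_abs f : L2 f -> L2 (fun x => `|f x|).
Proof.
move=> hf; split; first by apply: measurableT_comp => //; case: hf.
under eq_fun do rewrite real_normK ?num_real//; by case: hf.
Qed.

Lemma L2_ae f g : measurable_fun setT g -> {ae mu, forall x, f x = g x} ->
  L2 f -> L2 g.
Proof.
move=> mg fg [mf hf]; split => //; apply: intg_ae hf; first exact: measurable_funX.
by apply: filterS fg => x ->.
Qed.

Definition ip f g := \int[mu]_x (f x * g x).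

Lemma ipC f g : ip f g = ip g f.
Proof. by apply: eq_Rintegral => x _; rewrite mulrC. Qed.

Lemma ipDl f g h : L2 f -> L2 g -> L2 h ->
  ip (fun x => f x + g x) h = ip f h + ip g h.
Proof.
move=> hf hg hh; rewrite /ip -intE_D; [|exact: L2M|exact: L2M].
by apply: eq_Rintegral => x _; rewrite mulrDl.
Qed.

Lemma ipZl c f h : L2 f -> L2 h -> ip (fun x => c * f x) h = c * ip f h.
Proof.
move=> hf hh; rewrite /ip -intE_Z; last exact: L2M.
by apply: eq_Rintegral => x _; rewrite mulrA.
Qed.

Lemma ipBl f g h : L2 f -> L2 g -> L2 h ->
  ip (fun x => f x - g x) h = ip f h - ip g h.
Proof.
move=> hf hg hh; rewrite /ip -intE_B; [|exact: L2M|exact: L2M].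
by apply: eq_Rintegral => x _; rewrite mulrBl.
Qed.

Lemma ip_suml (I : Type) (s : seq I) (h : I -> T -> R) g :
  (forall i, L2 (h i)) -> L2 g ->
  ip (fun x => \sum_(i <- s) h i x) g = \sum_(i <- s) ip (h i) g.
Proof.
move=> H hg; rewrite /ip -intE_sum; last by move=> i; exact: L2M.
by apply: eq_Rintegral => x _; rewrite mulr_suml.
Qed.

Lemma ipDr f g h : L2 f -> L2 g -> L2 h ->
  ip h (fun x => f x + g x) = ip h f + ip h g.
Proof. by move=> *; rewrite ipC ipDl// ![ip _ h]ipC. Qed.

Lemma ipBr f g h : L2 f -> L2 g -> L2 h ->
  ip h (fun x => f x - g x) = ip h f - ip h g.
Proof. by move=> *; rewrite ipC ipBl// ![ip _ h]ipC. Qed.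

Lemma ipZr c f h : L2 f -> L2 h -> ip h (fun x => c * f x) = c * ip h f.
Proof. by move=> *; rewrite ipC ipZl// ![ip _ h]ipC. Qed.

Lemma ip_sumr (I : Type) (s : seq I) (h : I -> T -> R) g :
  (forall i, L2 (h i)) -> L2 g ->
  ip g (fun x => \sum_(i <- s) h i x) = \sum_(i <- s) ip g (h i).
Proof. by move=> *; rewrite ipC ip_suml//; apply: eq_bigr => i _; rewrite ipC. Qed.

Lemma ip_ae f1 f2 g1 g2 : measurable_fun setT f1 -> measurable_fun setT f2 ->
  measurable_fun setT g1 -> measurable_fun setT g2 ->
  {ae mu, forall x, f1 x = f2 x} -> {ae mu, forall x, g1 x = g2 x} ->
  ip f1 g1 = ip f2 g2.
Proof.
move=> m1 m2 m3 m4 h1 h2; apply: intE_ae; [exact: measurable_funM..|].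
by apply: filterS2 h1 h2 => x -> ->.
Qed.

Lemma ip_ge0 f : 0 <= ip f f.
Proof. by apply: intE_ge0 => x; rewrite -expr2 sqr_ge0. Qed.

Lemma ip_le f g : L2 f -> L2 g -> 2 * `|ip f g| <= ip f f + ip g g.
Proof.
move=> hf hg.
have h1 := ip_ge0 (fun x => f x + g x); have h2 := ip_ge0 (fun x => f x - g x).
have hD := L2D hf hg; have hB := L2B hf hg.
move: h1 h2; rewrite (ipDl hf hg hD) (ipDr hf hg hf) (ipDr hf hg hg).
rewrite (ipBl hf hg hB) (ipBr hf hg hf) (ipBr hf hg hg) [ip g f]ipC => h1 h2.
by case: (ger0P (ip f g)) => _; lra.
Qed.

Lemma ip_le_eps e f g : 0 < e -> L2 f -> L2 g ->
  2 * `|ip f g| <= e * ip f f + e^-1 * ip g g.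
Proof.
move=> e0 hf hg.
have hs := L2Z (Num.sqrt e) hf; have ht := L2Z (Num.sqrt e)^-1 hg.
have s0 : Num.sqrt e != 0 by rewrite gt_eqF// sqrtr_gt0.
have := ip_le hs ht; rewrite (ipZl _ hf ht) (ipZr _ hg hf) mulrA divff// mul1r.
rewrite (ipZl _ hf hs) (ipZr _ hf hf) (ipZl _ hg ht) (ipZr _ hg hg) !mulrA.
have se : Num.sqrt e * Num.sqrt e = e by rewrite -expr2 sqr_sqrtr// ltW.
by rewrite -invfM se.
Qed.

(** If [ip g g] is positive, expand the square of [f] minus its projection on [g]. If it is 0, the
    weighted inequality [ip_le_eps] with an arbitrarily small weight on [f] forces [ip f g] to
    vanish. *)
Lemma CS f g : L2 f -> L2 g -> ip f g ^+ 2 <= ip f f * ip g g.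
Proof.
move=> hf hg; have F0 := ip_ge0 f; have noise_bound := ip_ge0 g.
have [G1|] := ltP 0 (ip g g); last first.
  move=> G1; have {}noise_bound : ip g g = 0 by apply/eqP; rewrite eq_le G1.
  suff -> : ip f g = 0 by rewrite expr0n/= noise_bound mulr0.
  apply/eqP; rewrite -normr_le0; apply/ler_addgt0Pr => e e0; rewrite add0r.
  pose c := e / (ip f f + 1); have c0 : 0 < c by rewrite divr_gt0// ltr_wpDl.
  have := ip_le_eps c0 hf hg; rewrite noise_bound mulr0 addr0.
  have : c * ip f f <= e by rewrite /c mulrAC ler_pdivrMr ?ltr_wpDl// ler_pM2l//; lra.
  have := normr_ge0 (ip f g); lra.
pose k := ip f g / ip g g; have hk := L2Z k hg; have hB := L2B hf hk.
have := ip_ge0 (fun x => f x - k * g x).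
rewrite (ipBl hf hk hB) (ipBr hf hk hf) (ipBr hf hk hk) (ipZl _ hg hf) (ipZl _ hg hk).
rewrite !(ipZr _ hg) // [ip g f]ipC -subr_ge0.
have -> : ip f f - k * ip f g - (k * ip f g - k * (k * ip g g)) =
  (ip f f * ip g g - ip f g ^+ 2) / ip g g.
  by rewrite /k; field; rewrite gt_eqF.
by rewrite pmulr_lge0// invr_gt0.
Qed.

Lemma ip_eq0 f : L2 f -> ip f f = 0 -> {ae mu, forall x, f x = 0}.
Proof.
move=> hf h0; have := intE_eq0 (L2M hf hf) (fun x => _) h0.
move=> /(_ (fun x => ltac:(rewrite -expr2; exact: sqr_ge0))).
by apply: filterS => x /eqP; rewrite mulf_eq0 orbb => /eqP.
Qed.

Lemma ip_cvg (S : nat -> T -> R) f g : (forall m, L2 (S m)) -> L2 f -> L2 g ->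
  (fun m => ip (fun x => f x - S m x) (fun x => f x - S m x)) @ \oo --> (0 : R) ->
  (fun m => ip (S m) g) @ \oo --> ip f g.
Proof.
move=> hS hf hg h; apply/cvgrPdist_le => e e0.
have hg0 := ip_ge0 g.
(* Young's inequality with weight [c^-1] on the error: the tolerance [c * e] for the squared
   distance makes the error term at most [e], and [c * ip g g <= e] by the choice of [c]. *)
pose c := e / (ip g g + 1).
have c0 : 0 < c by rewrite divr_gt0// ltr_wpDl.
move/cvgrPdist_le : h => /(_ (c * e)); rewrite mulr_gt0// => /(_ isT).
apply: filterS => m; rewrite sub0r normrN ger0_norm ?ip_ge0// => H.
rewrite -ipBl//; have := @ip_le_eps c^-1 _ _ _ (L2B hf (hS m)) hg.
rewrite invr_gt0 => /(_ c0); rewrite invrK => H2.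
have : c * ip g g <= e.
  by rewrite /c mulrAC ler_pdivrMr ?ltr_wpDl// ler_pM2l//; lra.
have : c^-1 * ip (fun x => f x - S m x) (fun x => f x - S m x) <= e.
  by rewrite mulrC ler_pdivrMr// mulrC.
lra.
Qed.

End RealIntegral.

Arguments ip_ae {d T R mu} f1 f2 g1 g2.

Section ProbL2.
Context {d : measure_display} {T : measurableType d} {R : realType}.
Variable P : probability T R.

Lemma L2_cst (c : R) : L2 P (fun=> c).
Proof. split=> //; exact: finite_measure_integrable_cst. Qed.

Lemma L2_intg (f : T -> R) : L2 P f -> intg P f.
Proof.
move=> hf; have := L2M (L2_cst 1) hf; by under eq_fun do rewrite mul1r.
Qed.

Lemma intE_cst (c : R) : \int[P]_x c = c.
Proof. by rewrite Rintegral_cst//= probability_setT mulr1. Qed.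
End ProbL2.

(** * Fubini and Tonelli for real-valued integrals *)

Section Fub.
Context {d1 d2 : measure_display} {T1 : measurableType d1} {T2 : measurableType d2}
  {R : realType}.
Variables (m1 : {sigma_finite_measure set T1 -> \bar R})
  (m2 : {sigma_finite_measure set T2 -> \bar R}).
Implicit Types F : T1 * T2 -> R.

Lemma fub_intg1 F : intg (m1 \x m2)%E F -> {ae m1, forall x, intg m2 (fun y => F (x, y))}.
Proof. by move=> /ae_integrable1; apply: filterS. Qed.

Lemma fub_intg2 F : intg (m1 \x m2)%E F -> {ae m2, forall y, intg m1 (fun x => F (x, y))}.
Proof. by move=> /ae_integrable2; apply: filterS. Qed.

(** On the null set of slices that are not integrable, the real integral takes the default value 0
    while [fubini_F] is infinite, so the two agree only almost everywhere. *)
Lemma fub_eq1 F : intg (m1 \x m2)%E F ->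
  {ae m1, forall x, fubini_F m2 (EFin \o F) x = (\int[m2]_y F (x, y))%:E}.
Proof. by move=> /fub_intg1; apply: filterS => x hx; rewrite -intE_EFin. Qed.

Lemma fub_eq2 F : intg (m1 \x m2)%E F ->
  {ae m2, forall y, fubini_G m1 (EFin \o F) y = (\int[m1]_x F (x, y))%:E}.
Proof. by move=> /fub_intg2; apply: filterS => x hx; rewrite -intE_EFin. Qed.

Lemma fub_meas1 F : intg (m1 \x m2)%E F ->
  measurable_fun setT (fun x => \int[m2]_y F (x, y)).
Proof.
move=> hF; have := measurable_fubini_F hF => mf.
exact: (measurableT_comp (@fine_measurable R setT measurableT) mf).
Qed.

Lemma fub_meas2 F : intg (m1 \x m2)%E F ->
  measurable_fun setT (fun y => \int[m1]_x F (x, y)).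
Proof.
move=> hF; have := measurable_fubini_G hF => mf.
exact: (measurableT_comp (@fine_measurable R setT measurableT) mf).
Qed.

Lemma fub_int1 F : intg (m1 \x m2)%E F -> intg m1 (fun x => \int[m2]_y F (x, y)).
Proof.
move=> hF; apply/integrableP; split; first by apply/measurable_EFinP; exact: fub_meas1.
have /integrableP[mf] := integrable_fubini_F hF; apply: le_lt_trans.
rewrite (@ae_eq_integral _ _ _ _ _ (abse \o fubini_F m2 (EFin \o F)))//.
- by apply: measurableT_comp => //; apply/measurable_EFinP; exact: fub_meas1.
- exact: measurableT_comp.
- by have := fub_eq1 hF; apply: filterS => x /= -> _.
Qed.

Lemma fub_int2 F : intg (m1 \x m2)%E F -> intg m2 (fun y => \int[m1]_x F (x, y)).
Proof.
move=> hF; apply/integrableP; split; first by apply/measurable_EFinP; exact: fub_meas2.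
have mF := intg_meas hF.
have maF : measurable_fun setT (abse \o (EFin \o F)).
  by apply: measurableT_comp => //; exact/measurable_EFinP.
have /integrableP[_] := hF; apply: le_lt_trans.
rewrite fubini_tonelli2//; apply: ge0_le_integral => //.
- apply: measurableT_comp => //; apply/measurable_EFinP; exact: fub_meas2.
- exact: measurable_fun_fubini_tonelli_G.
- move=> y _ /=; rewrite /fubini_G /=.
  have mFy : measurable_fun setT (fun x => (F (x, y))%:E).
    by apply/measurable_EFinP; exact: measurable_fun_pair1.
  apply: le_trans (le_abse_integral m1 measurableT mFy).
  (* An infinite slice integral has [fine] value 0, for which the bound is trivial. *)
  rewrite /Rintegral; case: (\int[m1]_x (F (x, y))%:E)%E => //=.
  - by rewrite normr0 leey.
  - by rewrite normr0 leey.
Qed.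

Lemma fub_E1 F : intg (m1 \x m2)%E F ->
  \int[m1]_x \int[m2]_y F (x, y) = \int[(m1 \x m2)%E]_z F z.
Proof.
move=> hF; apply: EFin_inj; rewrite -intE_EFin; last exact: fub_int1.
rewrite -intE_EFin// -[RHS](integral12_prod_meas1 hF).
apply: ae_eq_integral => //; first by apply/measurable_EFinP; exact: fub_meas1.
  exact: (measurable_fubini_F hF).
by have := fub_eq1 hF; apply: filterS => x /= -> _.
Qed.

Lemma fub_E2 F : intg (m1 \x m2)%E F ->
  \int[m2]_y \int[m1]_x F (x, y) = \int[(m1 \x m2)%E]_z F z.
Proof.
move=> hF; apply: EFin_inj; rewrite -intE_EFin; last exact: fub_int2.
rewrite -intE_EFin// -[RHS](integral21_prod_meas1 hF).
apply: ae_eq_integral => //; first by apply/measurable_EFinP; exact: fub_meas2.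
  exact: (measurable_fubini_G hF).
by have := fub_eq2 hF; apply: filterS => x /= -> _.
Qed.

Lemma prod_intg (f : T1 -> R) (g : T2 -> R) : intg m1 f -> intg m2 g ->
  intg (m1 \x m2)%E (fun z => f z.1 * g z.2).
Proof.
move=> hf hg; have mf := intg_meas hf; have mg := intg_meas hg.
have mfg : measurable_fun setT (fun z : T1 * T2 => f z.1 * g z.2).
  by apply: measurable_funM; [exact: measurableT_comp|exact: measurableT_comp].
apply/integrable12ltyP; first exact/measurable_EFinP.
rewrite (eq_integral (fun x => `|f x|%:E * (\int[m2]_y `|g y|)%:E)%E).
  rewrite integralZr//; last exact: intg_abs.
  by rewrite lte_mul_pinfty// ?integral_ge0// ?integrable_fin_num ?ltry//; exact: intg_abs.
move=> x _; rewrite -intE_EFin; last exact: intg_abs.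
rewrite -ge0_integralZl//; last exact/measurable_EFinP/measurableT_comp.
by apply: eq_integral => y _ /=; rewrite normrM EFinM.
Qed.

(** Tonelli applied to the positive and negative parts. This serves processes whose paths are
    integrable only almost surely. *)
Lemma Rint_meas1 (G : T1 * T2 -> R) : measurable_fun setT G ->
  measurable_fun setT (fun x => \int[m2]_y G (x, y)).
Proof.
move=> mG; apply: (measurableT_comp (@fine_measurable R setT measurableT)).
have mE : measurable_fun setT (EFin \o G) by exact/measurable_EFinP.
rewrite (_ : (fun x => _) = (fun x => fubini_F m2 (EFin \o G)^\+ x
   - fubini_F m2 (EFin \o G)^\- x)%E); last first.
  apply/funext => x; rewrite [LHS]integralE /fubini_F; congr (_ - _)%E; apply: eq_integral => y _.
  by rewrite !funeposE.
  by rewrite !funenegE.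
apply: emeasurable_funB; apply: measurable_fun_fubini_tonelli_F => //.
- exact: measurable_funepos.
- exact: measurable_funeneg.
Qed.

Lemma ae_prod2 (Q : T2 -> Prop) : {ae m2, forall y, Q y} ->
  {ae (m1 \x m2)%E, forall z, Q z.2}.
Proof.
move=> [N [mN N0 sN]]; exists (setT `*` N); split.
- exact: measurableX.
- by rewrite product_measure1E// N0 mule0.
- by move=> z /= nQ; split => //; apply: sN.
Qed.

Lemma fub_L2_1 F : L2 (m1 \x m2)%E F -> {ae m1, forall x, L2 m2 (fun y => F (x, y))}.
Proof.
move=> [mF hF]; have := fub_intg1 hF; apply: filterS => x hx; split => //.
exact: measurable_fun_pair2.
Qed.

Lemma fub_L2_2 F : L2 (m1 \x m2)%E F -> {ae m2, forall y, L2 m1 (fun x => F (x, y))}.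
Proof.
move=> [mF hF]; have := fub_intg2 hF; apply: filterS => x hx; split => //.
exact: measurable_fun_pair1.
Qed.

(** The square of [F] is nonnegative, so Tonelli turns the condition on slices into a vanishing
    integral over the product. *)
Lemma fub_ae F : measurable_fun setT F ->
  {ae m1, forall x, {ae m2, forall y, F (x, y) = 0}} ->
  {ae (m1 \x m2)%E, forall z, F z = 0}.
Proof.
move=> mF H.
have m2F : measurable_fun setT (fun z => (F z ^+ 2)%:E).
  by apply/measurable_EFinP; exact: measurable_funX.
have h0 : (\int[m1 \x m2]_z `|(F z ^+ 2)%:E| = 0)%E.
  rewrite fubini_tonelli1//; last by apply: measurableT_comp.
  rewrite -(integral0 m1 setT); apply: ae_eq_integral => //.
    by apply: measurable_fun_fubini_tonelli_F => //; apply: measurableT_comp.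
  apply: filterS H => x Hx _; rewrite /fubini_F.
  have -> : 0%E = (\int[m2]_y (cst 0 y))%E by rewrite integral0.
  apply: ae_eq_integral => //.
    by apply: measurableT_comp => //; exact: (measurable_fun_pair2 x m2F).
  by apply: filterS Hx => y /= -> _; rewrite expr0n normr0.
have [+ _] := @ae_eq_integral_abs _ _ _ (m1 \x m2)%E setT measurableT _ m2F.
move=> /(_ h0); apply: filterS => z /= /(_ I) [] /eqP.
by rewrite expf_eq0/= => /eqP.
Qed.
End Fub.

(** * Time integrals *)

Section Time.
Context {R : realType}.
Notation leb := (@lebesgue_measure R).
Implicit Types (k l b : R -> R) (s t : R).

(** Time windows are multiplicative weights instead of domains: every integral is then over a whole
    space, which is the form of the Fubini lemmas above. *)
Definition cut t s : R := \1_(`[0, t]) s.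

Lemma cutE t s : cut t s = (nat_of_bool (0 <= s <= t)%R)%:R.
Proof. by rewrite /cut indicE; congr (nat_of_bool _)%:R; apply/idP/idP; rewrite inE/= in_itv. Qed.

Lemma cut_ge0 t s : 0 <= cut t s. Proof. by rewrite cutE. Qed.
Lemma cut_le1 t s : cut t s <= 1. Proof. by rewrite cutE; case: (0 <= s <= t). Qed.
Lemma cut1 t s : 0 <= s <= t -> cut t s = 1. Proof. by rewrite cutE => ->. Qed.
Lemma cut0 t s : ~~ (0 <= s <= t) -> cut t s = 0. Proof. by rewrite cutE => /negbTE ->. Qed.
Lemma cut_idem t s : cut t s * cut t s = cut t s.
Proof. by rewrite cutE; case: (0 <= s <= t); rewrite ?mulr1 ?mulr0. Qed.
Lemma cut_le t t' s : t <= t' -> cut t' s * cut t s = cut t s.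
Proof.
move=> tt; have [/andP[h1 h2]|/cut0 ->] := boolP (0 <= s <= t); last by rewrite mulr0.
by rewrite (@cut1 t')// ?mul1r// h1 (le_trans h2).
Qed.
Lemma cut_neg t s : t < 0 -> cut t s = 0.
Proof.
move=> t0; apply: cut0; apply/negP => /andP[h1 h2].
by move: (le_trans h1 h2); rewrite leNgt t0.
Qed.

Lemma measurable_cut t : measurable_fun setT (cut t).
Proof. by apply: measurable_indic. Qed.

Lemma measurable_cut2 d (T : measurableType d) (f g : T -> R) :
  measurable_fun setT f -> measurable_fun setT g ->
  measurable_fun setT (fun z => cut (f z) (g z)).
Proof.
move=> mf mg; rewrite (_ : (fun z => _) = \1_[set z | (0 <= g z) && (g z <= f z)]).
  apply: measurable_indic.
  have -> : [set z | (0 <= g z) && (g z <= f z)] =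
     ((fun z => 0 <= g z) @^-1` [set true]) `&` ((fun z => g z <= f z) @^-1` [set true]).
    by apply/seteqP; split => z /=; [move=> /andP[-> ->]|move=> [-> ->]].
  apply: measurableI; rewrite -[X in measurable X]setTI;
    [exact: measurable_fun_ler|exact: measurable_fun_ler].
by apply/funext => z; rewrite cutE indicE; congr (nat_of_bool _)%:R; apply/idP/idP; rewrite inE.
Qed.

Definition loc1 b := forall t, intg leb (fun s => cut t s * b s).
Definition It t b := \int[leb]_s (cut t s * b s).

Lemma intg_cut t : intg leb (cut t).
Proof. by have := @integrable_indic_itv R 0 t true false. Qed.

Lemma I_cst t : 0 <= t -> \int[leb]_s cut t s = t.
Proof.
move=> t0; rewrite /Rintegral integral_indic//= setIT lebesgue_measure_itv/= lte_fin.
by case: (ltP 0 t) => [_|h] /=; rewrite ?subr0//=; apply/eqP; rewrite eq_le ?h ?t0.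
Qed.

Lemma L2_cut t : L2 leb (cut t).
Proof.
split; first exact: measurable_cut.
by under eq_fun do rewrite expr2 cut_idem; exact: intg_cut.
Qed.

Lemma I_neg t b : t < 0 -> It t b = 0.
Proof.
move=> t0; rewrite -[RHS](intE_0 leb); apply: eq_Rintegral => s _.
by rewrite cut_neg// mul0r.
Qed.

Lemma I0 b : loc1 b -> It 0 b = 0.
Proof.
move=> lb; rewrite -[RHS](intE_0 leb); apply: intE_ae => //; first exact: (intg_meas (lb 0)).
exists [set 0]; split; [exact: measurable_set1|exact: lebesgue_measure_set1|].
move=> s /= H; apply: contrapT => s0; apply: H; rewrite cut0 ?mul0r//.
by apply/negP => /andP[h1 h2]; apply: s0; apply/eqP; rewrite eq_le h1 h2.
Qed.

Lemma eq_I t k l : (forall s, 0 <= s <= t -> k s = l s) -> It t k = It t l.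
Proof.
move=> H; apply: eq_Rintegral => s _.
by have [/H ->//|/cut0 ->] := boolP (0 <= s <= t); rewrite !mul0r.
Qed.

Lemma loc1D k l : loc1 k -> loc1 l -> loc1 (fun s => k s + l s).
Proof. by move=> hk hl t; under eq_fun do rewrite mulrDr; exact: intgD. Qed.
Lemma loc1Z c k : loc1 k -> loc1 (fun s => c * k s).
Proof. by move=> hk t; under eq_fun do rewrite mulrCA; exact: intgZ. Qed.
Lemma loc1_sum (J : Type) (r : seq J) (h : J -> R -> R) :
  (forall i, loc1 (h i)) -> loc1 (fun s => \sum_(i <- r) h i s).
Proof. by move=> H t; under eq_fun do rewrite mulr_sumr; apply: intg_sum => i _; exact: H. Qed.

Lemma I_D t k l : loc1 k -> loc1 l -> It t (fun s => k s + l s) = It t k + It t l.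
Proof.
move=> hk hl; rewrite /It -intE_D//.
by apply: eq_Rintegral => s _; rewrite mulrDr.
Qed.
Lemma I_Z t c k : loc1 k -> It t (fun s => c * k s) = c * It t k.
Proof.
move=> hk; rewrite /It -intE_Z//.
by apply: eq_Rintegral => s _; rewrite mulrCA.
Qed.
Lemma I_sum (J : Type) (r : seq J) (h : J -> R -> R) t :
  (forall i, loc1 (h i)) -> It t (fun s => \sum_(i <- r) h i s) = \sum_(i <- r) It t (h i).
Proof.
move=> H; rewrite /It -intE_sum//.
  by apply: eq_Rintegral => s _; rewrite mulr_sumr.
by move=> i; exact: H.
Qed.

Lemma I_le t k l : loc1 k -> loc1 l -> (forall s, 0 <= s <= t -> k s <= l s) -> It t k <= It t l.
Proof.
move=> hk hl H; apply: intE_le => // s.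
by have [h|/cut0 ->] := boolP (0 <= s <= t); rewrite ?mul0r// cut1// !mul1r H.
Qed.

Lemma I_abs t k : loc1 k -> `|It t k| <= It t (fun s => `|k s|).
Proof.
move=> hk; apply: le_trans (intE_abs (hk t)) _; rewrite le_eqVlt; apply/orP; left; apply/eqP.
by apply: eq_Rintegral => s _; rewrite normrM ger0_norm ?cut_ge0.
Qed.

Lemma loc1_abs k : loc1 k -> loc1 (fun s => `|k s|).
Proof.
move=> hk t; have := intg_abs (hk t).
by under eq_fun do rewrite normrM ger0_norm ?cut_ge0//.
Qed.

Lemma loc1_cst c : loc1 (fun=> c).
Proof. by move=> t; under eq_fun do rewrite mulrC; apply: intgZ; exact: intg_cut. Qed.

Lemma I_mono t T k : t <= T -> loc1 k -> (forall s, 0 <= s <= T -> 0 <= k s) -> It t k <= It T k.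
Proof.
move=> tT hk k0; apply: intE_le => // s.
have [h|h] := boolP (0 <= s <= T).
  by rewrite ler_wpM2r ?k0// (cut1 h) cut_le1.
rewrite (cut0 h) -(cut_le s tT) (cut0 h) !mul0r//.
Qed.

Lemma I_ge0 t k : (forall s, 0 <= s <= t -> 0 <= k s) -> 0 <= It t k.
Proof.
move=> k0; apply: intE_ge0 => s.
by have [h|/cut0 ->] := boolP (0 <= s <= t); rewrite ?mul0r// mulr_ge0 ?cut_ge0 ?k0.
Qed.

Lemma loc1M_bounded k l (M : R -> R) : loc1 k -> measurable_fun setT l -> (forall t s, 0 <= s <= t -> `|l s| <= M t) ->
  loc1 (fun s => l s * k s).
Proof.
move=> hk ml hM t; apply: (@intg_le _ _ _ leb _ (fun s => M t * `|cut t s * k s|)).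
- under eq_fun do rewrite mulrCA; apply: measurable_funM => //; exact: intg_meas (hk t).
- move=> s; rewrite mulrCA normrM.
  have [h|/cut0 ->] := boolP (0 <= s <= t); last by rewrite !mul0r normr0 !mulr0.
  by rewrite ler_wpM2r// hM.
- by apply: intgZ; exact: intg_abs.
Qed.

Lemma measurable_I b : measurable_fun setT b -> measurable_fun setT (It^~ b).
Proof.
move=> mb.
have := @Rint_meas1 _ _ _ _ _ leb (fun z : R * R => cut z.1 z.2 * b z.2).
apply; apply: measurable_funM; last exact: measurableT_comp.
exact: measurable_cut2.
Qed.

Lemma I_bounded t s k : loc1 k -> 0 <= s <= t -> `|It s k| <= It t (fun s => `|k s|).
Proof.
move=> hk /andP[s0 st]; apply: le_trans (I_abs _ hk) _; apply: I_mono => //.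
exact: loc1_abs.
Qed.

Lemma loc1_IM k l : measurable_fun setT k -> loc1 k -> loc1 l -> loc1 (fun s => It s k * l s).
Proof.
move=> mk hk hl; apply: (@loc1M_bounded _ _ (fun t => It t (fun s => `|k s|))) => //.
  exact: measurable_I.
by move=> t s; exact: I_bounded.
Qed.

(* Fubini on the square [0,t]^2, split along the diagonal. *)
Lemma ibp t k l : 0 <= t -> measurable_fun setT k -> measurable_fun setT l ->
  loc1 k -> loc1 l ->
  It t k * It t l = It t (fun s => k s * It s l + l s * It s k).
Proof.
move=> t0 mk ml hk hl.
pose F (z : R * R) := (cut t z.1 * k z.1) * (cut t z.2 * l z.2).
have iF : intg (leb \x leb)%E F by exact: (prod_intg (hk t) (hl t)).
have mF := intg_meas iF.
(* [F1] is the part of the square where [z.2 <= z.1], diagonal included. *)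
pose F1 z := cut z.1 z.2 * F z.
have iF1 : intg (leb \x leb)%E F1.
  apply: (@intg_le _ _ _ (leb \x leb)%E _ (fun z => `|F z|)); last exact: intg_abs.
    by apply: measurable_funM => //; exact: measurable_cut2.
  move=> z; rewrite normrM ger0_norm ?cut_ge0//.
  by rewrite ler_piMl// cut_le1.
have iF2 : intg (leb \x leb)%E (fun z => F z - F1 z) by exact: intgB.
have eF : \int[(leb \x leb)%E]_z F z = It t k * It t l.
  rewrite -(fub_E1 iF) /It mulrC -intE_Z//; apply: eq_Rintegral => x _ /=.
  by rewrite mulrC -intE_Z.
have e1 : \int[(leb \x leb)%E]_z F1 z = It t (fun s => k s * It s l).
  rewrite -(fub_E1 iF1) /It; apply: eq_Rintegral => s _ /=; rewrite mulrA -intE_Z//.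
  apply: eq_Rintegral => r _; rewrite /F1 /F /=.
  have [/andP[h1 h2]|/cut0 ->] := boolP (0 <= s <= t); last by rewrite !(mul0r,mulr0).
  by rewrite mulrCA; congr (_ * _); rewrite mulrCA !mulrA cut_le.
have e2 : \int[(leb \x leb)%E]_z (F z - F1 z) = It t (fun s => l s * It s k).
  rewrite -(fub_E2 iF2) /It; apply: eq_Rintegral => r _ /=; rewrite mulrA -intE_Z//.
  apply: intE_ae.
  - exact: measurable_fun_pair1 (intg_meas iF2).
  - by apply: measurable_funM => //; apply: measurable_funM => //; exact: measurable_cut.
  (* [F1] has taken the diagonal, so the two integrands differ at most at the single point [r]. *)
  - exists [set r]; split; [exact: measurable_set1|exact: lebesgue_measure_set1|].
    move=> s /= H; apply: contrapT => sr; apply: H; rewrite /F1 /F /=.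
    have [/andP[h1 h2]|/cut0 ->] := boolP (0 <= r <= t); last by rewrite !(mul0r,mulr0) subr0.
    rewrite (@cut1 t r) ?h1// mul1r.
    have [/andP[s0 s1]|/cut0 e0] := boolP (0 <= s <= t); last first.
      rewrite e0 !(mul0r,mulr0) subr0 cut0 ?mul0r ?mulr0//.
      apply: contraTN (isT) => /andP[a1 a2].
      have : 0 <= s <= t by rewrite a1 (le_trans a2).
      by move/(@cut1 t) => E; move/eqP: e0; rewrite E oner_eq0.
    rewrite (@cut1 t s) ?s0// mul1r !cutE s0 h1/=.
    case: (ltgtP r s) => [_|_|rs]; rewrite ?(mul0r,mul1r,mulr0,mulr1,subr0,subrr)//.
    by rewrite mulrC.
    by case: sr.
rewrite -eF I_D.
- rewrite -e1 -e2 -intE_D//; apply: eq_Rintegral => z _; by rewrite addrC subrK.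
- by under eq_fun do rewrite mulrC; exact: loc1_IM.
- by under eq_fun do rewrite mulrC; exact: loc1_IM.
Qed.

(** The product rule for two absolutely continuous functions, in integrated form. *)
Lemma ibp_affine t k l (a b : R) : 0 <= t -> measurable_fun setT k -> measurable_fun setT l ->
  loc1 k -> loc1 l ->
  (a + It t k) * (b + It t l) =
  a * b + (It t (fun s => k s * (b + It s l)) + It t (fun s => (a + It s k) * l s)).
Proof.
move=> t0 mk ml hk hl.
have l1 : loc1 (fun s => k s * It s l) by under eq_fun do rewrite mulrC; exact: loc1_IM.
have l2 : loc1 (fun s => l s * It s k) by under eq_fun do rewrite mulrC; exact: loc1_IM.
have -> : It t (fun s => k s * (b + It s l)) = It t (fun s => b * k s + k s * It s l).
  by apply: eq_I => s _; ring.
have -> : It t (fun s => (a + It s k) * l s) = It t (fun s => a * l s + l s * It s k).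
  by apply: eq_I => s _; ring.
rewrite (I_D _ (loc1Z b hk) l1) (I_D _ (loc1Z a hl) l2) (I_Z _ _ hk) (I_Z _ _ hl).
have := ibp t0 mk ml hk hl; rewrite (I_D _ l1 l2); move: (It t k) (It t l) (It t _) (It t _).
by move=> x y z u e; rewrite mulrDl !mulrDr e; ring.
Qed.

Lemma measurable_expRZ (c : R) : measurable_fun setT (fun s : R => expR (c * s)).
Proof. by apply: measurableT_comp; [exact: measurable_expR|exact: mulrl_measurable]. Qed.

Lemma expRZ_bounded (c t s : R) : 0 <= s <= t -> `|expR (c * s)| <= expR (`|c| * t).
Proof.
move=> /andP[s0 st]; rewrite ger0_norm ?expR_ge0// ler_expR.
by rewrite (le_trans (ler_wpM2r s0 (ler_norm c)))// ler_wpM2l.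
Qed.

Lemma loc1_expM c k : loc1 k -> loc1 (fun s => expR (c * s) * k s).
Proof.
move=> hk; apply: (@loc1M_bounded _ _ (fun t => expR (`|c| * t))) => //.
  exact: measurable_expRZ.
by move=> t s; exact: expRZ_bounded.
Qed.

Lemma loc1_exp c : loc1 (fun s => expR (c * s)).
Proof. by have := loc1_expM c (loc1_cst 1); under eq_fun do rewrite mulr1. Qed.

Lemma is_derive_expRZ (c s : R) : is_derive s 1 (fun x : R => expR (c * x)) (c * expR (c * s)).
Proof.
apply: is_derive_eq.
by rewrite /GRing.scale/= mulr1 mulrC.
Qed.

Lemma continuous_expRZ (c : R) : continuous (fun x : R => expR (c * x)).
Proof.
move=> x; apply/differentiable_continuous/derivable1_diffP.
by have [] := is_derive_expRZ c x.
Qed.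

Lemma It_restrict t b : It t b = \int[leb]_(s in `[0, t]) b s.
Proof.
rewrite Rintegral_mkcond; apply: eq_Rintegral => s _; rewrite patchE cutE.
rewrite (_ : (s \in _) = (0 <= s <= t)%R); last by apply/idP/idP; rewrite inE/= in_itv.
by case: (0 <= s <= t); rewrite ?mul1r ?mul0r.
Qed.

Lemma It_expR c t : 0 <= t -> It t (fun s => c * expR (c * s)) = expR (c * t) - 1.
Proof.
rewrite le_eqVlt => /predU1P[<-|t0].
  by rewrite I0 ?mulr0 ?expR0 ?subrr//; apply: loc1Z; exact: loc1_exp.
rewrite It_restrict /Rintegral (@continuous_FTC2 _ _ (fun x => expR (c * x)))//.
- by rewrite mulr0 expR0.
- apply: continuous_subspaceT => x; apply: cvgM; first exact: cvg_cst.
  exact: continuous_expRZ.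
- split.
  + by move=> x _; have [] := is_derive_expRZ c x.
  + apply: cvg_at_right_filter; exact: continuous_expRZ.
  + apply: cvg_at_left_filter; exact: continuous_expRZ.
- by move=> x _; rewrite derive1E; exact: (@derive_val _ _ _ _ _ _ _ (is_derive_expRZ c x)).
Qed.

(* Taking the supremum of [y t * expR (- 2 c t)] avoids iterating the inequality. *)
Lemma gronwall y (a c M T : R) : 0 <= c -> 0 <= a -> loc1 y ->
  (forall t, 0 <= t <= T -> 0 <= y t <= M) ->
  (forall t, 0 <= t <= T -> y t <= a + c * It t y) ->
  forall t, 0 <= t <= T -> y t <= 2 * a * expR (2 * c * t).
Proof.
move=> c0 a0 hy yM H.
pose S := [set expR (- (2 * c * t)) * y t | t in `[0, T]].
have S_ub : has_ubound S.
  exists M => z [t]; rewrite /= in_itv/= => ht <-; have /andP[y0 y1] := yM _ ht.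
  have /andP[t0 _] := ht; rewrite (le_trans _ y1)// ler_piMl// -expR0 ler_expR.
  by rewrite oppr_le0 !mulr_ge0.
have BRB t : 0 <= t <= T -> y t <= sup S * expR (2 * c * t).
  move=> ht; have : expR (- (2 * c * t)) * y t <= sup S.
    by apply: sup_upper_bound; [split => //; exists (expR (- (2 * c * t)) * y t); exists t|exists t]; rewrite //= in_itv.
  by rewrite expRN mulrC ler_pdivrMr// expR_gt0.
move=> t ht; have T0 : 0 <= T by case/andP: ht => h; exact: le_trans.
have m0 : 0 <= sup S.
  have := BRB 0; rewrite lexx T0 mulr0 expR0 mulr1 => /(_ isT); apply: le_trans.
  by have := yM 0; rewrite lexx T0 => /(_ isT)/andP[].
have H2 r : 0 <= r <= T -> y r <= (a + sup S / 2) * expR (2 * c * r).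
  move=> hr; have /andP[r0 rT] := hr; apply: le_trans (H _ hr) _.
  have : c * It r y <= c * It r (fun s => sup S * expR (2 * c * s)).
    rewrite ler_wpM2l// I_le//; first by apply: loc1Z; exact: loc1_exp.
    by move=> s /andP[s0 sr]; apply: BRB; rewrite s0 (le_trans sr).
  have -> : c * It r (fun s => sup S * expR (2 * c * s)) = sup S / 2 * (expR (2 * c * r) - 1).
    rewrite -It_expR// !I_Z; [|exact: loc1_exp..]; by field.
  have : 1 <= expR (2 * c * r) by rewrite -expR0 ler_expR !mulr_ge0.
  move: (expR _) => e e1 h; nra.
(* Doubling the rate of the exponential halves the contribution of the supremum, which can then be
   absorbed: [sup S <= 2 * a]. *)
have {}m0 : sup S <= a + sup S / 2.
  apply: ge_sup; first by exists (expR (- (2 * c * t)) * y t); exists t; rewrite //= in_itv.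
  move=> z [r]; rewrite /= in_itv/= => hr <-.
  by rewrite expRN mulrC ler_pdivrMr ?expR_gt0// H2.
apply: le_trans (BRB _ ht) _; rewrite ler_wpM2r ?expR_ge0//; lra.
Qed.

Lemma gronwall0 y (c M T : R) : 0 <= c -> loc1 y ->
  (forall t, 0 <= t <= T -> 0 <= y t <= M) ->
  (forall t, 0 <= t <= T -> y t <= c * It t y) ->
  forall t, 0 <= t <= T -> y t = 0.
Proof.
move=> c0 hy yM H t ht; apply/eqP; rewrite eq_le; apply/andP; split; last by have /andP[] := yM _ ht.
have := @gronwall y 0 c M T c0 (lexx _) hy yM _ t ht; rewrite mulr0 mul0r; apply.
by move=> s hs; rewrite add0r H.
Qed.

(** This is [rho] times the integral of e^(-rho t) over [s, T]: the weight that a rate at time [s]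
    receives in a discounted integral up to [T]. It vanishes at [s] = [T], hence no boundary term at
    the horizon, and for positive [rho] it tends to e^(-rho s) as [T] grows. *)
Definition wT (rho T s : R) := expR (- rho * s) - expR (- rho * T).

(** Integration by parts of [h0 + It t k] against the derivative of e^(-rho t). *)
Lemma laplace rho (h0 T : R) k : 0 <= T -> measurable_fun setT k -> loc1 k ->
  It T (fun t => rho * expR (- rho * t) * (h0 + It t k)) =
  wT rho T 0 * h0 + It T (fun s => wT rho T s * k s).
Proof.
move=> T0 mk hk; rewrite /wT mulr0 expR0.
pose l s := - rho * expR (- rho * s).
have ll : loc1 l by apply: loc1Z; exact: loc1_exp.
have ml : measurable_fun setT l by apply: measurable_funM => //; exact: measurable_expRZ.
have Il s : 0 <= s -> It s l = expR (- rho * s) - 1 by move=> s0; rewrite It_expR.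
have := ibp T0 mk ml hk ll; rewrite Il//.
have lIk := loc1_IM mk hk ll; have lkI := loc1_IM ml ll hk.
rewrite I_D; [|by under eq_fun do rewrite mulrC|by under eq_fun do rewrite mulrC].
have -> : It T (fun t => rho * expR (- rho * t) * (h0 + It t k)) =
   - h0 * It T l - It T (fun s => l s * It s k).
  rewrite -I_Z// -[X in _ + X]mulN1r -I_Z; last by under eq_fun do rewrite mulrC.
  rewrite -I_D; [|exact: loc1Z|by apply: loc1Z; under eq_fun do rewrite mulrC].
  by apply: eq_I => s _; rewrite /l; ring.
have -> : It T (fun s => k s * It s l) = It T (fun s => (expR (- rho * s) - 1) * k s).
  by apply: eq_I => s /andP[s0 _]; rewrite Il// mulrC.
have le := loc1_expM (- rho) hk.
have -> : It T (fun s => (expR (- rho * s) - 1) * k s) = It T (fun s => expR (- rho * s) * k s) - It T k.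
  rewrite -[X in _ + X]mulN1r -I_Z// -I_D//; last exact: loc1Z.
  by apply: eq_I => s _; ring.
have -> : It T (fun s => (expR (- rho * s) - expR (- rho * T)) * k s) =
  It T (fun s => expR (- rho * s) * k s) - expR (- rho * T) * It T k.
  rewrite -mulNr -I_Z// -I_D//; last exact: loc1Z.
  by apply: eq_I => s _; ring.
rewrite Il//; lra.
Qed.

End Time.

(** * Square integrable processes *)

Section Proc.
Context {d : measure_display} {T : measurableType d} {R : realType}.
Variable P : probability T R.
Notation leb := (@lebesgue_measure R).
Notation LP := (@lebesgue_measure R \x P)%E.
Implicit Types (b c : R -> T -> R) (s t : R) (xi : T -> R).

Definition mproc b := measurable_fun setT (fun z : R * T => b z.1 z.2).
(** Square integrability on bounded time windows, without discount. This is the a priori regularity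
    of states; the discounted version [L2r] has to be earned for each process. *)
Definition lproc b := mproc b /\ forall t, L2 LP (fun z : R * T => cut t z.1 * b z.1 z.2).

Lemma mproc1 b t : mproc b -> measurable_fun setT (b t).
Proof. by move=> mb; exact: (measurable_fun_pair2 t mb). Qed.

Lemma mproc2 b w : mproc b -> measurable_fun setT (b^~ w).
Proof. by move=> mb; exact: (measurable_fun_pair1 w mb). Qed.

Lemma mprocD b c : mproc b -> mproc c -> mproc (fun s w => b s w + c s w).
Proof. exact: measurable_funD. Qed.

Lemma mprocM b c : mproc b -> mproc c -> mproc (fun s w => b s w * c s w).
Proof. exact: measurable_funM. Qed.

Lemma mproc_rv xi : measurable_fun setT xi -> mproc (fun _ => xi).
Proof. by move=> mx; apply: (measurableT_comp mx). Qed.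

Lemma mproc_det (g : R -> R) : measurable_fun setT g -> mproc (fun s _ => g s).
Proof. by move=> mg; apply: (measurableT_comp mg). Qed.

Lemma mprocZ k b : mproc b -> mproc (fun s w => k * b s w).
Proof. by move=> mb; apply: measurable_funM. Qed.

Lemma mproc_sum (J : Type) (r : seq J) (h : J -> R -> T -> R) :
  (forall i, mproc (h i)) -> mproc (fun s w => \sum_(i <- r) h i s w).
Proof. by move=> H; apply: measurable_sum => i; exact: H. Qed.

Lemma lprocD b c : lproc b -> lproc c -> lproc (fun s w => b s w + c s w).
Proof.
move=> [mb hb] [mc hc]; split; first exact: mprocD.
by move=> t; under eq_fun do rewrite mulrDr; exact: L2D.
Qed.

Lemma lprocZ k b : lproc b -> lproc (fun s w => k * b s w).
Proof.
move=> [mb hb]; split; first exact: mprocZ.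
by move=> t; under eq_fun do rewrite mulrCA; exact: L2Z.
Qed.

Lemma lproc_sum (J : Type) (r : seq J) (h : J -> R -> T -> R) :
  (forall i, lproc (h i)) -> lproc (fun s w => \sum_(i <- r) h i s w).
Proof.
move=> H; split; first by apply: mproc_sum => i; case: (H i).
by move=> t; under eq_fun do rewrite mulr_sumr; apply: L2_sum => i _; case: (H i).
Qed.

Lemma L2_prod (g : R -> R) xi : L2 leb g -> L2 P xi -> L2 LP (fun z : R * T => g z.1 * xi z.2).
Proof.
move=> [mg hg] [mx hx]; split.
  by apply: measurable_funM; [exact: (measurableT_comp mg)|exact: (measurableT_comp mx)].
by under eq_fun do rewrite exprMn; exact: (prod_intg hg hx).
Qed.

Lemma lproc_rv xi : L2 P xi -> lproc (fun _ => xi).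
Proof.
move=> hx; split; first by apply: mproc_rv; case: hx.
by move=> t; apply: L2_prod => //; exact: L2_cut.
Qed.

(** A single null set serves all [t]: integer windows are handled by Fubini and dominate the smaller
    ones. *)
Lemma lproc_L2_path b : lproc b -> {ae P, forall w, forall t, L2 leb (fun s => cut t s * b s w)}.
Proof.
move=> [mb hb].
have : {ae P, forall w, forall n : nat, L2 leb (fun s => cut n%:R s * b s w)}.
  by apply: ae_foralln => n; exact: (fub_L2_2 (hb n%:R)).
apply: filterS => w Hw t.
have tn : t <= (Num.trunc t).+1%:R by apply: ltW; exact: truncnS_gt.
have mbw : measurable_fun setT (fun s => cut t s * b s w).
  by apply: measurable_funM; [exact: measurable_cut|exact: mproc2].
apply: (@L2_le _ _ _ leb _ (fun s => `|cut (Num.trunc t).+1%:R s * b s w|)) => //.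
  move=> s; have -> : cut t s * b s w = cut t s * (cut (Num.trunc t).+1%:R s * b s w).
    by rewrite mulrA [cut t s * cut _ _]mulrC cut_le.
  by rewrite normrM ler_piMl// ger0_norm ?cut_ge0 ?cut_le1.
exact: L2_abs.
Qed.

Lemma loc1_path (b : R -> R) : (forall t, L2 leb (fun s => cut t s * b s)) -> loc1 b.
Proof.
move=> H t; have := L2M (L2_cut t) (H t).
by under eq_fun do rewrite mulrA cut_idem.
Qed.

Lemma lproc_loc1_path b : lproc b -> {ae P, forall w, loc1 (b^~ w)}.
Proof. by move=> /lproc_L2_path; apply: filterS => w /loc1_path. Qed.

Lemma mproc_It b : mproc b -> mproc (fun t w => It t (b^~ w)).
Proof.
move=> mb; have := @Rint_meas1 _ _ _ _ _ leb (fun z : (R * T) * R => cut z.1.1 z.2 * b z.2 z.1.2).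
apply; apply: measurable_funM.
  by apply: measurable_cut2 => //; apply: measurableT_comp.
have mp : measurable_fun setT (fun x : (R * T) * R => (x.2, x.1.2)).
  by apply: measurable_fun_pair => //; exact: measurableT_comp.
exact: (measurableT_comp mb mp).
Qed.

(** Cauchy-Schwarz against the window itself, whose squared norm is [t]. *)
Lemma It_sqr (g : R -> R) t : 0 <= t -> L2 leb (fun s => cut t s * g s) ->
  It t g ^+ 2 <= t * \int[leb]_s (cut t s * g s) ^+ 2.
Proof.
move=> t0 hg; have := CS (L2_cut t) hg.
rewrite {1 3}/ip; have -> : \int[leb]_x (cut t x * (cut t x * g x)) = It t g.
  by apply: eq_Rintegral => s _; rewrite mulrA cut_idem.
by under [X in _ <= _ * X -> _]eq_Rintegral do rewrite -expr2; rewrite /ip;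
   under [X in _ <= X * _ -> _]eq_Rintegral do rewrite cut_idem; rewrite I_cst.
Qed.

Lemma lproc_sq_int b t : lproc b ->
  intg P (fun w => \int[leb]_s (cut t s * b s w) ^+ 2).
Proof. by move=> [_ /(_ t) [_ hb]]; exact: (fub_int2 hb). Qed.

Lemma L2_It b t : lproc b -> L2 P (fun w => It t (b^~ w)).
Proof.
move=> hb; have [mb _] := hb.
have mI := mproc1 t (mproc_It mb).
have [t0|t0] := leP 0 t; last by under eq_fun do rewrite I_neg//; exact: L2_0.
split => //; apply: (@intg_le_ae _ _ _ P _ (fun w => t * \int[leb]_s (cut t s * b s w) ^+ 2)).
- exact: measurable_funX.
- have := lproc_L2_path hb; apply: filterS => w Hw; rewrite ger0_norm ?sqr_ge0//.
  exact: It_sqr.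
- by apply: intgZ; exact: lproc_sq_int.
Qed.

Lemma lproc_It b : lproc b -> lproc (fun t w => It t (b^~ w)).
Proof.
move=> hb; have [mb _] := hb; have mI := mproc_It mb; split => // t.
have mc : measurable_fun setT (fun z : R * T => cut t z.1).
  exact: (measurableT_comp (measurable_cut t)).
split; first exact: measurable_funM.
apply: (@intg_le_ae _ _ _ LP _ (fun z : R * T =>
   (`|t| * cut t z.1) * \int[leb]_s (cut t s * b s z.2) ^+ 2)).
- apply: measurable_funX; exact: measurable_funM.
- have := ae_prod2 leb (lproc_L2_path hb); apply: filterS => -[s w] /= Hw.
  rewrite ger0_norm ?sqr_ge0//.
  have [/andP[s0 st]|/cut0 ->] := boolP (0 <= s <= t); last by rewrite !(mul0r,mulr0) expr0n.
  rewrite (@cut1 _ t s) ?s0// mul1r mulr1 ger0_norm ?(le_trans s0)//.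
  apply: le_trans (It_sqr s0 (Hw s)) _; apply: ler_pM => //.
    by apply: intE_ge0 => r; exact: sqr_ge0.
  apply: intE_le; [by case: (Hw s)|by case: (Hw t)|].
  move=> r; rewrite -(cut_le r st) !exprMn ler_wpM2r ?sqr_ge0//.
  by rewrite ler_piMr ?sqr_ge0// expr_le1 ?cut_ge0 ?cut_le1.
- have := prod_intg (intgZ `|t| (intg_cut t)) (lproc_sq_int t hb).
  by [].
Qed.

Lemma lproc_L2_ae b : lproc b -> {ae leb, forall s, 0 <= s -> L2 P (b s)}.
Proof.
move=> [mb hb].
have : {ae leb, forall s, forall n : nat, L2 P (fun w => cut n%:R s * b s w)}.
  by apply: ae_foralln => n; exact: (fub_L2_1 (hb n%:R)).
apply: (@filterS _ (almost_everywhere leb)) => s Hs s0; have := Hs (Num.trunc s).+1.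
rewrite (@cut1 _ _ s); first by under eq_fun do rewrite mul1r.
by rewrite s0 ltW// truncnS_gt.
Qed.

Section pair.
Variables b c : R -> T -> R.
Hypotheses (hb : lproc b) (hc : lproc c).

Lemma lprocM_intg t : intg LP (fun z : R * T => cut t z.1 * (b z.1 z.2 * c z.1 z.2)).
Proof.
have := L2M (hb.2 t) (hc.2 t).
by under eq_fun do rewrite mulrACA cut_idem.
Qed.

Lemma E_cut t s : \int[P]_w (cut t s * (b s w * c s w)) = cut t s * ip P (b s) (c s).
Proof.
rewrite /ip cutE; case: (0 <= s <= t); rewrite ?(mul1r,mul0r).
  by apply: eq_Rintegral => w _; rewrite mul1r.
by rewrite -[RHS](intE_0 P); apply: eq_Rintegral => w _; rewrite mul0r.
Qed.

Lemma loc1_ip : loc1 (fun s => ip P (b s) (c s)).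
Proof. by move=> t; have := fub_int1 (lprocM_intg t); under eq_fun do rewrite E_cut. Qed.

Lemma measurable_ip : measurable_fun setT (fun s => ip P (b s) (c s)).
Proof.
have /(Rint_meas1 P) := mprocM hb.1 hc.1; exact.
Qed.

Lemma E_ItM t : \int[P]_w It t (fun s => b s w * c s w) = It t (fun s => ip P (b s) (c s)).
Proof.
have := fub_E1 (lprocM_intg t); rewrite -(fub_E2 (lprocM_intg t)) => <-.
by apply: eq_Rintegral => s _; rewrite /= -E_cut.
Qed.

Lemma intg_ItM t : intg P (fun w => It t (fun s => b s w * c s w)).
Proof. exact: (fub_int2 (lprocM_intg t)). Qed.


(* Time weights that vanish outside [0, t] are absorbed into [g]. *)
Lemma LP_ItM (g : R -> R) t : measurable_fun setT g -> (exists M, forall s, 0 <= s <= t -> `|g s| <= M) ->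
  intg LP (fun z : R * T => cut t z.1 * g z.1 * (b z.1 z.2 * c z.1 z.2)) /\
  \int[LP]_z (cut t z.1 * g z.1 * (b z.1 z.2 * c z.1 z.2)) = It t (fun s => g s * ip P (b s) (c s)).
Proof.
move=> mg [M HM].
have iF : intg LP (fun z : R * T => cut t z.1 * g z.1 * (b z.1 z.2 * c z.1 z.2)).
  have /(intgZ M)/intg_abs H := lprocM_intg t; apply: intg_le H.
    apply: measurable_funM; last exact: mprocM hb.1 hc.1.
    by apply: measurable_funM; [exact: (measurableT_comp (measurable_cut t))|exact: (measurableT_comp mg)].
  move=> [s w] /=; have [h|/cut0 ->] := boolP (0 <= s <= t); last by rewrite !mul0r mulr0 normr0.
  rewrite cut1// !mul1r normrM [X in _ <= X]normrM ler_wpM2r//.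
  by rewrite (le_trans (HM _ h))// ler_norm.
split => //; rewrite -(fub_E1 iF) /It; apply: intE_ae.
- exact: (fub_meas1 iF).
- apply: measurable_funM; first exact: measurable_cut.
  by apply: measurable_funM => //; exact: measurable_ip.
- have := fub_intg1 (lprocM_intg t); apply: (@filterS _ (almost_everywhere leb)) => s /= Hs.
  rewrite mulrCA -E_cut -intE_Z//.
  by apply: eq_Rintegral => w _; ring.
Qed.
End pair.

Lemma E_It xi b t : L2 P xi -> lproc b ->
  ip P xi (fun w => It t (b^~ w)) = It t (fun s => ip P xi (b s)).
Proof.
move=> hx hb; rewrite -(E_ItM (lproc_rv hx) hb) /ip; apply: intE_ae.
- by apply: measurable_funM; [case: hx|exact: (mproc1 t (mproc_It hb.1))].
- by apply: (mproc1 t (b := fun t w => It t (fun s => xi w * b s w))); apply: mproc_It;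
     apply: mprocM hb.1; apply: mproc_rv; case: hx.
- by have := lproc_loc1_path hb; apply: filterS => w hw; rewrite I_Z.
Qed.

Lemma loc1_ipl xi b : L2 P xi -> lproc b -> loc1 (fun s => ip P xi (b s)).
Proof. by move=> hx hb; exact: (loc1_ip (lproc_rv hx) hb). Qed.

Definition Dp (Y0 : T -> R) b : R -> T -> R := fun t w => Y0 w + It t (b^~ w).

Lemma lproc_Dp Y0 b : L2 P Y0 -> lproc b -> lproc (Dp Y0 b).
Proof. by move=> h hb; apply: lprocD; [exact: lproc_rv|exact: lproc_It]. Qed.

Lemma L2_Dp Y0 b t : L2 P Y0 -> lproc b -> L2 P (Dp Y0 b t).
Proof. by move=> h hb; apply: L2D => //; exact: L2_It. Qed.

Lemma E_ibp Y0 Y0' b b' t : 0 <= t -> L2 P Y0 -> L2 P Y0' -> lproc b -> lproc b' ->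
  ip P (Dp Y0 b t) (Dp Y0' b' t) = ip P Y0 Y0' +
    It t (fun s => ip P (b s) (Dp Y0' b' s) + ip P (Dp Y0 b s) (b' s)).
Proof.
move=> t0 h0 h0' hb hb'.
have hD := lproc_Dp h0 hb; have hD' := lproc_Dp h0' hb'.
rewrite I_D; [|exact: loc1_ip|exact: loc1_ip].
rewrite -(E_ItM hb hD') -(E_ItM hD hb') -intE_D; [|exact: intg_ItM|exact: intg_ItM].
rewrite -intE_D; [|exact: L2M|by apply: intgD; exact: intg_ItM].
have m1 := mprocM (mproc_It hb.1) (mproc_It hb'.1).
apply: intE_ae.
- by apply: measurable_funM; [exact: (L2_Dp t h0 hb).1|exact: (L2_Dp t h0' hb').1].
- apply: measurable_funD; first by apply: measurable_funM; [case: h0|case: h0'].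
  apply: measurable_funD.
    exact: (mproc1 t (mproc_It (mprocM hb.1 hD'.1))).
  exact: (mproc1 t (mproc_It (mprocM hD.1 hb'.1))).
- apply: filterS2 (lproc_loc1_path hb) (lproc_loc1_path hb') => w lw lw'.
  have mw := mproc2 w hb.1; have mw' := mproc2 w hb'.1.
  exact: ibp_affine.
Qed.

(** At an exceptional time the slices need not lie in L2 and the inner product need not be additive,
    so linearity is available only under the time integral. *)
Lemma It_ipDr b c c' t : lproc b -> lproc c -> lproc c' ->
  It t (fun s => ip P (b s) (fun w => c s w + c' s w)) =
  It t (fun s => ip P (b s) (c s)) + It t (fun s => ip P (b s) (c' s)).
Proof.
move=> hb hc hc'; have hcc := lprocD hc hc'.
have l1 := loc1_ip hb hc; have l2 := loc1_ip hb hc'.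
rewrite -(I_D _ l1 l2); apply: intE_ae.
- by apply: measurable_funM; [exact: measurable_cut|exact: (measurable_ip hb hcc)].
- apply: measurable_funM; first exact: measurable_cut.
  by apply: measurable_funD; [exact: (measurable_ip hb hc)|exact: (measurable_ip hb hc')].
- apply: (@filterS3 _ (almost_everywhere leb) (ae_filter_ringOfSetsType leb) _ _ _ _ _
    (lproc_L2_ae hb) (lproc_L2_ae hc) (lproc_L2_ae hc')) => s H1 H2 H3.
  have [/andP[h _]|/cut0 ->] := boolP (0 <= s <= t); last by rewrite !mul0r.
  by rewrite (ipDr (H2 h) (H3 h) (H1 h)).
Qed.

(* [perp] is kept abstract: only the pairing of the noises with the drifts matters. *)
Lemma E_semimart Y0 Y0' b b' (Z Z' : R -> T -> R) (cov_rate : R -> R) t : 0 <= t ->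
  L2 P Y0 -> L2 P Y0' -> lproc b -> lproc b' -> lproc Z -> lproc Z' ->
  (forall s, 0 <= s -> L2 P (Z s)) -> (forall s, 0 <= s -> L2 P (Z' s)) ->
  ip P Y0 (Z' t) = 0 -> ip P Y0' (Z t) = 0 ->
  {ae leb, forall s, 0 <= s <= t -> ip P (b s) (Z' t) = ip P (b s) (Z' s)} ->
  {ae leb, forall s, 0 <= s <= t -> ip P (b' s) (Z t) = ip P (b' s) (Z s)} ->
  ip P (Z t) (Z' t) = It t cov_rate -> loc1 cov_rate ->
  let Y s w := Dp Y0 b s w + Z s w in let Y' s w := Dp Y0' b' s w + Z' s w in
  ip P (Y t) (Y' t) = ip P Y0 Y0' +
    It t (fun s => ip P (b s) (Y' s) + ip P (Y s) (b' s) + cov_rate s).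
Proof.
move=> t0 h0 h0' hb hb' hZ hZ' Z_L2 Z2' o1 o2 o3 o4 hg lg Y Y'.
have hD := lproc_Dp h0 hb; have hD' := lproc_Dp h0' hb'.
have D2 := L2_Dp t h0 hb; have D2' := L2_Dp t h0' hb'.
have z2 := Z_L2 _ t0; have z2' := Z2' _ t0.
rewrite /Y /Y' (ipDl D2 z2 (L2D D2' z2')) (ipDr D2' z2' D2) (ipDr D2' z2' z2).
rewrite hg (E_ibp t0 h0 h0' hb hb').
(* A drift integral against a noise: by Fubini the value [V t] meets each [c s], and may be replaced
   there by [V s] because of the hypothesis on [c], which says that the later increment is
   orthogonal to [c s]. *)
have aux W0 c (V : R -> T -> R) : L2 P W0 -> lproc c -> lproc V -> (forall s, 0 <= s -> L2 P (V s)) ->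
   ip P W0 (V t) = 0 ->
   {ae leb, forall s, 0 <= s <= t -> ip P (c s) (V t) = ip P (c s) (V s)} ->
   ip P (Dp W0 c t) (V t) = It t (fun s => ip P (c s) (V s)).
  move=> hW hc hV V2 W_0 hcV.
  rewrite /Dp (ipDl hW (L2_It t hc) (V2 _ t0)) W_0 add0r ipC (E_It t (V2 _ t0) hc).
  apply: intE_ae.
  - apply: measurable_funM; first exact: measurable_cut.
    exact: (measurable_ip (lproc_rv (V2 _ t0)) hc).
  - apply: measurable_funM; first exact: measurable_cut.
    exact: (measurable_ip hc hV).
  - apply: (@filterS _ (almost_everywhere leb)) hcV => s hcV.
    have [h|/cut0 ->] := boolP (0 <= s <= t); last by rewrite !mul0r.
    by rewrite ipC hcV.
rewrite (aux _ _ _ h0 hb hZ' Z2' o1 o3) [ip P (Z t) _]ipC (aux _ _ _ h0' hb' hZ Z_L2 o2 o4).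
have hY : lproc Y by exact: lprocD.
have hY' : lproc Y' by exact: lprocD.
have lb := loc1_ip hb hY'; have lb' := loc1_ip hY hb'.
rewrite (I_D _ (loc1D lb lb') lg) (I_D _ lb lb') (It_ipDr t hb hD' hZ').
have eY : (fun s => ip P (Y s) (b' s)) = fun s => ip P (b' s) (Y s).
  by apply/funext => s; rewrite ipC.
rewrite eY (It_ipDr t hb' hD hZ).
rewrite (I_D _ (loc1_ip hb hD') (loc1_ip hD hb')).
have -> : (fun s => ip P (Dp Y0 b s) (b' s)) = fun s => ip P (b' s) (Dp Y0 b s).
  by apply/funext => s; rewrite ipC.
move: (It t cov_rate) (ip P Y0 Y0') (It t _) (It t _) (It t _) (It t _) => *; ring.
Qed.
End Proc.

(** * Independence and normal moments *)

Section Indep.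
Context {d : measure_display} {T : measurableType d} {R : realType}.
Variable P : probability T R.

(** Two finite measures, [P] restricted to [B] and [P] scaled by the probability of [B], agree on
    the pi-system [G], hence on the sigma-algebra that it generates. *)
Lemma indep_dynkin (G : set (set T)) (B : set T) : measurable B ->
  G `<=` measurable -> G setT -> setI_closed G ->
  (forall E, G E -> P (E `&` B) = (P E * P B)%E) ->
  forall E, <<s G >> E -> P (E `&` B) = (P E * P B)%E.
Proof.
move=> mB mG GT GI H E GE.
have fB : P B \is a fin_num by exact: fin_num_measure.
have p0 : 0 <= fine (P B) by rewrite fine_ge0.
have e2 A : mscale (NngNum p0) P A = (P A * P B)%E.
  by rewrite /mscale /= fineK// muleC.
have := @g_sigma_algebra_measure_unique _ R T G mG (fun=> setT) (fun=> GT) _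
  (mrestr P mB) (mscale (NngNum p0) P) GI _ _ E GE.
move=> h; rewrite -e2; apply: h.
- by apply/seteqP; split => // x _; exists 0%N.
- by move=> A GA; exact: (etrans (H A GA) (esym (e2 A))).
- move=> _; rewrite /mrestr; apply: le_lt_trans (probability_le1 P _) _; last exact: ltry.
  exact: measurableI.
Qed.

Definition as_mfun (X : T -> R) (mX : measurable_fun setT X) : {mfun T >-> R} :=
  MeasurableFun.Pack (MeasurableFun.Class (isMeasurableFun.Build _ _ _ _ _ mX)).

(** The joint law of [X] and [Y] agrees with the product of the marginal laws on rectangles, hence
    everywhere; the expectation of the product is then computed by Fubini on the plane. *)
Lemma indep_ip (X Y : T -> R) : L2 P X -> L2 P Y ->
  (forall A B, measurable A -> measurable B ->
     P (X @^-1` A `&` Y @^-1` B) = (P (X @^-1` A) * P (Y @^-1` B))%E) ->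
  ip P X Y = \int[P]_w X w * \int[P]_w Y w.
Proof.
move=> hX hY H; have mX := hX.1; have mY := hY.1.
have mXY : measurable_fun setT (fun w => (X w, Y w)) by exact: measurable_fun_pair.
pose XY : {mfun T >-> (R * R)%type} :=
  MeasurableFun.Pack (MeasurableFun.Class (isMeasurableFun.Build _ _ _ _ _ mXY)).
pose X' := as_mfun mX; pose Y' := as_mfun mY.
pose m' := pushforward P XY.
pose m1 := distribution P X'; pose m2 := distribution P Y'.
have U A : measurable A -> (m1 \x m2)%E A = m' A.
  by apply: product_measure_unique => A1 A2 mA1 mA2; rewrite -H.
have mf : measurable_fun setT (fun z : R * R => (z.1 * z.2)%:E).
  by apply/measurable_EFinP; apply: measurable_funM.
have iXY : P.-integrable setT ((fun z : R * R => (z.1 * z.2)%:E) \o XY) by exact: L2M.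
have i1 : intg m1 (fun x => x).
  have := @integrable_pushforward _ _ _ _ _ X' mX P setT EFin.
  apply => //; rewrite preimage_setT; exact: (L2_intg hX).
have i2 : intg m2 (fun x => x).
  have := @integrable_pushforward _ _ _ _ _ Y' mY P setT EFin.
  apply => //; rewrite preimage_setT; exact: (L2_intg hY).
have e1 : \int[m1]_x x = \int[P]_w X w.
  congr fine; have := @integral_pushforward _ _ _ _ _ X' mX P setT EFin.
  by apply => //; rewrite preimage_setT; exact: (L2_intg hX).
have e2 : \int[m2]_x x = \int[P]_w Y w.
  congr fine; have := @integral_pushforward _ _ _ _ _ Y' mY P setT EFin.
  by apply => //; rewrite preimage_setT; exact: (L2_intg hY).
have := fub_E1 (prod_intg i1 i2).
have -> : \int[m1]_x \int[m2]_y (x * y) = \int[P]_w X w * \int[P]_w Y w.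
  rewrite -e1 -e2 mulrC -(intE_Z _ i1); apply: eq_Rintegral => x _.
  by rewrite mulrC -intE_Z.
move=> ->; congr fine.
have := @integral_pushforward _ _ _ _ _ XY mXY P setT _ mf.
rewrite preimage_setT => /(_ iXY measurableT) <-.
by symmetry; apply: eq_measure_integral => A mA _; exact: U.
Qed.

Lemma mutually_independent2 (I : eqType) (F : I -> set_system T) i j E E' :
  mutually_independent P F -> i != j -> F i E -> F j E' ->
  P (E `&` E') = (P E * P E')%E.
Proof.
move=> mi ij Fi Fj.
have := mi [:: i; j] (fun k => if k == i then E else E').
rewrite /= inE ij => /(_ isT); rewrite !big_cons big_nil mule1 eqxx eq_sym (negbTE ij).
have -> : \bigcap_(i0 in [set` [:: i; j]]) (if i0 == i then E else E') = E `&` E'.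
  apply/seteqP; split => w /=.
    move=> H; split; first by have := H i; rewrite /= inE eqxx; apply.
    by have := H j; rewrite /= !inE eqxx orbT eq_sym (negbTE ij); apply.
  move=> [h1 h2] k /=; rewrite !inE => /orP[]/eqP ->; rewrite ?eqxx//.
  by rewrite eq_sym (negbTE ij).
apply => k; rewrite !inE => /orP[]/eqP ->; rewrite ?eqxx//.
by rewrite eq_sym (negbTE ij).
Qed.

Lemma sigma_rv_mem (J : Type) (D : set J) (X : J -> T -> R) j A : D j -> measurable A ->
  sigma_rv D X (X j @^-1` A).
Proof.
move=> Dj mA; apply: sub_sigma_algebra; exists j => //; exists A => //.
by rewrite setTI.
Qed.

Lemma sigma_rv_measurable (J : Type) (D : set J) (X : J -> T -> R) :
  (forall j, D j -> measurable_fun setT (X j)) -> sigma_rv D X `<=` measurable.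
Proof.
move=> mX; apply: smallest_sub; first exact: sigma_algebra_measurable.
by move=> E [j Dj [A mA <-]]; exact: mX.
Qed.

Lemma sigma_rv_sub (J : Type) (D : set J) (X : J -> T -> R) (S : set_system T) :
  sigma_algebra setT S -> (forall j A, D j -> measurable A -> S (X j @^-1` A)) ->
  sigma_rv D X `<=` S.
Proof.
move=> sS H; apply: smallest_sub => // E [j Dj [A mA <-]]; rewrite setTI; exact: H.
Qed.
End Indep.

(** * Densities and moments of the normal law *)

Section Density.
Context {d d' : measure_display} {T : measurableType d} {T' : measurableType d'} {R : realType}.
Variables (mu : {sigma_finite_measure set T -> \bar R}) (nu : {sigma_finite_measure set T' -> \bar R}).
Notation leb := (@lebesgue_measure R).

(* Layer cake: f x is the Lebesgue measure of [0, f x]. *)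
Lemma density_integral (X : T' -> T) (g f : T -> R) : measurable_fun setT X ->
  (forall x, 0 <= g x) -> measurable_fun setT g ->
  (forall x, 0 <= f x) -> measurable_fun setT f ->
  (forall E, measurable E -> nu (X @^-1` E) = \int[mu]_(x in E) (g x)%:E)%E ->
  (\int[nu]_x (f (X x))%:E = \int[mu]_x (f x * g x)%:E)%E.
Proof.
move=> mX g0 mg f0 mf H.
pose F (z : T * R) := cut (f z.1) z.2.
pose F' (z : T' * R) := cut (f (X z.1)) z.2.
have mF : measurable_fun setT F by apply: measurable_cut2 => //; exact: measurableT_comp.
have mF' : measurable_fun setT F'.
  by apply: measurable_cut2 => //; apply: (measurableT_comp mf); exact: measurableT_comp.
have layer (x : T) : (\int[leb]_r (cut (f x) r)%:E)%E = (f x)%:E.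
  by rewrite (intE_EFin (intg_cut _)) I_cst.
have -> : (\int[nu]_x (f (X x))%:E = \int[nu]_x \int[leb]_r (F' (x, r))%:E)%E.
  by apply: eq_integral => x _; exact: (esym (layer (X x))).
have -> : (\int[mu]_x (f x * g x)%:E = \int[mu]_x \int[leb]_r (F (x, r) * g x)%:E)%E.
  apply: eq_integral => x _; rewrite EFinM -layer -ge0_integralZr// ?lee_fin//.
  - by apply/measurable_EFinP; exact: measurable_cut.
  - by move=> r _; rewrite lee_fin cut_ge0.
rewrite ((@fubini_tonelli _ _ _ _ _ nu leb (EFin \o F'))); last 2 first.
- exact/measurable_EFinP.
- by move=> z; rewrite lee_fin cut_ge0.
rewrite ((@fubini_tonelli _ _ _ _ _ mu leb (fun z => (F z * g z.1)%:E))); last 2 first.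
- by apply/measurable_EFinP; apply: measurable_funM => //; exact: measurableT_comp.
- by move=> z; rewrite lee_fin mulr_ge0 ?cut_ge0.
apply: eq_integral => r _ /=.
pose A := [set x : T | (0 <= r <= f x)%R].
have eA x : F (x, r) = \1_A x.
  by rewrite /F /= cutE indicE; congr (nat_of_bool _)%:R; apply/idP/idP; rewrite inE.
have mA : measurable A.
  have [r0|r0] := boolP (0 <= r)%R.
    rewrite (_ : A = f @^-1` `[r, +oo[); first by rewrite -[X in measurable X]setTI; exact: mf.
    by apply/seteqP; split => x /=; rewrite /A /= in_itv/= andbT r0.
  rewrite (_ : A = set0)//; apply/seteqP; split => x //=.
  by rewrite /A /= (negbTE r0).
have mXA : measurable (X @^-1` A) by rewrite -[X in measurable X]setTI; exact: mX.
transitivity (\int[nu]_x (\1_(X @^-1` A) x)%:E)%E.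
  by apply: eq_integral => x _; congr EFin; exact: eA.
transitivity (nu (X @^-1` A)); first by rewrite integral_indic// setIT.
rewrite (H _ mA) integral_mkcond.
apply: eq_integral => x _; rewrite eA patchE indicE.
by case: ifP => _; rewrite ?mul1r ?mul0r.
Qed.
End Density.

Section Normal.
Context {R : realType}.
Notation leb := (@lebesgue_measure R).

(* Its value 1 is never needed. *)
Definition normal_m2 : R := \int[leb]_x (x ^+ 2 * normal_pdf 0 1 x).

(** From 1 + y <= e^y with y = x^2 / 4, the integrand is at most a multiple of e^(- x^2 / 4), that
    is, of the normal density with standard deviation sqrt 2. *)
Lemma intg_normal_m2 : intg leb (fun x : R => x ^+ 2 * normal_pdf 0 1 x).
Proof.
have s2 : Num.sqrt 2 != 0 :> R by rewrite gt_eqF// sqrtr_gt0.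
have := intgZ (4 * normal_peak 1 / normal_peak (Num.sqrt 2)) (@integrable_normal_pdf R 0 (Num.sqrt 2)).
apply: (@intg_le _ _ _ leb).
  by apply: measurable_funM => //; exact: measurable_normal_pdf.
move=> x; rewrite ger0_norm; last by apply: mulr_ge0; [exact: sqr_ge0|exact: normal_pdf_ge0].
rewrite !normal_pdfE ?oner_eq0// !mulrA mulfVK; last by rewrite gt_eqF// normal_peak_gt0.
rewrite -[X in X <= _]mulrA [X in X <= _]mulrCA.
rewrite [4 * _]mulrC -[X in _ <= X]mulrA ler_wpM2l ?normal_peak_ge0//.
rewrite /normal_fun subr0 expr1n sqr_sqrtr//.
have -> : - x ^+ 2 / (1 *+ 2) = - (x ^+ 2 / 4) + (- x ^+ 2 / (2 *+ 2)) by field.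
rewrite expRD mulrA ler_wpM2r ?expR_ge0//.
rewrite expRN ler_pdivrMr ?expR_gt0//.
have := expR_ge1Dx (x ^+ 2 / 4); lra.
Qed.

Lemma normal_m2_ge0 : 0 <= normal_m2.
Proof. by apply: intE_ge0 => x; rewrite mulr_ge0 ?sqr_ge0 ?normal_pdf_ge0. Qed.

Lemma normal_pdf_scale (a x : R) : 0 < a -> a * normal_pdf 0 a (a * x) = normal_pdf 0 1 x.
Proof.
move=> a0; have an0 : a != 0 by rewrite gt_eqF.
rewrite !normal_pdfE ?oner_eq0// mulrA; congr (_ * _); last first.
  by rewrite /normal_fun !subr0 exprMn -mulrnAr; congr expR; field.
rewrite /normal_peak -mulrnAr expr1n mul1r sqrtrM ?sqr_ge0// sqrtr_sqr gtr0_norm//.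
by rewrite invfM mulrA divff// mul1r.
Qed.

(** The substitution x -> a x reduces to the standard density by [normal_pdf_scale]. *)
Lemma normal_second_moment (a : R) : 0 < a ->
  (\int[leb]_x (x ^+ 2 * normal_pdf 0 a x)%:E = (a ^+ 2 * normal_m2)%:E)%E.
Proof.
move=> a0; have an0 : a != 0 by rewrite gt_eqF.
have dF (x : R) : is_derive x 1 (fun y : R => a * y) a.
  by apply: is_derive_eq; rewrite /GRing.scale/= mulr1.
have dF1 : derive1 (fun y : R => a * y) = (fun=> a).
  by apply/funext => x; rewrite derive1E; exact: derive_val.
rewrite (@increasing_ge0_integration_by_substitutionT _ (fun x => a * x)).
- rewrite dF1; transitivity (\int[leb]_x ((a ^+ 2)%:E * (x ^+ 2 * normal_pdf 0 1 x)%:E))%E.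
    apply: eq_integral => x _; rewrite -EFinM /=; congr EFin.
    rewrite -(normal_pdf_scale x a0) /GRing.mul/= -[RHS]/(a ^+ 2 * (x ^+ 2 * (a * normal_pdf 0 a (a * x)))).
    rewrite -[LHS]/((a * x) ^+ 2 * normal_pdf 0 a (a * x) * a); ring.
  rewrite integralZl//; last exact: intg_normal_m2.
  by rewrite (intE_EFin intg_normal_m2) -EFinM.
- by move=> x y; rewrite ltr_pM2l.
- by rewrite dF1; exact: cst_continuous.
- by rewrite dF1; exact: is_cvg_cst.
- by rewrite dF1; exact: is_cvg_cst.
- by move=> x; have [] := dF x.
- by apply: gt0_cvgMrNy => //; exact: cvg_id.
- by apply: gt0_cvgMry => //; exact: cvg_id.
- move=> x; apply: cvgM; first exact: sqr_continuous.
  exact: continuous_normal_pdf.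
- by move=> x; rewrite mulr_ge0 ?sqr_ge0 ?normal_pdf_ge0.
Qed.

Lemma normal_pdfN (a x : R) : 0 < a -> normal_pdf 0 a (- x) = normal_pdf 0 a x.
Proof.
move=> a0; have an0 : a != 0 by rewrite gt_eqF.
by rewrite !normal_pdfE// /normal_fun !subr0 sqrrN.
Qed.

Lemma normal_reflect (a : R) (g : R -> R) : 0 < a -> measurable_fun setT g -> (forall x, 0 <= g x) ->
  (\int[leb]_x (g x * normal_pdf 0 a x)%:E = \int[leb]_x (g (- x)%R * normal_pdf 0 a x)%:E)%E.
Proof.
move=> a0 mg g0; have mf : measurable_fun setT (fun x => (g x * normal_pdf 0 a x)%:E).
  by apply/measurable_EFinP; apply: measurable_funM => //; exact: measurable_normal_pdf.
have f0 x : (0 <= (g x * normal_pdf 0 a x)%:E)%E by rewrite lee_fin mulr_ge0 ?normal_pdf_ge0.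
transitivity (\int[pushforward leb (-%R : _ -> measurableTypeR R)]_x (g x * normal_pdf 0 a x)%:E)%E.
  by apply: eq_measure_integral => //= A mA AS; exact/esym/lebesgue_measureN.
rewrite ge0_integral_pushforward; last first.
- by move=> x _; exact: f0.
- exact: mf.
- exact: measurableT.
- exact: oppr_measurable.
rewrite preimage_setT; apply: eq_integral => x _.
by rewrite -[in RHS](normal_pdfN x a0).
Qed.
End Normal.

Section NormalRV.
Context {d : measure_display} {T : measurableType d} {R : realType}.
Variable P : probability T R.
Notation leb := (@lebesgue_measure R).
Variables (X : T -> R) (a : R).
Hypotheses (mX : measurable_fun setT X) (a0 : 0 < a)
  (HX : forall E, measurable E -> P (X @^-1` E) = normal_prob 0 a E).

Lemma normal_rv_ge0 (f : R -> R) : measurable_fun setT f -> (forall x, 0 <= f x) ->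
  (\int[P]_w (f (X w))%:E = \int[leb]_x (f x * normal_pdf 0 a x)%:E)%E.
Proof.
move=> mf f0; apply: (@density_integral _ _ _ _ _ leb P X (normal_pdf 0 a) f) => //.
- by move=> x; exact: normal_pdf_ge0.
- exact: measurable_normal_pdf.
Qed.

Lemma normal_rv_L2 : L2 P X.
Proof.
apply: L2P => //.
have -> := @normal_rv_ge0 (fun x => x ^+ 2) (measurable_funX 2 (@measurable_id _ _ _)) (fun x => sqr_ge0 x).
by rewrite normal_second_moment// ltry.
Qed.

Lemma normal_rv_ip : ip P X X = a ^+ 2 * normal_m2.
Proof.
have [_ i2] := normal_rv_L2; rewrite /ip.
under eq_Rintegral do rewrite -expr2.
rewrite /Rintegral; have -> := @normal_rv_ge0 (fun x => x ^+ 2) (measurable_funX 2 (@measurable_id _ _ _)) (fun x => sqr_ge0 x).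
by rewrite normal_second_moment.
Qed.

(** The density formula [normal_rv_ge0] is for nonnegative functions, so [X] is split into its
    positive and negative parts, [p (X w)] and [p (- X w)], whose integrals agree by reflection. *)
Lemma normal_rv_mean : \int[P]_w X w = 0.
Proof.
have iX := L2_intg normal_rv_L2.
pose p (x : R) := Num.max x 0.
have mp : measurable_fun setT p by exact: measurable_maxr.
have p0 x : 0 <= p x by rewrite /p le_max lexx orbT.
have E1 := normal_rv_ge0 mp p0.
have mpN : measurable_fun setT (fun x : R => p (- x)) by exact: measurableT_comp.
have E2 := normal_rv_ge0 mpN (fun x => p0 (- x)).
have pd (x : R) : x = p x - p (- x).
  by rewrite /p !maxEle; case: (leP x 0); case: (leP (- x) 0); lra.
have pi (x : R) : `|p x| <= `|x|.
  by rewrite ger0_norm// /p ge_max normr_ge0 ler_norm.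
have iXp : intg P (fun w => p (X w)).
  apply: (intg_le (measurableT_comp mp mX) (fun w => pi (X w))); exact: intg_abs.
have iXn : intg P (fun w => p (- X w)).
  apply: (intg_le (g := fun w => `|X w|) (measurableT_comp mpN mX)); last exact: intg_abs.
  by move=> w; rewrite -[X in _ <= X]normrN; exact: pi.
rewrite (_ : \int[P]_w X w = \int[P]_w (p (X w) - p (- X w))); last by apply: eq_Rintegral => w _; exact: pd.
rewrite intE_B//; apply/eqP; rewrite subr_eq0; apply/eqP; congr fine.
by rewrite E1 E2; exact: normal_reflect.
Qed.
End NormalRV.

(** * Brownian motions and the filtration *)

Section SubSigma.
Context {d : measure_display} {T : measurableType d} {R : realType}.
Implicit Types (G : set_system T) (X Y : T -> R).

(** A predicate relative to a generating family, so that one map can be compared with several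
    sub-sigma-algebras; [gmeasP] transports the usual closure properties. *)
Definition gmeas G X := forall E, measurable E -> <<s G>> (X @^-1` E).

Lemma gmeasP G X : gmeas G X <-> measurable_fun (setT : set (g_sigma_algebraType G)) (X : g_sigma_algebraType G -> R).
Proof.
split=> [H _ E mE|H E mE]; first by rewrite setTI; exact: H.
by have := H measurableT E mE; rewrite setTI.
Qed.

Lemma gmeasD G X Y : gmeas G X -> gmeas G Y -> gmeas G (fun w => X w + Y w).
Proof. by move=> /gmeasP hX /gmeasP hY; apply/gmeasP; exact: measurable_funD. Qed.

Lemma gmeasB G X Y : gmeas G X -> gmeas G Y -> gmeas G (fun w => X w - Y w).
Proof. by move=> /gmeasP hX /gmeasP hY; apply/gmeasP; exact: measurable_funB. Qed.

Lemma gmeasZ G c X : gmeas G X -> gmeas G (fun w => c * X w).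
Proof. by move=> /gmeasP hX; apply/gmeasP; exact: measurable_funM. Qed.

Lemma gmeas_cst G c : gmeas G (fun=> c).
Proof. by apply/gmeasP; exact: measurable_cst. Qed.

Lemma gmeas_sum G (I : Type) (r : seq I) (h : I -> T -> R) :
  (forall i, gmeas G (h i)) -> gmeas G (fun w => \sum_(i <- r) h i w).
Proof. by move=> H; apply/gmeasP; apply: measurable_sum => i; exact/gmeasP. Qed.

Lemma gmeas_sub G G' X : <<s G>> `<=` <<s G'>> -> gmeas G X -> gmeas G' X.
Proof. by move=> GG H E mE; apply: GG; exact: H. Qed.

Lemma sigma_rv_gmeas (J : Type) (D : set J) (X : J -> T -> R) j : D j ->
  gmeas (\bigcup_(j in D) preimage_set_system setT (X j) measurable) (X j).
Proof. by move=> Dj E mE; exact: sigma_rv_mem. Qed.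
End SubSigma.

Section Join.
Context {d : measure_display} {T : measurableType d} {R : realType}.
Variable P : probability T R.

Lemma bigcap_seq_closed (I : eqType) (S : set_system T) (l : seq I) (A : I -> set T) :
  setI_closed S -> S setT -> (forall j, j \in l -> S (A j)) -> S (\bigcap_(j in [set` l]) A j).
Proof.
move=> SI ST; elim: l => [_|x l IH H]; first by rewrite set_nil bigcap_set0.
have -> : \bigcap_(j in [set` x :: l]) A j = A x `&` \bigcap_(j in [set` l]) A j.
  apply/seteqP; split => w.
    move=> h; split; first by apply: h; rewrite /= mem_head.
    by move=> j jl; apply: h; rewrite /= inE; apply/orP; right.
  by move=> [h1 h2] j /=; rewrite inE => /predU1P[->//|]; exact: h2.
apply: SI; first by apply: H; rewrite mem_head.
by apply: IH => j jl; apply: H; rewrite inE jl orbT.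
Qed.

Lemma gsigma_setI (G : set_system T) : setI_closed <<s G>>.
Proof. by move=> A B HA HB; exact: (@measurableI _ (g_sigma_algebraType G)). Qed.

Lemma gsigma_setT (G : set_system T) : <<s G>> setT.
Proof. exact: (@measurableT _ (g_sigma_algebraType G)). Qed.

Lemma measurable_setI : setI_closed (@measurable _ T).
Proof. by move=> A B; exact: measurableI. Qed.

Lemma measure_ae (A B : set T) : measurable A -> measurable B ->
  {ae P, forall w, A w <-> B w} -> P A = P B.
Proof.
move=> mA mB H; rewrite -(setIT A) -(setIT B) -!integral_indic//.
apply: ae_eq_integral => //.
- by apply/measurable_EFinP; exact: measurable_indic.
- by apply/measurable_EFinP; exact: measurable_indic.
by apply: filterS H => w h _; rewrite !indicE; congr ((nat_of_bool _)%:R)%:E; apply/idP/idP; rewrite !inE => /h.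
Qed.

(** Intersections of one event from each [F j], [j] in [s], form a pi-system that generates the
    joint sigma-algebra; on it the claim is mutual independence for the list [i :: s]. *)
Lemma mi_join (I : eqType) (F : I -> set_system T) (s : seq I) i E E' :
  uniq s -> i \notin s -> mutually_independent P F ->
  (forall j, setI_closed (F j)) -> (forall j, F j setT) -> (forall j, F j `<=` measurable) ->
  <<s \bigcup_(j in [set` s]) F j >> E -> F i E' -> P (E `&` E') = (P E * P E')%E.
Proof.
move=> us is_ mi FI FT Fm HE FE'.
pose G := [set E | exists2 A : I -> set T, forall j, F j (A j) & E = \bigcap_(j in [set` s]) A j].
have GE : <<s G>> E.
  apply: (smallest_sub _ _ HE); first exact: smallest_sigma_algebra.
  move=> A [j /= js FA]; apply: sub_sigma_algebra.
  exists (fun k => if k == j then A else setT); first by move=> k; case: eqP => [->|].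
  apply/seteqP; split => w; first by move=> Aw k _; case: eqP.
  by move=> /(_ j js); rewrite eqxx.
apply: (indep_dynkin (Fm _ _ FE') _ _ _ _ GE) => {E HE GE}.
- move=> _ [A FA ->]; apply: bigcap_seq_closed => //; [exact: measurable_setI|]; move=> j _; exact: Fm (FA j).
- exists (fun=> setT) => //; by apply/seteqP; split.
- move=> _ _ [A FA ->] [A' FA' ->]; exists (fun j => A j `&` A' j); last by rewrite bigcapI.
  by move=> j; exact: FI.
move=> _ [A FA ->].
pose A' j := if j == i then E' else A j.
have nis j : j \in s -> j == i = false by move=> js; apply: contraNF is_ => /eqP <-.
have -> : \bigcap_(j in [set` s]) A j `&` E' = \bigcap_(j in [set` i :: s]) A' j.
  apply/seteqP; split => w.
    move=> [H1 H2] j /=; rewrite inE /A'; case: eqP => [//|_ /=]; exact: H1.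
  move=> H; split; last by have := H i; rewrite /A' /= inE eqxx; apply.
  by move=> j /= js; have := H j; rewrite /A' /= inE js orbT nis//; apply.
rewrite mi/= ?is_//; last by move=> j _; rewrite /A'; case: eqP => [->|].
rewrite big_cons {1}/A' eqxx [in RHS](mi s A)//.
rewrite muleC; congr (_ * _)%E.
by apply: eq_big_seq => j js; rewrite /A' nis.
Qed.
End Join.

(** * Increments of the Brownian motions and independence of the past *)

Section Brown.
Context {d : measure_display} {T : measurableType d} {R : realType}.
Variable P : probability T R.
Notation leb := (@lebesgue_measure R).

Section one.
Variable W : R -> T -> R.
Hypothesis hW : brownian_motion P W.

Definition incr a b : T -> R := fun w => W b w - W a w.

Lemma bm_meas t : 0 <= t -> measurable_fun setT (W t).
Proof. by case: hW => + _ _ _ _; apply. Qed.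

Lemma incr_meas a b : 0 <= a -> 0 <= b -> measurable_fun setT (incr a b).
Proof. by move=> a0 b0; apply: measurable_funB; exact: bm_meas. Qed.

Lemma incr_normal a b : 0 <= a -> a <= b ->
  [/\ L2 P (incr a b), \int[P]_w incr a b w = 0 & ip P (incr a b) (incr a b) = normal_m2 * (b - a)].
Proof.
(* The normal law of an increment is prescribed for distinct times; the zero increment is treated
   apart. *)
move=> a0; rewrite le_eqVlt => /predU1P[<-|ab].
  have -> : incr a a = fun=> 0 by apply/funext => w; rewrite /incr subrr.
  split; [exact: L2_0|exact: intE_0|].
  rewrite subrr mulr0 -[RHS](intE_0 P); apply: eq_Rintegral => w _; exact: mulr0.
have s0 : 0 < Num.sqrt (b - a) by rewrite sqrtr_gt0 subr_gt0.
have m := incr_meas a0 (ltW (le_lt_trans a0 ab)).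
have H E : measurable E -> P (incr a b @^-1` E) = normal_prob 0 (Num.sqrt (b - a)) E.
  by case: hW => _ _ _ + _; apply; rewrite a0.
split; [exact: (normal_rv_L2 m s0 H)|exact: (normal_rv_mean m s0 H)|].
by rewrite (normal_rv_ip m s0 H) sqr_sqrtr ?subr_ge0 ?ltW// mulrC.
Qed.

Lemma incr_L2 a b : 0 <= a -> a <= b -> L2 P (incr a b).
Proof. by move=> a0 /(incr_normal a0)[]. Qed.

Lemma incr_mean a b : 0 <= a -> a <= b -> \int[P]_w incr a b w = 0.
Proof. by move=> a0 /(incr_normal a0)[]. Qed.

Lemma incr_disjoint a b c e : 0 <= a -> a <= b -> b <= c -> c <= e ->
  ip P (incr a b) (incr c e) = 0.
Proof.
move=> a0 ab bc ce; have c0 : 0 <= c by rewrite (le_trans a0)// (le_trans ab).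
rewrite indep_ip ?incr_mean ?mul0r//; [exact: incr_L2|exact: incr_L2|].
(* The four times give three consecutive increments, of which the first and the third are wanted. *)
move=> A B mA mB; case: hW => _ _ _ _ /(_ 3%N (fun j => nth e [:: a; b; c; e] j) a0).
have H j : (j < 3)%N -> nth e [:: a; b; c; e] j <= nth e [:: a; b; c; e] j.+1.
  by case: j => [|[|[|]]].
move=> /(_ H) mi.
apply: (@mutually_independent2 _ _ _ _ _ _ (ord0 : 'I_3) (inord 2) _ _ mi).
- by apply/eqP => /(congr1 val); rewrite /= inordK.
- exact: (@sigma_rv_mem _ _ _ _ [set: unit] (fun _ => incr a b) tt).
- have -> : (nth e [:: a; b; c; e] (inord 2 : 'I_3)) = c by rewrite inordK.
  have -> : (nth e [:: a; b; c; e] (inord 2 : 'I_3).+1) = e by rewrite inordK.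
  exact: (@sigma_rv_mem _ _ _ _ [set: unit] (fun _ => incr c e) tt).
Qed.

Lemma incr0_cov s t : 0 <= s -> s <= t -> ip P (incr 0 s) (incr 0 t) = normal_m2 * s.
Proof.
move=> s0 st; have -> : incr 0 t = fun w => incr 0 s w + incr s t w.
  by apply/funext => w; rewrite /incr; ring.
rewrite ipDr; [|exact: incr_L2..].
by rewrite (incr_disjoint (lexx 0) s0 (lexx s) st) addr0; have [_ _ ->] := incr_normal (lexx 0) s0; rewrite subr0.
Qed.

Lemma cut_mul_int s t : 0 <= s -> s <= t -> \int[leb]_x (cut s x * cut t x) = s.
Proof.
by move=> s0 st; rewrite -[RHS](I_cst s0); apply: eq_Rintegral => x _; rewrite mulrC cut_le.
Qed.

Lemma incr0_cov_ip s t : 0 <= s -> 0 <= t -> ip P (incr 0 s) (incr 0 t) = normal_m2 * ip leb (cut s) (cut t).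
Proof.
move=> s0 t0; have [st|/ltW ts] := leP s t; first by rewrite incr0_cov// /ip cut_mul_int.
by rewrite ipC incr0_cov// ipC /ip cut_mul_int.
Qed.

Lemma incrE a b : incr a b = fun w => incr 0 b w - incr 0 a w.
Proof. by apply/funext => w; rewrite /incr; ring. Qed.

Lemma indic_cut (a b s : R) : 0 <= a -> a <= b -> \1_(`]a, b]) s = cut b s - cut a s :> R.
Proof.
move=> a0 ab; rewrite !cutE indicE.
rewrite (_ : (s \in _) = (a < s <= b)%R); last by apply/idP/idP; rewrite inE/= in_itv.
case: (ltP a s) => [as_|sa] /=.
  by rewrite (ltW (le_lt_trans a0 as_)) /= subr0.
rewrite (le_trans sa ab) andbT.
by rewrite subrr.
Qed.

Lemma L2_indic_itv (a b : R) : 0 <= a -> a <= b -> L2 leb (\1_(`]a, b]) : R -> R).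
Proof.
move=> a0 ab; rewrite (_ : \1__ = fun s => cut b s - cut a s); first by apply: L2B; exact: L2_cut.
by apply/funext => s; exact: indic_cut.
Qed.

(** With indicators on the right, both sides are bilinear in the same way, which gives the Ito
    isometry of step functions term by term. Expanding increments from 0 reduces to the covariance
    of [W s] and [W t], proportional to their earlier time. *)
Lemma incr_cov a b c e : 0 <= a -> a <= b -> 0 <= c -> c <= e ->
  ip P (incr a b) (incr c e) = normal_m2 * ip leb \1_(`]a, b]) \1_(`]c, e]).
Proof.
move=> a0 ab c0 ce; have b0 := le_trans a0 ab; have e0 := le_trans c0 ce.
have -> : (\1_(`]a, b]) : R -> R) = fun s => cut b s - cut a s by apply/funext => s; exact: indic_cut.
have -> : (\1_(`]c, e]) : R -> R) = fun s => cut e s - cut c s by apply/funext => s; exact: indic_cut.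
have w2 t : 0 <= t -> L2 P (incr 0 t) by exact: incr_L2.
have c2 t : L2 leb (cut t) by exact: L2_cut.
rewrite (incrE a b) (incrE c e).
rewrite (ipBl (w2 _ b0) (w2 _ a0) (L2B (w2 _ e0) (w2 _ c0))).
rewrite (ipBr (w2 _ e0) (w2 _ c0) (w2 _ b0)) (ipBr (w2 _ e0) (w2 _ c0) (w2 _ a0)).
rewrite (ipBl (c2 b) (c2 a) (L2B (c2 e) (c2 c))) (ipBr (c2 e) (c2 c) (c2 b)) (ipBr (c2 e) (c2 c) (c2 a)).
rewrite !incr0_cov_ip//; move: (ip leb _ _) (ip leb _ _) (ip leb _ _) (ip leb _ _) => *; ring.
Qed.


(** The definition of a Brownian motion speaks of consecutive increments only. The past is generated
    by cylinders at finitely many times; sorting these times together with 0 and appending [a] and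
    [b] gives a partition in which the cylinder depends on the increments before [a] and the last
    increment is the given one. *)
Lemma bm_past_indep s a b E B : 0 <= s -> s <= a -> a <= b ->
  sigma_rv `[0, s] W E -> measurable B ->
  P (E `&` incr a b @^-1` B) = (P E * P (incr a b @^-1` B))%E.
Proof.
move=> s0 sa ab HE mB; have a0 := le_trans s0 sa; have b0 := le_trans a0 ab.
have mD : measurable (incr a b @^-1` B) by rewrite -[X in measurable X]setTI; exact: incr_meas.
pose G := [set E | exists (l : seq R) (A : R -> set R), [/\ forall t, t \in l -> 0 <= t <= s,
  forall t, measurable (A t) & E = \bigcap_(t in [set` l]) W t @^-1` A t]].
have Wi t A : 0 <= t <= s -> measurable A -> measurable (W t @^-1` A).
  by move=> /andP[t0 _] mA; rewrite -[X in measurable X]setTI; exact: bm_meas.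
have GE : <<s G>> E.
  apply: (sigma_rv_sub _ _ HE); first exact: smallest_sigma_algebra.
  move=> t A /=; rewrite in_itv/= => ts mA; apply: sub_sigma_algebra.
  exists [:: t], (fun=> A); split => //; first by move=> u; rewrite inE => /eqP ->.
  by rewrite set_cons1 bigcap_set1.
apply: (indep_dynkin mD _ _ _ _ GE) => {E HE GE}.
- move=> _ [l [A [Hl mA ->]]]; apply: bigcap_seq_closed => //; [exact: measurable_setI|] => t tl.
  by apply: Wi => //; exact: Hl.
- exists [::], (fun=> setT); split => //; by rewrite set_nil bigcap_set0.
- move=> _ _ [l [A [Hl mA ->]]] [l' [A' [Hl' mA' ->]]].
  exists (l ++ l'), (fun t => (if t \in l then A t else setT) `&` (if t \in l' then A' t else setT)).
  split.
  + by move=> t; rewrite mem_cat => /orP[/Hl|/Hl'].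
  + by move=> t; apply: measurableI; case: ifP.
  + apply/seteqP; split => w.
      move=> [H1 H2] t /= _; split; case: ifP => // h; [exact: (H1 t)|exact: (H2 t)].
    move=> H; split => t /= h; have := H t; rewrite /= mem_cat h ?orbT => /(_ isT)[]//.
move=> _ [l [A [Hl mA ->]]].
(* [W t] is replaced by [W t - W 0], a sum of increments; the two cylinders agree almost surely
   because [W 0] vanishes almost surely. *)
set E := \bigcap_(t in _) _; pose E' := \bigcap_(t in [set` l]) incr 0 t @^-1` A t.
have mE : measurable E by apply: bigcap_seq_closed => //; [exact: measurable_setI|] => t tl; apply: Wi => //; exact: Hl.
have mE' : measurable E'.
  apply: bigcap_seq_closed => //; [exact: measurable_setI|] => t tl; have /andP[t0 _] := Hl _ tl.
  by rewrite -[X in measurable X]setTI; exact: incr_meas.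
have aeE (D : set T) : measurable D -> P (E `&` D) = P (E' `&` D).
  move=> mD'; apply: measure_ae => //; [exact: measurableI|exact: measurableI|].
  have [_ W0 _ _ _] := hW; apply: filterS W0 => w W0.
  have e t A' : (W t @^-1` A') w <-> (incr 0 t @^-1` A') w by rewrite /= /incr W0 subr0.
  by split=> -[H1 H2]; split => // t tl; apply/e; exact: H1.
have := aeE _ measurableT; rewrite !setIT => ->; rewrite aeE//.
pose v := sort <=%R (0 :: l) ++ [:: a; b]; pose tau j := nth b v j; pose k := (size l).+1.
have sk : size (sort <=%R (0 :: l)) = k by rewrite size_sort.
have vk : tau k = a by rewrite /tau /v nth_cat sk ltnn subnn.
have vk1 : tau k.+1 = b by rewrite /tau /v nth_cat sk ltnNge leqnSn /= subSnn.
have sl t : t \in sort <=%R (0 :: l) -> 0 <= t <= s.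
  by rewrite mem_sort inE => /predU1P[->|/Hl//]; rewrite lexx.
have sv : sorted <=%R v.
  rewrite (sorted_pairwise le_trans) /v pairwise_cat -(sorted_pairwise le_trans) sort_le_sorted/= ab !andbT.
  by apply/allrelP => x y /sl/andP[_ xs]; rewrite !inE => /orP[]/eqP ->; rewrite (le_trans xs)// (le_trans sa).
have szv : size v = k.+2 by rewrite size_cat sk /= addn2.
have tm i j : (i <= j)%N -> (j <= k.+1)%N -> tau i <= tau j.
  move=> ij jk; apply: (sorted_leq_nth le_trans le_refl) => //; rewrite inE szv ltnS//.
  exact: leq_trans jk.
have tau0 : 0 <= tau 0%N.
  by move: (sl (tau 0%N)); rewrite {1}/tau /v nth_cat sk /= mem_nth ?sk// => /(_ isT)/andP[].
have tau_ge0 j : (j <= k.+1)%N -> 0 <= tau j by move=> jk; apply: le_trans tau0 _; exact: tm.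
case: hW => _ _ _ _ /(_ k.+1 tau tau0) mi.
have {mi}mi := mi (fun j jk => tm _ _ (leqnSn j) jk).
pose F (j : 'I_k.+1) := sigma_rv [set: unit] (fun _ w => W (tau j.+1) w - W (tau j) w).
pose js := seq.filter (fun j : 'I_k.+1 => (j < k)%N) (enum 'I_k.+1).
have FE' : <<s \bigcup_(j in [set` js]) F j >> E'.
  set GG := \bigcup_(j in _) _.
  have h j : (j <= k)%N -> gmeas GG (incr (tau 0%N) (tau j)).
    elim: j => [_|j IH jk].
      by rewrite (_ : incr _ _ = fun=> 0); [exact: gmeas_cst|apply/funext => w; rewrite /incr subrr].
    rewrite (_ : incr _ _ = fun w => incr (tau 0%N) (tau j) w + incr (tau j) (tau j.+1) w); last first.
      by apply/funext => w; rewrite /incr; ring.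
    apply: gmeasD; first by apply: IH; exact: ltnW.
    move=> C mC; apply: sub_sigma_algebra; exists (Ordinal (ltnW jk : (j < k.+1)%N)).
      by rewrite /= mem_filter jk mem_enum.
    exact: (@sigma_rv_mem _ _ _ _ [set: unit] (fun _ => incr (tau j) (tau j.+1)) tt).
  have hl t : t \in 0 :: l -> exists2 j, (j <= k)%N & t = tau j.
    rewrite -(mem_sort <=%R) => tl; exists (index t (sort <=%R (0 :: l))).
      by rewrite -sk; rewrite index_size.
    by rewrite /tau /v nth_cat index_mem tl nth_index.
  have hA t : t \in l -> <<s GG>> (incr 0 t @^-1` A t).
    move=> tl; have [i ik ei] := hl 0 (mem_head _ _).
    have [j jk ->] : exists2 j, (j <= k)%N & t = tau j by apply: hl; rewrite inE tl orbT.
    rewrite ei (_ : incr _ _ = fun w => incr (tau 0%N) (tau j) w - incr (tau 0%N) (tau i) w).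
      by apply: (gmeasB (h j jk) (h i ik)).
    by apply/funext => w; rewrite /incr; ring.
  by apply: bigcap_seq_closed => //; [exact: gsigma_setI|exact: gsigma_setT].
have jk : (k < k.+1)%N by [].
apply: (@mi_join _ _ _ P _ F js (Ordinal jk)) => //.
- by rewrite filter_uniq// enum_uniq.
- by rewrite mem_filter /= ltnn.
- by move=> j; exact: gsigma_setI.
- by move=> j; exact: gsigma_setT.
- move=> j; apply: sigma_rv_measurable => _ _; apply: incr_meas; apply: tau_ge0 => //; exact: ltnW.
- rewrite /F /= vk vk1.
  exact: (@sigma_rv_mem _ _ _ _ [set: unit] (fun _ => incr a b) tt).
Qed.
End one.

Section agents.
Variables (n : nat) (x0 : nat -> T -> 'cV[R]_n) (W : nat -> R -> T -> R).
Hypotheses (hW : forall i, brownian_motion P (W i))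
  (hWindep : mutually_independent P (fun i => sigma_rv `[0, +oo[ (W i)))
  (hx0 : forall i (k : 'I_n), measurable_fun setT (fun w => x0 i w k 0))
  (hx0W : independent2 P (<<s \bigcup_i sigma_init x0 i >>)
                          (<<s \bigcup_i sigma_rv `[0, +oo[ (W i) >>)).

Lemma W_incr_gmeas i a b : 0 <= a -> 0 <= b ->
  gmeas (\bigcup_(t in `[0, +oo[) preimage_set_system setT (W i t) measurable) (incr (W i) a b).
Proof. by move=> a0 b0; apply: gmeasB; apply: sigma_rv_gmeas; rewrite /= in_itv/= ?a0 ?b0. Qed.

Lemma incr_indep i j a b c e : i != j -> 0 <= a -> a <= b -> 0 <= c -> c <= e ->
  ip P (incr (W i) a b) (incr (W j) c e) = 0.
Proof.
move=> ij a0 ab c0 ce; rewrite indep_ip ?incr_mean ?mul0r//; [exact: incr_L2|exact: incr_L2|].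
move=> A B mA mB; apply: (mutually_independent2 hWindep ij).
  by apply: W_incr_gmeas => //; exact: le_trans ab.
by apply: W_incr_gmeas => //; exact: le_trans ce.
Qed.

Lemma incr_cov2 i j a b c e : 0 <= a -> a <= b -> 0 <= c -> c <= e ->
  ip P (incr (W i) a b) (incr (W j) c e) =
  (i == j)%:R * (normal_m2 * ip leb \1_(`]a, b]) \1_(`]c, e])).
Proof.
move=> a0 ab c0 ce; case: (eqVneq i j) => [->|ij]; first by rewrite mul1r incr_cov.
by rewrite mul0r incr_indep.
Qed.

Lemma sigma_rv_sub_itv i s : sigma_rv `[0, s] (W i) `<=` sigma_rv `[0, +oo[ (W i).
Proof.
apply: sigma_rv_sub; first exact: smallest_sigma_algebra.
by move=> t A /=; rewrite in_itv/= => /andP[t0 _] mA; apply: sigma_rv_mem => //=; rewrite in_itv/= t0.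
Qed.

(** Put [D] into the factor of agent [i]: independence across the motions separates the factors, and
    [bm_past_indep] splits the one of agent [i]. *)
Lemma W_past_indep N s i a b E B : (i < N)%N -> 0 <= s -> s <= a -> a <= b ->
  <<s \bigcup_(j in `I_N) sigma_rv `[0, s] (W j) >> E -> measurable B ->
  P (E `&` incr (W i) a b @^-1` B) = (P E * P (incr (W i) a b @^-1` B))%E.
Proof.
move=> iN s0 sa ab HE mB; have a0 := le_trans s0 sa; have b0 := le_trans a0 ab.
set D := incr (W i) a b @^-1` B.
have mW j : sigma_rv `[0, +oo[ (W j) `<=` measurable.
  by apply: sigma_rv_measurable => t; rewrite /= in_itv/= andbT; exact: bm_meas.
have WD : sigma_rv `[0, +oo[ (W i) D by apply: W_incr_gmeas.
have mD := mW _ _ WD.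
pose G := [set E | exists2 A : nat -> set T, forall j, sigma_rv `[0, s] (W j) (A j)
   & E = \bigcap_(j in [set` iota 0 N]) A j].
have GE : <<s G>> E.
  apply: (smallest_sub _ _ HE); first exact: smallest_sigma_algebra.
  move=> A [j /= jN FA]; apply: sub_sigma_algebra.
  exists (fun k => if k == j then A else setT).
    by move=> k; case: eqP => [->//|_]; exact: gsigma_setT.
  apply/seteqP; split => w; first by move=> Aw k _; case: eqP.
  by move=> /(_ j); rewrite /= mem_iota add0n jN eqxx; apply.
apply: (indep_dynkin mD _ _ _ _ GE) => {E HE GE}.
- move=> _ [A FA ->]; apply: bigcap_seq_closed => //; [exact: measurable_setI|].
  by move=> j _; exact: mW (sigma_rv_sub_itv (FA j)).
- by exists (fun=> setT); [move=> j; exact: gsigma_setT|apply/seteqP; split].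
- move=> _ _ [A FA ->] [A' FA' ->]; exists (fun j => A j `&` A' j); last by rewrite bigcapI.
  by move=> j; exact: gsigma_setI (FA j) (FA' j).
move=> _ [A FA ->].
pose A' j := if j == i then A i `&` D else A j.
have FA' j : sigma_rv `[0, +oo[ (W j) (A' j).
  rewrite /A'; case: eqP => [->|_]; last exact: sigma_rv_sub_itv.
  by apply: gsigma_setI => //; exact: sigma_rv_sub_itv.
have iI : i \in iota 0 N by rewrite mem_iota add0n.
have -> : \bigcap_(j in [set` iota 0 N]) A j `&` D = \bigcap_(j in [set` iota 0 N]) A' j.
  apply/seteqP; split => w.
    move=> [H1 H2] j jN; rewrite /A'; case: eqP => [_|_]; last exact: H1.
    by split => //; exact: H1.
  move=> H; split; last by have := H i iI; rewrite /A' eqxx => -[].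
  by move=> j jN; have := H j jN; rewrite /A'; case: eqP => [-> []|].
rewrite (hWindep (iota_uniq 0 N) (fun j _ => FA' j)) (hWindep (iota_uniq 0 N) (fun j _ => sigma_rv_sub_itv (FA j))).
rewrite !(bigD1_seq i iI (iota_uniq 0 N))/= {1}/A' eqxx (bm_past_indep (hW i) s0 sa ab (FA i) mB).
rewrite -!muleA; congr (_ * _)%E; rewrite muleC; congr (_ * _)%E.
by apply: eq_bigr => j; rewrite /A' => /negbTE ->.
Qed.

Lemma sigma_init_measurable i : sigma_init x0 i `<=` measurable.
Proof. by apply: sigma_rv_measurable => k _; exact: hx0. Qed.

Lemma filtration_measurable N s : filtration x0 W N s `<=` measurable.
Proof.
apply: smallest_sub; first exact: sigma_algebra_measurable.
move=> E [j _]; apply: smallest_sub; first exact: sigma_algebra_measurable.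
move=> {}E [|]; first exact: sigma_init_measurable.
by apply: sigma_rv_measurable => t; rewrite /= in_itv/= => /andP[t0 _]; exact: bm_meas.
Qed.

(** Events of the initial states intersected with events of the past of the motions form a
    generating pi-system; independence of initial states and motions then reduces the claim to
    [W_past_indep]. *)
Lemma filtration_indep N s i a b E B : (i < N)%N -> 0 <= s -> s <= a -> a <= b ->
  filtration x0 W N s E -> measurable B ->
  P (E `&` incr (W i) a b @^-1` B) = (P E * P (incr (W i) a b @^-1` B))%E.
Proof.
move=> iN s0 sa ab HE mB; have a0 := le_trans s0 sa; have b0 := le_trans a0 ab.
set D := incr (W i) a b @^-1` B.
pose SX := <<s \bigcup_i sigma_init x0 i >>.
pose SN := <<s \bigcup_(j in `I_N) sigma_rv `[0, s] (W j) >>.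
pose SW := <<s \bigcup_i sigma_rv `[0, +oo[ (W i) >>.
have mSW : SW `<=` measurable.
  apply: smallest_sub; first exact: sigma_algebra_measurable.
  move=> A [j _]; apply: sigma_rv_measurable => t; rewrite /= in_itv/= andbT; exact: bm_meas.
have mSX : SX `<=` measurable.
  apply: smallest_sub; first exact: sigma_algebra_measurable.
  by move=> A [j _]; exact: sigma_init_measurable.
have SNW : SN `<=` SW.
  apply: smallest_sub; first exact: smallest_sigma_algebra.
  by move=> A [j _ HA]; apply: sub_sigma_algebra; exists j => //; exact: sigma_rv_sub_itv HA.
have WD : SW D by apply: sub_sigma_algebra; exists i => //; apply: W_incr_gmeas.
have mD := mSW _ WD.
pose G := [set E | exists A A', [/\ SX A, SN A' & E = A `&` A']].
have GX A : SX A -> G A by move=> h; exists A, setT; rewrite setIT; split => //; exact: gsigma_setT.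
have GN A : SN A -> G A by move=> h; exists setT, A; rewrite setTI; split => //; exact: gsigma_setT.
have GE : <<s G>> E.
  apply: (smallest_sub _ _ HE); first exact: smallest_sigma_algebra.
  move=> A [j /= jN]; apply: smallest_sub; first exact: smallest_sigma_algebra.
  move=> {}A [HA|HA]; apply: sub_sigma_algebra.
    by apply: GX; apply: sub_sigma_algebra; exists j.
  by apply: GN; apply: sub_sigma_algebra; exists j.
apply: (indep_dynkin mD _ _ _ _ GE) => {E HE GE}.
- by move=> _ [A [A' [HA HA' ->]]]; apply: measurableI; [exact: mSX|exact: mSW (SNW _ HA')].
- by apply: GX; exact: gsigma_setT.
- move=> _ _ [A [A' [HA HA' ->]]] [B1 [B' [HB HB' ->]]]; exists (A `&` B1), (A' `&` B').
  by rewrite setIACA; by split => //; apply: gsigma_setI.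
move=> _ [A [A' [HA HA' ->]]].
rewrite -setIA (hx0W HA (gsigma_setI (SNW _ HA') WD)) (hx0W HA (SNW _ HA')).
by rewrite (W_past_indep iN s0 sa ab HA' mB) muleA.
Qed.

Definition perp N s xi := forall i a b, (i < N)%N -> s <= a -> a <= b ->
  ip P xi (incr (W i) a b) = 0.

Lemma filtration_perp N s xi : 0 <= s -> L2 P xi ->
  (forall E, measurable E -> filtration x0 W N s (xi @^-1` E)) -> perp N s xi.
Proof.
move=> s0 hx Hx i a b iN sa ab; have a0 := le_trans s0 sa.
rewrite indep_ip//; last 2 first.
- exact: incr_L2.
- by move=> A B mA mB; apply: (filtration_indep iN s0 sa ab _ mB); exact: Hx.
by rewrite (incr_mean (hW i) a0 ab) mulr0.
Qed.

Lemma x0_filtration N s i k E : (i < N)%N -> measurable E ->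
  filtration x0 W N s ((fun w => x0 i w k 0) @^-1` E).
Proof.
move=> iN mE; apply: sub_sigma_algebra; exists i => //; apply: sub_sigma_algebra; left.
exact: (@sigma_rv_mem _ _ _ _ [set: 'I_n] (fun k w => x0 i w k 0) k).
Qed.
End agents.
End Brown.

(** * Quadratic forms *)

Section Dot.
Context {K : realType}.

Definition dot n (y z : 'cV[K]_n) : K := \sum_(k < n) y k 0 * z k 0.

Lemma dotE n (y z : 'cV[K]_n) : dot y z = (y^T *m z) 0 0.
Proof. by rewrite mxE; apply: eq_bigr => k _; rewrite mxE. Qed.
Lemma dotC n (y z : 'cV[K]_n) : dot y z = dot z y.
Proof. by apply: eq_bigr => k _; rewrite mulrC. Qed.
Lemma dotDl n (x y z : 'cV[K]_n) : dot (x + y) z = dot x z + dot y z.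
Proof. by rewrite /dot -big_split; apply: eq_bigr => k _; rewrite mxE mulrDl. Qed.
Lemma dotZl n a (y z : 'cV[K]_n) : dot (a *: y) z = a * dot y z.
Proof. by rewrite /dot mulr_sumr; apply: eq_bigr => k _; rewrite mxE mulrA. Qed.
Lemma dotDr n (x y z : 'cV[K]_n) : dot z (x + y) = dot z x + dot z y.
Proof. by rewrite dotC dotDl !(dotC z). Qed.
Lemma dotZr n a (y z : 'cV[K]_n) : dot z (a *: y) = a * dot z y.
Proof. by rewrite dotC dotZl dotC. Qed.
Lemma dotNl n (y z : 'cV[K]_n) : dot (- y) z = - dot y z.
Proof. by rewrite -scaleN1r dotZl mulN1r. Qed.
Lemma dotNr n (y z : 'cV[K]_n) : dot z (- y) = - dot z y.
Proof. by rewrite dotC dotNl dotC. Qed.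
Lemma dotBl n (x y z : 'cV[K]_n) : dot (x - y) z = dot x z - dot y z.
Proof. by rewrite dotDl dotNl. Qed.
Lemma dotBr n (x y z : 'cV[K]_n) : dot z (x - y) = dot z x - dot z y.
Proof. by rewrite dotDr dotNr. Qed.
Lemma dot0l n (z : 'cV[K]_n) : dot 0 z = 0.
Proof. by rewrite -(scale0r 0) dotZl mul0r. Qed.
Lemma dot_suml n (I : Type) (r : seq I) (Q : pred I) (f : I -> 'cV[K]_n) z :
  dot (\sum_(i <- r | Q i) f i) z = \sum_(i <- r | Q i) dot (f i) z.
Proof. by apply: (big_morph (fun y => dot y z)) => [x y|]; rewrite ?dotDl ?dot0l. Qed.
Lemma dot_sumr n (I : Type) (r : seq I) (Q : pred I) (f : I -> 'cV[K]_n) z :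
  dot z (\sum_(i <- r | Q i) f i) = \sum_(i <- r | Q i) dot z (f i).
Proof. by rewrite dotC dot_suml; apply: eq_bigr => i _; rewrite dotC. Qed.
Lemma dot_adj m n (M : 'M[K]_(m, n)) y z : dot (M *m y) z = dot y (M^T *m z).
Proof. by rewrite !dotE trmx_mul mulmxA. Qed.

Lemma qformE n (M : 'M[K]_n) z : qform M z = dot z (M *m z).
Proof. by rewrite dotE mulmxA. Qed.
Lemma sqnE n (z : 'cV[K]_n) : sqn z = dot z z.
Proof. by apply: eq_bigr => k _; rewrite expr2. Qed.
Lemma sqn_ge0 n (z : 'cV[K]_n) : 0 <= sqn z.
Proof. by apply: sumr_ge0 => k _; exact: sqr_ge0. Qed.
Lemma sqn_eq0 n (z : 'cV[K]_n) : sqn z = 0 -> z = 0.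
Proof.
move=> /psumr_eq0P H; apply/colP => k; rewrite mxE; apply/eqP; rewrite -sqrf_eq0.
by apply/eqP/H => // i _; exact: sqr_ge0.
Qed.
Lemma sqn_gt0 n (z : 'cV[K]_n) : z != 0 -> 0 < sqn z.
Proof. by move=> z0; rewrite lt_def sqn_ge0 andbT; apply: contra_neq z0 => /sqn_eq0. Qed.

Lemma dot_young n e (y z : 'cV[K]_n) : 0 < e -> 2 * dot y z <= e * sqn y + e^-1 * sqn z.
Proof.
move=> e0; have := sqn_ge0 (e *: y - z).
rewrite sqnE dotBl !dotBr !dotZl !dotZr -!sqnE (dotC z) => h.
rewrite -(ler_pM2l e0) mulrDr [e * (e^-1 * _)]mulrA divff ?gt_eqF// mul1r.
by rewrite -subr_ge0; move: h; congr (0 <= _); ring.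
Qed.

Lemma sqnD n (y z : 'cV[K]_n) : sqn (y + z) <= 2 * (sqn y + sqn z).
Proof.
have := dot_young y z ltr01; rewrite invr1 !mul1r.
rewrite !sqnE dotDl !dotDr (dotC z y); lra.
Qed.

Lemma sqnN n (z : 'cV[K]_n) : sqn (- z) = sqn z.
Proof. by rewrite !sqnE dotNl dotNr opprK. Qed.

Lemma dot_CS n (y z : 'cV[K]_n) : dot y z ^+ 2 <= sqn y * sqn z.
Proof.
have [->|y0] := eqVneq y 0; first by rewrite dot0l sqnE dot0l expr0n mul0r.
have s0 := sqn_gt0 y0; have := sqn_ge0 (sqn y *: z - dot y z *: y).
rewrite sqnE dotBl !dotBr !dotZl !dotZr -!sqnE (dotC z y) => h.
rewrite -(ler_pM2l s0) -subr_ge0; move: h; congr (0 <= _); ring.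
Qed.

Lemma mx_bound m n (M : 'M[K]_(m, n)) : exists2 C, 0 <= C & forall z, sqn (M *m z) <= C * sqn z.
Proof.
exists (\sum_(i < m) sqn (row i M)^T) => [|z]; first by apply: sumr_ge0 => i _; exact: sqn_ge0.
rewrite mulr_suml; apply: ler_sum => i _; apply: le_trans (dot_CS _ _).
have -> : (M *m z) i 0 = dot (row i M)^T z by rewrite dotE trmxK -row_mul [RHS]mxE.
by [].
Qed.

Lemma form_bound m n (M : 'M[K]_(m, n)) : exists2 C, 0 <= C &
  forall y z, `|dot y (M *m z)| <= C * (sqn y + sqn z).
Proof.
have [C C0 H] := mx_bound M; exists (C + 1) => [|y z]; first by rewrite addr_ge0.
have h1 := dot_young y (M *m z) ltr01; have h2 := dot_young (- y) (M *m z) ltr01.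
have h3 := H z; have h4 := sqn_ge0 y; have h5 := sqn_ge0 z.
move: h1 h2; rewrite dotNl sqnN invr1 !mul1r => h1 h2.
have : `|dot y (M *m z)| <= sqn y + C * sqn z by rewrite ler_norml; apply/andP; split; nra.
nra.
Qed.

Lemma qformZ n (M : 'M[K]_n) a z : qform M (a *: z) = a ^+ 2 * qform M z.
Proof. by rewrite !qformE -scalemxAr dotZl dotZr mulrA expr2. Qed.

Lemma sqn0 n : sqn (0 : 'cV[K]_n) = 0.
Proof. by rewrite /sqn big1// => i _; rewrite mxE expr0n. Qed.

Lemma qform0 n (M : 'M[K]_n) : qform M 0 = 0.
Proof. by rewrite qformE dot0l. Qed.

Lemma qform_continuous n (M : 'M[K]_n) : continuous (fun v : 'rV[K]_n => qform M v^T).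
Proof.
have -> : (fun v : 'rV[K]_n => qform M v^T) =
    fun v => \sum_(i < n) v 0 i * \sum_(j < n) M i j * v 0 j.
  apply/funext => v; rewrite qformE; apply: eq_bigr => i _; rewrite !mxE; congr (_ * _).
  by apply: eq_bigr => j _; rewrite mxE.
have C i : continuous (fun v : 'rV[K]_n => v 0 i) by exact: (@coord_continuous K 1 n 0 i).
apply: (continuous_big (@add_continuous K)) => i _ v; apply: cvgM; [exact: nbhs_filter|exact: (C i v)|].
apply: (continuous_big (@add_continuous K)) => j _ u.
by apply: cvgM; [exact: nbhs_filter|apply: cvg_cst; exact: nbhs_filter|exact: (C j u)].
Qed.

(** The squared norm is written [qform 1%:M], so that [qform_continuous] gives closedness; the
    sphere lies in the compact cube of coordinates in [-1, 1]. *)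
Lemma sphere_compact n : compact [set v : 'rV[K]_n | qform 1%:M v^T = 1].
Proof.
have C : compact [set v : 'rV[K]_n | forall i, `[-1, 1]%classic (v ord0 i)].
  by apply: (@rV_compact K n (fun=> `[-1, 1]%classic)) => i; exact: segment_compact.
apply: (subclosed_compact _ C).
- have -> : [set v : 'rV[K]_n | qform 1%:M v^T = 1] = (fun v => qform 1%:M v^T) @^-1` [set 1] by [].
  by apply: closed_comp; [move=> v _; exact: qform_continuous|exact: closed_eq].
- move=> v /=; rewrite qformE mul1mx -sqnE => h i; rewrite in_itv/= -ler_norml.
  rewrite -(@expr_le1 _ 2)// real_normK ?num_real// -h /sqn (bigD1 i)//= mxE lerDl.
  by apply: sumr_ge0 => k _; exact: sqr_ge0.
Qed.

(* The minimum of the quadratic form over the unit sphere. *)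
Lemma qform_min n (M : 'M[K]_n) : (0 < n)%N ->
  exists2 z : 'cV[K]_n, sqn z = 1 & forall y, qform M z * sqn y <= qform M y.
Proof.
move=> n0.
have ne : [set v : 'rV[K]_n | qform 1%:M v^T = 1] !=set0.
  exists (delta_mx 0 (Ordinal n0)); rewrite /= qformE mul1mx -sqnE /sqn (bigD1 (Ordinal n0))//=.
  rewrite !mxE !eqxx/= expr1n big1 ?addr0// => i /negbTE ni.
  by rewrite !mxE ni /= ?andbF expr0n.
have [v /= hv H] := EVT_min_rV ne (@sphere_compact n)
  (continuous_subspaceT (@qform_continuous n M)).
have sv : sqn v^T = 1 by rewrite sqnE -[X in dot _ X]mul1mx -qformE; move: hv; rewrite inE.
exists v^T => // y; have [->|y0] := eqVneq y 0.
  by rewrite sqn0 qform0 mulr0.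
have s0 := sqn_gt0 y0; pose a := (Num.sqrt (sqn y))^-1.
have a2 : a ^+ 2 = (sqn y)^-1 by rewrite /a exprVn sqr_sqrtr ?ltW.
have := H (a *: y)^T; rewrite inE /= trmxK !qformZ a2 qformE mul1mx -sqnE mulVf ?gt_eqF//.
by move=> /(_ erefl); rewrite mulrC ler_pdivlMr.
Qed.

Lemma posdef_lb n (X : 'M[K]_n) : posdefmx X ->
  exists2 c, 0 < c & forall z, c * sqn z <= qform X z.
Proof.
(* In dimension 0 the unit sphere is empty and there is no minimizer. *)
case: n X => [|n] X [_ hX].
  by exists 1 => // z; rewrite (flatmx0 z) sqnE qformE !dot0l mulr0.
have [z z1 H] := qform_min X (ltn0Sn n); exists (qform X z) => //; apply: hX.
by apply: contra_eq_neq z1 => ->; rewrite sqnE dot0l eq_sym oner_eq0.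
Qed.

(** With w = X z, the polynomial e -> qform X (z + e w) has no constant term, so its nonnegativity
    forces the linear coefficient 2 |w|^2 to vanish. *)
Lemma psd_ker n (X : 'M[K]_n) (z : 'cV[K]_n) : X^T = X -> (forall y, 0 <= qform X y) ->
  qform X z = 0 -> X *m z = 0.
Proof.
move=> sX X0 h0; apply: sqn_eq0; set w := X *m z.
have [C C0 HC] := form_bound X.
have H (e : K) : 0 <= 2 * e * sqn w + e ^+ 2 * qform X w.
  have := X0 (z + e *: w); rewrite qformE mulmxDr -scalemxAr !dotDl !dotDr !dotZl !dotZr.
  rewrite -qformE h0 -/w [dot z (X *m w)]dotC dot_adj sX -/w -sqnE -qformE.
  by congr (0 <= _); ring.
have hw := sqn_ge0 w; have qw := X0 w.
apply/eqP; rewrite eq_le hw andbT.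
have [q0|q0] := eqVneq (qform X w) 0; first by have := H (-1); rewrite q0; lra.
have {}q0 : 0 < qform X w by rewrite lt_def q0.
have := H (- (sqn w / qform X w)).
have -> : 2 * - (sqn w / qform X w) * sqn w + (- (sqn w / qform X w)) ^+ 2 * qform X w
  = - (sqn w ^+ 2 / qform X w) by field; rewrite gt_eqF.
rewrite oppr_ge0 pmulr_lle0 ?invr_gt0// => h.
by rewrite leNgt; apply/negP => /(exprn_gt0 2); rewrite ltNge h.
Qed.

(* Applied to [F - (rho / 2)%:M], such a form bounds the discounted energy of a solution of
   y' = F y + v by those of the output [H y], of the input [v] and of the noise. *)
Definition lyap_form n p (F : 'M[K]_n) (H : 'M[K]_(p, n)) (X : 'M[K]_n) (c C : K) :=
  [/\ posdefmx X, 0 < c, 0 <= C &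
  forall z v, 2 * dot z (X *m (F *m z + v)) <= - c * sqn z + C * (sqn (H *m z) + sqn v)].

(** Half of the dissipation [c0 * sqn z] pays for the input term through Young's inequality. *)
Lemma lyap_form_input n p (F : 'M[K]_n) (H : 'M[K]_(p, n)) X c0 : posdefmx X -> 0 < c0 ->
  (forall z, 2 * dot z (X *m (F *m z)) <= - c0 * sqn z + sqn (H *m z)) ->
  exists c C, lyap_form F H X c C.
Proof.
move=> pX c0_gt0 hX; have [D D0 HD] := mx_bound X.
exists (c0 / 2), (1 + (c0 / 2)^-1 * D); split => //; first by rewrite divr_gt0.
  by rewrite addr_ge0// mulr_ge0// invr_ge0 divr_ge0// ltW.
move=> z v; have c2 : 0 < c0 / 2 by rewrite divr_gt0.
rewrite mulmxDr dotDr mulrDr.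
have h1 := hX z; have h2 := dot_young z (X *m v) c2; have h3 := HD v.
have h4 := sqn_ge0 (H *m z); have h5 := sqn_ge0 v.
have i0 : 0 <= (c0 / 2)^-1 by rewrite invr_ge0 ltW.
have h6 : (c0 / 2)^-1 * sqn (X *m v) <= (c0 / 2)^-1 * D * sqn v by rewrite -mulrA ler_wpM2l.
have h7 : 0 <= (c0 / 2)^-1 * D * sqn (H *m z) by rewrite !mulr_ge0.
set i := (c0 / 2)^-1 in h2 h6 h7 *.
have -> : (1 + i * D) * (sqn (H *m z) + sqn v) =
  sqn (H *m z) + sqn v + i * D * sqn (H *m z) + i * D * sqn v by ring.
lra.
Qed.
End Dot.

(** * Ito integrals of deterministic functions *)

Section Cont.
Context {R : realType}.
Notation leb := (@lebesgue_measure R).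
Implicit Types (g : R -> R).

Lemma within_cont_eps g : {within `[0, +oo[, continuous g} -> forall x e, 0 <= x -> 0 < e ->
  exists2 h, 0 < h & forall z, 0 <= z -> `|z - x| < h -> `|g z - g x| < e.
Proof.
move=> /subspace_continuousP cg x e x0 e0.
have xi : `[0, +oo[%classic x by rewrite /= in_itv/= x0.
have /cvgrPdist_lt/(_ e e0) := cg x xi; rewrite near_withinE /=.
move/nbhs_ballP => [h /= h0 H]; exists h => // z z0 zx.
by rewrite distrC; apply: (H z); rewrite /ball/= ?in_itv/= ?z0// distrC.
Qed.

Lemma coord_within n (s : R -> 'cV[R]_n) k : {within `[0, +oo[, continuous s} ->
  {within `[0, +oo[, continuous (fun t => s t k 0)}.
Proof.
move=> /subspace_continuousP cs; apply/subspace_continuousP => x xi.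
have h : s y @[y --> within `[0, +oo[ (nbhs x)] --> s x := cs x xi.
have c : (fun M : 'cV[R]_n => M k 0) v @[v --> s x] --> s x k 0 by exact: coord_continuous.
exact: (cvg_comp _ _ h c).
Qed.

(** Uniform continuity by compactness of [0, t]; continuity is relative to the half-line, so both
    points are kept nonnegative. *)
Lemma heine g t e : {within `[0, +oo[, continuous g} -> 0 < e ->
  exists2 h, 0 < h & forall x y, 0 <= x <= t -> 0 <= y <= t -> `|x - y| < h -> `|g x - g y| <= e.
Proof.
move=> cg e0; have e20 : 0 < e / 2 by rewrite divr_gt0.
have := @segment_compact R 0 t; move/compact_near_coveringP.
move=> /(_ R (0 : R)^'+ (fun h x => forall y, 0 <= x <= t -> 0 <= y <= t -> `|x - y| < h -> `|g x - g y| <= e)).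
move=> H; suff : \forall d \near (0 : R)^'+, `[0, t] `<=` (fun x => forall y, 0 <= x <= t -> 0 <= y <= t -> `|x - y| < d -> `|g x - g y| <= e).
  move=> /(filterI (nbhs_right_gt (0 : R)))/filter_ex[h [h0 H1]]; exists h => // x y xt yt xy.
  by apply: H1 => //=; rewrite in_itv.
apply: H => x; rewrite /= in_itv/= => /andP[x0 xt].
  have [h h0 H] := within_cont_eps cg x0 e20.
  have h20 : 0 < h / 2 by rewrite divr_gt0.
  near=> x' d => y /andP[x'0 _] /andP[y0 _] x'y.
  have xx' : `|x' - x| < h / 2 by rewrite distrC; near: x'; exact: nbhsx_ballx.
  have dh : d < h / 2 by near: d; exact: nbhs_right_lt.
  have h1 := H x' x'0; have h2 := H y y0.
  have yx : `|y - x| < h.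
    have -> : y - x = - (x' - y) + (x' - x) by ring.
    by rewrite (le_lt_trans (ler_normD _ _))// normrN (splitr h) ltrD// (lt_trans x'y).
  have {}h1 := h1 (lt_trans xx' (_ : h / 2 < h)); have {}h2 := h2 yx.
  have -> : g x' - g y = (g x' - g x) - (g y - g x) by ring.
  rewrite (le_trans (ler_normB _ _))// (splitr e) lerD// ltW//.
  by apply: h1; rewrite ltr_pdivrMr// mulr2n mulrDr mulr1 ltrDl.
Unshelve. all: by end_near. Qed.


Lemma within_measurable g (t : R) : {within `[0, +oo[, continuous g} -> measurable_fun `[0, t] g.
Proof.
move=> cg; have mg : measurable_fun (`[0, +oo[ : set R) g.
  by apply: subspace_continuous_measurable_fun.
apply: measurable_funS mg => //.
by move=> x /=; rewrite !in_itv/= => /andP[->].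
Qed.

Lemma cvg_sum_ord n (u : nat -> 'I_n -> R) (l : 'I_n -> R) : (forall k, (fun m => u m k) @ \oo --> l k) ->
  (fun m => \sum_(k < n) u m k) @ \oo --> \sum_(k < n) l k.
Proof.
elim: n u l => [u l _|n IH u l H].
  by rewrite big_ord0; under eq_fun do rewrite big_ord0; exact: cvg_cst.
rewrite big_ord_recr; under eq_fun do rewrite big_ord_recr.
by apply: cvgD => //; apply: (IH (fun m k => u m (widen_ord (leqnSn n) k))).
Qed.

Lemma ereal_cvg0 (F : nat -> \bar R) : (forall m, 0 <= F m)%E ->
  (F @ \oo --> 0%E) <-> (forall e, 0 < e -> exists M, forall m, (M <= m)%N -> (F m <= e%:E)%E).
Proof.
move=> F0; split.
  move=> /fine_cvgP[[M1 _ fF] /cvgrPdist_le cF] e e0; have [M2 _ H] := cF e e0.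
  exists (maxn M1 M2) => m; rewrite geq_max => /andP[m1 m2].
  have ff := fF m m1; rewrite -(fineK ff) lee_fin.
  by have := H m m2; rewrite /= sub0r normrN; apply: le_trans; exact: ler_norm.
move=> H; apply/fine_cvgP; split.
  have [M HM] := H 1 ltr01; exists M => // m /= mM.
  by rewrite ge0_fin_numE ?F0// (le_lt_trans (HM m mM))// ltry.
apply/cvgrPdist_le => e e0; have [M HM] := H e e0; exists M => // m /= mM.
rewrite sub0r normrN ger0_norm ?fine_ge0//.
have ff : F m \is a fin_num by rewrite ge0_fin_numE ?F0// (le_lt_trans (HM m mM))// ltry.
by rewrite -lee_fin fineK// HM.
Qed.
End Cont.

(** * Riemann step functions *)

Section StepFun.
Context {R : realType} {n : nat}.
Notation leb := (@lebesgue_measure R).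
Implicit Types (phi : seq (R * R * 'cV[R]_n)).

Definition okphi (a t : R) phi := forall p, p \in phi -> [/\ a <= p.1.1, p.1.1 <= p.1.2 & p.1.2 <= t].

Lemma step_funE phi s k : step_fun phi s k 0 =
  \sum_(j < size phi) (nth 0 phi j).2 k 0 * \1_(`](nth 0 phi j).1.1, (nth 0 phi j).1.2]) s.
Proof.
rewrite /step_fun summxE (big_nth 0) big_mkord; apply: eq_bigr => j _.
by rewrite mxE mulrC.
Qed.

Lemma step_integralE d (T : measurableType d) (W : R -> T -> R) phi w k : step_integral W phi w k 0 =
  \sum_(j < size phi) (nth 0 phi j).2 k 0 * incr W (nth 0 phi j).1.1 (nth 0 phi j).1.2 w.
Proof.
rewrite /step_integral summxE (big_nth 0) big_mkord; apply: eq_bigr => j _.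
by rewrite mxE mulrC.
Qed.

Lemma ok_nth a t phi (j : 'I_(size phi)) : okphi a t phi ->
  [/\ a <= (nth 0 phi j).1.1, (nth 0 phi j).1.1 <= (nth 0 phi j).1.2 & (nth 0 phi j).1.2 <= t].
Proof. by apply; rewrite mem_nth. Qed.

Lemma L2_step phi t k : okphi 0 t phi -> L2 leb (fun s => step_fun phi s k 0).
Proof.
move=> ok; under eq_fun do rewrite step_funE.
by apply: L2_sum => j _; apply: L2Z; have [? ? _] := ok_nth j ok; exact: L2_indic_itv.
Qed.

Lemma step_fun_cat phi psi s : step_fun (phi ++ psi) s = step_fun phi s + step_fun psi s.
Proof. by rewrite /step_fun big_cat. Qed.

Lemma step_integral_cat d (T : measurableType d) (W : R -> T -> R) phi psi w :
  step_integral W (phi ++ psi) w = step_integral W phi w + step_integral W psi w.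
Proof. by rewrite /step_integral big_cat. Qed.

Definition grid (a b : R) m j := a + (b - a) * (j%:R / m.+1%:R).
Definition part (sg : R -> 'cV[R]_n) (a b : R) m :=
  [seq ((grid a b m j, grid a b m j.+1), sg (grid a b m j)) | j <- iota 0 m.+1].

Lemma grid0 a b m : grid a b m 0 = a. Proof. by rewrite /grid mul0r mulr0 addr0. Qed.
Lemma grid1 a b m : grid a b m m.+1 = b.
Proof. by rewrite /grid divff ?mulr1 ?pnatr_eq0//; ring. Qed.
Lemma grid_mono a b m i j : a <= b -> (i <= j)%N -> grid a b m i <= grid a b m j.
Proof. by move=> ab ij; rewrite lerD2l ler_wpM2l ?subr_ge0// ler_wpM2r ?invr_ge0// ler_nat. Qed.
Lemma grid_step a b m j : grid a b m j.+1 - grid a b m j = (b - a) / m.+1%:R.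
Proof. by rewrite /grid -[j.+1]addn1 natrD; field; rewrite addrC natr1 pnatr_eq0. Qed.

Lemma grid_in a b m j : a <= b -> (j <= m.+1)%N -> a <= grid a b m j <= b.
Proof.
move=> ab jm; apply/andP; split; first by have := grid_mono m ab (leq0n j); rewrite grid0.
by have := grid_mono m ab jm; rewrite grid1.
Qed.

Lemma part_ok sg a b m : a <= b -> okphi a b (part sg a b m).
Proof.
move=> ab p /mapP[j]; rewrite mem_iota add0n => /andP[_ jm] -> /=; split.
- by have /andP[] := grid_in ab (ltnW jm).
- by rewrite grid_mono.
- by have /andP[] := grid_in ab jm.
Qed.

Lemma okphi_cat a b phi psi : okphi a b phi -> okphi a b psi -> okphi a b (phi ++ psi).
Proof. by move=> h1 h2 p; rewrite mem_cat => /orP[/h1|/h2]. Qed.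

Lemma okphi_widen a b a' b' phi : a' <= a -> b <= b' -> okphi a b phi -> okphi a' b' phi.
Proof. by move=> aa bb H p /H[h1 h2 h3]; split => //; [exact: le_trans h1|exact: le_trans bb]. Qed.

Lemma part_step_fun sg a b m s k : step_fun (part sg a b m) s k 0 =
  \sum_(0 <= j < m.+1) sg (grid a b m j) k 0 * \1_(`]grid a b m j, grid a b m j.+1]) s.
Proof.
rewrite /step_fun /part big_map summxE /index_iota subn0; apply: eq_bigr => j _.
by rewrite mxE mulrC.
Qed.

Lemma part_indic a b m (s : R) : 0 <= a -> a <= b ->
  \1_(`]a, b]) s = \sum_(0 <= j < m.+1) \1_(`]grid a b m j, grid a b m j.+1]) s :> R.
Proof.
move=> a0 ab; rewrite indic_cut//.
have := @telescope_sumr R 0 m.+1 (fun j => cut (grid a b m j) s) isT.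
rewrite grid0 grid1 => <-; apply: eq_big_nat => j /andP[_ jm]; rewrite indic_cut//.
- by apply: le_trans a0 _; have /andP[] := grid_in ab (ltnW jm).
- by rewrite grid_mono.
Qed.

(** Uniform continuity on [0, b], with the least of the moduli of the coordinates. The indicator on
    the right makes the approximation exact outside ]a, b]. *)
Lemma part_unif (sg : R -> 'cV[R]_n) (a b e : R) : {within `[0, +oo[, continuous sg} -> 0 <= a -> a <= b -> 0 < e ->
  exists M, forall m, (M <= m)%N -> forall s k,
  `|sg s k 0 * \1_(`]a, b]) s - step_fun (part sg a b m) s k 0| <= e * \1_(`]a, b]) s.
Proof.
move=> cs a0 ab e0.
have H k : exists2 h, 0 < h & forall x y, 0 <= x <= b -> 0 <= y <= b -> `|x - y| < h ->
    `|sg x k 0 - sg y k 0| <= e by apply: heine => //; exact: coord_within.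
have [h h0 Hh] : exists2 h, 0 < h & forall k x y, 0 <= x <= b -> 0 <= y <= b -> `|x - y| < h ->
    `|sg x k 0 - sg y k 0| <= e.
  exists (\big[Num.min/1]_k s2val (cid2 (H k))).
    by elim/big_ind: _ => // [x y x0 y0|k _]; [rewrite lt_min x0|case: cid2].
  move=> k x y hx hy xy; move: (bigmin_le_cond 1 (fun k => s2val (cid2 (H k))) (erefl : xpredT k)).
  by case: (cid2 (H k)) => /= h _ Hk hh; apply: Hk => //; exact: lt_le_trans hh.
exists (Num.trunc ((b - a) / h)).+1 => m mM s k.
have gb : (b - a) / m.+1%:R < h.
  rewrite ltr_pdivrMr// mulrC -ltr_pdivrMr//; apply: lt_le_trans (truncnS_gt _) _.
  by rewrite ler_nat (leq_trans mM).
rewrite part_step_fun (part_indic m s a0 ab) !mulr_sumr -sumrB.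
apply: le_trans (ler_norm_sum _ _ _) _; rewrite big_nat_cond [X in _ <= X]big_nat_cond.
apply: ler_sum => j; rewrite andbT => /andP[_ jm].
rewrite -mulrBl normrM [`|\1_ _ _|]ger0_norm; last by rewrite indicE.
rewrite indicE; have [|_] := boolP (s \in _); last by rewrite !mulr0.
rewrite inE/= in_itv/= => /andP[g1 g2]; rewrite ler_wpM2r//; apply: Hh.
- have /andP[_ h1] := grid_in ab jm; have /andP[h2 _] := grid_in ab (ltnW jm).
  by rewrite (le_trans g2 h1) (le_trans a0)// (le_trans h2)// ltW.
- have /andP[h1 ->] := grid_in ab (ltnW jm); by rewrite (le_trans a0).
rewrite ger0_norm; last by rewrite subr_ge0 ltW.
by rewrite (le_lt_trans _ gb)// -(grid_step a b m j) lerD2r.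
Qed.
End StepFun.


Section Ito.
Context {d : measure_display} {T : measurableType d} {R : realType} {n : nat}.
Variable P : probability T R.
Notation leb := (@lebesgue_measure R).
Variables (W : nat -> R -> T -> R) (sg : R -> 'cV[R]_n).
Hypotheses (hW : forall i, brownian_motion P (W i))
  (hWindep : mutually_independent P (fun i => sigma_rv `[0, +oo[ (W i)))
  (csg : {within `[0, +oo[, continuous sg}).
Implicit Types (phi psi : seq (R * R * 'cV[R]_n)).

Lemma L2_step_integral i t phi k : okphi 0 t phi -> L2 P (fun w => step_integral (W i) phi w k 0).
Proof.
move=> ok; under eq_fun do rewrite step_integralE.
by apply: L2_sum => j _; apply: L2Z; have [? ? _] := ok_nth j ok; exact: incr_L2.
Qed.

(** The intervals of a step function may overlap: [incr_cov2] covers any pair of intervals, and both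
    sides expand into the same double sum. *)
Lemma step_isometry i j t t' phi psi k l : okphi 0 t phi -> okphi 0 t' psi ->
  ip P (fun w => step_integral (W i) phi w k 0) (fun w => step_integral (W j) psi w l 0) =
  (i == j)%:R * (normal_m2 * ip leb (fun s => step_fun phi s k 0) (fun s => step_fun psi s l 0)).
Proof.
move=> ok ok'; have h2 := L2_step_integral j l ok'; have g2 := L2_step l ok'.
under eq_fun do rewrite step_integralE.
under [X in ip leb X]eq_fun do rewrite step_funE.
rewrite ip_suml//; last by move=> a; apply: L2Z; have [? ? _] := ok_nth a ok; exact: incr_L2.
rewrite ip_suml//; last by move=> a; apply: L2Z; have [? ? _] := ok_nth a ok; exact: L2_indic_itv.
rewrite !mulr_sumr; apply: eq_bigr => a _; have [a1 a2 _] := ok_nth a ok.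
rewrite (ipZl _ (incr_L2 (hW i) a1 a2) h2) (ipZl _ (L2_indic_itv a1 a2) g2).
rewrite ![normal_m2 * (_ * _)]mulrCA ![(i == j)%:R * (_ * _)]mulrCA; congr (_ * _).
under eq_fun do rewrite step_integralE.
under [X in ip leb _ X]eq_fun do rewrite step_funE.
rewrite ip_sumr//; [|by move=> b; apply: L2Z; have [? ? _] := ok_nth b ok'; exact: incr_L2|exact: incr_L2].
rewrite ip_sumr//; [|by move=> b; apply: L2Z; have [? ? _] := ok_nth b ok'; exact: L2_indic_itv|exact: L2_indic_itv].
rewrite !mulr_sumr; apply: eq_bigr => b _; have [b1 b2 _] := ok_nth b ok'.
rewrite (ipZr _ (incr_L2 (hW j) b1 b2) (incr_L2 (hW i) a1 a2)).
rewrite (ipZr _ (L2_indic_itv b1 b2) (L2_indic_itv a1 a2)) (incr_cov2 hW hWindep)//.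
by move: (ip leb _ _) => z; ring.
Qed.

Definition clip t s k : R := sg s k 0 * \1_(`]0, t]) s.

Section approx.
Variables (a t : R).
Hypotheses (a0 : 0 <= a) (le_at : a <= t).
Let t0 : 0 <= t := le_trans a0 le_at.
(** The point [a] is always a node, so that the part after [a] can be split off in [ito_perp];
    elsewhere [a] is 0. *)
Definition riemann_steps m := part sg 0 a m ++ part sg a t m.

Lemma riemann_steps_ok m : okphi 0 t (riemann_steps m).
Proof.
apply: okphi_cat.
- by apply: (@okphi_widen _ _ 0 a) => //; exact: part_ok.
- by apply: (@okphi_widen _ _ a t) => //; exact: part_ok.
Qed.

Lemma riemann_steps_unif e : 0 < e -> exists M, forall m, (M <= m)%N -> forall s k,
  `|clip t s k - step_fun (riemann_steps m) s k 0| <= e * \1_(`]0, t]) s.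
Proof.
move=> e0; have [M1 H1] := part_unif csg (lexx 0) a0 e0; have [M2 H2] := part_unif csg a0 le_at e0.
exists (maxn M1 M2) => m; rewrite geq_max => /andP[m1 m2] s k.
have i3 : \1_(`]0, t]) s = \1_(`]0, a]) s + \1_(`]a, t]) s :> R.
  by rewrite !indic_cut//; ring.
rewrite /clip i3 step_fun_cat mxE mulrDr.
have := H1 m m1 s k; have := H2 m m2 s k.
move: (\1_(`]0, a]) s) (\1_(`]a, t]) s) (step_fun _ _ _ _) (step_fun _ _ _ _) => x y u v h2 h1.
have -> : sg s k 0 * x + sg s k 0 * y - (u + v) = (sg s k 0 * x - u) + (sg s k 0 * y - v) by ring.
by rewrite (le_trans (ler_normD _ _))// mulrDr lerD.
Qed.

Lemma clip_meas k : measurable_fun setT (clip t ^~ k).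
Proof.
rewrite (_ : clip t ^~ k = (fun s => sg s k 0) \_ `]0, t]).
  have mg : measurable_fun (`]0, t] : set R) (fun s => sg s k 0).
    have mc := @within_measurable _ _ t (@coord_within _ _ _ k csg); apply: measurable_funS mc => //.
    by move=> x /=; rewrite !in_itv/= => /andP[/ltW -> ->].
  exact: (proj1 (measurable_restrictT _ (measurable_itv _)) mg).
by apply/funext => s; rewrite patchE /clip indicE; case: ifP => _; rewrite ?mulr1 ?mulr0.
Qed.

Lemma L2_clip k : L2 leb (clip t ^~ k).
Proof.
have [M H] := riemann_steps_unif ltr01; have h := L2_step k (@riemann_steps_ok M).
have h2 : L2 leb (fun s => 1 * \1_(`]0, t]) s : R) by apply: L2Z; exact: L2_indic_itv.
apply: (@L2_le _ _ _ leb _ (fun s => `|step_fun (riemann_steps M) s k 0| + 1 * \1_(`]0, t]) s) (clip_meas k)).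
  move=> s; have := H M (leqnn M) s k.
  rewrite -lerBlDl; apply: le_trans; exact: lerB_dist.
by apply: L2D => //; exact: L2_abs.
Qed.

Lemma riemann_steps_L2 k :
  (fun m => ip leb (fun s => clip t s k - step_fun (riemann_steps m) s k 0) (fun s => clip t s k - step_fun (riemann_steps m) s k 0))
    @ \oo --> (0 : R).
Proof.
apply/cvgrPdist_le => e e0.
pose e1 := e / (t + 1); have t1 : 0 < t + 1 by rewrite ltr_wpDl.
have e10 : 0 < e1 by rewrite divr_gt0.
have s0 : 0 < Num.sqrt e1 by rewrite sqrtr_gt0.
have [M H] := riemann_steps_unif s0; exists M => // m /= mM.
have h := L2B (L2_clip k) (L2_step k (@riemann_steps_ok m)).
rewrite sub0r normrN ger0_norm ?ip_ge0//.
have l2 := L2_indic_itv (lexx 0) t0.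
apply: (@le_trans _ _ (\int[leb]_s (e1 * (\1_(`]0, t]) s * \1_(`]0, t]) s)))).
  apply: intE_le; [exact: L2M|by apply: intgZ; exact: L2M|].
  move=> s; have hh := H m mM s k.
  rewrite -[e1](sqr_sqrtr (ltW e10)) -!expr2 -exprMn -[X in X <= _]real_normK ?num_real//.
  by rewrite lerXn2r ?nnegrE ?mulr_ge0 ?sqrtr_ge0 ?indicE.
rewrite intE_Z; last exact: L2M.
have -> : \int[leb]_s (\1_(`]0, t]) s * \1_(`]0, t]) s) = t.
  rewrite (_ : \int[leb]_s _ = \int[leb]_s \1_(`]0, t]) s).
    rewrite /Rintegral integral_indic//= setIT lebesgue_measure_itv/= lte_fin.
    by case: (ltP 0 t) => [_|h1] /=; rewrite ?subr0//=; apply/eqP; rewrite eq_le h1 t0.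
  apply: eq_Rintegral => s _; rewrite indicE; case: (s \in _); rewrite ?mulr1 ?mulr0//.
by rewrite /e1 -mulrA ger_pMr// ler_pdivrMl// mulr1 lerDl.
Qed.

Lemma riemann_steps_ereal :
  ((fun m => \int[leb]_(s in `[0%R, t]) (sqn (sg s - step_fun (riemann_steps m) s))%:E) @ \oo --> 0)%E.
Proof.
apply/ereal_cvg0 => [m|e e0]; first by apply: integral_ge0 => s _; rewrite lee_fin sqn_ge0.
pose D m k s := clip t s k - step_fun (riemann_steps m) s k 0.
have D2 m k : L2 leb (D m k) by apply: L2B; [exact: L2_clip|exact: L2_step (@riemann_steps_ok m)].
have cv : (fun m => \sum_(k < n) ip leb (D m k) (D m k)) @ \oo --> (0 : R).
  have := @cvg_sum_ord _ n (fun m k => ip leb (D m k) (D m k)) (fun=> 0) (fun k => riemann_steps_L2 k).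
  by rewrite big1.
have [M1 H1] := riemann_steps_unif ltr01; have /cvgrPdist_le/(_ e e0)[M2 _ H2] := cv.
exists (maxn M1 M2) => m; rewrite geq_max => /andP[m1 m2].
have {}H2 := H2 m m2; rewrite sub0r normrN in H2.
have out k s : s \notin `]0, t]%classic -> D m k s = 0.
  move=> h; apply/eqP; rewrite -normr_le0; apply: le_trans (H1 m m1 s k) _.
  by rewrite indicE (negbTE h) mulr0.
have iS : intg leb (fun s => \sum_(k < n) D m k s ^+ 2).
  by apply: intg_sum => k _; exact: (D2 m k).2.
have e1 : {in `]0, t]%classic, (fun s => (sqn (sg s - step_fun (riemann_steps m) s))%:E) =1
    (fun s => (\sum_(k < n) D m k s ^+ 2)%:E)}.
  move=> s st; congr EFin; apply: eq_bigr => k _; rewrite !mxE /D /clip indicE st mulr1//.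
(* Step functions live on left-open intervals, so the point 0 is dropped from the window. *)
rewrite -integral_itv_obnd_cbnd; last first.
  apply: (eq_measurable_fun (fun s => (\sum_(k < n) D m k s ^+ 2)%:E)).
    by move=> s st; rewrite e1.
  by apply: measurable_funTS; apply/measurable_EFinP; exact: intg_meas iS.
have e2 : (\int[leb]_(x in `]0%R, t]) (sqn (sg x - step_fun (riemann_steps m) x))%:E =
    \int[leb]_(x in `]0%R, t]) (\sum_(k < n) D m k x ^+ 2)%:E)%E by apply: eq_integral => s st; exact: e1.
rewrite e2 integral_mkcond.
have e3 : (\int[leb]_x (((fun s => (\sum_(k < n) D m k s ^+ 2)%:E) \_ `]0%R, t]) x) =
    \int[leb]_x (\sum_(k < n) D m k x ^+ 2)%:E)%E.
  apply: eq_integral => s _; rewrite patchE; case: ifP => // /negbT st.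
  by rewrite big1// => k _; rewrite out// expr0n.
rewrite e3 (intE_EFin iS) lee_fin intE_sum; last by move=> k; exact: (D2 m k).2.
apply: le_trans H2; apply: le_trans (ler_norm _).
by rewrite le_eqVlt; apply/orP; left; apply/eqP; apply: eq_bigr => k _; apply: eq_Rintegral => s _; rewrite expr2.
Qed.
End approx.

Definition vmeas (Y : T -> 'cV[R]_n) := forall k, measurable_fun setT (fun w => Y w k 0).

Section one.
Variables (i : nat) (t : R) (Y : T -> 'cV[R]_n).
Hypotheses (t0 : 0 <= t) (mY : vmeas Y)
  (hY : ito_integral P (W i) sg t Y).

Let SI a m k w := step_integral (W i) (riemann_steps a t m) w k 0.

(** The definition of [ito_integral] is instantiated at the Riemann steps; [Y] lies in L2 because it
    is at finite L2 distance from one step integral. *)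
Lemma ito_apx a k : 0 <= a -> a <= t -> L2 P (fun w => Y w k 0) /\
  (fun m => ip P (fun w => Y w k 0 - SI a m k w) (fun w => Y w k 0 - SI a m k w)) @ \oo --> (0 : R).
Proof.
move=> a0 le_at.
have pos m : (0 <= \int[P]_w (sqn (Y w - step_integral (W i) (riemann_steps a t m) w))%:E)%E.
  by apply: integral_ge0 => w _; rewrite lee_fin sqn_ge0.
have ok m p : p \in riemann_steps a t m -> 0 <= p.1.1 <= p.1.2 /\ p.1.2 <= t.
  by move=> hp; have [? ? ?] := riemann_steps_ok a0 le_at hp; split => //; exact/andP.
have [H' _] := ereal_cvg0 pos; have {}H' := H' (hY ok (riemann_steps_ereal a0 le_at)).
have S2 m : L2 P (SI a m k) by exact: L2_step_integral (@riemann_steps_ok _ _ a0 le_at m).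
have mD m : measurable_fun setT (fun w => (Y w k 0 - SI a m k w) ^+ 2).
  by apply: measurable_funX; apply: measurable_funB => //; case: (S2 m).
have mS m k' : measurable_fun setT (fun w => step_integral (W i) (riemann_steps a t m) w k' 0).
  by case: (L2_step_integral i k' (@riemann_steps_ok _ _ a0 le_at m)).
have mQ m : measurable_fun setT (fun w => sqn (Y w - step_integral (W i) (riemann_steps a t m) w)).
  rewrite /sqn; apply: measurable_sum => k'; apply: measurable_funX.
  by under eq_fun do rewrite !mxE; exact: measurable_funB.
have le m : (\int[P]_w ((Y w k 0 - SI a m k w) ^+ 2)%:E <=
    \int[P]_w (sqn (Y w - step_integral (W i) (riemann_steps a t m) w))%:E)%E.
  apply: ge0_le_integral => //.
  - by move=> w _; rewrite lee_fin sqr_ge0.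
  - exact/measurable_EFinP.
  - exact/measurable_EFinP.
  - move=> w _; rewrite lee_fin /sqn (bigD1 k)//= !mxE lerDl sumr_ge0// => k' _; exact: sqr_ge0.
have D2 m e : (\int[P]_w (sqn (Y w - step_integral (W i) (riemann_steps a t m) w))%:E <= e%:E)%E ->
    L2 P (fun w => Y w k 0 - SI a m k w).
  move=> h; apply: L2P; first by apply: measurable_funB => //; case: (S2 m).
  by rewrite (le_lt_trans (le m))// (le_lt_trans h)// ltry.
split.
  have [M HM] := H' 1 ltr01; have h := D2 M 1 (HM M (leqnn M)).
  have := L2D h (S2 M); by under eq_fun do rewrite subrK.
apply/cvgrPdist_le => e e0; have [M HM] := H' e e0; exists M => // m /= mM.
rewrite sub0r normrN ger0_norm ?ip_ge0// -lee_fin.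
have [_ h2] := D2 m e (HM m mM); rewrite /ip.
under eq_Rintegral do rewrite -expr2.
rewrite -(intE_EFin h2); exact: le_trans (le m) (HM m mM).
Qed.

Lemma ito_L2 k : L2 P (fun w => Y w k 0).
Proof. by have [] := ito_apx k (lexx 0) t0. Qed.

Lemma ito_ip_incr j c e k : t <= c -> c <= e -> ip P (fun w => Y w k 0) (incr (W j) c e) = 0.
Proof.
move=> tc ce; have c0 := le_trans t0 tc.
have [hL hc] := ito_apx k (lexx 0) t0.
have ok m := @riemann_steps_ok 0 t (lexx 0) t0 m.
have := ip_cvg (fun m => L2_step_integral i k (ok m)) hL (incr_L2 (hW j) c0 ce) hc.
rewrite (_ : (fun m => _) = fun=> 0); first by move=> h; exact: (cvg_unique _ h (cvg_cst _)).
apply/funext => m; under eq_fun do rewrite step_integralE.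
rewrite ip_suml; [|by move=> b; apply: L2Z; have [? ? _] := ok_nth b (ok m); exact: incr_L2|exact: incr_L2].
apply: big1 => b _; have [b1 b2 b3] := ok_nth b (ok m).
rewrite ipZl; [|exact: incr_L2|exact: incr_L2].
case: (eqVneq i j) => [<-|ij]; first by rewrite (incr_disjoint (hW i) b1 b2 (le_trans b3 tc) ce) mulr0.
by rewrite (incr_indep hW hWindep ij b1 b2 c0 ce) mulr0.
Qed.
End one.

(** The isometry of step functions is passed to the limit in one factor at a time, since [ip_cvg]
    keeps the other factor fixed. *)
Lemma ito_ip i j t Y Y' k l : 0 <= t ->
  vmeas Y -> ito_integral P (W i) sg t Y ->
  vmeas Y' -> ito_integral P (W j) sg t Y' ->
  ip P (fun w => Y w k 0) (fun w => Y' w l 0) =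
  (i == j)%:R * (normal_m2 * ip leb (clip t ^~ k) (clip t ^~ l)).
Proof.
move=> t0 mY hY mY' hY'.
have [hL hc] := ito_apx mY hY k (lexx 0) t0.
have [hL' hc'] := ito_apx mY' hY' l (lexx 0) t0.
have ok m := @riemann_steps_ok 0 t (lexx 0) t0 m.
have S2 i' k' m := L2_step_integral i' k' (ok m).
have c2 k' := L2_clip (lexx 0) t0 k'.
have f2 k' m := L2_step k' (ok m).
have step1 m : ip P (fun w => Y w k 0) (fun w => step_integral (W j) (riemann_steps 0 t m) w l 0) =
    (i == j)%:R * (normal_m2 * ip leb (clip t ^~ k) (fun s => step_fun (riemann_steps 0 t m) s l 0)).
  have A := ip_cvg (S2 i k) hL (S2 j l m) hc.
  have B := ip_cvg (f2 k) (c2 k) (f2 l m) (riemann_steps_L2 (lexx 0) t0 k).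
  have E : (fun m' => ip P (fun w => step_integral (W i) (riemann_steps 0 t m') w k 0)
      (fun w => step_integral (W j) (riemann_steps 0 t m) w l 0)) = fun m' => (i == j)%:R * (normal_m2 *
      ip leb (fun s => step_fun (riemann_steps 0 t m') s k 0) (fun s => step_fun (riemann_steps 0 t m) s l 0)).
    by apply/funext => m'; rewrite (step_isometry i j k l (ok m') (ok m)).
  rewrite E in A; exact: (cvg_unique _ A (cvgMl_tmp (cvgMl_tmp B))).
have A := ip_cvg (S2 j l) hL' hL hc'.
have B := ip_cvg (f2 l) (c2 l) (c2 k) (riemann_steps_L2 (lexx 0) t0 l).
rewrite ipC [ip leb _ _]ipC.
have E : (fun m' => ip P (fun w => step_integral (W j) (riemann_steps 0 t m') w l 0) (fun w => Y w k 0)) =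
    fun m' => (i == j)%:R * (normal_m2 * ip leb (fun s => step_fun (riemann_steps 0 t m') s l 0) (clip t ^~ k)).
  by apply/funext => m'; rewrite ipC step1 [ip leb _ _]ipC.
rewrite E in A; exact: (cvg_unique _ A (cvgMl_tmp (cvgMl_tmp B))).
Qed.

(** By [ito_ip] the four terms in the expansion of the squared distance have the same value and
    cancel. This identifies the noises of states driven by different controls. *)
Lemma ito_unique i t Y Y' k : 0 <= t ->
  vmeas Y -> ito_integral P (W i) sg t Y ->
  vmeas Y' -> ito_integral P (W i) sg t Y' ->
  {ae P, forall w, Y w k 0 = Y' w k 0}.
Proof.
move=> t0 mY hY mY' hY'; have h := ito_L2 t0 mY hY k; have h' := ito_L2 t0 mY' hY' k.
have hB := L2B h h'.
have := ip_eq0 hB; rewrite (ipBl h h' hB) (ipBr h h' h) (ipBr h h' h').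
rewrite !(ito_ip _ _ t0 mY hY mY hY) !(ito_ip _ _ t0 mY hY mY' hY') !(ito_ip _ _ t0 mY' hY' mY hY) !(ito_ip _ _ t0 mY' hY' mY' hY').
rewrite !subrr => /(_ erefl); apply: filterS => w /eqP; rewrite subr_eq0 => /eqP.
exact.
Qed.

(** With [a] as a node, the terms of the step integral after [a] are multiples of increments
    orthogonal to [xi], and those before [a] approximate the integral up to [a]. *)
Lemma ito_perp i a t Ya Yt xi k : 0 <= a -> a <= t -> L2 P xi ->
  vmeas Ya -> ito_integral P (W i) sg a Ya ->
  vmeas Yt -> ito_integral P (W i) sg t Yt ->
  (forall c e, a <= c -> c <= e -> ip P xi (incr (W i) c e) = 0) ->
  ip P xi (fun w => Yt w k 0) = ip P xi (fun w => Ya w k 0).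
Proof.
move=> a0 le_at hx mYa hYa mYt hYt hp; have t0 := le_trans a0 le_at.
have [hL hc] := ito_apx mYt hYt k a0 le_at.
have [hL' hc'] := ito_apx mYa hYa k a0 (lexx a).
have okt m := @riemann_steps_ok a t a0 le_at m; have oka m := @riemann_steps_ok a a a0 (lexx a) m.
have A := ip_cvg (fun m => L2_step_integral i k (okt m)) hL hx hc.
have B := ip_cvg (fun m => L2_step_integral i k (oka m)) hL' hx hc'.
rewrite ipC [RHS]ipC.
suff E : (fun m => ip P (fun w => step_integral (W i) (riemann_steps a t m) w k 0) xi) =
    fun m => ip P (fun w => step_integral (W i) (riemann_steps a a m) w k 0) xi.
  by rewrite E in A; exact: (cvg_unique _ A B).
apply/funext => m; rewrite /riemann_steps.
have z phi : okphi 0 t phi -> okphi a t phi -> ip P (fun w => step_integral (W i) phi w k 0) xi = 0.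
  move=> ok0 ok; under eq_fun do rewrite step_integralE.
  rewrite ip_suml//; last by move=> b; apply: L2Z; have [? ? _] := ok_nth b ok0; exact: incr_L2.
  apply: big1 => b _; have [b1 b2 _] := ok_nth b ok; have [b0 _ _] := ok_nth b ok0.
  by rewrite (ipZl _ (incr_L2 (hW i) b0 b2) hx) ipC hp// mulr0.
have ok1 : okphi 0 t (part sg 0 a m) by apply: (@okphi_widen _ _ 0 a) => //; exact: part_ok.
have ok2 t' : a <= t' -> t' <= t -> okphi 0 t (part sg a t' m) /\ okphi a t (part sg a t' m).
  move=> h1 h2; split; [apply: (@okphi_widen _ _ a t') => //; exact: part_ok|].
  by apply: (@okphi_widen _ _ a t') => //; exact: part_ok.
have s2 phi : okphi 0 t phi -> L2 P (fun w => step_integral (W i) phi w k 0) by exact: L2_step_integral.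
have e psi : okphi 0 t psi -> okphi a t psi ->
   ip P (fun w => step_integral (W i) (part sg 0 a m ++ psi) w k 0) xi =
   ip P (fun w => step_integral (W i) (part sg 0 a m) w k 0) xi.
  move=> q1 q2; under eq_fun do rewrite step_integral_cat mxE.
  by rewrite (ipDl (s2 _ ok1) (s2 _ q1) hx) (z _ q1 q2) addr0.
have [q1 q2] := ok2 t le_at (lexx t).
have [q3 q4] := ok2 a (lexx a) le_at.
by rewrite (e _ q1 q2) (e _ q3 q4).
Qed.

Lemma clip_ip t k l : 0 <= t -> ip leb (clip t ^~ k) (clip t ^~ l) = It t (fun s => sg s k 0 * sg s l 0).
Proof.
move=> t0; rewrite /ip It_restrict /Rintegral; congr fine.
have L := L2M (L2_clip (lexx 0) t0 k) (L2_clip (lexx 0) t0 l).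
rewrite -integral_itv_obnd_cbnd; last first.
  apply: (eq_measurable_fun (fun s => (clip t s k * clip t s l)%:E)).
    by move=> s st; rewrite /clip indicE st !mulr1.
  by apply: measurable_funTS; apply/measurable_EFinP; exact: intg_meas L.
rewrite [RHS]integral_mkcond; apply: eq_integral => s _; rewrite patchE /clip !indicE.
by case: ifP => _; rewrite ?mulr1 ?mulr0 ?mul0r.
Qed.
End Ito.

(** * Discounted inner products *)

Section Weighted.
Context {d : measure_display} {T : measurableType d} {R : realType}.
Variable P : probability T R.
Notation leb := (@lebesgue_measure R).
Notation LP := (@lebesgue_measure R \x P)%E.
Variable rho : R.
Hypothesis rho0 : 0 < rho.
Implicit Types (b c y : R -> T -> R) (s t : R).

Definition hp s : R := (nat_of_bool (0 <= s)%R)%:R.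
(* [hw s ^+ 2] is the discount factor on [0, +oo[, so that [ipr] is the inner product of
   L^2(e^(-rho s) ds x P). *)
Definition hw s : R := hp s * expR (- (rho / 2) * s).

Lemma hp_ge0 s : 0 <= hp s. Proof. by rewrite /hp. Qed.
Lemma hp1 s : 0 <= s -> hp s = 1. Proof. by rewrite /hp => ->. Qed.
Lemma hp_idem s : hp s * hp s = hp s.
Proof. by rewrite /hp; case: (0 <= s); rewrite ?mulr1 ?mulr0. Qed.
Lemma cut_hp t s : cut t s * hp s = cut t s.
Proof. by rewrite cutE /hp; case: (0 <= s); rewrite ?mulr1//= mulr0. Qed.

Lemma measurable_hp : measurable_fun setT hp.
Proof.
rewrite (_ : hp = \1_(`[0, +oo[)); first exact: measurable_indic.
apply/funext => s; rewrite indicE /hp; congr (nat_of_bool _)%:R.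
by apply/idP/idP; rewrite inE/= in_itv/= andbT.
Qed.

Lemma measurable_hw : measurable_fun setT hw.
Proof. by apply: measurable_funM; [exact: measurable_hp|exact: measurable_expRZ]. Qed.

Lemma hw_sqr s : hw s * hw s = hp s * expR (- rho * s).
Proof. by rewrite /hw mulrACA hp_idem -expRD; congr (_ * expR _); lra. Qed.

Definition wb b : R * T -> R := fun z => hw z.1 * b z.1 z.2.
Definition L2r b := mproc b /\ L2 LP (wb b).
Definition ipr b c := ip LP (wb b) (wb c).

Lemma L2rD b c : L2r b -> L2r c -> L2r (fun s w => b s w + c s w).
Proof.
move=> [mb hb] [mc hc]; split; first exact: mprocD.
by rewrite /wb; under eq_fun do rewrite mulrDr; exact: L2D.
Qed.
Lemma L2rZ k b : L2r b -> L2r (fun s w => k * b s w).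
Proof.
move=> [mb hb]; split; first exact: mprocZ.
by rewrite /wb; under eq_fun do rewrite mulrCA; exact: L2Z.
Qed.
Lemma L2r_sum (J : Type) (r : seq J) (h : J -> R -> T -> R) :
  (forall i, L2r (h i)) -> L2r (fun s w => \sum_(i <- r) h i s w).
Proof.
move=> H; split; first by apply: mproc_sum => i; case: (H i).
by rewrite /wb; under eq_fun do rewrite mulr_sumr; apply: L2_sum => i _; case: (H i).
Qed.

Lemma ipr_ge0 b : 0 <= ipr b b. Proof. exact: ip_ge0. Qed.
Lemma intg_wb b c : L2r b -> L2r c -> intg LP (fun z => hp z.1 * expR (- rho * z.1) * (b z.1 z.2 * c z.1 z.2)).
Proof.
move=> [_ hb] [_ hc]; have := L2M hb hc; rewrite (_ : (fun z => _) = (fun z => hp z.1 * expR (- rho * z.1) * (b z.1 z.2 * c z.1 z.2)))//.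
by apply/funext => z; rewrite /wb mulrACA hw_sqr.
Qed.

Lemma iprE b c : ipr b c = \int[LP]_z (hp z.1 * expR (- rho * z.1) * (b z.1 z.2 * c z.1 z.2)).
Proof. by apply: eq_Rintegral => z _; rewrite /wb mulrACA hw_sqr. Qed.

Lemma L2r_lproc b : L2r b -> lproc P b.
Proof.
move=> [mb hb]; split => // t.
have mc : measurable_fun setT (fun z : R * T => cut t z.1 * b z.1 z.2).
  by apply: measurable_funM => //; exact: (measurableT_comp (measurable_cut t)).
have [t0|t0] := leP 0 t; last by under eq_fun do rewrite cut_neg// mul0r; exact: L2_0.
apply: (@L2_le _ _ _ LP _ (fun z => `|expR (rho / 2 * t) * wb b z|)) => //; last by apply: L2_abs; exact: L2Z.
move=> [s w]; rewrite /wb /hw /=.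
have [/andP[s0 st]|/cut0 ->] := boolP (0 <= s <= t); last by rewrite mul0r normr0.
rewrite cut1 ?s0// mul1r hp1// mul1r mulrA normrM ler_peMl// -expRD ger0_norm ?expR_ge0//.
by rewrite -[X in X <= _]expR0 ler_expR mulNr -mulrBr mulr_ge0 ?subr_ge0// divr_ge0// ltW.
Qed.

Lemma wT_ge0 t s : s <= t -> 0 <= wT rho t s.
Proof. by move=> st; rewrite subr_ge0 ler_expR !mulNr lerN2 ler_wpM2l// ltW. Qed.
Lemma wT_le t s : wT rho t s <= expR (- rho * s).
Proof. by rewrite lerBlDr lerDl expR_ge0. Qed.

Lemma cut_wT t s : 0 <= cut t s * wT rho t s <= hp s * expR (- rho * s).
Proof.
have [/andP[s0 st]|/cut0 ->] := boolP (0 <= s <= t); last by rewrite mul0r lexx mulr_ge0 ?hp_ge0 ?expR_ge0.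
by rewrite cut1 ?s0// hp1// !mul1r wT_le wT_ge0.
Qed.
Lemma cut_exp t s : 0 <= cut t s * expR (- rho * s) <= hp s * expR (- rho * s).
Proof.
rewrite mulr_ge0 ?cut_ge0 ?expR_ge0//= ler_wpM2r ?expR_ge0// -cut_hp.
by rewrite ler_piMl ?hp_ge0 ?cut_le1.
Qed.

Lemma exp_nat_cvg : (fun m : nat => expR (- rho * m%:R)) @ \oo --> (0 : R).
Proof.
apply/cvgrPdist_le => e e0; exists (Num.trunc (e^-1 / rho)).+1 => // m /= mM.
rewrite sub0r normrN ger0_norm ?expR_ge0// mulNr expRN invf_ple ?posrE ?expR_gt0//.
have h := expR_ge1Dx (rho * m%:R).
have h2 : e^-1 / rho <= m%:R.
  by rewrite (le_trans (ltW (truncnS_gt _)))// ler_nat.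
have : e^-1 <= rho * m%:R by rewrite mulrC -ler_pdivrMr.
by move: h; lra.
Qed.

Lemma cut_near s : 0 <= s -> \forall m \near \oo, cut m%:R s = 1.
Proof.
move=> s0; exists (Num.trunc s).+1 => // m /= mM; apply: cut1; rewrite s0/=.
by rewrite (le_trans (ltW (truncnS_gt s)))// ler_nat.
Qed.

Lemma cut_wT_cvg s : (fun m : nat => cut m%:R s * wT rho m%:R s) @ \oo --> hp s * expR (- rho * s).
Proof.
have [s0|s0] := leP 0 s; last first.
  rewrite /hp leNgt s0/= mul0r; under eq_fun do rewrite cut0 ?leNgt ?s0// mul0r.
  exact: cvg_cst.
rewrite hp1// mul1r.
have h : (fun m : nat => wT rho m%:R s) @ \oo --> expR (- rho * s).
  rewrite -[X in _ --> X]subr0; apply: cvgB; [exact: cvg_cst|exact: exp_nat_cvg].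
apply: cvg_trans h; apply: near_eq_cvg; near=> m.
by have -> : cut m%:R s = 1; [near: m; exact: cut_near|rewrite mul1r].
Unshelve. all: by end_near. Qed.

Lemma cut_exp_cvg s : (fun m : nat => cut m%:R s * expR (- rho * s)) @ \oo --> hp s * expR (- rho * s).
Proof.
have [s0|s0] := leP 0 s; last first.
  rewrite /hp leNgt s0/= mul0r; under eq_fun do rewrite cut0 ?leNgt ?s0// mul0r.
  exact: cvg_cst.
rewrite hp1// mul1r.
have h : (fun m : nat => expR (- rho * s)) @ \oo --> expR (- rho * s) by exact: cvg_cst.
apply: cvg_trans h; apply: near_eq_cvg; near=> m.
by have -> : cut m%:R s = 1; [near: m; exact: cut_near|rewrite mul1r].
Unshelve. all: by end_near. Qed.

(** * Removing the finite horizon *)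

Section limits.
Variable (W : nat -> R -> R).
Hypotheses (mW : forall m, measurable_fun setT (W m))
  (W1 : forall m s, 0 <= W m s <= hp s * expR (- rho * s))
  (Wc : forall s, (fun m => W m s) @ \oo --> hp s * expR (- rho * s)).

Lemma weight_int (F : R * T -> R) m : measurable_fun setT F ->
  intg LP (fun z => hp z.1 * expR (- rho * z.1) * F z) -> intg LP (fun z => W m z.1 * F z).
Proof.
move=> mF iF; apply: (@intg_le _ _ _ LP _ (fun z => `|hp z.1 * expR (- rho * z.1) * F z|)).
- by apply: measurable_funM => //; exact: (measurableT_comp (mW m)).
- move=> z; have /andP[h1 h2] := W1 m z.1.
  by rewrite normrM [X in _ <= X]normrM ler_wpM2r// ger0_norm// (le_trans h2)// ler_norm.
- exact: intg_abs.
Qed.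

Lemma weight_cvg (F : R * T -> R) : measurable_fun setT F ->
  intg LP (fun z => hp z.1 * expR (- rho * z.1) * F z) ->
  (fun m => \int[LP]_z (W m z.1 * F z)) @ \oo --> \int[LP]_z (hp z.1 * expR (- rho * z.1) * F z).
Proof.
move=> mF iF.
have iW m := weight_int m mF iF.
have := @dominated_convergence _ _ _ LP setT measurableT (fun m z => (W m z.1 * F z)%:E)
  (fun z => (hp z.1 * expR (- rho * z.1) * F z)%:E) (fun z => `|hp z.1 * expR (- rho * z.1) * F z|%:E).
case.
- by move=> m; apply/measurable_EFinP; exact: intg_meas (iW m).
- by apply/measurable_EFinP; exact: intg_meas iF.
- apply: aeW => z _; apply: cvg_EFin; first exact: nearW.
  by apply: cvgMr_tmp; exact: Wc.
- exact: intg_abs.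
- apply: aeW => z m _; rewrite lee_fin; have /andP[h1 h2] := W1 m z.1.
  by rewrite normrM [X in _ <= X]normrM ler_wpM2r// ger0_norm// (le_trans h2)// ler_norm.
by move=> _ _; rewrite (intE_EFin iF) => /fine_cvgP[_].
Qed.

(** This is how discounted integrability is gained: from bounds on truncated weights that are
    uniform in the horizon. *)
Lemma weight_fatou (F : R * T -> R) (M : R) : measurable_fun setT F -> (forall z, 0 <= F z) ->
  (forall m, intg LP (fun z => W m z.1 * F z)) -> (forall m, \int[LP]_z (W m z.1 * F z) <= M) ->
  intg LP (fun z => hp z.1 * expR (- rho * z.1) * F z) /\
  \int[LP]_z (hp z.1 * expR (- rho * z.1) * F z) <= M.
Proof.
move=> mF F0 iW HM.
have w0 z : 0 <= hp z.1 * expR (- rho * z.1) * F z by rewrite !mulr_ge0 ?hp_ge0 ?expR_ge0.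
have mw : measurable_fun setT (fun z : R * T => hp z.1 * expR (- rho * z.1) * F z).
  apply: measurable_funM => //; apply: (measurableT_comp (f := fun s : R => hp s * expR (- rho * s))) => //.
  by apply: measurable_funM; [exact: measurable_hp|exact: measurable_expRZ].
have W0 m z : 0 <= W m z.1 * F z by rewrite mulr_ge0//; have /andP[] := W1 m z.1.
have H : (\int[LP]_z (hp z.1 * expR (- rho * z.1) * F z)%:E <= M%:E)%E.
  rewrite (_ : (\int[LP]_z _)%E = (\int[LP]_z limn_einf (fun m => (W m z.1 * F z)%:E))%E).
    apply: le_trans (fatou _ _ _ _) _ => //.
    - by move=> m; apply/measurable_EFinP; exact: intg_meas (iW m).
    - by move=> m z _; rewrite lee_fin.
    rewrite limn_einf_lim; apply: lime_le; first exact: is_cvg_einfs.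
    apply: nearW => m; rewrite /einfs /=; apply: (@le_trans _ _ (\int[LP]_z (W m z.1 * F z)%:E)%E).
      by apply: ereal_inf_lbound; exists m => /=.
    by rewrite (intE_EFin (iW m)) lee_fin.
  apply: eq_integral => z _.
  have h : (fun m => (W m z.1 * F z)%:E) @ \oo --> (hp z.1 * expR (- rho * z.1) * F z)%:E.
    by apply: cvg_EFin; [exact: nearW|apply: cvgMr_tmp; exact: Wc].
  by rewrite is_cvg_limn_einfE; [apply/esym/cvg_lim|apply/cvg_ex; eexists; exact: h].
have i : intg LP (fun z => hp z.1 * expR (- rho * z.1) * F z).
  by apply/intg_ge0P => //; rewrite (le_lt_trans H)// ltry.
by split => //; rewrite -lee_fin -(intE_EFin i).
Qed.
End limits.

Lemma wT_measurable (t : R) : measurable_fun setT (fun s => cut t s * wT rho t s).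
Proof.
apply: measurable_funM; first exact: measurable_cut.
by apply: measurable_funB => //; exact: measurable_expRZ.
Qed.

Lemma cut_exp_measurable (t : R) : measurable_fun setT (fun s => cut t s * expR (- rho * s)).
Proof. by apply: measurable_funM; [exact: measurable_cut|exact: measurable_expRZ]. Qed.

Lemma mul_measurable b c : mproc b -> mproc c -> measurable_fun setT (fun z : R * T => b z.1 z.2 * c z.1 z.2).
Proof. exact: mprocM. Qed.

Lemma wT_ipr b c : L2r b -> L2r c ->
  (fun m : nat => \int[LP]_z (cut m%:R z.1 * wT rho m%:R z.1 * (b z.1 z.2 * c z.1 z.2))) @ \oo --> ipr b c.
Proof.
move=> hb hc; rewrite iprE.
apply: (weight_cvg (W := fun m s => cut m%:R s * wT rho m%:R s)) => //.
- by move=> m; exact: wT_measurable.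
- by move=> m s; exact: cut_wT.
- exact: cut_wT_cvg.
- exact: mul_measurable hb.1 hc.1.
- exact: intg_wb.
Qed.

Lemma exp_ipr b c : L2r b -> L2r c ->
  (fun m : nat => \int[LP]_z (cut m%:R z.1 * expR (- rho * z.1) * (b z.1 z.2 * c z.1 z.2))) @ \oo --> ipr b c.
Proof.
move=> hb hc; rewrite iprE.
apply: (weight_cvg (W := fun m s => cut m%:R s * expR (- rho * s))) => //.
- by move=> m; exact: cut_exp_measurable.
- by move=> m s; exact: cut_exp.
- exact: cut_exp_cvg.
- exact: mul_measurable hb.1 hc.1.
- exact: intg_wb.
Qed.

Lemma wT_ipr_le b (m : nat) : L2r b ->
  \int[LP]_z (cut m%:R z.1 * wT rho m%:R z.1 * (b z.1 z.2 * b z.1 z.2)) <= ipr b b.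
Proof.
move=> hb; rewrite iprE; apply: intE_le; last 2 first.
- exact: intg_wb.
- move=> z; rewrite ler_wpM2r -?expr2 ?sqr_ge0//; by have /andP[] := cut_wT m%:R z.1.
apply: (weight_int (W := fun m s => cut m%:R s * wT rho m%:R s)).
- by move=> k; exact: wT_measurable.
- by move=> k s; exact: cut_wT.
- exact: mul_measurable hb.1 hb.1.
- exact: intg_wb.
Qed.
End Weighted.

(** * Energy identities for drift plus noise processes *)

Section Semimart.
Context {d : measure_display} {T : measurableType d} {R : realType}.
Variable P : probability T R.
Notation leb := (@lebesgue_measure R).
Notation LP := (@lebesgue_measure R \x P)%E.
Variable future : R -> set (T -> R).
Hypothesis futureL2 : forall s, 0 <= s -> future s `<=` L2 P.
Implicit Types (b c y : R -> T -> R) (s t : R) (xi : T -> R).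

(* This replaces adaptedness: [future s] will be the set of increments of the Brownian motions
   after [s], and only orthogonality to them is used. States inherit it from the initial data, the
   control and the noise by a deterministic Gronwall argument. *)
Definition orth s xi := forall h, future s h -> ip P xi h = 0.

Lemma orthD s xi xi' : 0 <= s -> L2 P xi -> L2 P xi' -> orth s xi -> orth s xi' ->
  orth s (fun w => xi w + xi' w).
Proof.
move=> s0 h h' p p' e te; have he := futureL2 s0 te.
by rewrite (ipDl h h' he) p// p'// addr0.
Qed.

Lemma orthZ s (k : R) xi : 0 <= s -> L2 P xi -> orth s xi -> orth s (fun w => k * xi w).
Proof. by move=> s0 h p e te; rewrite (ipZl _ h (futureL2 s0 te)) p// mulr0. Qed.

(** Only almost every time is asked, since square integrability of [c s] comes from Fubini. *)
Definition orthproc (c : R -> T -> R) := lproc P c /\ {ae leb, forall s, 0 <= s -> L2 P (c s) /\ orth s (c s)}.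

Lemma orthprocD b c : orthproc b -> orthproc c -> orthproc (fun s w => b s w + c s w).
Proof.
move=> [hb pb] [hc pc]; split; first exact: lprocD.
apply: (@filterS2 _ (almost_everywhere leb) (ae_filter_ringOfSetsType leb) _ _ _ _ pb pc) => s h1 h2 s0.
have [h3 h4] := h1 s0; have [h5 h6] := h2 s0; split; [exact: L2D|exact: orthD].
Qed.

Lemma orthprocZ k b : orthproc b -> orthproc (fun s w => k * b s w).
Proof.
move=> [hb pb]; split; first exact: lprocZ.
apply: (@filterS _ (almost_everywhere leb) _ _ _ _ pb) => s h1 s0.
have [h3 h4] := h1 s0; split; [exact: L2Z|exact: orthZ].
Qed.

Lemma orthproc0 : orthproc (fun _ _ => 0).
Proof.
split; first by apply: lproc_rv; exact: L2_0.
apply: (@filterE _ (almost_everywhere leb)) => s s0; split; first exact: L2_0.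
move=> e _; rewrite -[RHS](intE_0 P); apply: eq_Rintegral => w _; exact: mul0r.
Qed.

Lemma orthproc_sum (J : Type) (r : seq J) (h : J -> R -> T -> R) :
  (forall j, orthproc (h j)) -> orthproc (fun s w => \sum_(j <- r) h j s w).
Proof.
move=> H; elim: r => [|j r IH].
  by rewrite (_ : (fun s w => _) = fun _ _ => 0); [exact: orthproc0|apply/funext => s; apply/funext => w; rewrite big_nil].
rewrite (_ : (fun s w => _) = fun s w => h j s w + \sum_(i <- r) h i s w); first exact: orthprocD.
by apply/funext => s; apply/funext => w; rewrite big_cons.
Qed.

(** The noises are abstract: only their L2 geometry is assumed. [Z_inv] is the martingale property,
    tested against variables orthogonal to the future. *)
Variables (I : finType) (Z : I -> R -> T -> R) (noise_cov : I -> I -> R -> R).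
Hypotheses (Z_lproc : forall a, lproc P (Z a)) (Z_L2 : forall a t, 0 <= t -> L2 P (Z a t))
  (Z_inv : forall a s t xi, 0 <= s -> s <= t -> L2 P xi -> orth s xi -> ip P xi (Z a t) = ip P xi (Z a s))
  (Z_ip0 : forall a t xi, 0 <= t -> L2 P xi -> orth 0 xi -> ip P xi (Z a t) = 0)
  (Z_orth : forall a t, 0 <= t -> orth t (Z a t))
  (Z_cov : forall (a b : I) t, 0 <= t -> ip P (Z a t) (Z b t) = It t (noise_cov a b))
  (noise_cov_loc1 : forall a b : I, loc1 (noise_cov a b)) (noise_cov_meas : forall a b : I, measurable_fun setT (noise_cov a b)).

Definition noise (g : I -> R) t w := \sum_a g a * Z a t w.

(* y = y0 + int b + \sum_a g a * Z a, almost surely at each time. *)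
Definition semimart y (y0 : T -> R) b (g : I -> R) := [/\ mproc y, L2 P y0, orth 0 y0, orthproc b &
  forall t, 0 <= t -> {ae P, forall w, y t w = Dp y0 b t w + noise g t w}].

(** The time density of the covariance of [noise g] and [noise g'], by [noise_ip]. *)
Definition cov_rate (g g' : I -> R) s := \sum_a \sum_b g a * g' b * noise_cov a b s.

Lemma noise_lproc g : lproc P (noise g).
Proof. by apply: lproc_sum => a; exact: lprocZ. Qed.

Lemma noise_L2 g t : 0 <= t -> L2 P (noise g t).
Proof. by move=> t0; apply: L2_sum => a _; apply: L2Z; exact: Z_L2. Qed.

Lemma cov_rate_loc1 g g' : loc1 (cov_rate g g').
Proof. by apply: loc1_sum => a; apply: loc1_sum => b; exact: loc1Z. Qed.

Lemma cov_rate_meas g g' : measurable_fun setT (cov_rate g g').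
Proof. by apply: measurable_sum => a; apply: measurable_sum => b; apply: measurable_funM. Qed.

Lemma noise_ip g g' t : 0 <= t -> ip P (noise g t) (noise g' t) = It t (cov_rate g g').
Proof.
move=> t0; rewrite /noise ip_suml; [|by move=> a; apply: L2Z; exact: Z_L2|exact: noise_L2].
rewrite /cov_rate I_sum; last by move=> a; apply: loc1_sum => b; exact: loc1Z.
apply: eq_bigr => a _; rewrite ip_sumr; [|by move=> b; apply: L2Z; exact: Z_L2|by apply: L2Z; exact: Z_L2].
rewrite I_sum; last by move=> b; exact: loc1Z.
apply: eq_bigr => b _; rewrite (ipZl _ (Z_L2 a t0) (L2Z _ (Z_L2 b t0))) (ipZr _ (Z_L2 b t0) (Z_L2 a t0)).
by rewrite Z_cov// I_Z// mulrA.
Qed.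

Lemma noise_inv g s t xi : 0 <= s -> s <= t -> L2 P xi -> orth s xi ->
  ip P xi (noise g t) = ip P xi (noise g s).
Proof.
move=> s0 st hx px; have t0 := le_trans s0 st.
rewrite /noise !ip_sumr//; [|by move=> a; apply: L2Z; exact: Z_L2..].
by apply: eq_bigr => a _; rewrite !ipZr//; [rewrite (Z_inv _ s0 st)|exact: Z_L2|exact: Z_L2].
Qed.

Lemma noise_0 g t xi : 0 <= t -> L2 P xi -> orth 0 xi -> ip P xi (noise g t) = 0.
Proof.
move=> t0 hx px; rewrite /noise ip_sumr//; last by move=> a; apply: L2Z; exact: Z_L2.
by apply: big1 => a _; rewrite ipZr//; [rewrite Z_ip0// mulr0|exact: Z_L2].
Qed.

Section semimart1.
Variables (y : R -> T -> R) (y0 : T -> R) (b : R -> T -> R) (g : I -> R).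
Hypothesis hy : semimart y y0 b g.
Definition ycan t w := Dp y0 b t w + noise g t w.

Lemma ycan_lproc : lproc P ycan.
Proof. by case: hy => _ h0 _ [hb _] _; apply: lprocD; [exact: lproc_Dp|exact: noise_lproc]. Qed.

Lemma ycan_L2 t : 0 <= t -> L2 P (ycan t).
Proof. by case: hy => _ h0 _ [hb _] _ t0; apply: L2D; [exact: L2_Dp|exact: noise_L2]. Qed.

Lemma semimart_ae t : 0 <= t -> {ae P, forall w, y t w = ycan t w}.
Proof. by case: hy => _ _ _ _ + t0; exact. Qed.

(** The decomposition holds almost surely at each time, not for all times at once; Fubini makes it
    an almost everywhere equality on the product, which is enough for integrals. *)
Lemma semimart_lproc : lproc P y.
Proof.
have [my _ _ _ _] := hy; split => // t.
have [mc hc] := ycan_lproc.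
have m1 : measurable_fun setT (fun z : R * T => cut t z.1 * y z.1 z.2).
  by apply: measurable_funM => //; exact: (measurableT_comp (measurable_cut t)).
have m2 : measurable_fun setT (fun z : R * T => cut t z.1 * ycan z.1 z.2).
  by case: (hc t).
apply: (@L2_ae _ _ _ LP (fun z : R * T => cut t z.1 * ycan z.1 z.2)) => //.
have := @fub_ae _ _ _ _ _ leb P _ (measurable_funB m2 m1).
move=> h; apply: filterS (h _) => [z /eqP|]; first by rewrite subr_eq0 => /eqP.
apply: (@filterE _ (almost_everywhere leb)) => s.
have [/andP[s0 _]|/cut0 e] := boolP (0 <= s <= t).
  by apply: filterS (semimart_ae s0) => w /= ->; rewrite subrr.
by apply: filterE => w /=; rewrite e !mul0r subrr.
Qed.

End semimart1.

Lemma semimartD y y' (y0 y0' : T -> R) b b' (g g' : I -> R) : semimart y y0 b g -> semimart y' y0' b' g' ->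
  semimart (fun t w => y t w + y' t w) (fun w => y0 w + y0' w) (fun t w => b t w + b' t w) (fun a => g a + g' a).
Proof.
move=> [my h0 p0 ab e] [my' h0' p0' ab' e']; split.
- exact: mprocD.
- exact: L2D.
- exact: orthD.
- exact: orthprocD.
move=> t t0.
apply: filterS3 (e t t0) (e' t t0) (filterI (lproc_loc1_path ab.1) (lproc_loc1_path ab'.1)) => w -> -> [l l'].
rewrite /Dp I_D// /noise; have -> : \sum_a (g a + g' a) * Z a t w = \sum_a g a * Z a t w + \sum_a g' a * Z a t w.
  by rewrite -big_split; apply: eq_bigr => a _; rewrite mulrDl.
by rewrite [LHS]addrACA [in LHS](addrACA (y0 w)).
Qed.

Lemma semimartZ (k : R) y (y0 : T -> R) b (g : I -> R) : semimart y y0 b g ->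
  semimart (fun t w => k * y t w) (fun w => k * y0 w) (fun t w => k * b t w) (fun a => k * g a).
Proof.
move=> [my h0 p0 ab e]; split.
- exact: mprocZ.
- exact: L2Z.
- exact: orthZ.
- exact: orthprocZ.
move=> t t0; apply: filterS2 (e t t0) (lproc_loc1_path ab.1) => w -> l.
rewrite /Dp I_Z// /noise !mulrDr; congr (_ + _).
by rewrite mulr_sumr; apply: eq_bigr => a _; rewrite mulrA.
Qed.

Lemma semimart0 : semimart (fun _ _ => 0) (fun _ => 0) (fun _ _ => 0) (fun=> 0).
Proof.
split.
- exact: mproc_rv.
- exact: L2_0.
- move=> e _; rewrite -[RHS](intE_0 P); apply: eq_Rintegral => w _; exact: mul0r.
- exact: orthproc0.
move=> t t0; apply: filterE => w; rewrite /Dp /noise big1 ?addr0 ?add0r; last by move=> a _; rewrite mul0r.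
by rewrite -[LHS](intE_0 leb); apply: eq_Rintegral => s _; rewrite mulr0.
Qed.

Lemma semimart_eq y y' (y0 y0' : T -> R) b b' (g g' : I -> R) : semimart y y0 b g -> y = y' -> y0 = y0' -> b = b' -> g = g' -> semimart y' y0' b' g'.
Proof. by move=> h <- <- <- <-. Qed.

Lemma semimart_sum (J : Type) (r : seq J) (y : J -> R -> T -> R) (y0 : J -> T -> R) (b : J -> R -> T -> R) (g : J -> I -> R) : (forall j : J, semimart (y j) (y0 j) (b j) (g j)) ->
  semimart (fun t w => \sum_(j <- r) y j t w) (fun w => \sum_(j <- r) y0 j w)
    (fun t w => \sum_(j <- r) b j t w) (fun a => \sum_(j <- r) g j a).
Proof.
move=> H; elim: r => [|j r IH].
  by apply: (semimart_eq semimart0); [apply/funext => t; apply/funext => w|apply/funext => w|apply/funext => t; apply/funext => w|apply/funext => a];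
    rewrite big_nil.
by apply: (semimart_eq (semimartD (H j) IH)); [apply/funext => t; apply/funext => w|apply/funext => w|apply/funext => t; apply/funext => w|apply/funext => a];
    rewrite big_cons.
Qed.

Section semimart2.
Variables (y y' : R -> T -> R) (y0 y0' : T -> R) (b b' : R -> T -> R) (g g' : I -> R).
Hypotheses (hy : semimart y y0 b g) (hy' : semimart y' y0' b' g').

Definition rate s := ip P (b s) (y' s) + ip P (y s) (b' s) + cov_rate g g' s.

Lemma semimart_drift_lproc : lproc P b. Proof. by case: hy => _ _ _ []. Qed.
Lemma semimart_drift_lproc' : lproc P b'. Proof. by case: hy' => _ _ _ []. Qed.

(** Ito's product rule in expectation. [E_semimart] is applied to the canonical versions [ycan], and
    each inner product is brought back by almost sure equality at its time. *)
Lemma semimart_ip t : 0 <= t -> ip P (y t) (y' t) = ip P y0 y0' + It t rate.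
Proof.
move=> t0; have [my h0 p0 [hb ab] e] := hy; have [my' h0' p0' [hb' ab'] e'] := hy'.
have mm (x : R -> T -> R) s : mproc x -> measurable_fun setT (x s) by move=> mx; exact: mproc1.
rewrite (ip_ae (y t) (ycan y0 b g t) (y' t) (ycan y0' b' g' t) (mm _ t my) _ (mm _ t my') _ (e t t0) (e' t t0)); last 2 first.
- by case: (ycan_L2 hy t0).
- by case: (ycan_L2 hy' t0).
have inv c h : {ae leb, forall s, 0 <= s -> L2 P (c s) /\ orth s (c s)} ->
    {ae leb, forall s, 0 <= s <= t -> ip P (c s) (noise h t) = ip P (c s) (noise h s)}.
  apply: (@filterS _ (almost_everywhere leb)) => s hs /andP[s0 st]; have [h1 h2] := hs s0.
  exact: noise_inv.
have E := @E_semimart _ _ _ P y0 y0' b b' (noise g) (noise g') (cov_rate g g') t t0 h0 h0' hb hb'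
  (noise_lproc g) (noise_lproc g') (@noise_L2 g) (@noise_L2 g') (noise_0 g' t0 h0 p0) (noise_0 g t0 h0' p0')
  (inv _ _ ab) (inv _ _ ab') (noise_ip g g' t0) (cov_rate_loc1 g g').
rewrite [LHS]E.
congr (_ + _); apply: eq_I => s /andP[s0 _]; rewrite /rate; congr (_ + _ + _).
- apply: ip_ae; [exact: (mm _ s hb.1)|exact: (mm _ s hb.1)|by case: (ycan_L2 hy' s0)|exact: (mm _ s my')|exact: filterE|].
  by apply: filterS (e' s s0) => w ->.
- apply: ip_ae; [by case: (ycan_L2 hy s0)|exact: (mm _ s my)|exact: (mm _ s hb'.1)|exact: (mm _ s hb'.1)| |exact: filterE].
  by apply: filterS (e s s0) => w ->.
Qed.

Lemma rate_loc1 : loc1 rate.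
Proof.
have h := semimart_lproc hy; have h' := semimart_lproc hy'.
have hb := semimart_drift_lproc; have hb' := semimart_drift_lproc'.
by apply: loc1D; [apply: loc1D; exact: loc1_ip|exact: cov_rate_loc1].
Qed.

Lemma rate_meas : measurable_fun setT rate.
Proof.
have h := semimart_lproc hy; have h' := semimart_lproc hy'.
have hb := semimart_drift_lproc; have hb' := semimart_drift_lproc'.
apply: measurable_funD; last exact: cov_rate_meas.
by apply: measurable_funD; [exact: (measurable_ip hb h')|exact: (measurable_ip h hb')].
Qed.

Variable rho : R.
Hypothesis rho0 : 0 < rho.

Lemma wT_meas (tau : R) : measurable_fun setT (wT rho tau).
Proof. by apply: measurable_funB => //; exact: measurable_expRZ. Qed.

Lemma wT_bd (tau : R) : 0 <= tau -> exists M, forall s, 0 <= s <= tau -> `|wT rho tau s| <= M.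
Proof.
move=> t0; exists 1 => s /andP[s0 st]; rewrite /wT ger0_norm.
  rewrite lerBlDr ler_wpDr ?expR_ge0// -[X in _ <= X]expR0 ler_expR mulNr oppr_le0 mulr_ge0//; exact: ltW.
by rewrite subr_ge0 ler_expR !mulNr lerN2 ler_wpM2l// ltW.
Qed.

Lemma exp_bd (tau : R) : 0 <= tau -> exists M, forall s, 0 <= s <= tau -> `|rho * expR (- rho * s)| <= M.
Proof.
move=> t0; exists rho => s /andP[s0 st]; rewrite ger0_norm; last by rewrite mulr_ge0 ?expR_ge0// ltW.
rewrite ler_piMr//; first exact: ltW.
by rewrite -[X in _ <= X]expR0 ler_expR mulNr oppr_le0 mulr_ge0// ltW.
Qed.

(** [laplace] applied to the second moment of [semimart_ip]: the product rule in discounted form, on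
    a finite horizon. *)
Lemma semimart_laplace tau : 0 <= tau ->
  \int[LP]_z (cut tau z.1 * (rho * expR (- rho * z.1)) * (y z.1 z.2 * y' z.1 z.2)) =
  wT rho tau 0 * ip P y0 y0' + (\int[LP]_z (cut tau z.1 * wT rho tau z.1 * (b z.1 z.2 * y' z.1 z.2))
   + \int[LP]_z (cut tau z.1 * wT rho tau z.1 * (y z.1 z.2 * b' z.1 z.2))
   + It tau (fun s => wT rho tau s * cov_rate g g' s)).
Proof.
move=> t0; have h := semimart_lproc hy; have h' := semimart_lproc hy'.
have hb := semimart_drift_lproc; have hb' := semimart_drift_lproc'.
have me : measurable_fun setT (fun s : R => rho * expR (- rho * s)).
  by apply: measurable_funM => //; exact: measurable_expRZ.
have [_ ->] := LP_ItM h h' me (exp_bd t0).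
have [_ ->] := LP_ItM hb h' (wT_meas tau) (wT_bd t0).
have [_ ->] := LP_ItM h hb' (wT_meas tau) (wT_bd t0).
have wl k : loc1 k -> loc1 (fun s => wT rho tau s * k s).
  move=> hk; rewrite (_ : (fun s => _) = fun s => expR (- rho * s) * k s + (- expR (- rho * tau)) * k s).
    by apply: loc1D; [exact: loc1_expM|exact: loc1Z].
  by apply/funext => s; rewrite /wT; ring.
rewrite -I_D; [|by apply: wl; exact: loc1_ip|by apply: wl; exact: loc1_ip].
rewrite -I_D; [|by apply: loc1D; apply: wl; exact: loc1_ip|by apply: wl; exact: cov_rate_loc1].
rewrite (_ : It tau (fun s => rho * _ * _) = It tau (fun s => rho * expR (- rho * s) * (ip P y0 y0' + It s rate))); last first.
  by apply: eq_I => s /andP[s0 _]; rewrite semimart_ip.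
rewrite (laplace _ _ t0 rate_meas rate_loc1); congr (_ + _).
by apply: eq_I => s _; rewrite /rate !mulrDr.
Qed.
End semimart2.

Lemma expRZ_bd (c tau : R) : exists M, forall s, 0 <= s <= tau -> `|expR (c * s)| <= M.
Proof. by exists (expR (`|c| * tau)) => s hs; exact: expRZ_bounded. Qed.

Lemma loc1_wT (rho tau : R) k : loc1 k -> loc1 (fun s => wT rho tau s * k s).
Proof.
move=> hk; rewrite (_ : (fun s => _) = fun s => expR (- rho * s) * k s + (- expR (- rho * tau)) * k s).
  by apply: loc1D; [exact: loc1_expM|exact: loc1Z].
by apply/funext => s; rewrite /wT; ring.
Qed.

(** * Vector processes: duality and energy estimates *)

Section vector.
Variable rho : R.
Hypothesis rho0 : 0 < rho.
Notation co Y k := (fun t w => Y t w k 0) (only parsing).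

Definition vsemimart m (Y : R -> T -> 'cV[R]_m) (Y0 : T -> 'cV[R]_m) (b : R -> T -> 'cV[R]_m) (g : 'I_m -> I -> R) :=
  forall k, semimart (fun t w => Y t w k 0) (fun w => Y0 w k 0) (fun t w => b t w k 0) (g k).

Definition vL2r m (Y : R -> T -> 'cV[R]_m) := forall k, L2r P rho (fun t w => Y t w k 0).
Definition iprv m (U V : R -> T -> 'cV[R]_m) := \sum_(k < m) ipr P rho (fun t w => U t w k 0) (fun t w => V t w k 0).

Lemma vsemimartD m (Y Y' : R -> T -> 'cV[R]_m) (Y0 Y0' : T -> 'cV[R]_m) (b b' : R -> T -> 'cV[R]_m) (g g' : 'I_m -> I -> R) : vsemimart Y Y0 b g -> vsemimart Y' Y0' b' g' ->
  vsemimart (fun t w => Y t w + Y' t w) (fun w => Y0 w + Y0' w) (fun t w => b t w + b' t w) (fun k a => g k a + g' k a).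
Proof.
move=> h h' k; apply: (semimart_eq (semimartD (h k) (h' k))) => //;
  by [apply/funext => t; apply/funext => w; rewrite mxE|apply/funext => w; rewrite mxE].
Qed.

Lemma vsemimart_mx m p (M : 'M[R]_(p, m)) (Y : R -> T -> 'cV[R]_m) (Y0 : T -> 'cV[R]_m) (b : R -> T -> 'cV[R]_m) (g : 'I_m -> I -> R) : vsemimart Y Y0 b g ->
  vsemimart (fun t w => M *m Y t w) (fun w => M *m Y0 w) (fun t w => M *m b t w) (fun k a => \sum_(l < m) M k l * g l a).
Proof.
move=> h k.
have H := semimart_sum (index_enum 'I_m) (fun l => semimartZ (M k l) (h l)).
apply: (semimart_eq H) => //; by [apply/funext => t; apply/funext => w; rewrite mxE|apply/funext => w; rewrite mxE].
Qed.

Lemma vL2rD m (Y Y' : R -> T -> 'cV[R]_m) : vL2r Y -> vL2r Y' -> vL2r (fun t w => Y t w + Y' t w).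
Proof.
move=> h h' k; have H := L2rD (h k) (h' k).
by rewrite (_ : (fun t w => _) = fun t w => Y t w k 0 + Y' t w k 0)//; apply/funext => t; apply/funext => w; rewrite mxE.
Qed.

Lemma vL2r_mx m p (M : 'M[R]_(p, m)) Y : vL2r Y -> vL2r (fun t w => M *m Y t w).
Proof.
move=> h k; have H := L2r_sum (index_enum 'I_m) (fun l => L2rZ (M k l) (h l)).
by rewrite (_ : (fun t w => _) = fun t w => \sum_(l < m) M k l * Y t w l 0)//; apply/funext => t; apply/funext => w; rewrite mxE.
Qed.

Lemma vL2r_sum m (J : Type) (r : seq J) (Y : J -> R -> T -> 'cV[R]_m) :
  (forall j, vL2r (Y j)) -> vL2r (fun t w => \sum_(j <- r) Y j t w).
Proof.
move=> h k; have H := L2r_sum r (fun j => h j k).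
by rewrite (_ : (fun t w => _) = fun t w => \sum_(j <- r) Y j t w k 0)//; apply/funext => t; apply/funext => w; rewrite summxE.
Qed.

Lemma vL2r_lproc m (Y : R -> T -> 'cV[R]_m) k : vL2r Y -> lproc P (fun t w => Y t w k 0).
Proof. by move=> h; exact: L2r_lproc (h k). Qed.

Lemma iprv_ge0 m (Y : R -> T -> 'cV[R]_m) : 0 <= iprv Y Y.
Proof. by apply: sumr_ge0 => k _; exact: ipr_ge0. Qed.

Lemma LP_dot m (U V : R -> T -> 'cV[R]_m) (h : R -> R) tau :
  (forall k, lproc P (fun t w => U t w k 0)) -> (forall k, lproc P (fun t w => V t w k 0)) ->
  measurable_fun setT h -> (exists M, forall s, 0 <= s <= tau -> `|h s| <= M) ->
  intg LP (fun z => cut tau z.1 * h z.1 * dot (U z.1 z.2) (V z.1 z.2)) /\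
  \int[LP]_z (cut tau z.1 * h z.1 * dot (U z.1 z.2) (V z.1 z.2)) =
  \sum_(k < m) \int[LP]_z (cut tau z.1 * h z.1 * (U z.1 z.2 k 0 * V z.1 z.2 k 0)).
Proof.
move=> hU hV mh bh.
have e : (fun z : R * T => cut tau z.1 * h z.1 * dot (U z.1 z.2) (V z.1 z.2)) =
  fun z => \sum_(k < m) (cut tau z.1 * h z.1 * (U z.1 z.2 k 0 * V z.1 z.2 k 0)).
  by apply/funext => z; rewrite mulr_sumr.
have i k := (LP_ItM (hU k) (hV k) mh bh).1.
rewrite e; split; first by apply: intg_sum => k _; exact: i.
exact: intE_sum.
Qed.

Section vlap.
Variables (m : nat) (Y Y' : R -> T -> 'cV[R]_m) (Y0 Y0' : T -> 'cV[R]_m) (b b' : R -> T -> 'cV[R]_m)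
  (g g' : 'I_m -> I -> R).
Hypotheses (hY : vsemimart Y Y0 b g) (hY' : vsemimart Y' Y0' b' g').

Let ly k := semimart_lproc (hY k).
Let ly' k := semimart_lproc (hY' k).
Let lb k := semimart_drift_lproc (hY k).
Let lb' k := semimart_drift_lproc (hY' k).

Lemma vlaplace tau : 0 <= tau ->
  \int[LP]_z (cut tau z.1 * (rho * expR (- rho * z.1)) * dot (Y z.1 z.2) (Y' z.1 z.2)) =
  wT rho tau 0 * (\sum_(k < m) ip P (fun w => Y0 w k 0) (fun w => Y0' w k 0)) +
   (\int[LP]_z (cut tau z.1 * wT rho tau z.1 * dot (b z.1 z.2) (Y' z.1 z.2))
   + \int[LP]_z (cut tau z.1 * wT rho tau z.1 * dot (Y z.1 z.2) (b' z.1 z.2))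
   + It tau (fun s => wT rho tau s * \sum_(k < m) cov_rate (g k) (g' k) s)).
Proof.
move=> t0.
have me : measurable_fun setT (fun s : R => rho * expR (- rho * s)).
  by apply: measurable_funM => //; exact: measurable_expRZ.
have [_ ->] := LP_dot ly ly' me (exp_bd rho0 t0).
have [_ ->] := LP_dot lb ly' (wT_meas rho tau) (wT_bd rho0 t0).
have [_ ->] := LP_dot ly lb' (wT_meas rho tau) (wT_bd rho0 t0).
under eq_bigr do rewrite (semimart_laplace (hY _) (hY' _) rho0 t0).
rewrite mulr_sumr !big_split /=; congr (_ + (_ + _)).
rewrite -I_sum; last by move=> k; apply: loc1_wT; exact: cov_rate_loc1.
by apply: eq_I => s _; rewrite mulr_sumr.
Qed.

(** The duality identity: the integral of the derivative of e^(-rho t) E <Y, Y'> over the half-line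
    is 0, because [Y'] starts at 0 and the boundary term at infinity disappears. The finite-horizon
    identities converge since all four processes lie in the discounted L2 space. *)
Lemma vcross : (forall k w, Y0' w k 0 = 0) -> (forall k a, g' k a = 0) -> vL2r Y -> vL2r Y' -> vL2r b -> vL2r b' ->
  rho * iprv Y Y' = iprv b Y' + iprv Y b'.
Proof.
move=> h0 hg y2 y2' b2 b2'.
have me : measurable_fun setT (fun s : R => rho * expR (- rho * s)).
  by apply: measurable_funM => //; exact: measurable_expRZ.
have E (n : nat) : \sum_(k < m) rho * (\int[LP]_z (cut n%:R z.1 * expR (- rho * z.1) * (Y z.1 z.2 k 0 * Y' z.1 z.2 k 0))) =
  \sum_(k < m) (\int[LP]_z (cut n%:R z.1 * wT rho n%:R z.1 * (b z.1 z.2 k 0 * Y' z.1 z.2 k 0)) +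
    \int[LP]_z (cut n%:R z.1 * wT rho n%:R z.1 * (Y z.1 z.2 k 0 * b' z.1 z.2 k 0))).
  apply: eq_bigr => k _; have n0 : 0 <= n%:R :> R by [].
  have := semimart_laplace (hY k) (hY' k) rho0 n0.
  have -> : ip P (fun w => Y0 w k 0) (fun w => Y0' w k 0) = 0.
    by rewrite -[RHS](intE_0 P); apply: eq_Rintegral => w _; rewrite h0 mulr0.
  have -> : It n%:R (fun s => wT rho n%:R s * cov_rate (g k) (g' k) s) = 0.
    rewrite -[RHS](intE_0 leb); apply: eq_Rintegral => s _; rewrite /cov_rate big1 ?mulr0// => a _.
    by rewrite big1// => a' _; rewrite hg mulr0 mul0r.
  rewrite mulr0 add0r addr0 => <-; rewrite -intE_Z.
    by apply: eq_Rintegral => z _; ring.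
  have [i _] := LP_ItM (ly k) (ly' k) (measurable_expRZ (- rho)) (expRZ_bd (- rho) n%:R).
  exact: i.
have A : (fun n : nat => \sum_(k < m) rho * (\int[LP]_z (cut n%:R z.1 * expR (- rho * z.1) * (Y z.1 z.2 k 0 * Y' z.1 z.2 k 0)))) @ \oo --> rho * iprv Y Y'.
  rewrite /iprv mulr_sumr; apply: cvg_sum_ord => k; apply: cvgMl_tmp; exact: exp_ipr.
have B : (fun n : nat => \sum_(k < m) (\int[LP]_z (cut n%:R z.1 * wT rho n%:R z.1 * (b z.1 z.2 k 0 * Y' z.1 z.2 k 0)) +
    \int[LP]_z (cut n%:R z.1 * wT rho n%:R z.1 * (Y z.1 z.2 k 0 * b' z.1 z.2 k 0)))) @ \oo --> iprv b Y' + iprv Y b'.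
  rewrite /iprv -big_split; apply: cvg_sum_ord => k; apply: cvgD; exact: wT_ipr.
by rewrite (funext E) in A; exact: (cvg_unique _ A B).
Qed.
End vlap.

(** The discounted product rule for [Y] and [X *m Y], combined with the Lyapunov inequality. Every
    discounted integrability statement about states goes through this lemma: the output and the
    input are known to have finite energy, and [Y] inherits it. *)
Lemma lyap_bound m p (F : 'M[R]_m) (H : 'M[R]_(p, m)) X (c C : R) (Y : R -> T -> 'cV[R]_m) (Y0 : T -> 'cV[R]_m) (b : R -> T -> 'cV[R]_m) (g : 'I_m -> I -> R) (v : R -> T -> 'cV[R]_m) (noise_bound : R -> R) :
  lyap_form (F - (rho / 2)%:M) H X c C -> vsemimart Y Y0 b g ->
  (forall s w, 0 <= s -> b s w = F *m Y s w + v s w) -> vL2r v -> vL2r (fun t w => H *m Y t w) ->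
  (forall s, 0 <= s -> \sum_(k < m) \sum_(l < m) X k l * cov_rate (g k) (g l) s <= noise_bound s) ->
  (forall s, 0 <= s -> 0 <= noise_bound s) -> intg leb (fun s => hp s * expR (- rho * s) * noise_bound s) ->
  vL2r Y /\ c * iprv Y Y <= \int[P]_w qform X (Y0 w) + C * (iprv (fun t w => H *m Y t w) (fun t w => H *m Y t w) + iprv v v)
     + \int[leb]_s (hp s * expR (- rho * s) * noise_bound s).
Proof.
move=> [Xpd c0 C0 lyap] hY hb v2 H2 HG G00 iG.
have [Xs Xp] := Xpd.
have hXY := vsemimart_mx X hY.
have ly k := semimart_lproc (hY k).
have lxy k := semimart_lproc (hXY k).
have lb k := semimart_drift_lproc (hY k).
have lxb k := semimart_drift_lproc (hXY k).
have lv k := vL2r_lproc k v2.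
have lh k := vL2r_lproc k H2.
have iq : intg P (fun w => qform X (Y0 w)).
  under eq_fun do rewrite qformE /dot.
  apply: intg_sum => k _; apply: L2M; [by case: (hY k)|by case: (hXY k)].
have q0 : 0 <= \int[P]_w qform X (Y0 w).
  apply: intE_ge0 => w; have [->|/Xp/ltW//] := eqVneq (Y0 w) 0.
  by rewrite qform0.
have bound (n : nat) : c * \int[LP]_z (cut n%:R z.1 * wT rho n%:R z.1 * dot (Y z.1 z.2) (Y z.1 z.2)) <=
  \int[P]_w qform X (Y0 w) + C * (iprv (fun t w => H *m Y t w) (fun t w => H *m Y t w) + iprv v v)
     + \int[leb]_s (hp s * expR (- rho * s) * noise_bound s).
  have n0 : 0 <= n%:R :> R by [].
  have me : measurable_fun setT (fun s : R => rho * expR (- rho * s)).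
    by apply: measurable_funM => //; exact: measurable_expRZ.
  have [i1 _] := LP_dot ly lxy me (exp_bd rho0 n0).
  have [i2 _] := LP_dot lb lxy (wT_meas rho n%:R) (wT_bd rho0 n0).
  have [i3 _] := LP_dot ly lxb (wT_meas rho n%:R) (wT_bd rho0 n0).
  have [iY _] := LP_dot ly ly (wT_meas rho n%:R) (wT_bd rho0 n0).
  have [iH eH] := LP_dot lh lh (wT_meas rho n%:R) (wT_bd rho0 n0).
  have [iv ev] := LP_dot lv lv (wT_meas rho n%:R) (wT_bd rho0 n0).
  have L := vlaplace hY hXY n0.
  (* The Lyapunov inequality is multiplied by the weight [wT]. The term rho * wT * <Y, X Y> created
     by the shift of [F] is bounded by the same term with the larger weight e^(-rho s), which is the
     left-hand side of [vlaplace]. *)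
  have ineq : c * \int[LP]_z (cut n%:R z.1 * wT rho n%:R z.1 * dot (Y z.1 z.2) (Y z.1 z.2)) <=
     \int[LP]_z (cut n%:R z.1 * (rho * expR (- rho * z.1)) * dot (Y z.1 z.2) (X *m Y z.1 z.2)) -
     (\int[LP]_z (cut n%:R z.1 * wT rho n%:R z.1 * dot (b z.1 z.2) (X *m Y z.1 z.2)) +
      \int[LP]_z (cut n%:R z.1 * wT rho n%:R z.1 * dot (Y z.1 z.2) (X *m b z.1 z.2))) +
     C * (\int[LP]_z (cut n%:R z.1 * wT rho n%:R z.1 * dot (H *m Y z.1 z.2) (H *m Y z.1 z.2)) +
      \int[LP]_z (cut n%:R z.1 * wT rho n%:R z.1 * dot (v z.1 z.2) (v z.1 z.2))).
    rewrite -(intE_D i2 i3) -(intE_D iH iv) -(intE_B i1 (intgD i2 i3)) -(intE_Z _ iY) -(intE_Z _ (intgD iH iv)).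
    rewrite -(intE_D (intgB i1 (intgD i2 i3)) (intgZ C (intgD iH iv))).
    apply: intE_le; [exact: intgZ|by apply: intgD; [apply: intgB => //; exact: intgD|apply: intgZ; exact: intgD]|].
    move=> [s w] /=.
    have [/andP[s0 sn]|/cut0 ->] := boolP (0 <= s <= n%:R); last by rewrite !(mul0r, mulr0, addr0, subr0).
    rewrite cut1 ?s0// !mul1r.
    have -> : dot (b s w) (X *m Y s w) = dot (Y s w) (X *m b s w) by rewrite dotC dot_adj Xs.
    have := lyap (Y s w) (v s w).
    have -> : (F - (rho / 2)%:M) *m Y s w + v s w = b s w - (rho / 2) *: Y s w.
      by rewrite hb// mulmxBl mul_scalar_mx addrAC.
    rewrite mulmxBr -scalemxAr dotBr dotZr -!sqnE -qformE.
    have w0 := wT_ge0 rho0 sn; have w1 := wT_le rho n%:R s.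
    have q1 : 0 <= qform X (Y s w).
      by have [->|/Xp/ltW//] := eqVneq (Y s w) 0; rewrite qform0.
    move: w0 w1 q1; move: (wT rho n%:R s) (expR _) (qform X _) (dot _ _) (sqn _) (sqn _) (sqn _) => W E q D y h u W0 EW q1 hh.
    have : 0 <= W * (- c * u + C * (h + y) - 2 * (D - rho / 2 * q)) by rewrite mulr_ge0// subr_ge0.
    have : 0 <= rho * ((E - W) * q) by rewrite mulr_ge0 ?(ltW rho0)// mulr_ge0// subr_ge0.
    lra.
  apply: le_trans ineq _; rewrite L; set D1 := \int[LP]_z _; set D2 := \int[LP]_z _; set J := It _ _.
  have -> : wT rho n%:R 0 * (\sum_(k < m) ip P (fun w => Y0 w k 0) (fun w => (X *m Y0 w) k 0)) + (D1 + D2 + J) - (D1 + D2) =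
    wT rho n%:R 0 * (\sum_(k < m) ip P (fun w => Y0 w k 0) (fun w => (X *m Y0 w) k 0)) + J by ring.
  rewrite -addrA [J + _]addrC addrA; apply: lerD; [apply: lerD|].
  - have -> : \sum_(k < m) ip P (fun w => Y0 w k 0) (fun w => (X *m Y0 w) k 0) = \int[P]_w qform X (Y0 w).
      rewrite -intE_sum; first by apply: eq_Rintegral => w _; rewrite qformE.
      by move=> k; apply: L2M; [case: (hY k)|case: (hXY k)].
    rewrite ler_piMl// /wT mulr0 expR0 lerBlDr lerDl expR_ge0//.
  - rewrite ler_wpM2l// lerD// ?eH ?ev; apply: ler_sum => k _; apply: wT_ipr_le => //; exact: (H2 k).
  rewrite /J /It; apply: intE_le => //.
    by apply: loc1_wT; apply: loc1_sum => k; exact: cov_rate_loc1.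
  move=> s; have [/andP[s0 sn]|/cut0 ->] := boolP (0 <= s <= n%:R); last first.
    rewrite mul0r /hp; case: (leP 0 s) => [s0|]; last by rewrite !mul0r.
    by rewrite mul1r mulr_ge0 ?expR_ge0 ?G00.
  rewrite cut1 ?s0// mul1r hp1// mul1r.
  have w0 := wT_ge0 rho0 sn; have w1 := wT_le rho n%:R s.
  apply: le_trans (ler_wpM2l w0 (_ : _ <= noise_bound s)) (ler_wpM2r (G00 _ s0) w1).
  apply: le_trans (HG s s0); rewrite le_eqVlt; apply/orP; left; apply/eqP; apply: eq_bigr => k _.
  rewrite /cov_rate exchange_big /=; under eq_bigr => a _.
    under eq_bigr do rewrite mulr_sumr mulr_suml; rewrite exchange_big /=. over.
  rewrite exchange_big /=; apply: eq_bigr => l _; rewrite mulr_sumr exchange_big /=; apply: eq_bigr => a _.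
  by rewrite mulr_sumr; apply: eq_bigr => a' _; ring.
set M := _ + _ + _ in bound *.
have mY : measurable_fun setT (fun z : R * T => dot (Y z.1 z.2) (Y z.1 z.2)).
  by apply: measurable_sum => k; apply: measurable_funM; [exact: (ly k).1|exact: (ly k).1].
have Wc : forall s : R, (fun n : nat => cut n%:R s * wT rho n%:R s) @ \oo --> hp s * expR (- rho * s).
  by move=> s; exact: cut_wT_cvg.
have W1 n s : 0 <= cut n%:R s * wT rho n%:R s <= hp s * expR (- rho * s) by exact: cut_wT.
have Ypos (z : R * T) : 0 <= dot (Y z.1 z.2) (Y z.1 z.2) by rewrite -sqnE sqn_ge0.
(* The bound does not depend on the horizon, so Fatou applies. *)
have [iY bY] := weight_fatou W1 Wc mY Ypos
   (fun n => (LP_dot ly ly (wT_meas rho n%:R) (wT_bd rho0 (ler0n R n))).1)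
   (fun n => etrans (ler_pdivlMr _ _ c0) (etrans (congr1 (fun x => x <= M) (mulrC _ _)) (bound n))).
have Y2 : vL2r Y.
  move=> k; split; first exact: (ly k).1.
  have mk : measurable_fun setT (wb rho (fun t w => Y t w k 0)).
    by apply: measurable_funM; [exact: (measurableT_comp (measurable_hw rho))|exact: (ly k).1].
  split => //; apply: (@intg_le _ _ _ LP _ _ _ _ iY); first exact: measurable_funX.
  move=> z; rewrite ger0_norm ?sqr_ge0// /wb exprMn expr2 hw_sqr ler_wpM2l ?mulr_ge0 ?hp_ge0 ?expR_ge0//.
  by rewrite /dot (bigD1 k)//= expr2 lerDl sumr_ge0// => l _; rewrite -expr2 sqr_ge0.
split => //.
have -> : iprv Y Y = \int[LP]_z (hp z.1 * expR (- rho * z.1) * dot (Y z.1 z.2) (Y z.1 z.2)).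
  rewrite /iprv; under eq_bigr do rewrite iprE.
  rewrite -intE_sum; last by move=> k; exact: (intg_wb (Y2 k) (Y2 k)).
  by apply: eq_Rintegral => z _; rewrite mulr_sumr.
by rewrite mulrC -ler_pdivlMr.
Qed.
End vector.
End Semimart.

(** * Linear systems driven by noise *)

Section System.
Context {d : measure_display} {T : measurableType d} {R : realType}.
Variable P : probability T R.
Notation leb := (@lebesgue_measure R).
Notation LP := (@lebesgue_measure R \x P)%E.

Lemma lproc_bounded (b : R -> T -> R) : mproc b ->
  (forall t, exists M, forall s, 0 <= s <= t -> L2 P (b s) /\ ip P (b s) (b s) <= M) -> lproc P b.
Proof.
move=> mb H; split => // t; have [M HM] := H t.
have mcb : measurable_fun setT (fun z : R * T => cut t z.1 * b z.1 z.2).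
  by apply: measurable_funM => //; exact: (measurableT_comp (measurable_cut t)).
apply: L2P => //.
rewrite (_ : (\int[LP]_z _)%E = (\int[leb]_s \int[P]_w ((cut t s * b s w) ^+ 2)%:E)%E); last first.
  rewrite [LHS]fubini_tonelli1//; first exact/measurable_EFinP/measurable_funX.
  by move=> z; rewrite lee_fin sqr_ge0.
apply: (@le_lt_trans _ _ (\int[leb]_s (`|M| * cut t s)%:E)%E); last first.
  have i := intgZ `|M| (intg_cut t); by rewrite (intE_EFin i) ltry.
apply: ge0_le_integral => //.
- by move=> s _; apply: integral_ge0 => w _; rewrite lee_fin sqr_ge0.
- apply: (@measurable_fun_fubini_tonelli_F _ _ _ _ _ P (fun z : R * T => ((cut t z.1 * b z.1 z.2) ^+ 2)%:E)).
    by apply/measurable_EFinP; exact: measurable_funX.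
  by move=> z; rewrite lee_fin sqr_ge0.
- by apply/measurable_EFinP; apply: measurable_funM => //; exact: measurable_cut.
move=> s _; have [h|/cut0 ->] := boolP (0 <= s <= t); last first.
  rewrite mulr0 (eq_integral (cst 0%E)) ?integral0// => w _; by rewrite mul0r expr0n.
have [[mbs ibs] hM] := HM s h; rewrite cut1// mulr1.
under eq_integral do rewrite mul1r.
rewrite (intE_EFin ibs) lee_fin (le_trans _ (ler_norm M))//.
Qed.

Variables (A : finType) (F : A -> A -> R) (Y zt v : A -> R -> T -> R).
Let b a s w := \sum_c F a c * Y c s w + v a s w.
Hypotheses (mY : forall a, mproc (Y a)) (lz : forall a, lproc P (zt a)) (lv : forall a, lproc P (v a))
  (Hp : {ae P, forall w, forall a, loc1 (b a ^~ w)})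
  (He : {ae P, forall w, forall a t, 0 <= t -> Y a t w = zt a t w + It t (b a ^~ w)}).

Let cF := \sum_a \sum_c `|F a c|.
Let cF0 : 0 <= cF. Proof. by apply: sumr_ge0 => a _; apply: sumr_ge0. Qed.
Let V s w := \sum_a `|\sum_c F a c * zt c s w + v a s w|.

Lemma lproc_abs (y : R -> T -> R) : lproc P y -> lproc P (fun s w => `|y s w|).
Proof.
move=> [my hy]; split; first exact: measurableT_comp.
move=> t; have := L2_abs (hy t); by under eq_fun do rewrite normrM ger0_norm ?cut_ge0//.
Qed.

Let lV : lproc P V.
Proof.
by apply: lproc_sum => a; apply: lproc_abs; apply: lprocD => //; apply: lproc_sum => c; apply: lprocZ.
Qed.

Lemma sum_abs_le (x : A -> R) (a : A) : `|x a| <= \sum_c `|x c|.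
Proof. by rewrite (bigD1 a)//= lerDl sumr_ge0. Qed.

(** Gronwall is applied to the integrals of the drifts, which are bounded on bounded windows,
    whereas the paths of [zt] are known only to be integrable there. *)
Lemma system_path : {ae P, forall w, forall a t, 0 <= t ->
  `|It t (b a ^~ w)| <= 2 * (#|A|%:R * It t (V ^~ w)) * expR (2 * (#|A|%:R * cF) * t)}.
Proof.
apply: filterS3 Hp He (lproc_loc1_path lV) => w lb eY lVw a T0 T00.
pose D c t := It t (b c ^~ w).
have Db c : D c = fun t => It t (b c ^~ w) by [].
have mb c : measurable_fun setT (b c ^~ w).
  have mbp : mproc (b c).
    apply: mprocD; last by case: (lv c).
    by apply: mproc_sum => e; apply: mprocZ.
  exact: mproc2 w mbp.
have mD c : measurable_fun setT (D c) by exact: measurable_I.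
have lD c : loc1 (D c).
  have := loc1_IM (mb c) (lb c) (loc1_cst 1); by under eq_fun do rewrite mulr1.
pose S t := \sum_c `|D c t|.
have lS : loc1 S by apply: loc1_sum => c; exact: loc1_abs.
have bD c s : 0 <= s -> `|b c s w| <= cF * S s + V s w.
  move=> s0; rewrite /b.
  have -> : \sum_e F c e * Y e s w + v c s w = \sum_e F c e * D e s + (\sum_e F c e * zt e s w + v c s w).
    rewrite addrA -big_split /=; congr (_ + _); apply: eq_bigr => e _.
    by rewrite eY// -/(D e s) mulrDr addrC.
  apply: le_trans (ler_normD _ _) _; apply: lerD; last exact: (sum_abs_le (fun c => \sum_e F c e * zt e s w + v c s w)).
  apply: le_trans (ler_norm_sum _ _ _) _; rewrite /S mulr_sumr; apply: ler_sum => e _.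
  rewrite normrM ler_wpM2r// /cF (bigD1 c)//= (bigD1 e)//= -addrA lerDl addr_ge0// ?sumr_ge0// => f _.
  by rewrite sumr_ge0.
have cA : 0 <= #|A|%:R :> R by [].
have SV (t : R) : 0 <= t <= T0 -> S t <= #|A|%:R * It T0 (V ^~ w) + (#|A|%:R * cF) * It t S.
  move=> /andP[t0 tT].
  apply: (@le_trans _ _ (\sum_(c : A) (cF * It t S + It T0 (V ^~ w)))); last first.
    by rewrite sumr_const -mulr_natl; move: (It _ _) (It _ _) => x y; lra.
  apply: ler_sum => c _; apply: le_trans (I_abs _ (lb c)) _.
  apply: (@le_trans _ _ (It t (fun s => cF * S s + V s w))).
    apply: I_le; [exact: loc1_abs|by apply: loc1D => //; exact: loc1Z|].
    by move=> s /andP[s0 _]; exact: bD.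
  rewrite I_D//; last exact: loc1Z.
  rewrite I_Z// lerD2l I_mono// => s _; by rewrite sumr_ge0.
have V0 s : 0 <= V s w by rewrite sumr_ge0.
have := @gronwall _ S (#|A|%:R * It T0 (V ^~ w)) (#|A|%:R * cF) (\sum_c It T0 (fun s => `|b c s w|)) T0 _ _ lS _ SV T0.
rewrite lexx T00 => h; apply: le_trans (sum_abs_le (D ^~ T0) a) (h _ _ _ isT).
- by rewrite mulr_ge0.
- by rewrite mulr_ge0// I_ge0.
- move=> t ht; rewrite sumr_ge0//=; apply: ler_sum => c _; exact: I_bounded.
Qed.

Let lb_meas a : mproc (b a).
Proof.
by apply: mprocD; [apply: mproc_sum => e; apply: mprocZ|case: (lv a)].
Qed.

(** The bound of [system_path] is linear in the time integral of [V], so second moments follow from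
    those of [V]. *)
Lemma system_It_lproc a : lproc P (fun t w => It t (b a ^~ w)).
Proof.
have [mV hV] := lproc_It lV.
have mI := mproc_It (lb_meas a); split => // t.
pose K := 2 * #|A|%:R * expR (2 * (#|A|%:R * cF) * `|t|).
have mc (y : R -> T -> R) : mproc y -> measurable_fun setT (fun z : R * T => cut t z.1 * y z.1 z.2).
  by move=> my; apply: measurable_funM => //; exact: (measurableT_comp (measurable_cut t)).
have hK := L2Z K (hV t); split; first exact: (mc _ mI).
apply: (@intg_le_ae _ _ _ LP _ (fun z => (K * (cut t z.1 * It z.1 (V ^~ z.2))) ^+ 2)); last by case: hK.
  by apply: measurable_funX; exact: (mc _ mI).
have := ae_prod2 leb system_path; apply: filterS => -[s w] /= Hw.
rewrite ger0_norm ?sqr_ge0//.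
have [/andP[s0 st]|/cut0 ->] := boolP (0 <= s <= t); last by rewrite !(mul0r,mulr0) expr0n.
rewrite cut1 ?s0// !mul1r -[X in X <= _]real_normK ?num_real//.
have I0_ : 0 <= It s (V ^~ w) by apply: I_ge0 => r _; rewrite sumr_ge0.
have K0 : 0 <= K by rewrite /K !mulr_ge0 ?expR_ge0.
rewrite lerXn2r ?nnegrE ?mulr_ge0//; apply: le_trans (Hw a s s0) _.
rewrite /K; have : expR (2 * (#|A|%:R * cF) * s) <= expR (2 * (#|A|%:R * cF) * `|t|).
  rewrite ler_expR ler_wpM2l//; first by rewrite !mulr_ge0.
  by rewrite (le_trans st)// ler_norm.
have A0 : 0 <= #|A|%:R :> R by [].
move: (expR _) (expR _) (It _ _) I0_ A0 => x y z z0 A0 xy.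
have -> : 2 * (#|A|%:R * z) * y = (2 * #|A|%:R * z) * y by ring.
have -> : 2 * #|A|%:R * x * z = (2 * #|A|%:R * z) * x by ring.
by rewrite ler_wpM2l// !mulr_ge0.
Qed.

Lemma system_lproc a : lproc P (Y a).
Proof.
have l := lprocD (lz a) (system_It_lproc a); split => // t.
have m1 : measurable_fun setT (fun z : R * T => cut t z.1 * Y a z.1 z.2).
  by apply: measurable_funM; [exact: (measurableT_comp (measurable_cut t))|exact: mY].
apply: (@L2_ae _ _ _ LP (fun z : R * T => cut t z.1 * (zt a z.1 z.2 + It z.1 (b a ^~ z.2)))) => //; last by case: l.
have := ae_prod2 leb He; apply: filterS => -[s w] /= Hw.
have [/andP[s0 st]|/cut0 ->] := boolP (0 <= s <= t); last by rewrite !mul0r.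
by rewrite -Hw.
Qed.

Lemma system_drift_lproc a : lproc P (b a).
Proof. by apply: lprocD => //; apply: lproc_sum => c; apply: lprocZ; exact: system_lproc. Qed.

Lemma system_L2 a t : 0 <= t -> L2 P (zt a t) -> L2 P (Y a t).
Proof.
move=> t0 hz; apply: (L2_ae _ _ (L2D hz (L2_It t (system_drift_lproc a)))); first exact: mproc1 t (mY a).
by apply: filterS He => w ->.
Qed.

(** Paired with [xi], the components satisfy a homogeneous linear integral equation, so they vanish
    by [gronwall0]. *)
Lemma system_orth xi S : L2 P xi -> (forall a s, 0 <= s <= S -> L2 P (zt a s)) ->
  (forall a s, 0 <= s <= S -> ip P xi (zt a s) = 0) ->
  (forall a, {ae leb, forall s, 0 <= s <= S -> ip P xi (v a s) = 0}) ->
  forall a s, 0 <= s <= S -> ip P xi (Y a s) = 0.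
Proof.
move=> hx z2 zp vp a s hs.
have Y2 c r : 0 <= r <= S -> L2 P (Y c r).
  by move=> hr; apply: system_L2; [case/andP: hr|exact: z2].
pose h c r := ip P xi (Y c r).
have lh c : loc1 (h c) by exact: loc1_ipl hx (system_lproc c).
have hE c r : 0 <= r <= S -> h c r = It r (fun q => \sum_e F c e * h e q).
  move=> hr; have /andP[r0 rS] := hr.
  have -> : h c r = ip P xi (fun w => zt c r w + It r (b c ^~ w)).
    apply: ip_ae; [by case: hx|by case: hx|by case: (Y2 c r hr)| |exact: filterE|by apply: filterS He => w ->].
    by apply: measurable_funD; [case: (z2 c r hr)|case: (L2_It r (system_drift_lproc c))].
  rewrite (ipDr (z2 c r hr) (L2_It r (system_drift_lproc c)) hx) zp// add0r.
  rewrite (E_It r hx (system_drift_lproc c)); apply: intE_ae.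
  - by apply: measurable_funM; [exact: measurable_cut|exact: (measurable_ip (lproc_rv hx) (system_drift_lproc c))].
  - apply: measurable_funM; first exact: measurable_cut.
    apply: measurable_sum => e; apply: measurable_funM => //; exact: (measurable_ip (lproc_rv hx) (system_lproc e)).
  apply: (@filterS2 _ (almost_everywhere leb) (ae_filter_ringOfSetsType leb) _ _ _ _ (vp c) (lproc_L2_ae (lv c))) => q Hq v2.
  have [hq|/cut0 ->] := boolP (0 <= q <= r); last by rewrite !mul0r.
  have /andP[q0 qr] := hq; have qS : 0 <= q <= S by rewrite q0 (le_trans qr).
  congr (_ * _); rewrite ipDr ?Hq ?addr0//; last 2 first.
  - by apply: L2_sum => e _; apply: L2Z; exact: Y2.
  - exact: v2.
  rewrite ip_sumr//; last by move=> e; apply: L2Z; exact: Y2.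
  by apply: eq_bigr => e _; rewrite ipZr//; exact: Y2.
pose H r := \sum_c `|h c r|.
have lH : loc1 H by apply: loc1_sum => c; exact: loc1_abs.
have lFh c : loc1 (fun q => \sum_e F c e * h e q) by apply: loc1_sum => e; exact: loc1Z.
have HH r : 0 <= r <= S -> H r <= (#|A|%:R * cF) * It r H.
  move=> hr; have /andP[r0 rS] := hr.
  apply: (@le_trans _ _ (\sum_(c : A) cF * It r H)); last by rewrite sumr_const -mulr_natl; move: (It r H) => x; lra.
  apply: ler_sum => c _; rewrite hE//; apply: le_trans (I_abs _ (lFh c)) _.
  rewrite -I_Z//; apply: I_le; [exact: loc1_abs|exact: loc1Z|].
  move=> q _; apply: le_trans (ler_norm_sum _ _ _) _; rewrite /H mulr_sumr; apply: ler_sum => e _.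
  rewrite normrM ler_wpM2r// /cF (bigD1 c)//= (bigD1 e)//= -addrA lerDl addr_ge0// ?sumr_ge0// => f _.
  by rewrite sumr_ge0.
have H0 := @gronwall0 _ H (#|A|%:R * cF) (\sum_c It S (fun q => `|\sum_e F c e * h e q|)) S _ lH _ HH s hs.
have /eqP : H s = 0.
  apply: H0; first by rewrite mulr_ge0.
  move=> r hr; rewrite sumr_ge0//=; apply: ler_sum => c _; rewrite hE//; exact: I_bounded.
by rewrite psumr_eq0// => /allP/(_ a (mem_index_enum a)); rewrite normr_eq0 => /eqP.
Qed.
End System.

Section ContDet.
Context {R : realType}.
Notation leb := (@lebesgue_measure R).
Implicit Types g h : R -> R.

Lemma hp_cont_meas g : {within `[0, +oo[, continuous g} -> measurable_fun setT (fun s => hp s * g s).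
Proof.
move=> cg; have mg : measurable_fun (`[0, +oo[ : set R) g.
  by apply: subspace_continuous_measurable_fun.
rewrite (_ : (fun s => _) = g \_ `[0, +oo[).
  exact: (proj1 (measurable_restrictT _ (measurable_itv _)) mg).
apply/funext => s; rewrite patchE /hp (_ : (s \in _) = (0 <= s)%R).
  by case: (0 <= s); rewrite ?mul1r ?mul0r.
by apply/idP/idP; rewrite inE/= in_itv/= andbT.
Qed.

Lemma cont_bounded g t : {within `[0, +oo[, continuous g} -> exists M, forall s, 0 <= s <= t -> `|g s| <= M.
Proof.
move=> cg; have cg' : {within `[0, t], continuous g}.
  by apply: continuous_subspaceW cg => x /=; rewrite !in_itv/= => /andP[->].
have /compact_bounded[M [_ HM]] := continuous_compact cg' (@segment_compact R 0 t).
exists (M + 1) => s hs; apply: (HM (M + 1)); first by rewrite ltrDl.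
by exists s => //=; rewrite in_itv.
Qed.

Lemma loc1_cont g : {within `[0, +oo[, continuous g} -> loc1 (fun s => hp s * g s).
Proof.
move=> cg t; have [M HM] := cont_bounded t cg.
apply: (@intg_le _ _ _ leb _ (fun s => `|M| * cut t s)); last by apply: intgZ; exact: intg_cut.
  by apply: measurable_funM; [exact: measurable_cut|exact: hp_cont_meas].
move=> s; have [hs|/cut0 ->] := boolP (0 <= s <= t); last by rewrite mul0r normr0 mulr0.
rewrite cut1// mul1r mulr1 hp1; last by case/andP: hs.
by rewrite mul1r (le_trans (HM s hs))// ler_norm.
Qed.

Lemma within_contM g h : {within `[0, +oo[, continuous g} -> {within `[0, +oo[, continuous h} ->
  {within `[0, +oo[, continuous (fun s => g s * h s)}.
Proof. by move=> cg ch x; apply: cvgM; [exact: cg|exact: ch]. Qed.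
End ContDet.

Section Agents.
Context {d : measure_display} {T : measurableType d} {R : realType} {n r : nat}.
Variable P : probability T R.
Notation leb := (@lebesgue_measure R).
Notation LP := (@lebesgue_measure R \x P)%E.
Variables (x0 : nat -> T -> 'cV[R]_n) (W : nat -> R -> T -> R) (sg : R -> 'cV[R]_n).
Hypotheses (hW : forall i, brownian_motion P (W i))
  (hWindep : mutually_independent P (fun i => sigma_rv `[0, +oo[ (W i)))
  (csg : {within `[0, +oo[, continuous sg})
  (hx0 : forall i (k : 'I_n), measurable_fun setT (fun w => x0 i w k 0))
  (hx0W : independent2 P (<<s \bigcup_i sigma_init x0 i >>)
                          (<<s \bigcup_i sigma_rv `[0, +oo[ (W i) >>))
  (x0L2 : forall i (k : 'I_n), L2 P (fun w => x0 i w k 0)).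
Variable N : nat.
Let I := ('I_N * 'I_n)%type.
Variable Z : I -> R -> T -> R.
Hypotheses (mZ : forall a, mproc (Z a))
  (Zito : forall (i : 'I_N) t, 0 <= t -> ito_integral P (W i) sg t (fun w => \col_k Z (i, k) t w)).

Definition future s : set (T -> R) := [set h | exists (i : 'I_N) a b, [/\ s <= a, a <= b & h = incr (W i) a b]].

Definition noise_cov (a b : I) s : R := (a.1 == b.1)%:R * (normal_m2 * (hp s * (sg s a.2 0 * sg s b.2 0))).

Lemma futureL2 s : 0 <= s -> future s `<=` L2 P.
Proof.
by move=> s0 h [i [a [b [sa ab ->]]]]; apply: (incr_L2 (hW i)) => //; exact: le_trans sa.
Qed.

Lemma col_comp (i : 'I_N) t k : (fun w => (\col_l Z (i, l) t w) k 0) = Z (i, k) t.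
Proof. by apply/funext => w; rewrite mxE. Qed.

Lemma colZ_meas i t : vmeas (fun w => \col_k Z (i, k) t w).
Proof. by move=> k; rewrite col_comp; exact: mproc1. Qed.

Lemma Z_L2 a t : 0 <= t -> L2 P (Z a t).
Proof.
case: a => i k t0; rewrite -col_comp.
exact: (ito_L2 hW csg t0 (colZ_meas i t) (Zito i t0)).
Qed.

Lemma loc1_sg2 k l : loc1 (fun s => hp s * (sg s k 0 * sg s l 0)).
Proof. by apply: loc1_cont; apply: within_contM; exact: coord_within. Qed.

Lemma Z_cov (a b : I) t : 0 <= t -> ip P (Z a t) (Z b t) = It t (noise_cov a b).
Proof.
case: a b => [i k] [j l] t0; rewrite -!col_comp.
rewrite (ito_ip hW hWindep csg k l t0 (colZ_meas i t) (Zito i t0) (colZ_meas j t) (Zito j t0)).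
rewrite (clip_ip csg k l t0) /noise_cov /=.
rewrite I_Z; last by apply: loc1Z; exact: loc1_sg2.
rewrite I_Z; last exact: loc1_sg2.
congr (_ * (_ * _)); apply: eq_I => s /andP[s0 _]; by rewrite hp1// mul1r.
Qed.

Lemma noise_cov_loc1 a b : loc1 (noise_cov a b).
Proof. by apply: loc1Z; apply: loc1Z; exact: loc1_sg2. Qed.

Lemma noise_cov_meas a b : measurable_fun setT (noise_cov a b).
Proof.
do 2 apply: measurable_funM => //; apply: hp_cont_meas.
by apply: within_contM; exact: coord_within.
Qed.

Lemma noise_lproc_of (z : R -> T -> R) a : mproc z -> (forall t, 0 <= t -> L2 P (z t)) ->
  (forall t, 0 <= t -> ip P (z t) (z t) = It t (noise_cov a a)) -> lproc P z.
Proof.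
move=> mz z2 zz; apply: lproc_bounded => // t; exists (It t (noise_cov a a)) => s /andP[s0 st].
split; [exact: z2|rewrite zz//; apply: I_mono => //; first exact: noise_cov_loc1].
move=> u _; rewrite /noise_cov eqxx mul1r mulr_ge0 ?normal_m2_ge0// mulr_ge0 ?hp_ge0// -expr2 sqr_ge0//.
Qed.

Lemma Z_lproc a : lproc P (Z a).
Proof. by apply: (@noise_lproc_of _ a) => //; [exact: Z_L2|move=> t t0; exact: Z_cov]. Qed.

Lemma Z_inv a s t xi : 0 <= s -> s <= t -> L2 P xi -> orth P future s xi -> ip P xi (Z a t) = ip P xi (Z a s).
Proof.
case: a => i k s0 st hx px; have t0 := le_trans s0 st; rewrite -!col_comp.
apply: (ito_perp hW csg k s0 st hx (colZ_meas i s) (Zito i s0) (colZ_meas i t) (Zito i t0)) => c e sc ce.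
by apply: px; exists i, c, e.
Qed.

Lemma Z_orth a t : 0 <= t -> orth P future t (Z a t).
Proof.
case: a => i k t0 h [j [c [e [tc ce ->]]]]; rewrite -col_comp.
exact: (ito_ip_incr hW hWindep csg t0 (colZ_meas i t) (Zito i t0) j k tc ce).
Qed.

(** By [Z_inv] the time [t] may be replaced by 0, where the noise has variance 0. *)
Lemma Z_ip0 a t xi : 0 <= t -> L2 P xi -> orth P future 0 xi -> ip P xi (Z a t) = 0.
Proof.
move=> t0 hx px; rewrite (Z_inv a (lexx 0) t0 hx px).
have z2 := Z_L2 a (lexx 0).
have : ip P xi (Z a 0) ^+ 2 <= ip P xi xi * ip P (Z a 0) (Z a 0) by exact: CS.
rewrite Z_cov// I0; last exact: noise_cov_loc1.
by rewrite mulr0 => h; apply/eqP; rewrite -sqrf_eq0 eq_le h sqr_ge0.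
Qed.

Lemma orth_mono s s' xi : s <= s' -> orth P future s xi -> orth P future s' xi.
Proof.
move=> ss h e [i [a [b [sa ab eE]]]]; apply: h; exists i, a, b; split => //; exact: le_trans sa.
Qed.

Lemma x0_orth s (i : 'I_N) k : 0 <= s -> orth P future s (fun w => x0 i w k 0).
Proof.
move=> s0 e [j [a [b [sa ab ->]]]].
apply: (filtration_perp hW hWindep hx0 hx0W (N := N) (s := s)) => //.
by move=> E mE; exact: x0_filtration.
Qed.

Lemma orth_cst s c : 0 <= s -> orth P future s (fun=> c).
Proof.
move=> s0 e [j [a [b [sa ab ->]]]]; have a0 := le_trans s0 sa.
by rewrite /ip (intE_Z c (L2_intg (incr_L2 (hW j) a0 ab))) (incr_mean (hW j) a0 ab) mulr0.
Qed.

(* Processes are unconstrained at negative times. *)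
Definition pos m (X : R -> T -> 'cV[R]_m) : R -> T -> 'cV[R]_m := fun t w => hp t *: X t w.

Lemma posE m (X : R -> T -> 'cV[R]_m) t w k : pos X t w k 0 = hp t * X t w k 0.
Proof. by rewrite /pos mxE. Qed.

Lemma mproc_pos m (X : R -> T -> 'cV[R]_m) k : measurable_process X -> mproc (fun t w => pos X t w k 0).
Proof.
move=> /(_ k) mX; rewrite /mproc.
have mD : measurable (`[(0 : R), +oo[ `*` [set: T]) by apply: measurableX.
rewrite (_ : (fun z : R * T => _) = (fun p : R * T => X p.1 p.2 k 0) \_ (`[(0 : R), +oo[ `*` [set: T])).
  exact: (proj1 (measurable_restrictT _ mD) mX).
apply/funext => -[t w]; rewrite patchE /pos mxE /hp.
rewrite (_ : ((t, w) \in _) = (0 <= t)%R); last first.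
  by apply/idP/idP; rewrite inE/= in_itv/= andbT; [case|split].
by case: (0 <= t); rewrite ?mul1r ?mul0r.
Qed.

Lemma It_pos m (X : R -> T -> 'cV[R]_m) t w k : It t (fun s => pos X s w k 0) = It t (fun s => X s w k 0).
Proof. by apply: eq_I => s /andP[s0 _]; rewrite /pos mxE hp1// mul1r. Qed.

Definition noise_row (i : 'I_N) (k : 'I_n) (a : I) : R := (a == (i, k))%:R.

Lemma noise_noise_row i k t w : noise Z (noise_row i k) t w = Z (i, k) t w.
Proof.
rewrite /noise (bigD1 (i, k))//= /noise_row eqxx mul1r big1 ?addr0// => a /negbTE ->.
by rewrite mul0r.
Qed.
End Agents.

(** * The state equation as a linear system *)

Section State.
Context {d : measure_display} {T : measurableType d} {R : realType} {n r : nat}.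
Variable P : probability T R.
Notation leb := (@lebesgue_measure R).
Variables (x0 : nat -> T -> 'cV[R]_n) (W : nat -> R -> T -> R) (sg : R -> 'cV[R]_n).
Hypotheses (hW : forall i, brownian_motion P (W i))
  (hWindep : mutually_independent P (fun i => sigma_rv `[0, +oo[ (W i)))
  (csg : {within `[0, +oo[, continuous sg})
  (hx0 : forall i (k : 'I_n), measurable_fun setT (fun w => x0 i w k 0))
  (hx0W : independent2 P (<<s \bigcup_i sigma_init x0 i >>)
                          (<<s \bigcup_i sigma_rv `[0, +oo[ (W i) >>))
  (x0L2 : forall i (k : 'I_n), L2 P (fun w => x0 i w k 0)).
Variable N : nat.
Let I := ('I_N * 'I_n)%type.
Notation future := (future W N).
Variables (A G : 'M[R]_n) (B : 'M[R]_(n, r)) (f : R -> 'cV[R]_n) (u : 'I_N -> R -> T -> 'cV[R]_r) (x : 'I_N -> R -> T -> 'cV[R]_n).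
Hypothesis hx : state_process P x0 W A G B f sg u x.

(* The Ito integral of [sg] recovered from the state equation, as a jointly measurable process. *)
Definition innov (a : I) t w := hp t * (pos (x a.1) t w a.2 0 - x0 a.1 w a.2 0 -
   It t (fun s => pos (drift A G B f u x a.1) s w a.2 0)).

Section drift_form.
(** One form for two cases: for an admissible control [v] contains B u, while for the feedback law
    the state part of the control goes into [F] and [v] is deterministic. *)
Variables (F : I -> I -> R) (v : I -> R -> T -> R).
Hypotheses (hv : forall a, orthproc P future (v a))
  (hF : forall i k s w, pos (drift A G B f u x i) s w k 0 = \sum_c F (i, k) c * pos (x c.1) s w c.2 0 + v (i, k) s w).

Let X (a : I) t w := pos (x a.1) t w a.2 0.
Let b (a : I) s w := \sum_c F a c * X c s w + v a s w.

Let mX a : mproc (X a).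
Proof. by case: hx => mx _ _ _; exact: mproc_pos. Qed.

Let bE (a : I) : b a = fun s w => pos (drift A G B f u x a.1) s w a.2 0.
Proof. by case: a => i k; apply/funext => s; apply/funext => w; rewrite hF. Qed.

Let mb a : mproc (b a).
Proof. by apply: mprocD; [apply: mproc_sum => c; apply: mprocZ; exact: mX|case: (hv a) => -[]]. Qed.

Lemma innov_meas a : mproc (innov a).
Proof.
apply: mprocM; first by apply: mproc_det; exact: measurable_hp.
apply: (measurable_funB (f := fun z : R * T => X a z.1 z.2 - x0 a.1 z.2 a.2 0)).
  apply: measurable_funB; first exact: mX.
  by apply: (measurableT_comp (hx0 a.1 a.2)).
by have := mproc_It (mb a); rewrite bE.
Qed.

Lemma innov_ito (i : 'I_N) t : 0 <= t -> ito_integral P (W i) sg t (fun w => \col_k innov (i, k) t w).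
Proof.
move=> t0; case: hx => _ _ _ /(_ i t t0).
rewrite (_ : (fun w => _ - _ - _) = fun w => \col_k innov (i, k) t w)//.
apply/funext => w; apply/matrixP => k j; rewrite !mxE /innov /= hp1// mul1r !ord1 /pos mxE hp1// mul1r.
by rewrite -It_restrict -(It_pos (drift A G B f u x i) t w k).
Qed.

Let zt (a : I) s w := x0 a.1 w a.2 0 + innov a s w.

Lemma state_drift_path : {ae P, forall w, forall a : I, loc1 (fun s => pos (drift A G B f u x a.1) s w a.2 0)}.
Proof.
case: hx => _ _ + _; apply: filterS => w H [i k] t /=.
have [t0|t0] := leP 0 t; last by under eq_fun do rewrite cut_neg// mul0r; exact: intg0.
have h0 : leb.-integrable setT ((fun s => (drift A G B f u x i s w k 0)%:E) \_ `[0, t]).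
  have mD : measurable (`[0, t]%classic : set (measurableTypeR R)) by exact: measurable_itv.
  have [h0 _] := @integrable_mkcond _ _ R leb _ (fun s => (drift A G B f u x i s w k 0)%:E) mD.
  exact: h0 (H i t k t0).
suff E : (fun s => (drift A G B f u x i s w k 0)%:E) \_ `[0, t] =
   EFin \o (fun s => cut t s * pos (drift A G B f u x i) s w k 0) by rewrite /intg -E.
apply/funext => s; rewrite patchE /= (_ : (s \in _) = (0 <= s <= t)%R); last first.
  by apply/idP/idP; rewrite inE/= in_itv.
have [h|/cut0 ->] := boolP (0 <= s <= t); last by rewrite mul0r.
by have /andP[s0 _] := h; rewrite posE hp1// mul1r cut1// mul1r.
Qed.

Let Hp : {ae P, forall w, forall a : I, loc1 (b a ^~ w)}.
Proof. by apply: filterS state_drift_path => w H a; rewrite bE; exact: H. Qed.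

Let He : {ae P, forall w, forall (a : I) t, 0 <= t -> X a t w = zt a t w + It t (b a ^~ w)}.
Proof.
apply: filterE => w a t t0; rewrite /zt /innov hp1// mul1r bE /X.
by move: (It t _) (pos _ _ _ _ _) (x0 _ _ _ _) => p q e; ring.
Qed.

Lemma innov_L2 a t : 0 <= t -> L2 P (innov a t).
Proof. exact: (Z_L2 hW csg innov_meas innov_ito). Qed.

Let lz a : lproc P (zt a).
Proof.
apply: lprocD; first exact: lproc_rv.
exact: (Z_lproc hW hWindep csg innov_meas innov_ito).
Qed.

Let lv a : lproc P (v a). Proof. by case: (hv a). Qed.

Lemma state_lproc i k : lproc P (fun t w => pos (x i) t w k 0).
Proof. exact: (system_lproc mX lz lv Hp He (i, k)). Qed.

Let z2 a s : 0 <= s -> L2 P (zt a s).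
Proof. by move=> s0; apply: L2D => //; exact: innov_L2. Qed.

Lemma state_L2 i k t : 0 <= t -> L2 P (fun w => pos (x i) t w k 0).
Proof. by move=> t0; apply: (system_L2 mX lz lv Hp He (a := (i, k))) => //; exact: z2. Qed.

(** The increment after [s] is the fixed test variable and the system runs up to [s]: initial state,
    noise and input at earlier times are all orthogonal to it. *)
Lemma state_orth i k s : 0 <= s -> orth P future s (fun w => pos (x i) s w k 0).
Proof.
move=> s0 e te; rewrite ipC.
have e2 : L2 P e := futureL2 hW s0 te.
apply: (system_orth mX lz lv Hp He (xi := e) (S := s) e2 _ _ _ (i, k)); last by rewrite s0 lexx.
- by move=> a t /andP[t0 _]; exact: z2.
- move=> [j l] t /andP[t0 ts]; rewrite /zt ipDr//; last exact: innov_L2.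
  rewrite ipC (x0_orth hW hWindep hx0 hx0W x0L2 j l s0 te) add0r ipC.
  exact: (orth_mono ts (Z_orth hW hWindep csg innov_meas innov_ito (j, l) t0) te).
- move=> a; case: (hv a) => _; apply: (@filterS _ (almost_everywhere leb)) => t h /andP[t0 ts].
  have [v2 vp] := h t0; rewrite ipC; exact: (orth_mono ts vp te).
Qed.

Lemma state_orthproc i k : orthproc P future (fun t w => pos (x i) t w k 0).
Proof.
split; first exact: state_lproc.
by apply: (@filterE _ (almost_everywhere leb)) => s s0; split; [exact: state_L2|exact: state_orth].
Qed.

Lemma drift_orthproc i k : orthproc P future (fun t w => pos (drift A G B f u x i) t w k 0).
Proof.
have := orthprocD (futureL2 hW (N := N)) (orthproc_sum (futureL2 hW (N := N)) (index_enum I) (fun c => orthprocZ (futureL2 hW (N := N)) (F (i, k) c) (state_orthproc c.1 c.2))) (hv (i, k)).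
by rewrite -[X in orthproc _ _ X]/(b (i, k)) bE.
Qed.

Variable Z : I -> R -> T -> R.
Hypotheses (mZ : forall a, mproc (Z a))
  (Zito : forall (i : 'I_N) t, 0 <= t -> ito_integral P (W i) sg t (fun w => \col_k Z (i, k) t w)).

Lemma innov_ae a t : 0 <= t -> {ae P, forall w, innov a t w = Z a t w}.
Proof.
case: a => i k t0.
have := ito_unique hW hWindep csg k t0 (colZ_meas innov_meas i t) (innov_ito i t0) (colZ_meas mZ i t) (Zito i t0).
by apply: filterS => w; rewrite !mxE.
Qed.

(** [Z] may be any jointly measurable choice of the Ito integrals: by uniqueness the innovation of
    the state equals it almost surely at each time. Hence several states can share one [Z]. *)
Lemma state_vsemimart i : vsemimart P future Z (pos (x i)) (x0 i) (pos (drift A G B f u x i)) (noise_row i).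
Proof.
move=> k; split.
- exact: (mX (i, k)).
- exact: x0L2.
- exact: (x0_orth hW hWindep hx0 hx0W x0L2 i k (lexx 0)).
- exact: drift_orthproc.
move=> t t0; apply: filterS2 He (innov_ae (i, k) t0) => w /(_ (i, k) t t0) e1 e2.
by rewrite noise_noise_row -[LHS]/(X (i, k) t w) e1 /zt e2 bE /Dp addrAC.
Qed.
End drift_form.
End State.

(** * Lyapunov forms *)

Section Lyap.
Context {K : realType}.

Lemma fin_pos_lb n (g : 'I_n -> K) : (forall i, 0 < g i) -> exists2 a, 0 < a & forall i, a <= g i.
Proof.
move=> g0; have : exists2 a, 0 < a & forall i, i \in enum 'I_n -> a <= g i.
  elim: (enum _) => [|i s [a a0 H]]; first by exists 1.
  exists (Num.min a (g i)); first by rewrite lt_min a0 g0.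
  by move=> j; rewrite inE => /predU1P[->|/H h]; rewrite ge_min ?lexx ?orbT// h.
by case=> a a0 H; exists a => // i; rewrite H// mem_enum.
Qed.

Lemma ReD (x y : K[i]) : complex.Re (x + y) = complex.Re x + complex.Re y.
Proof. by case: x => ? ?; case: y. Qed.
Lemma ImD (x y : K[i]) : complex.Im (x + y) = complex.Im x + complex.Im y.
Proof. by case: x => ? ?; case: y. Qed.
Lemma ReM (x y : K[i]) : complex.Re (x * y) = complex.Re x * complex.Re y - complex.Im x * complex.Im y.
Proof. by case: x => ? ?; case: y. Qed.
Lemma ImM (x y : K[i]) : complex.Im (x * y) = complex.Re x * complex.Im y + complex.Im x * complex.Re y.
Proof. by case: x => ? ?; case: y. Qed.
Lemma Re_sum (J : Type) (r : seq J) (h : J -> K[i]) :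
  complex.Re (\sum_(j <- r) h j) = \sum_(j <- r) complex.Re (h j).
Proof. by elim: r => [|i r IH]; rewrite ?big_nil ?big_cons// ReD IH. Qed.
Lemma Im_sum (J : Type) (r : seq J) (h : J -> K[i]) :
  complex.Im (\sum_(j <- r) h j) = \sum_(j <- r) complex.Im (h j).
Proof. by elim: r => [|i r IH]; rewrite ?big_nil ?big_cons// ImD IH. Qed.

Notation cmx := (map_mx (real_complex K)).
Definition Rm m n (M : 'M[K[i]]_(m, n)) : 'M[K]_(m, n) := map_mx (@complex.Re K) M.
Definition Im m n (M : 'M[K[i]]_(m, n)) : 'M[K]_(m, n) := map_mx (@complex.Im K) M.

Lemma RmM m n p (M : 'M[K[i]]_(m, n)) (N : 'M[K[i]]_(n, p)) :
  Rm (M *m N) = Rm M *m Rm N - Im M *m Im N.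
Proof.
apply/matrixP => i j; rewrite !mxE Re_sum -sumrB; apply: eq_bigr => k _.
by rewrite !mxE ReM.
Qed.
Lemma ImM' m n p (M : 'M[K[i]]_(m, n)) (N : 'M[K[i]]_(n, p)) :
  Im (M *m N) = Rm M *m Im N + Im M *m Rm N.
Proof.
apply/matrixP => i j; rewrite !mxE Im_sum -big_split; apply: eq_bigr => k _.
by rewrite !mxE ImM.
Qed.
Lemma Rm_cmx m n (M : 'M[K]_(m, n)) : Rm (cmx M) = M.
Proof. by apply/matrixP => i j; rewrite !mxE. Qed.
Lemma Im_cmx m n (M : 'M[K]_(m, n)) : Im (cmx M) = 0.
Proof. by apply/matrixP => i j; rewrite !mxE. Qed.
Lemma RIm0 m n (M : 'M[K[i]]_(m, n)) : Rm M = 0 -> Im M = 0 -> M = 0.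
Proof.
move=> /matrixP h1 /matrixP h2; apply/matrixP => i j; move: (h1 i j) (h2 i j).
by rewrite !mxE; case: (M i j) => a b /= -> ->.
Qed.

(* In the Schur basis the cross terms are made small by the weights d^(2k). *)
Lemma hurwitz_lyap n (F : 'M[K]_n) : hurwitz F ->
  exists X c C, lyap_form F (0 : 'M[K]_n) X c C.
Proof.
move=> hF.
suff [X [c0 [pX c00 HX]]] : exists X c0, [/\ posdefmx X, 0 < c0 &
    forall z : 'cV[K]_n, 2 * dot z (X *m (F *m z)) <= - c0 * sqn z].
  by exists X; apply: lyap_form_input pX c00 _ => z; rewrite mul0mx sqn0 addr0.
have [n0|n0] := posnP n.
  move: F hF; rewrite n0 => F hF; exists 0, 1; split => //.
    by split; [exact: trmx0|move=> z; rewrite (flatmx0 z) eqxx].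
  by move=> z; rewrite (flatmx0 z) dot0l sqn0 !mulr0.
(* In the Schur basis the matrix becomes lower triangular with the eigenvalues of [F] on the
   diagonal. Its real and imaginary parts are then followed separately, so that the form [X] is
   real. *)
have [P Pu Ptrig0] := Schur (cmx F) n0.
have Punit := unitarymx_unit Pu.
pose S := P *m cmx F *m invmx P.
have PS : P *m cmx F = S *m P by rewrite /S -mulmxA mulVmx// mulmx1.
have tS : is_trig_mx S by move: Ptrig0; rewrite /similar_to /= mxred.conjumx.
have Sdiag k : complex.Re (S k k) < 0.
  have : eigenvalue S (S k k).
    rewrite eigenvalue_root_char char_poly_trig// /root horner_prod prodf_seq_eq0.
    by apply/hasP; exists k; [exact: mem_index_enum|rewrite /= !hornerE subrr].
  move=> /eigenvalueP[v hv v0]; apply: hF; apply/eigenvalueP; exists (v *m P).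
    by rewrite -mulmxA PS mulmxA hv -scalemxAl.
  by apply: contra_neq v0 => /(congr1 (mulmx^~ (invmx P))); rewrite mulmxK// mul0mx.
pose pr := Rm P; pose pi := Im P; pose sr := Rm S; pose si := Im S.
have er : pr *m F = sr *m pr - si *m pi.
  by rewrite -RmM -PS RmM Rm_cmx Im_cmx mulmx0 subr0.
have ei : pi *m F = sr *m pi + si *m pr.
  by rewrite -ImM' -PS ImM' Rm_cmx Im_cmx mulmx0 add0r.
have [al al0 Hal] := @fin_pos_lb n (fun k => - sr k k)
   (fun k => ltac:(by rewrite oppr_gt0 mxE)).
pose M := \sum_(k < n) \sum_(j < n) (`|sr k j| + `|si k j|).
have M0 : 0 <= M by apply: sumr_ge0 => k _; apply: sumr_ge0 => j _; rewrite addr_ge0.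
have HM k j : `|sr k j| + `|si k j| <= M.
  rewrite /M (bigD1 k)//= (bigD1 j)//= -addrA lerDl addr_ge0//.
    by apply: sumr_ge0 => ? _; rewrite addr_ge0.
  by apply: sumr_ge0 => ? _; apply: sumr_ge0 => ? _; rewrite addr_ge0.
(* The off-diagonal terms will add up to at most 2 n M dl times the form, and [dl] makes this at
   most half of the dissipation rate [al]. The summand 1 avoids a zero denominator, and [dl <= 1]
   makes the powers decrease. *)
pose dl := Num.min 1 (al / (2 * n%:R * M + 1) / 2).
have den0 : 0 < 2 * n%:R * M + 1 by rewrite ltr_wpDl// !mulr_ge0.
have dl0 : 0 < dl by rewrite lt_min ltr01/= !divr_gt0.
have dl1 : dl <= 1 by rewrite ge_min lexx.
have dlM : 2 * n%:R * M * dl <= al / 2.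
  have : dl <= al / (2 * n%:R * M + 1) / 2 by rewrite ge_min lexx orbT.
  rewrite -(ler_pM2l den0); have -> : (2 * n%:R * M + 1) * (al / (2 * n%:R * M + 1) / 2) = al / 2.
    by field; rewrite gt_eqF.
  by rewrite mulrDl mul1r => h; move: (ltW dl0) h; lra.
pose D : 'M[K]_n := diag_mx (\row_k (dl ^+ k) ^+ 2).
(* With this choice [qform X z] is the sum over k of dl^(2 k) times the squared modulus of the k-th
   coordinate of z in the Schur basis. *)
pose X := pr^T *m D *m pr + pi^T *m D *m pi.
have dotD (y z : 'cV[K]_n) : dot y (D *m z) = \sum_(k < n) (dl ^+ k) ^+ 2 * (y k 0 * z k 0).
  by apply: eq_bigr => k _; rewrite mul_diag_mx !mxE; ring.
have dotX (y z : 'cV[K]_n) : dot y (X *m z) = \sum_(k < n) (dl ^+ k) ^+ 2 *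
    ((pr *m y) k 0 * (pr *m z) k 0 + (pi *m y) k 0 * (pi *m z) k 0).
  rewrite mulmxDl dotDr -!mulmxA -(dot_adj pr) -(dot_adj pi) !dotD -big_split.
  by apply: eq_bigr => k _ /=; ring.
have sX : X^T = X by rewrite /X linearD/= !trmx_mul !trmxK tr_diag_mx !mulmxA.
pose q (z : 'cV[K]_n) k := (pr *m z) k 0 ^+ 2 + (pi *m z) k 0 ^+ 2.
have q0 z k : 0 <= q z k by rewrite addr_ge0 ?sqr_ge0.
have qX z : qform X z = \sum_(k < n) (dl ^+ k) ^+ 2 * q z k.
  by rewrite qformE dotX; apply: eq_bigr => k _; rewrite /q !expr2.
have pX : posdefmx X.
  split => // z z0; rewrite qX lt_def; apply/andP; split; last first.
    by apply: sumr_ge0 => k _; rewrite mulr_ge0 ?sqr_ge0.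
  apply: contra_neq z0 => /psumr_eq0P H.
  have {}H k : q z k = 0.
    have := H (fun k _ => mulr_ge0 (sqr_ge0 _) (q0 _ _)) k isT.
    by move/eqP; rewrite mulf_eq0 expf_eq0/= expf_eq0 (gt_eqF dl0) andbF/= => /eqP.
  have Hr : pr *m z = 0.
    apply/colP => k; rewrite [RHS]mxE; apply/eqP; rewrite -sqrf_eq0.
    by have := H k; rewrite /q => /eqP; rewrite paddr_eq0 ?sqr_ge0// => /andP[].
  have Hi : pi *m z = 0.
    apply/colP => k; rewrite [RHS]mxE; apply/eqP; rewrite -sqrf_eq0.
    by have := H k; rewrite /q => /eqP; rewrite paddr_eq0 ?sqr_ge0// => /andP[].
  have : P *m cmx z = 0.
    by apply: RIm0; rewrite ?RmM ?ImM' Rm_cmx Im_cmx mulmx0 ?subr0 ?add0r.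
  move=> /(congr1 (mulmx (invmx P))); rewrite mulmxA mulVmx// mul1mx mulmx0.
  by move=> /(congr1 (@Rm _ _)); rewrite Rm_cmx => ->; apply/matrixP => i j; rewrite !mxE.
have [c c0 Hc] := posdef_lb pX.
exists X, (al * c); split => //; first exact: mulr_gt0.
move=> z.
suff : dot z (X *m (F *m z)) <= - (al / 2) * qform X z.
  have := Hc z => h1 h2; have : al * (c * sqn z) <= al * qform X z by rewrite ler_wpM2l// ltW.
  lra.
pose a := pr *m z; pose b := pi *m z.
have ea k : (pr *m (F *m z)) k 0 = \sum_(j < n) (sr k j * a j 0 - si k j * b j 0).
  by rewrite mulmxA er mulmxBl -!mulmxA !mxE sumrB.
have eb k : (pi *m (F *m z)) k 0 = \sum_(j < n) (sr k j * b j 0 + si k j * a j 0).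
  by rewrite mulmxA ei mulmxDl -!mulmxA !mxE big_split.
rewrite dotX.
pose t (k j : 'I_n) : K := (dl ^+ k) ^+ 2 * (a k 0 * (sr k j * a j 0 - si k j * b j 0) +
   b k 0 * (sr k j * b j 0 + si k j * a j 0)).
have -> : \sum_(k < n) (dl ^+ k) ^+ 2 * ((pr *m z) k 0 * (pr *m (F *m z)) k 0 +
   (pi *m z) k 0 * (pi *m (F *m z)) k 0) = \sum_(k < n) \sum_(j < n) t k j.
  apply: eq_bigr => k _; rewrite ea eb !mulr_sumr -big_split/= mulr_sumr.
  by apply: eq_bigr.
pose Q (k : 'I_n) : K := (dl ^+ k) ^+ 2 * q z k.
have Q0 k : 0 <= Q k by rewrite mulr_ge0 ?sqr_ge0.
have tkk k : t k k <= - al * Q k.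
  have -> : t k k = sr k k * Q k by rewrite /t /Q /q -/a -/b; ring.
  by rewrite ler_wpM2r// lerNr.
have tkj (k j : 'I_n) : k != j -> t k j <= M * dl * (Q k + Q j).
  move=> kj; have [jk|] := ltnP j k; last first.
    rewrite leq_eqVlt => /predU1P[e|kj']; first by rewrite (val_inj e) eqxx in kj.
    have s0 : S k j = 0 by move/is_trig_mxP: tS => ->.
    have r0 : sr k j = 0 by rewrite /sr /Rm mxE s0.
    have i0 : si k j = 0 by rewrite /si /Im mxE s0.
    rewrite /t r0 i0 !mul0r subr0 addr0 !mulr0 addr0 mulr0.
    by rewrite !mulr_ge0// ?addr_ge0// ltW.
  pose x1 := dl ^+ k * `|a k 0|; pose x2 := dl ^+ k * `|b k 0|.
  pose y1 := dl ^+ j * `|a j 0|; pose y2 := dl ^+ j * `|b j 0|.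
  have dk0 (m : nat) : 0 <= dl ^+ m by rewrite exprn_ge0// ltW.
  have Qk : Q k = x1 ^+ 2 + x2 ^+ 2.
    by rewrite /Q /q /x1 /x2 !exprMn !real_normK ?num_real// -/a -/b; ring.
  have Qj : Q j = y1 ^+ 2 + y2 ^+ 2.
    by rewrite /Q /q /y1 /y2 !exprMn !real_normK ?num_real// -/a -/b; ring.
  (* An off-diagonal coefficient survives only for j < k, where the weight of row k supplies the
     small factor [dl]. *)
  have dkj : dl ^+ k <= dl * dl ^+ j.
    rewrite -exprS -(subnK jk) exprD ler_piMl//.
    by rewrite exprn_ile1// ltW.
  have hM := HM k j.
  have B1 : a k 0 * (sr k j * a j 0 - si k j * b j 0) + b k 0 * (sr k j * b j 0 + si k j * a j 0) <=
     M * ((`|a k 0| + `|b k 0|) * (`|a j 0| + `|b j 0|)).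
    have -> : a k 0 * (sr k j * a j 0 - si k j * b j 0) + b k 0 * (sr k j * b j 0 + si k j * a j 0) =
      sr k j * (a k 0 * a j 0 + b k 0 * b j 0) + si k j * (b k 0 * a j 0 - a k 0 * b j 0) by ring.
    have n1 : a k 0 * a j 0 + b k 0 * b j 0 <= `|a k 0 * a j 0 + b k 0 * b j 0| by exact: ler_norm.
    have n2 : `|a k 0 * a j 0 + b k 0 * b j 0| <= (`|a k 0| + `|b k 0|) * (`|a j 0| + `|b j 0|).
      apply: le_trans (ler_normD _ _) _; rewrite !normrM.
      have := normr_ge0 (a k 0); have := normr_ge0 (b k 0);
      have := normr_ge0 (a j 0); have := normr_ge0 (b j 0); nra.
    have n3 : `|b k 0 * a j 0 - a k 0 * b j 0| <= (`|a k 0| + `|b k 0|) * (`|a j 0| + `|b j 0|).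
      apply: le_trans (ler_normB _ _) _; rewrite !normrM.
      have := normr_ge0 (a k 0); have := normr_ge0 (b k 0);
      have := normr_ge0 (a j 0); have := normr_ge0 (b j 0); nra.
    set W := (_ + _) * (_ + _) in n2 n3 *.
    have W0 : 0 <= W by rewrite mulr_ge0// addr_ge0.
    apply: (@le_trans _ _ (`|sr k j| * W + `|si k j| * W)).
      apply: lerD; (apply: le_trans (ler_norm _) _; rewrite normrM ler_wpM2l//).
    by rewrite -mulrDl ler_wpM2r.
  rewrite /t; apply: (@le_trans _ _ (M * dl * ((x1 + x2) * (y1 + y2)))).
    apply: le_trans (ler_wpM2l (sqr_ge0 _) B1) _.
    rewrite expr2 /x1 /x2 /y1 /y2 -!mulrDr.
    set u := _ + `|b k 0|; set v := _ + `|b j 0|.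
    have u0 : 0 <= u by rewrite addr_ge0.
    have v0 : 0 <= v by rewrite addr_ge0.
    have -> : dl ^+ k * dl ^+ k * (M * (u * v)) = (M * u * v * dl ^+ k) * dl ^+ k by ring.
    have -> : M * dl * (dl ^+ k * u * (dl ^+ j * v)) = (M * u * v * dl ^+ k) * (dl * dl ^+ j) by ring.
    by rewrite ler_wpM2l// !mulr_ge0.
  rewrite ler_wpM2l ?mulr_ge0 ?(ltW dl0)// Qk Qj.
  have := sqr_ge0 (x1 - y1); have := sqr_ge0 (x1 - y2); have := sqr_ge0 (x2 - y1); have := sqr_ge0 (x2 - y2).
  rewrite !expr2; nra.
have Md0 : 0 <= M * dl by rewrite mulr_ge0// ltW.
have step k : \sum_(j < n) t k j <= - al * Q k + \sum_(j < n) (M * dl * (Q k + Q j)).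
  rewrite (bigD1 k)//= lerD ?tkk// [X in _ <= X](bigD1 k)//= ler_wpDl ?mulr_ge0 ?addr_ge0 ?(ltW dl0)//.
  by apply: ler_sum => j jk; apply: tkj; rewrite eq_sym.
apply: le_trans (ler_sum _ (fun k _ => step k)) _.
rewrite big_split/= -mulr_sumr qX -/(Q _).
have -> : \sum_(i < n) \sum_(j < n) M * dl * (Q i + Q j) = 2 * n%:R * M * dl * \sum_(i < n) Q i.
  have -> : \sum_(i < n) \sum_(j < n) M * dl * (Q i + Q j) =
     \sum_(i < n) (M * dl) * (n%:R * Q i + \sum_(j < n) Q j).
    apply: eq_bigr => i _; rewrite -mulr_sumr big_split/= sumr_const card_ord mulr_natl.
    by [].
  rewrite -mulr_sumr big_split/= -mulr_sumr sumr_const card_ord -mulr_natl; ring.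
have SQ : 0 <= \sum_(i < n) Q i by apply: sumr_ge0.
have : 2 * n%:R * M * dl * \sum_(i < n) Q i <= al / 2 * \sum_(i < n) Q i by rewrite ler_wpM2r.
rewrite -/(Q _); lra.
Qed.

Lemma mxtrace_qform n m (N : 'M[K]_n) (X : 'M[K]_(n, m)) :
  \tr (X^T *m N *m X) = \sum_(j < m) qform N (col j X).
Proof.
apply: eq_bigr => j _; rewrite /qform tr_col -row_mul !mxE.
by apply: eq_bigr => k _; rewrite !mxE.
Qed.

Lemma mxtrace_sqr_eq0 n (X : 'M[K]_n) : \sum_(j < n) sqn (col j X) = 0 -> X = 0.
Proof.
move=> /psumr_eq0P H; apply/matrixP => i j.
have /sqn_eq0/colP/(_ i) := H (fun j _ => sqn_ge0 _) j isT.
by rewrite !mxE.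
Qed.

Lemma qform_tr n (N : 'M[K]_n) z : qform N^T z = qform N z.
Proof. by rewrite !qformE -dot_adj dotC. Qed.

Definition lyop n (F X : 'M[K]_n) := F^T *m X + X *m F.

(* Taking the trace against X shows that the Lyapunov operator of a coercive F is injective. *)
Lemma lyop_inj n (F X : 'M[K]_n) : (forall z, sqn z <= qform F z) ->
  lyop F X = 0 -> X = 0.
Proof.
move=> hF h0; apply: mxtrace_sqr_eq0; apply/eqP; rewrite eq_le; apply/andP; split; last first.
  by apply: sumr_ge0 => j _; exact: sqn_ge0.
have : \tr (X^T *m lyop F X) = 0 by rewrite h0 mulmx0 mxtrace0.
rewrite /lyop mulmxDr mxtraceD mulmxA mxtrace_qform.
rewrite mxtrace_mulC -mulmxA (_ : F *m X^T = F *m X^T)// -[X in X *m (F *m _)]trmxK mulmxA.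
rewrite mxtrace_qform => h.
have h1 : \sum_(j < n) sqn (col j X) <= \sum_(j < n) qform F^T (col j X).
  by apply: ler_sum => j _; rewrite qform_tr.
have h2 : 0 <= \sum_(j < n) qform F (col j X^T).
  by apply: sumr_ge0 => j _; apply: le_trans (hF _); exact: sqn_ge0.
lra.
Qed.

(** Written as a square matrix acting on vectorized matrices, the injective operator [lyop F] is
    invertible. *)
Lemma lyop_surj n (F Y : 'M[K]_n) : (forall z, sqn z <= qform F z) ->
  exists X, lyop F X = Y.
Proof.
move=> hF.
pose M := lin_mx (mulmx F^T) + lin_mx (mulmxr F) : 'M[K]_(n * n).
have ME X : mxvec X *m M = mxvec (lyop F X).
  by rewrite mulmxDr !mul_vec_lin -linearD.
have Mu : M \in unitmx.
  rewrite -row_free_unit; apply: inj_row_free => v; rewrite -[v]vec_mxK ME => /eqP.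
  rewrite mxvec_eq0 => /eqP/(lyop_inj hF) ->; exact: linear0.
exists (vec_mx (mxvec Y *m invmx M)); apply: (can_inj mxvecK).
by rewrite -ME vec_mxK mulmxKV.
Qed.

Lemma is_derive_mx m n (M : K -> 'M[K]_(m, n)) (t : K) (D : 'M[K]_(m, n)) :
  (forall i j, is_derive t 1 (fun x => M x i j) (D i j)) -> is_derive t 1 M D.
Proof.
move=> H; have dM : derivable M t 1 by apply/derivable_mxP => i j; case: (H i j).
split => //; rewrite derive_mx//; apply/matrixP => i j; rewrite mxE.
exact: (@derive_val _ _ _ _ _ _ _ (H i j)).
Qed.

(* A complex eigenvector in the kernel of H yields solutions with zero output. *)
Lemma observable_pbh n p (F : 'M[K]_n) (H : 'M[K]_(p, n)) (al be : K) (x y : 'cV[K]_n) :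
  observable F H -> F *m x = al *: x - be *: y -> F *m y = al *: y + be *: x ->
  H *m x = 0 -> H *m y = 0 -> x = 0 /\ y = 0.
Proof.
move=> [T T0 obs] ex ey Hx Hy.
pose e t := expR (al * t); pose c t := cos (be * t); pose s t := sin (be * t).
have de (t : K) : is_derive t 1 e (al * e t).
  by apply: is_derive_eq; rewrite /GRing.scale/= mulr1 mulrC.
have dc (t : K) : is_derive t 1 c (- be * s t).
  by apply: is_derive_eq; rewrite /GRing.scale/= mulr1; rewrite /s; ring.
have ds (t : K) : is_derive t 1 s (be * c t).
  by apply: is_derive_eq; rewrite /GRing.scale/= mulr1 mulrC.
have d0 (t : K) : is_derive t 1 (fun _ : K => 0 : 'cV[K]_n) (F *m 0).
  by rewrite mulmx0; exact: is_derive_cst.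
(* [z1] and [z2] are the real and imaginary parts of e^((al + i be) t) (x + i y), where x + i y is
   an eigenvector of [F] for al + i be. *)
pose z1 t := (e t * c t) *: x - (e t * s t) *: y.
pose z2 t := (e t * s t) *: x + (e t * c t) *: y.
have dz1 (t : K) : is_derive t 1 z1 (F *m z1 t).
  apply: is_derive_mx => i j.
  have -> : (F *m z1 t) i j = (al * e t * c t + e t * (- be * s t)) * x i j
     - (al * e t * s t + e t * (be * c t)) * y i j.
    by rewrite mulmxBr -!scalemxAr ex ey !mxE; ring.
  have -> : (fun x0 : K => z1 x0 i j) = fun u => (e u * c u) * x i j - (e u * s u) * y i j.
    by apply/funext => u; rewrite !mxE.
  have := de t; have := dc t; have := ds t => h1 h2 h3.
  by apply: is_derive_eq; rewrite /GRing.scale/=; ring.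
have dz2 (t : K) : is_derive t 1 z2 (F *m z2 t).
  apply: is_derive_mx => i j.
  have -> : (F *m z2 t) i j = (al * e t * s t + e t * (be * c t)) * x i j
     + (al * e t * c t + e t * (- be * s t)) * y i j.
    by rewrite mulmxDr -!scalemxAr ex ey !mxE; ring.
  have -> : (fun x0 : K => z2 x0 i j) = fun u => (e u * s u) * x i j + (e u * c u) * y i j.
    by apply/funext => u; rewrite !mxE.
  have := de t; have := dc t; have := ds t => h1 h2 h3.
  by apply: is_derive_eq; rewrite /GRing.scale/=; ring.
have e0 : e 0 = 1 by rewrite /e mulr0 expR0.
have c0 : c 0 = 1 by rewrite /c mulr0 cos0.
have s0 : s 0 = 0 by rewrite /s mulr0 sin0.
have := obs z1 (fun=> 0) dz1 d0; rewrite /z1 e0 c0 s0 !mulr1 mulr0 scale1r scale0r subr0 => -> //.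
  split => //; have := obs z2 (fun=> 0) dz2 d0.
  rewrite /z2 e0 c0 s0 !mulr1 mulr0 scale1r scale0r add0r; apply => t _.
  by rewrite mulmxDr -!scalemxAr Hx Hy !scaler0 addr0 mulmx0.
by move=> t _; rewrite mulmxBr -!scalemxAr Hx Hy !scaler0 subr0 mulmx0.
Qed.
End Lyap.

(** * Lyapunov forms from observability *)

Section Obs.
Context {K : realType}.
Notation cmx := (map_mx (real_complex K)).

Lemma col_mulmx m n q (M : 'M[K]_(m, n)) (N : 'M[K]_(n, q)) j : col j (M *m N) = M *m col j N.
Proof. by rewrite !colE mulmxA. Qed.

Lemma col_eq0 m n (M : 'M[K]_(m, n)) : (forall j, col j M = 0) -> M = 0.
Proof. by move=> h; apply/matrixP => i j; have /colP/(_ i) := h j; rewrite !mxE. Qed.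

(** By the equation, the kernel of [X] lies in that of [H] and is stable under [F]. If it were
    nonzero, it would yield a complex eigenvector of [F] with zero output, contrary to
    [observable_pbh]. *)
Lemma lyop_ker n p (F : 'M[K]_n) (H : 'M[K]_(p, n)) (X : 'M[K]_n) (lam : K) :
  observable F H -> X^T = X -> lyop (F + lam%:M) X = H^T *m H ->
  forall z : 'cV[K]_n, X *m z = 0 -> z = 0.
Proof.
move=> obs sX eX y Xy; apply: contrapT => y0.
pose F2 := F + lam%:M.
have k1 (z : 'cV[K]_n) : X *m z = 0 -> H *m z = 0 /\ X *m (F *m z) = 0.
  move=> Xz.
  have h : X *m (F2 *m z) = H^T *m (H *m z).
    by rewrite [RHS]mulmxA -eX /lyop mulmxDl -!mulmxA Xz mulmx0 add0r.
  have Hz : H *m z = 0.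
    by apply: sqn_eq0; rewrite sqnE dot_adj -h -{1}sX -dot_adj Xz dot0l.
  split => //; move: h; rewrite Hz mulmx0 mulmxDl mulmxDr mul_scalar_mx -scalemxAr Xz.
  by rewrite scaler0 addr0.
pose V := row_base (kermx X).
have VX : V *m X = 0 by apply/sub_kermxP; rewrite eq_row_base.
have XV : X *m V^T = 0 by have := congr1 trmx VX; rewrite trmx_mul sX trmx0.
have colV j : X *m col j V^T = 0 by rewrite -col_mulmx XV; apply/colP => i; rewrite !mxE.
have HV : H *m V^T = 0 by apply: col_eq0 => j; rewrite col_mulmx; case: (k1 _ (colV j)).
have XFV : X *m (F *m V^T) = 0.
  by apply: col_eq0 => j; rewrite !col_mulmx; case: (k1 _ (colV j)).
(* [M] is the matrix of [F] on the kernel of [X], in the row basis [V]; a complex eigenvector of [M]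
   is lifted back through [V]. *)
have [M eM] : exists M, V *m F^T = M *m V.
  apply/submxP; rewrite eq_row_base; apply/sub_kermxP.
  apply: trmx_inj; rewrite trmx_mul trmx_mul trmxK sX trmx0; exact: XFV.
have k0 : (0 < \rank (kermx X))%N.
  rewrite lt0n mxrank_eq0; apply: contra_notN y0 => /eqP kX.
  have /sub_kermxP : y^T *m X = 0 by have := congr1 trmx Xy; rewrite trmx_mul sX trmx0.
  by rewrite kX submx0 => /eqP /(congr1 trmx); rewrite trmxK trmx0.
have [a /eigenvalueP[v va v0]] := eigenvalue_closed (cmx M) k0.
pose u := v *m cmx V.
have uF : u *m cmx F^T = a *: u.
  by rewrite /u -mulmxA -map_mxM eM map_mxM mulmxA va scalemxAl.
have uH : u *m cmx H^T = 0.
  by rewrite /u -mulmxA -map_mxM -[V]trmxK -trmx_mul HV trmx0 map_mx0 mulmx0.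
have RF := congr1 (@Rm K _ _) uF; have IF := congr1 (@Im K _ _) uF.
have RH := congr1 (@Rm K _ _) uH; have IH := congr1 (@Im K _ _) uH.
rewrite RmM Rm_cmx Im_cmx mulmx0 subr0 in RF; rewrite ImM' Rm_cmx Im_cmx mulmx0 add0r in IF.
rewrite RmM Rm_cmx Im_cmx mulmx0 subr0 in RH; rewrite ImM' Rm_cmx Im_cmx mulmx0 add0r in IH.
have [] := @observable_pbh K n p F H (complex.Re a) (complex.Im a) (Rm u)^T (Im u)^T obs.
- by apply: trmx_inj; rewrite trmx_mul trmxK RF; apply/matrixP => i j; rewrite !mxE ReM.
- apply: trmx_inj; rewrite trmx_mul trmxK IF; apply/matrixP => i j; rewrite !mxE ImM; ring.
- by apply: trmx_inj; rewrite trmx_mul trmxK RH; apply/matrixP => i j; rewrite !mxE.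
- by apply: trmx_inj; rewrite trmx_mul trmxK IH; apply/matrixP => i j; rewrite !mxE.
move=> /(congr1 trmx) + /(congr1 trmx); rewrite !trmxK !trmx0 => Ru Iu.
have u0 := RIm0 Ru Iu.
have /row_freeP[V' VV'] := row_base_free (kermx X).
move/eqP: v0; apply; have := congr1 (mulmx^~ (cmx V')) u0.
by rewrite /u -mulmxA -map_mxM VV' map_mx1 mulmx1 mul0mx.
Qed.

(** Solve the Lyapunov equation of F + lam I with right-hand side H^T H. Removing the shift moves -
    2 lam X to the right, which is the dissipation, at the price of the output term. Symmetry of X
    follows from uniqueness, and definiteness from observability. *)
Lemma observable_lyap n p (F : 'M[K]_n) (H : 'M[K]_(p, n)) : observable F H ->
  exists X c C, lyap_form F H X c C.
Proof.
move=> obs.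
suff [X [c0 [pX c00 HX]]] : exists X c0, [/\ posdefmx X, 0 < c0 &
    forall z : 'cV[K]_n, 2 * dot z (X *m (F *m z)) <= - c0 * sqn z + sqn (H *m z)].
  by exists X; exact: lyap_form_input pX c00 HX.
have [Cb Cb0 HCb] := form_bound F.
(* The form <z, F z> is at most 2 Cb |z|^2 in absolute value, so this shift makes F + lam I coercive
   with constant 1. *)
pose lam := 2 * Cb + 1; have lam0 : 0 < lam by rewrite ltr_wpDl// mulr_ge0.
have hF2 (z : 'cV[K]_n) : sqn z <= qform (F + lam%:M) z.
  rewrite qformE mulmxDl dotDr mul_scalar_mx dotZr -sqnE.
  by have := HCb z z; rewrite ler_norml /lam => /andP[h _]; lra.
have [X eX] := lyop_surj (H^T *m H) hF2.
have sX : X^T = X.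
  apply/eqP; rewrite -subr_eq0; apply/eqP; apply: (lyop_inj hF2).
  have eXt : lyop (F + lam%:M) X^T = H^T *m H.
    have := congr1 trmx eX; rewrite /lyop linearD/= !trmx_mul !trmxK => <-.
    by rewrite addrC.
  by move: eX eXt; rewrite /lyop mulmxBr mulmxBl => e1 e2; rewrite addrACA -opprD e1 e2 subrr.
have key (z : 'cV[K]_n) : 2 * dot z (X *m ((F + lam%:M) *m z)) = sqn (H *m z).
  rewrite sqnE dot_adj [H^T *m (H *m z)]mulmxA -eX /lyop mulmxDl dotDr -!mulmxA.
  by rewrite -(dot_adj (F + lam%:M)) [dot (_ *m z) (X *m z)]dotC (dot_adj X) sX; ring.
have kX := lyop_ker obs sX eX.
(* A minimizer z of the form on the unit sphere is an eigenvector, X z = mu z, by [psd_ker] applied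
   to X - mu I. The equation then reads 2 mu <z, (F + lam I) z> = |H z|^2, and coercivity gives mu
   >= 0. *)
have psd (y : 'cV[K]_n) : 0 <= qform X y.
  have [n0|n0] := posnP n; first by rewrite qformE; apply: sumr_ge0 => i _; exfalso; case: i => m; rewrite n0.
  have [z z1 Hmin] := qform_min X n0; set mu := qform X z in Hmin.
  have XZ : X *m z = mu *: z.
    apply/eqP; rewrite -subr_eq0 -mul_scalar_mx -mulmxBl; apply/eqP; apply: psd_ker.
    - by rewrite linearB/= sX tr_scalar_mx.
    - move=> w; rewrite qformE mulmxBl dotBr mul_scalar_mx dotZr -sqnE -qformE subr_ge0; exact: Hmin.
    - by rewrite qformE mulmxBl dotBr mul_scalar_mx dotZr -sqnE -qformE z1 mulr1 subrr.
  have mu0 : 0 <= mu.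
    have := key z; rewrite -{1}sX -dot_adj XZ dotZl -qformE => h.
    have h1 : 0 < qform (F + lam%:M) z by apply: lt_le_trans (hF2 z); rewrite z1.
    have := sqn_ge0 (H *m z); rewrite -h mulrA pmulr_lge0//; lra.
  by apply: le_trans (Hmin y); rewrite mulr_ge0// sqn_ge0.
have pX : posdefmx X.
  split => // z z0; rewrite lt_def psd andbT; apply: contra_neq z0 => h; apply: kX.
  exact: psd_ker.
have [c c0 Hc] := posdef_lb pX.
exists X, (2 * lam * c); split => //; first by rewrite !mulr_gt0.
move=> z; have := key z; rewrite mulmxDl mulmxDr dotDr mul_scalar_mx -scalemxAr dotZr -qformE => h.
have : lam * (c * sqn z) <= lam * qform X z by rewrite ler_wpM2l// ltW.
move: h; move: (dot z _) => u h h2; lra.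
Qed.
End Obs.

(** * The pointwise cost identity *)

Section LinAlg.
Context {K : realType}.

Lemma posdef_unit n (M : 'M[K]_n) : posdefmx M -> M \in unitmx.
Proof.
move=> [Ms Mp]; rewrite unitmxE unitfE; apply/negP => /det0P[v v0 vM].
have vT : v^T != 0 by apply: contraNneq v0 => h; rewrite -[v]trmxK h trmx0.
have := Mp _ vT; rewrite /qform trmxK vM mul0mx mxE ltxx//.
Qed.

Lemma invmx_sym n (M : 'M[K]_n) : M^T = M -> (invmx M)^T = invmx M.
Proof. by move=> h; rewrite trmx_inv h. Qed.

Definition mean n N (y : 'I_N -> 'cV[K]_n) : 'cV[K]_n := N%:R^-1 *: \sum_(j < N) y j.

Lemma meanE n N (y : 'I_N -> 'cV[K]_n) : (0 < N)%N -> \sum_(j < N) y j = N%:R *: mean y.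
Proof. by move=> N0; rewrite /mean scalerA divff ?scale1r// pnatr_eq0 -lt0n. Qed.

Lemma mean_mul n m N (M : 'M[K]_(m, n)) (y : 'I_N -> 'cV[K]_n) : mean (fun i => M *m y i) = M *m mean y.
Proof. by rewrite /mean -scalemxAr mulmx_sumr. Qed.

Lemma meanB n N (y z : 'I_N -> 'cV[K]_n) : mean (fun i => y i - z i) = mean y - mean z.
Proof. by rewrite /mean -scalerBr sumrB. Qed.

Lemma mean_cst n N (c : 'cV[K]_n) : (0 < N)%N -> mean (fun _ : 'I_N => c) = c.
Proof.
by move=> N0; rewrite /mean sumr_const card_ord -[c *+ N]scaler_nat scalerA mulVf ?scale1r// pnatr_eq0 -lt0n.
Qed.

(** Nonnegativity of the sum of squared deviations from the mean. *)
Lemma sqn_mean n N (y : 'I_N -> 'cV[K]_n) : (0 < N)%N -> N%:R * sqn (mean y) <= \sum_(i < N) sqn (y i).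
Proof.
move=> N0; have : 0 <= \sum_(i < N) sqn (y i - mean y) by apply: sumr_ge0 => i _; exact: sqn_ge0.
under eq_bigr do rewrite sqnE dotBl !dotBr -!sqnE.
rewrite !sumrB -dot_suml -dot_sumr meanE// dotZl dotZr -sqnE sumr_const card_ord -mulr_natl.
by move: (sqn _) (\sum_(i < N) _) => a b; lra.
Qed.

Lemma qformDl n (M : 'M[K]_n) y z : M^T = M -> qform M (y + z) = qform M y + 2 * dot (M *m y) z + qform M z.
Proof.
move=> Ms; rewrite !qformE mulmxDr dotDl !dotDr (dotC y (M *m z)) dot_adj Ms.
by rewrite (dotC z (M *m y)); ring.
Qed.

Variables (n r : nat) (rho : K) (A G Gam Q : 'M[K]_n) (B : 'M[K]_(n, r)) (Rm : 'M[K]_r) (eta : 'cV[K]_n)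
  (P Pi sQ : 'M[K]_n).
Hypotheses (rho0 : 0 < rho) (hR : posdefmx Rm) (Qs : Q^T = Q) (hsQ : is_sqrtmx Q sQ)
  (hP : posdefmx P) (hPric : riccati rho A B Rm Q P) (hPi : posdefmx Pi)
  (hPiric : riccati rho (A + G) B Rm ((1%:M - Gam)^T *m Q *m (1%:M - Gam)) Pi).

Definition BRB := B *m invmx Rm *m B^T.
Definition Qhat := (1%:M - Gam)^T *m Q *m (1%:M - Gam).
Definition etabar := Q *m eta - Gam^T *m Q *m eta.

Lemma qform_sQ z : qform Q z = sqn (sQ *m z).
Proof. by case: hsQ => -[ss _] <-; rewrite qformE sqnE dot_adj ss mulmxA. Qed.

Lemma BRB_sym : BRB^T = BRB.
Proof. by rewrite /BRB !trmx_mul trmxK invmx_sym ?mulmxA//; case: hR. Qed.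

(** Seen from the open loop, the feedback is an input B w. By the Riccati equation the form of [P]
    decays along the closed loop exactly by |sQ z|^2 + <w, R w>, so a multiple of [P] added to the
    open-loop form absorbs both its output and its input terms. *)
Lemma closed_lyap : observable (A - (rho / 2)%:M) sQ ->
  exists X c C, lyap_form (A - BRB *m P - (rho / 2)%:M) (0 : 'M[K]_n) X c C.
Proof.
move=> /observable_lyap[X1 [c1 [C1 [[X1s X1p] c10 C10 H1]]]].
have [cR cR0 hcR] := posdef_lb hR; have [CB CB0 hCB] := mx_bound B.
have [Ps Pp] := hP.
have P0 z : 0 <= qform P z by have [->|/Pp/ltW//] := eqVneq z 0; rewrite qform0.
(* The first summand pays for the output, the second for |B w|^2, which is at most CB / cR times <w,
   R w>. *)
pose k := C1 + C1 * (CB / cR).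
have k0 : 0 <= k by rewrite /k addr_ge0// mulr_ge0// divr_ge0// ltW.
have XX : posdefmx (X1 + k *: P).
  split; first by rewrite linearD linearZ /= X1s Ps.
  move=> z z0; rewrite qformE mulmxDl dotDr -scalemxAl dotZr -!qformE.
  by rewrite ltr_wpDr// ?mulr_ge0// X1p.
exists (X1 + k *: P); apply: (@lyap_form_input _ _ _ (A - BRB *m P - (rho/2)%:M) (0 : 'M[K]_n) (X1 + k *: P) c1) => // z.
rewrite mul0mx sqn0 addr0.
pose w := invmx Rm *m (B^T *m (P *m z)).
have eS : BRB *m (P *m z) = B *m w by rewrite /BRB /w !mulmxA.
have qw : dot z (P *m (BRB *m (P *m z))) = qform Rm w.
  have eR : Rm *m w = B^T *m (P *m z) by rewrite /w !mulmxA mulmxV ?posdef_unit// mul1mx.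
  by rewrite eS qformE eR -dot_adj dotC dot_adj Ps.
have hB := hCB w; have hRw := hcR w.
have eF : (A - BRB *m P - (rho / 2)%:M) *m z = (A - (rho / 2)%:M) *m z + (- (BRB *m (P *m z))).
  by rewrite !mulmxBl -!mulmxA addrAC.
have pA : dot z (P *m (A *m z)) = dot z (A^T *m (P *m z)).
  by rewrite -{1}Ps -dot_adj dotC dot_adj.
have pric : rho * dot z (P *m z) = 2 * dot z (P *m (A *m z)) - dot z (P *m (BRB *m (P *m z))) + sqn (sQ *m z).
  have := congr1 (fun M => dot z (M *m z)) hPric.
  rewrite /= -qform_sQ qformE -scalemxAl dotZr => ->.
  rewrite !mulmxDl mulNmx !dotDr dotNr /BRB -!mulmxA -pA; ring.
have h1 := H1 z (- (BRB *m (P *m z))); rewrite sqnN eS in h1.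
rewrite eF mulmxDl dotDr -scalemxAl dotZr.
have -> : dot z (P *m ((A - (rho / 2)%:M) *m z + - (BRB *m (P *m z)))) =
    dot z (P *m (A *m z)) - rho / 2 * dot z (P *m z) - dot z (P *m (BRB *m (P *m z))).
  by rewrite mulmxDr mulmxBl mulmxBr mulmxN !dotDr !dotNr mul_scalar_mx -scalemxAr dotZr.
rewrite eS in qw pric *; rewrite qw in pric *.
have hS : sqn (B *m w) <= CB / cR * qform Rm w.
  apply: le_trans hB _; rewrite -mulrA ler_wpM2l// ler_pdivlMl//.
have q0 : 0 <= qform Rm w.
  by apply: le_trans hRw; rewrite mulr_ge0 ?sqn_ge0// ltW.
have s0 := sqn_ge0 (sQ *m z).
have c2 : 0 <= C1 * (CB / cR) by rewrite mulr_ge0// divr_ge0// ltW.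
have h2 : C1 * sqn (B *m w) <= C1 * (CB / cR) * qform Rm w by rewrite -mulrA ler_wpM2l.
have h3 : 0 <= C1 * qform Rm w by rewrite mulr_ge0.
have h4 : 0 <= C1 * (CB / cR) * sqn (sQ *m z) by rewrite mulr_ge0.
rewrite mulrDr; apply: le_trans (lerD h1 (lexx _)) _.
have -> : 2 * (k * (dot z (P *m (A *m z)) - rho / 2 * dot z (P *m z) - qform Rm w)) =
   - k * (sqn (sQ *m z) + qform Rm w).
  move: pric; move: (dot z _) (dot z _) => a b ab; rewrite !mulrBr.
  have -> : rho / 2 * b = (rho * b) / 2 by ring.
  by rewrite ab; field.
rewrite /k; move: h2 h3 h4; move: (C1 * (CB / cR)) => c3; move: (sqn (sQ *m z)) (qform _ _) (sqn (B *m w)) (sqn z) => a b c e.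
lra.
Qed.

Section pointwise.
Variables (N : nat) (xh x : 'I_N -> 'cV[K]_n) (u : 'I_N -> 'cV[K]_r) (xb s : 'cV[K]_n).
Hypothesis N0 : (0 < N)%N.

Definition adjoint i := P *m xh i + (Pi - P) *m xb + s.
Definition feedback i := - (invmx Rm *m B^T *m adjoint i).
Definition mean_dev := mean xh - xb.
(** The drift of the adjoint state minus [rho] times that state, see [adjoint_drift]; the subtracted
    term cancels the derivative of the discount factor. *)
Definition adjoint_rate i := - (A^T *m adjoint i) - Q *m (xh i - xb) - Qhat *m xb + P *m (G *m mean_dev)
   - G^T *m (Pi *m xb + s) + etabar.
Definition run_cost (y : 'I_N -> 'cV[K]_n) (v : 'I_N -> 'cV[K]_r) i :=
  qform Q (y i - Gam *m mean y - eta) + qform Rm (v i).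
(** Up to the factor e^(-rho t), the drift part of the derivative of e^(-rho t) <p_i, del_i>. *)
Definition cross_rate i := dot (adjoint_rate i) (x i - xh i) +
  dot (adjoint i) (A *m (x i - xh i) + B *m (u i - feedback i) + G *m (mean x - mean xh)).

(** The Riccati equation of [P] is used on [xh i - xb], that of [Pi] on [xb]. *)
Lemma adjoint_drift i (dxb dxh f ds : 'cV[K]_n) :
  dxh = A *m xh i + B *m feedback i + G *m mean xh + f ->
  dxb = (A + G) *m xb - BRB *m (Pi *m xb + s) + f ->
  ds = rho *: s - (A + G - BRB *m Pi)^T *m s - Pi *m f + etabar ->
  P *m dxh + (Pi - P) *m dxb + ds = rho *: adjoint i + adjoint_rate i.
Proof.
move=> -> -> ->.
have eB : B *m feedback i = - (BRB *m adjoint i) by rewrite /feedback mulmxN /BRB !mulmxA.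
have [Pis _] := hPi.
have eAG : (A + G)^T = A^T + G^T by rewrite linearD.
rewrite eB linearB /= trmx_mul Pis BRB_sym.
have e1 := congr1 (fun M => M *m (xh i - xb)) hPric.
have e2 := congr1 (fun M => M *m xb) hPiric.
move: e1 e2; rewrite /= -/Qhat.
have -> : P *m B *m invmx Rm *m B^T *m P = P *m (BRB *m P) by rewrite /BRB !mulmxA.
have -> : Pi *m B *m invmx Rm *m B^T *m Pi = Pi *m (BRB *m Pi) by rewrite /BRB !mulmxA.
rewrite /adjoint_rate /adjoint /mean_dev eAG.
move: (BRB) (Qhat) (A^T) (G^T) => S QQ At Gt.
rewrite !(mulmxDl, mulmxDr, mulmxBl, mulmxBr, mulmxN, mulNmx, scalerDr, scalerBr, scalerN) -!scalemxAl -!mulmxA.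
(* After full expansion every matrix product is an opaque vector, and the claim is a linear
   consequence of the two Riccati identities, entry by entry. *)
move: (etabar) => ee; repeat match goal with |- context [mulmx ?a ?b] => move: (mulmx a b) => ? end.
move=> e1 e2; apply/matrixP => k j; move: (congr1 (fun M : 'cV[K]_n => M k j) e1) (congr1 (fun M : 'cV[K]_n => M k j) e2).
rewrite !mxE; lra.
Qed.

(* The coupling that remains because [p_i] solves the adjoint equation with the mean field
   [xbar] in place of the empirical mean. *)
Definition gap_mx := Qhat - Q + P *m G + G^T *m P.

Lemma mean_adjoint : mean adjoint = P *m mean_dev + Pi *m xb + s.
Proof.
rewrite /mean_dev mulmxBr.
have -> : mean adjoint = mean (fun i => P *m xh i - - ((Pi - P) *m xb + s)).
  by congr mean; apply/funext => i; rewrite /adjoint opprK addrA.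
rewrite meanB mean_mul mean_cst// opprK mulmxBl !addrA.
by congr (_ + s); rewrite addrAC.
Qed.

(** An exact second-order expansion around the closed loop. The feedback cancels the first-order
    terms in the control, and the adjoint equation makes the coefficient of each del_i independent
    of i, so that the remaining first-order terms see only the mean of the del_i. *)
Lemma cost_gap : \sum_(i < N) (run_cost x u i - run_cost xh feedback i) + 2 * \sum_(i < N) cross_rate i =
  \sum_(i < N) (qform Q (x i - xh i - Gam *m (mean x - mean xh)) + qform Rm (u i - feedback i))
  + 2 * (N%:R * dot (gap_mx *m mean_dev) (mean x - mean xh)).
Proof.
pose del i := x i - xh i; pose dm := mean x - mean xh; pose du i := u i - feedback i.
pose xi i := xh i - Gam *m mean xh - eta.
have [Rs _] := hR; have [Ps _] := hP.
have xiE i : x i - Gam *m mean x - eta = xi i + (del i - Gam *m dm).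
  rewrite /xi /del /dm mulmxBr; move: (x i) (xh i) (Gam *m mean x) (Gam *m _) => a b c e.
  by apply/matrixP => k l; rewrite !mxE; ring.
have uE i : u i = feedback i + du i by rewrite /du addrC subrK.
have dR i : dot (Rm *m feedback i) (du i) = - dot (adjoint i) (B *m du i).
  rewrite /feedback mulmxN -!mulmxA (mulmxA Rm) mulmxV ?posdef_unit// mul1mx dotNl.
  by rewrite dot_adj trmxK.
have step i : run_cost x u i - run_cost xh feedback i =
    qform Q (del i - Gam *m dm) + qform Rm (du i)
    + 2 * (dot (Q *m xi i) (del i) - dot (Gam^T *m (Q *m xi i)) dm - dot (adjoint i) (B *m du i)).
  rewrite /run_cost xiE -/(xi i) {1}uE !qformDl// dR dotBr.
  rewrite (dot_adj Gam^T) trmxK; ring.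
(* The coefficient of del_i common to all agents: Q xh_i from the cost cancels against the same term
   in the adjoint rate. *)
pose c := Q *m (xb - Gam *m mean xh - eta) - Qhat *m xb + P *m (G *m mean_dev) - G^T *m (Pi *m xb + s) + etabar.
have cE i : Q *m xi i + (adjoint_rate i + A^T *m adjoint i) = c.
  rewrite /adjoint_rate /c /xi !mulmxBr.
  repeat match goal with |- context [mulmx ?a ?b] => move: (mulmx a b) => ? end; move: (etabar) => ?.
  by apply/matrixP => k l; rewrite !mxE; ring.
have cr i : cross_rate i = dot (adjoint_rate i + A^T *m adjoint i) (del i) + dot (adjoint i) (B *m du i) + dot (G^T *m adjoint i) dm.
  rewrite /cross_rate /del /dm /du /=; move: (x i - xh i) (mean x - mean xh) (u i - feedback i) => a b e.
  by rewrite !dotDr (dotDl (adjoint_rate i)) (dot_adj A^T (adjoint i)) (dot_adj G^T (adjoint i)) !trmxK; ring.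
have sdel : \sum_(i < N) del i = N%:R *: dm by rewrite sumrB !meanE// -scalerBr.
have main : \sum_(i < N) (run_cost x u i - run_cost xh feedback i) + 2 * \sum_(i < N) cross_rate i =
  \sum_(i < N) (qform Q (del i - Gam *m dm) + qform Rm (du i))
  + 2 * \sum_(i < N) (dot c (del i) + dot (G^T *m adjoint i - Gam^T *m (Q *m xi i)) dm).
  rewrite !big_distrr -!big_split; apply: eq_bigr => i _ /=.
  by rewrite step cr -(cE i) dotBl !dotDl; ring.
rewrite main; congr (_ + 2 * _).
rewrite big_split /= -dot_sumr sdel dotZr -dot_suml.
have -> : \sum_(i < N) (G^T *m adjoint i - Gam^T *m (Q *m xi i)) =
   N%:R *: (G^T *m mean adjoint - Gam^T *m (Q *m (mean xh - Gam *m mean xh - eta))).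
  have -> : mean xh - Gam *m mean xh - eta = mean xi.
    by rewrite /xi meanB meanB !mean_cst.
  by rewrite -!mean_mul -meanB meanE.
rewrite dotZl -mulrDr -dotDl mean_adjoint; congr (_ * dot _ _).
have -> : mean xh = mean_dev + xb by rewrite /mean_dev subrK.
have eT : (1%:M - Gam)^T = 1%:M - Gam^T by rewrite linearB /= trmx1.
rewrite /c /etabar /gap_mx /Qhat eT.
have -> : mean xh = mean_dev + xb by rewrite /mean_dev subrK.
move: (Gam^T) (G^T) => Gt Gtt.
rewrite !(mulmxDl, mulmxDr, mulmxBl, mulmxBr, mulmxN, mulNmx, mul1mx, mulmx1) -!mulmxA.
repeat match goal with |- context [mulmx ?a ?b] => move: (mulmx a b) => ? end.
by apply/matrixP => k l; rewrite !mxE; ring.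
Qed.

(** By Jensen's inequality the quadratic functional dominates its value on the means, that is, the
    output and the input of the averaged equation. *)
Lemma quad_lb cR : 0 < cR -> (forall z, cR * sqn z <= qform Rm z) ->
  N%:R * (sqn (sQ *m (1%:M - Gam) *m (mean x - mean xh)) + cR * sqn (mean (fun i => u i - feedback i))) <=
  \sum_(i < N) (qform Q (x i - xh i - Gam *m (mean x - mean xh)) + qform Rm (u i - feedback i)).
Proof.
move=> cR0 hcR; rewrite big_split mulrDr lerD//.
  under eq_bigr do rewrite qform_sQ.
  apply: le_trans (sqn_mean _ N0); rewrite mean_mul meanB mean_cst// meanB.
  by rewrite -mulmxA mulmxBl mul1mx.
rewrite mulrCA; apply: le_trans (ler_wpM2l (ltW cR0) (sqn_mean _ N0)) _.
by rewrite mulr_sumr ler_sum.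
Qed.
End pointwise.
End LinAlg.

(** * Discounted running costs *)

Section Det.
Context {d : measure_display} {T : measurableType d} {R : realType}.
Variable P : probability T R.
Notation leb := (@lebesgue_measure R).
Notation LP := (@lebesgue_measure R \x P)%E.
Variable rho : R.
Hypothesis rho0 : 0 < rho.

Lemma integral_hp (F : R -> R) :
  (\int[leb]_(t in `[0%R, +oo[) (F t)%:E = \int[leb]_t (hp t * F t)%:E)%E.
Proof.
rewrite integral_mkcond; apply: eq_integral => t _; rewrite patchE /hp (_ : (t \in _) = (0 <= t)%R).
  by case: (0 <= t); rewrite ?mul1r ?mul0r.
by apply/idP/idP; rewrite inE/= in_itv/= andbT.
Qed.

Lemma within_coord_meas m (g : R -> 'cV[R]_m) k : {within `[0, +oo[, continuous g} ->
  measurable_fun setT (fun s => hp s * g s k 0).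
Proof. by move=> cg; apply: hp_cont_meas; exact: coord_within. Qed.

Lemma exp_hp_meas : measurable_fun setT (fun s : R => hp s * expR (- rho * s)).
Proof. by apply: measurable_funM; [exact: measurable_hp|exact: measurable_expRZ]. Qed.

Lemma Crho2_intg m (g : R -> 'cV[R]_m) : Crho2 rho g -> intg leb (fun s => hp s * expR (- rho * s) * sqn (g s)).
Proof.
move=> [cg Hg]; have mg : measurable_fun setT (fun s => hp s * sqn (g s)).
  rewrite (_ : (fun s => _) = fun s => \sum_(k < m) (hp s * g s k 0) * (hp s * g s k 0)).
    by apply: measurable_sum => k; apply: measurable_funM; exact: within_coord_meas.
  by apply/funext => s; rewrite /sqn mulr_sumr; apply: eq_bigr => k _; rewrite mulrACA hp_idem expr2.
apply: intg_ge0P.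
- rewrite (_ : (fun s => _) = fun s => expR (- rho * s) * (hp s * sqn (g s))).
    by apply: measurable_funM => //; exact: measurable_expRZ.
  by apply/funext => s; ring.
- by move=> s; rewrite !mulr_ge0 ?hp_ge0 ?expR_ge0 ?sqn_ge0.
- move: Hg; rewrite integral_hp; congr (_ < _)%E; apply: eq_integral => s _.
  by rewrite mulrA mulNr.
Qed.

(** The integrand is a multiple of the density of the exponential law. *)
Lemma exp_intg : intg leb (fun s : R => hp s * expR (- rho * s)).
Proof.
have := integral_exponential_pdf rho0 => h.
apply: intg_ge0P; first exact: exp_hp_meas.
  by move=> s; rewrite mulr_ge0 ?hp_ge0 ?expR_ge0.
have e : (\int[leb]_s (hp s * expR (- rho * s))%:E = rho^-1%:E * \int[leb]_s (exponential_pdf rho s)%:E)%E.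
  rewrite -ge0_integralZl//; last 3 first.
  - by apply/measurable_EFinP; exact: measurable_exponential_pdf.
  - by move=> s _; rewrite lee_fin exponential_pdf_ge0// ltW.
  - by rewrite lee_fin invr_ge0 ltW.
  apply: eq_integral => s _; rewrite -EFinM; congr (_%:E).
  rewrite /exponential_pdf patchE (_ : (s \in _) = (0 <= s)%R); last first.
    by apply/idP/idP; rewrite inE/= in_itv/= andbT.
  rewrite /hp; case: (0 <= s); rewrite ?mul0r ?mulr0//= mul1r.
  by rewrite mulrA mulVf ?mul1r// gt_eqF.
by rewrite e h mule1 ltry.
Qed.

Definition det m (g : R -> 'cV[R]_m) : R -> T -> 'cV[R]_m := pos (fun s _ => g s).

Lemma det_L2r m (g : R -> 'cV[R]_m) : Crho2 rho g -> vL2r P rho (det g).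
Proof.
move=> hg k; have mg := within_coord_meas k hg.1.
have e : (fun t w => det g t w k 0) = fun t (_ : T) => hp t * g t k 0 by apply/funext => t; apply/funext => w; rewrite /det posE.
rewrite e; split; first exact: mproc_det.
rewrite (_ : wb _ _ = fun z : R * T => (hw rho z.1 * (hp z.1 * g z.1 k 0)) * (fun _ : T => 1) z.2); last first.
  by apply/funext => z; rewrite /wb mulr1.
apply: (@L2_prod _ _ _ P (fun s => hw rho s * (hp s * g s k 0)) (fun _ => 1)); last exact: L2_cst.
have mm : measurable_fun setT (fun s => hw rho s * (hp s * g s k 0)).
  by apply: measurable_funM => //; exact: measurable_hw.
split => //; apply: (@intg_le _ _ _ leb _ (fun s => hp s * expR (- rho * s) * sqn (g s))).
- exact: measurable_funX.
- move=> s; rewrite ger0_norm ?sqr_ge0// exprMn expr2 hw_sqr// exprMn expr2 hp_idem mulrA.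
  rewrite (mulrAC _ _ (hp s)) hp_idem ler_wpM2l ?mulr_ge0 ?hp_ge0 ?expR_ge0//.
  by rewrite /sqn (bigD1 k)//= lerDl sumr_ge0// => j _; rewrite sqr_ge0.
- exact: Crho2_intg.
Qed.

Lemma cst_L2r m (c : 'cV[R]_m) : vL2r P rho (fun _ _ => c).
Proof.
move=> k; split; first exact: measurable_cst.
rewrite (_ : wb _ _ = fun z : R * T => hw rho z.1 * (fun _ : T => c k 0) z.2)//.
apply: (@L2_prod _ _ _ P (hw rho) (fun _ => c k 0)); last exact: L2_cst.
split; first exact: measurable_hw.
rewrite (_ : (fun s => _) = fun s => hp s * expR (- rho * s)); first exact: exp_intg.
by apply/funext => s; rewrite expr2 hw_sqr.
Qed.

Definition rint (F : R -> T -> R) : R := \int[LP]_z (hp z.1 * expR (- rho * z.1) * F z.1 z.2).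
Definition rintg (F : R -> T -> R) := intg LP (fun z : R * T => hp z.1 * expR (- rho * z.1) * F z.1 z.2).

Lemma rint_ext F F' : (forall s w, 0 <= s -> F s w = F' s w) ->
  (fun z : R * T => hp z.1 * expR (- rho * z.1) * F z.1 z.2) = fun z => hp z.1 * expR (- rho * z.1) * F' z.1 z.2.
Proof.
move=> h; apply/funext => -[s w] /=; have [s0|s0] := boolP (0 <= s); first by rewrite h.
by rewrite /hp (negbTE s0) !mul0r.
Qed.

Lemma rint_eq F F' : (forall s w, 0 <= s -> F s w = F' s w) -> rint F = rint F'.
Proof. by move=> h; rewrite /rint (rint_ext h). Qed.

Lemma rintg_eq F F' : (forall s w, 0 <= s -> F s w = F' s w) -> rintg F -> rintg F'.
Proof. by move=> h; rewrite /rintg (rint_ext h). Qed.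

Lemma rintgD F F' : rintg F -> rintg F' -> rintg (fun s w => F s w + F' s w).
Proof.
by move=> h h'; rewrite /rintg; under eq_fun do rewrite mulrDr; exact: intgD.
Qed.

Lemma rintgZ k F : rintg F -> rintg (fun s w => k * F s w).
Proof. by move=> h; rewrite /rintg; under eq_fun do rewrite mulrCA; exact: intgZ. Qed.

Lemma rintg_sum (J : Type) (r : seq J) (F : J -> R -> T -> R) : (forall j, rintg (F j)) ->
  rintg (fun s w => \sum_(j <- r) F j s w).
Proof.
by move=> h; rewrite /rintg; under eq_fun do rewrite mulr_sumr; apply: intg_sum => j _; exact: h.
Qed.

Lemma rintD F F' : rintg F -> rintg F' -> rint (fun s w => F s w + F' s w) = rint F + rint F'.
Proof. by move=> h h'; rewrite /rint; under eq_fun do rewrite mulrDr; exact: intE_D. Qed.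

Lemma rintZ k F : rintg F -> rint (fun s w => k * F s w) = k * rint F.
Proof. by move=> h; rewrite /rint; under eq_fun do rewrite mulrCA; exact: intE_Z. Qed.

Lemma rint_sum (J : Type) (r : seq J) (F : J -> R -> T -> R) : (forall j, rintg (F j)) ->
  rint (fun s w => \sum_(j <- r) F j s w) = \sum_(j <- r) rint (F j).
Proof. by move=> h; rewrite /rint; under eq_fun do rewrite mulr_sumr; exact: intE_sum. Qed.

Lemma rint_le F F' : rintg F -> rintg F' -> (forall s w, 0 <= s -> F s w <= F' s w) -> rint F <= rint F'.
Proof.
move=> h h' H; apply: intE_le => // -[s w] /=; have [s0|s0] := boolP (0 <= s).
  by rewrite ler_wpM2l ?H// mulr_ge0 ?hp_ge0 ?expR_ge0.
by rewrite /hp (negbTE s0) !mul0r.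
Qed.

Lemma rint_dot m (U V : R -> T -> 'cV[R]_m) : vL2r P rho U -> vL2r P rho V ->
  rintg (fun s w => dot (U s w) (V s w)) /\ rint (fun s w => dot (U s w) (V s w)) = iprv P rho U V.
Proof.
move=> hU hV; have h k : rintg (fun s w => U s w k 0 * V s w k 0) by exact: (intg_wb (hU k) (hV k)).
split; first exact: rintg_sum.
by rewrite rint_sum//; apply: eq_bigr => k _; rewrite iprE.
Qed.

(** Tonelli rewrites the iterated integral of a cost as one integral over the product, before
    anything is known about its finiteness. *)
Lemma running_LP (F : R -> T -> R) : measurable_fun setT (fun z : R * T => hp z.1 * F z.1 z.2) ->
  (forall s w, 0 <= s -> 0 <= F s w) ->
  (\int[P]_w \int[leb]_(t in `[0%R, +oo[) (expR (- (rho * t)) * F t w)%:E =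
   \int[LP]_z (hp z.1 * expR (- rho * z.1) * F z.1 z.2)%:E)%E.
Proof.
move=> mF F0; have mG : measurable_fun setT (fun z : R * T => hp z.1 * expR (- rho * z.1) * F z.1 z.2).
  rewrite (_ : (fun z => _) = fun z : R * T => expR (- rho * z.1) * (hp z.1 * F z.1 z.2)).
    apply: measurable_funM => //.
    by apply: (measurableT_comp (measurable_expRZ _)).
  by apply/funext => z; ring.
rewrite fubini_tonelli2//; last 2 first.
- exact/measurable_EFinP.
- move=> [s w] /=; rewrite lee_fin; have [s0|s0] := boolP (0 <= s).
    by rewrite !mulr_ge0 ?hp_ge0 ?expR_ge0 ?F0.
  by rewrite /hp (negbTE s0) !mul0r.
apply: eq_integral => w _; rewrite integral_hp; apply: eq_integral => t _ /=.
by rewrite mulrA mulNr.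
Qed.

Section Testing.
Context {n : nat}.
Variables (x0 : nat -> T -> 'cV[R]_n) (W : nat -> R -> T -> R).
Hypotheses (hW : forall i, brownian_motion P (W i)).
Variable N : nat.

Lemma det_orthproc m (g : R -> 'cV[R]_m) k : Crho2 rho g -> orthproc P (future W N) (fun t w => det g t w k 0).
Proof.
move=> hg; split; first exact: (L2r_lproc rho0 (det_L2r hg k)).
apply: aeW => s s0; split; first exact: L2_cst.
by rewrite /det; exact: orth_cst.
Qed.

(** The differential equations hold at positive times; continuity covers the endpoint 0. *)
Lemma FTC (g h : R -> R) t : 0 <= t -> {within `[0, +oo[, continuous g} -> {within `[0, +oo[, continuous h} ->
  (forall s : R, 0 < s -> derivable g s 1 /\ 'D_1 g s = h s) ->
  It t (fun s => hp s * h s) = g t - g 0.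
Proof.
move=> t0 cg ch H; move: t0; rewrite le_eqVlt => /orP[/eqP <-|t0].
  by rewrite subrr I0//; exact: loc1_cont.
have sub : `[0, t] `<=` `[0, +oo[%classic by move=> x /=; rewrite !in_itv/= => /andP[->].
have cg' : {within `[0, t], continuous g} by exact: continuous_subspaceW cg.
have [_ c0 c1] := (continuous_within_itvP g t0).1 cg'.
rewrite It_restrict (_ : \int[leb]_(s in `[0, t]) (hp s * h s) = \int[leb]_(s in `[0, t]) h s).
  rewrite /Rintegral (continuous_FTC2 (F := g) t0)//.
  - exact: continuous_subspaceW ch.
  - split => // x; rewrite in_itv/= => /andP[x0' _]; exact: (H x x0').1.
  - by move=> x; rewrite in_itv/= => /andP[x0' _]; rewrite derive1E (H x x0').2.
by apply: eq_Rintegral => s; rewrite inE/= in_itv/= => /andP[s0 _]; rewrite hp1// mul1r.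
Qed.

Lemma det_vsemimart (I : finType) (Z : I -> R -> T -> R) m (g h : R -> 'cV[R]_m) : Crho2 rho g -> Crho2 rho h ->
  (forall s : R, 0 < s -> derivable g s 1 /\ 'D_1 g s = h s) ->
  vsemimart P (future W N) Z (det g) (fun _ => g 0) (det h) (fun _ _ => 0).
Proof.
move=> hg hh H k; split.
- exact: (det_L2r hg k).1.
- exact: L2_cst.
- exact: orth_cst.
- exact: det_orthproc.
- move=> t t0; apply: aeW => w; rewrite /noise big1 ?addr0; last by move=> a _; rewrite mul0r.
  rewrite /Dp /det posE hp1// mul1r.
  rewrite (_ : (fun s => pos (fun s0 _ => h s0) s w k 0) = fun s => hp s * h s k 0); last first.
    by apply/funext => s; rewrite posE.
  rewrite (@FTC (fun s => g s k 0))//; first by rewrite addrC subrK.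
  - by apply: coord_within; exact: hg.1.
  - by apply: coord_within; exact: hh.1.
  move=> s s0; have [d1 d2] := H s s0; split; first by have /derivable_mxP := d1; exact.
  by rewrite -d2 derive_mx// mxE.
Qed.
End Testing.
End Det.

Section Crho2.
Context {R : realType}.
Notation leb := (@lebesgue_measure R).
Variable rho : R.
Hypothesis rho0 : 0 < rho.

Lemma sqn_hp_meas m (g : R -> 'cV[R]_m) : {within `[0, +oo[, continuous g} ->
  measurable_fun setT (fun s => hp s * expR (- rho * s) * sqn (g s)).
Proof.
move=> cg; rewrite (_ : (fun s => _) = fun s => expR (- rho * s) * \sum_(k < m) (hp s * g s k 0) * (hp s * g s k 0)).
  apply: measurable_funM; first exact: measurable_expRZ.
  by apply: measurable_sum => k; apply: measurable_funM; exact: within_coord_meas.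
apply/funext => s; rewrite -mulrA mulrCA; congr (_ * _); rewrite /sqn mulr_sumr.
by apply: eq_bigr => k _; rewrite mulrACA hp_idem expr2.
Qed.

Lemma Crho2_of m (g : R -> 'cV[R]_m) : {within `[0, +oo[, continuous g} ->
  intg leb (fun s => hp s * expR (- rho * s) * sqn (g s)) -> Crho2 rho g.
Proof.
move=> cg ig; split => //; rewrite integral_hp.
have e : (\int[leb]_t (hp t * (expR (- (rho * t)) * sqn (g t)))%:E = \int[leb]_t (hp t * expR (- rho * t) * sqn (g t))%:E)%E.
  by apply: eq_integral => s _; rewrite mulrA mulNr.
by rewrite e (intE_EFin ig) ltry.
Qed.

Lemma Crho2D m (g h : R -> 'cV[R]_m) : Crho2 rho g -> Crho2 rho h -> Crho2 rho (fun s => g s + h s).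
Proof.
move=> hg hh; have cD : {within `[0, +oo[, continuous (fun s => g s + h s)}.
  by move=> x; apply: cvgD; [exact: hg.1|exact: hh.1].
apply: Crho2_of => //; apply: (@intg_le _ _ _ leb _ (fun s => 2 * (hp s * expR (- rho * s) * sqn (g s) + hp s * expR (- rho * s) * sqn (h s)))).
- exact: sqn_hp_meas.
- move=> s; have h0 : 0 <= hp s * expR (- rho * s) by rewrite mulr_ge0 ?hp_ge0 ?expR_ge0.
  rewrite ger0_norm ?mulr_ge0 ?sqn_ge0// -mulrDr mulrCA ler_wpM2l//; exact: sqnD.
- by apply: intgZ; apply: intgD; exact: Crho2_intg.
Qed.

Lemma Crho2_mx m p (M : 'M[R]_(p, m)) (g : R -> 'cV[R]_m) : Crho2 rho g -> Crho2 rho (fun s => M *m g s).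
Proof.
move=> hg; have cM : {within `[0, +oo[, continuous (fun s => M *m g s)}.
  rewrite (_ : (fun s => _) = fun s => \sum_(k < m) g s k 0 *: col k M).
    move=> x; apply: cvg_big => [|k _]; first exact: add_continuous.
    apply: cvgZr_tmp; exact: coord_within hg.1 x.
  by apply/funext => s; apply/matrixP => i j; rewrite mxE summxE; apply: eq_bigr => k _; rewrite !mxE mulrC ord1.
have [C C0 HC] := mx_bound M.
apply: Crho2_of => //; apply: (@intg_le _ _ _ leb _ (fun s => C * (hp s * expR (- rho * s) * sqn (g s)))).
- exact: sqn_hp_meas.
- move=> s; have h0 : 0 <= hp s * expR (- rho * s) by rewrite mulr_ge0 ?hp_ge0 ?expR_ge0.
  by rewrite ger0_norm ?mulr_ge0 ?sqn_ge0// mulrCA ler_wpM2l.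
- by apply: intgZ; exact: Crho2_intg.
Qed.
End Crho2.

Section VecProc.
Context {d : measure_display} {T : measurableType d} {R : realType}.
Variable P : probability T R.
Variables (rho : R) (future : R -> set (T -> R)).
Hypothesis rho0 : 0 < rho.
Hypothesis futureL2 : forall s, 0 <= s -> future s `<=` L2 P.

Lemma vL2rN m (Y : R -> T -> 'cV[R]_m) : vL2r P rho Y -> vL2r P rho (fun s w => - Y s w).
Proof.
move=> hY k; rewrite (_ : (fun t w => _) = fun t w => -1 * Y t w k 0); first exact: L2rZ.
by apply/funext => t; apply/funext => w; rewrite mxE mulN1r.
Qed.

Lemma vL2rB m (Y Y' : R -> T -> 'cV[R]_m) : vL2r P rho Y -> vL2r P rho Y' -> vL2r P rho (fun s w => Y s w - Y' s w).
Proof. by move=> hY hY'; apply: vL2rD => //; exact: vL2rN. Qed.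

Lemma vL2r_mean m N (Y : 'I_N -> R -> T -> 'cV[R]_m) : (forall i, vL2r P rho (Y i)) ->
  vL2r P rho (fun s w => mean (fun i => Y i s w)).
Proof.
move=> h k; rewrite (_ : (fun t w => _) = fun t w => N%:R^-1 * (\sum_(j < N) Y j t w) k 0); last first.
  by apply/funext => t; apply/funext => w; rewrite mxE.
by apply: L2rZ; exact: (vL2r_sum _ h).
Qed.

Variables (I : finType) (Z : I -> R -> T -> R).

Lemma vsemimart_mean m N (Y : 'I_N -> R -> T -> 'cV[R]_m) (Y0 : 'I_N -> T -> 'cV[R]_m) (b : 'I_N -> R -> T -> 'cV[R]_m) (g : 'I_N -> 'I_m -> I -> R) :
  (forall i, vsemimart P future Z (Y i) (Y0 i) (b i) (g i)) ->
  vsemimart P future Z (fun s w => mean (fun i => Y i s w)) (fun w => mean (fun i => Y0 i w))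
    (fun s w => mean (fun i => b i s w)) (fun k a => N%:R^-1 * \sum_(i < N) g i k a).
Proof.
move=> h k; apply: (semimart_eq (semimartZ futureL2 N%:R^-1 (semimart_sum futureL2 (index_enum 'I_N) (fun j => h j k)))).
- by apply/funext => t; apply/funext => w; rewrite /mean mxE summxE.
- by apply/funext => w; rewrite /mean mxE summxE.
- by apply/funext => t; apply/funext => w; rewrite /mean mxE summxE.
- by apply/funext => a; congr (_ * _); rewrite fct_sumE.
Qed.

Lemma vsemimartB m (Y Y' : R -> T -> 'cV[R]_m) (Y0 Y0' : T -> 'cV[R]_m) (b b' : R -> T -> 'cV[R]_m) (g g' : 'I_m -> I -> R) :
  vsemimart P future Z Y Y0 b g -> vsemimart P future Z Y' Y0' b' g' ->
  vsemimart P future Z (fun t w => Y t w - Y' t w) (fun w => Y0 w - Y0' w) (fun t w => b t w - b' t w) (fun k a => g k a - g' k a).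
Proof.
move=> h h' k; apply: (semimart_eq (semimartD futureL2 (h k) (semimartZ futureL2 (-1) (h' k)))).
- by apply/funext => t; apply/funext => w; rewrite !mxE mulN1r.
- by apply/funext => w; rewrite !mxE mulN1r.
- by apply/funext => t; apply/funext => w; rewrite !mxE mulN1r.
- by apply/funext => a; rewrite mulN1r.
Qed.

Definition vorthproc m (Y : R -> T -> 'cV[R]_m) := forall k, orthproc P future (fun t w => Y t w k 0).

Lemma vorthprocD m (Y Y' : R -> T -> 'cV[R]_m) : vorthproc Y -> vorthproc Y' -> vorthproc (fun t w => Y t w + Y' t w).
Proof.
move=> h h' k; rewrite (_ : (fun t w => _) = fun t w => Y t w k 0 + Y' t w k 0); first exact: orthprocD.
by apply/funext => t; apply/funext => w; rewrite mxE.
Qed.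

Lemma vorthproc_mx m p (M : 'M[R]_(p, m)) (Y : R -> T -> 'cV[R]_m) : vorthproc Y -> vorthproc (fun t w => M *m Y t w).
Proof.
move=> h k; rewrite (_ : (fun t w => _) = fun t w => \sum_(l < m) M k l * Y t w l 0).
  by apply: orthproc_sum => // l; exact: orthprocZ.
by apply/funext => t; apply/funext => w; rewrite mxE.
Qed.
End VecProc.

(** Agents and coordinates are merged into one index, to match the system of scalar equations of the
    [State] section. *)
Lemma lin_form {R : realType} n N (M1 M2 : 'M[R]_n) (X : 'I_N -> 'cV[R]_n) i k :
  (M1 *m X i + M2 *m mean X) k 0 =
  \sum_(c : 'I_N * 'I_n) ((i == c.1)%:R * M1 k c.2 + N%:R^-1 * M2 k c.2) * X c.1 c.2 0.
Proof.
rewrite -(pair_bigA _ (fun j l => ((i == j)%:R * M1 k l + N%:R^-1 * M2 k l) * X j l 0)) /=.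
transitivity (\sum_(j < N) ((i == j)%:R * (M1 *m X j) k 0 + N%:R^-1 * (M2 *m X j) k 0)).
  rewrite big_split /= (bigD1 i)//= eqxx mul1r [X in _ = _ + X + _]big1 ?addr0; last first.
    by move=> j; rewrite eq_sym => /negbTE ->; rewrite mul0r.
  by rewrite mxE -mean_mul /mean [X in _ + X = _]mxE summxE mulr_sumr.
apply: eq_bigr => j _; rewrite !mxE !mulr_sumr -big_split /=; apply: eq_bigr => l _.
by rewrite mulrDl !mulrA.
Qed.

(** * Independence of the agents *)

Section Init.
Context {d : measure_display} {T : measurableType d} {R : realType} {n : nat}.
Variable P : probability T R.
Variables (x0 : nat -> T -> 'cV[R]_n) (xbar0 : 'cV[R]_n) (C0 : R).
Hypotheses (hx0 : forall i (k : 'I_n), measurable_fun setT (fun w => x0 i w k 0))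
  (hx0indep : mutually_independent P (sigma_init x0))
  (hx0mean : forall i (k : 'I_n), ('E_P[fun w => x0 i w k 0%R] = (xbar0 k 0%R)%:E)%E)
  (hx0var : forall i, (\int[P]_w (sqn (x0 i w))%:E < C0%:E)%E).

Lemma x0_sqn_meas i : measurable_fun setT (fun w => sqn (x0 i w)).
Proof. by apply: measurable_sum => k; apply: measurable_funX; exact: hx0. Qed.

Lemma x0_sqn i : intg P (fun w => sqn (x0 i w)).
Proof.
apply: intg_ge0P; [exact: x0_sqn_meas|by move=> w; exact: sqn_ge0|].
by apply: lt_trans (hx0var i) _; rewrite ltry.
Qed.

Lemma x0_sqn_le i : \int[P]_w sqn (x0 i w) <= C0.
Proof. by have := hx0var i; rewrite (intE_EFin (x0_sqn i)) lte_fin => /ltW. Qed.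

Lemma x0L2 i k : L2 P (fun w => x0 i w k 0).
Proof.
split; first exact: hx0.
apply: (@intg_le _ _ _ P _ (fun w => sqn (x0 i w))); last exact: x0_sqn.
  by apply: measurable_funX; exact: hx0.
move=> w; rewrite ger0_norm ?sqr_ge0// /sqn (bigD1 k)//= lerDl.
by apply: sumr_ge0 => j _; exact: sqr_ge0.
Qed.

Lemma x0_mean i k : \int[P]_w x0 i w k 0 = xbar0 k 0.
Proof. by have := hx0mean i k; rewrite unlock (intE_EFin (L2_intg (x0L2 i k))) => -[]. Qed.

Let yk i k w := x0 i w k 0 - xbar0 k 0.

Lemma x0c_L2 i k : L2 P (yk i k).
Proof. by apply: L2B; [exact: x0L2|exact: L2_cst]. Qed.

Lemma ip_cst (X : T -> R) c : L2 P X -> ip P X (fun=> c) = c * \int[P]_w X w.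
Proof.
by move=> hX; rewrite /ip; under eq_fun do rewrite mulrC; rewrite intE_Z//; exact: L2_intg.
Qed.

Lemma x0c_indep i j k : i != j -> ip P (yk i k) (yk j k) = 0.
Proof.
move=> ij; have h : ip P (fun w => x0 i w k 0) (fun w => x0 j w k 0) = xbar0 k 0 * xbar0 k 0.
  rewrite indep_ip; [by rewrite !x0_mean|exact: x0L2|exact: x0L2|].
  move=> A B mA mB.
  pose E l := if l == i then (fun w => x0 i w k 0) @^-1` A else (fun w => x0 j w k 0) @^-1` B.
  have sub l (D : set R) : measurable D -> sigma_init x0 l ((fun w => x0 l w k 0) @^-1` D).
    move=> mD; apply: sub_sigma_algebra; exists k => //; exists D => //; by rewrite setTI.
  have := hx0indep (s := [:: i; j]) (E := E); rewrite /= inE ij !big_cons big_nil mule1 /E eqxx eq_sym (negbTE ij).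
  have -> : \bigcap_(l in [set` [:: i; j]]) (if l == i then (fun w => x0 i w k 0) @^-1` A else (fun w => x0 j w k 0) @^-1` B) =
     (fun w => x0 i w k 0) @^-1` A `&` (fun w => x0 j w k 0) @^-1` B.
    apply/seteqP; split => w.
      move=> H; split; first by have := H i; rewrite eqxx; apply; rewrite /= inE eqxx.
      by have := H j; rewrite eq_sym (negbTE ij); apply; rewrite /= !inE eqxx orbT.
    move=> [wA wB] l; rewrite /= !inE; case: eqP => [->//|_ /=].
    by move=> _; exact: wB.
  apply => // l; rewrite !inE => /orP[/eqP ->|/eqP ->]; first by rewrite eqxx; exact: sub.
  by rewrite eq_sym (negbTE ij); exact: sub.
have cL := @L2_cst _ _ _ P (xbar0 k 0).
rewrite /yk ipBl; [|exact: x0L2|exact: cL|exact: x0c_L2].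
rewrite [X in _ - X]ipC ip_cst; last exact: x0c_L2.
rewrite ipBr; [|exact: x0L2|exact: cL|exact: x0L2].
rewrite h ip_cst; last exact: x0L2.
by rewrite x0_mean intE_B; [|exact: L2_intg (x0L2 _ _)|exact: L2_intg cL]; rewrite x0_mean intE_cst; ring.
Qed.

Lemma x0c_le i k : ip P (yk i k) (yk i k) <= \int[P]_w x0 i w k 0 ^+ 2.
Proof.
have cL := @L2_cst _ _ _ P (xbar0 k 0).
rewrite /yk ipBl; [|exact: x0L2|exact: cL|exact: x0c_L2].
rewrite [X in _ - X]ipC ip_cst; last exact: x0c_L2.
rewrite ipBr; [|exact: x0L2|exact: cL|exact: x0L2].
rewrite ip_cst; last exact: x0L2.
rewrite x0_mean intE_B; [|exact: L2_intg (x0L2 _ _)|exact: L2_intg cL].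
rewrite x0_mean intE_cst subrr mulr0 subr0.
have -> : ip P (fun w => x0 i w k 0) (fun w => x0 i w k 0) = \int[P]_w x0 i w k 0 ^+ 2.
  by rewrite /ip; under eq_fun do rewrite -expr2.
by rewrite gerBl -expr2 sqr_ge0.
Qed.

(** Centred initial states of distinct agents are orthogonal by independence, so N of the N^2 terms
    survive against the factor N^-2. *)
Lemma x0_mean_dev N : (0 < N)%N ->
  intg P (fun w => sqn (mean (fun i : 'I_N => x0 i w) - xbar0)) /\
  \int[P]_w sqn (mean (fun i : 'I_N => x0 i w) - xbar0) <= C0 / N%:R.
Proof.
move=> N0; have N0' : (N%:R : R) != 0 by rewrite pnatr_eq0 -lt0n.
have e w k : (mean (fun i : 'I_N => x0 i w) - xbar0) k 0 = N%:R^-1 * \sum_(i < N) yk i k w.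
  rewrite -[in LHS](mean_cst xbar0 N0) -meanB /mean mxE summxE; congr (_ * _).
  by apply: eq_bigr => i _; rewrite !mxE.
have L k : L2 P (fun w => N%:R^-1 * \sum_(i < N) yk i k w).
  by apply: L2Z; apply: L2_sum => i _; exact: x0c_L2.
have eq : (fun w => sqn (mean (fun i : 'I_N => x0 i w) - xbar0)) =
    fun w => \sum_(k < n) (N%:R^-1 * \sum_(i < N) yk i k w) ^+ 2.
  by apply/funext => w; rewrite /sqn; apply: eq_bigr => k _; rewrite e.
rewrite eq; split; first by apply: intg_sum => k _; exact: (L k).2.
rewrite intE_sum => [|k]; last exact: (L k).2.
have ek k : \int[P]_w (N%:R^-1 * \sum_(i < N) yk i k w) ^+ 2 <= N%:R^-1 ^+ 2 * \sum_(i < N) \int[P]_w x0 i w k 0 ^+ 2.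
  have -> : \int[P]_w (N%:R^-1 * \sum_(i < N) yk i k w) ^+ 2 =
     ip P (fun w => N%:R^-1 * \sum_(i < N) yk i k w) (fun w => N%:R^-1 * \sum_(i < N) yk i k w).
    by rewrite /ip; under eq_fun do rewrite expr2.
  have S : L2 P (fun w => \sum_(i < N) yk i k w) by apply: L2_sum => i _; exact: x0c_L2.
  rewrite ipZl// ipZr// mulrA -expr2 ler_wpM2l ?sqr_ge0//.
  rewrite ip_suml// => [|i]; last exact: x0c_L2.
  apply: ler_sum => i _; rewrite ip_sumr; [|by move=> j; exact: x0c_L2|exact: x0c_L2].
  rewrite (bigD1 i)//= big1 ?addr0; first exact: x0c_le.
  by move=> j ji; apply: x0c_indep; rewrite eq_sym.
apply: le_trans (ler_sum _ (fun k _ => ek k)) _.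
rewrite -mulr_sumr exchange_big /=.
have -> : \sum_(j < N) \sum_(i < n) \int[P]_w x0 j w i 0 ^+ 2 = \sum_(j < N) \int[P]_w sqn (x0 j w).
  by apply: eq_bigr => j _; rewrite intE_sum// => k; exact: (x0L2 j k).2.
have h : \sum_(j < N) \int[P]_w sqn (x0 j w) <= C0 * N%:R.
  rewrite mulr_natr -[N in _ *+ N]card_ord -sumr_const; apply: ler_sum => j _; exact: x0_sqn_le.
apply: le_trans (ler_wpM2l (sqr_ge0 _) h) _.
by rewrite mulrCA expr2 -mulrA mulVf// mulr1.
Qed.

End Init.

Section Gam.
Context {R : realType} {n N : nat}.
Variable sg : R -> 'cV[R]_n.
Let I := ('I_N * 'I_n)%type.

Lemma sum_noise_row (i : 'I_N) (k : 'I_n) (h : I -> R) : \sum_(a : I) noise_row i k a * h a = h (i, k).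
Proof.
rewrite (bigD1 (i, k))//= /noise_row eqxx mul1r big1 ?addr0// => a /negbTE ->; exact: mul0r.
Qed.

Lemma cov_rate_gd i j k l (s : R) : cov_rate (noise_cov sg (N := N)) (noise_row i k) (noise_row j l) s = noise_cov sg (i, k) (j, l) s.
Proof.
rewrite /cov_rate.
under eq_bigr do under eq_bigr do rewrite -mulrA.
under eq_bigr do rewrite -mulr_sumr sum_noise_row.
by rewrite sum_noise_row.
Qed.

(** The noises of distinct agents are uncorrelated: averaging divides the covariance by N. *)
Lemma cov_rate_mean k l (s : R) : (0 < N)%N ->
  cov_rate (noise_cov sg (N := N)) (fun a : I => N%:R^-1 * \sum_(i < N) noise_row i k a) (fun a : I => N%:R^-1 * \sum_(i < N) noise_row i l a) s =
  N%:R^-1 * (normal_m2 * (hp s * (sg s k 0 * sg s l 0))).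
Proof.
move=> N0.
transitivity (N%:R^-1 * (N%:R^-1 * \sum_(i < N) \sum_(j < N) cov_rate (noise_cov sg (N := N)) (noise_row i k) (noise_row j l) s)).
  rewrite /cov_rate.
  transitivity (\sum_(a : I) \sum_(b : I) N%:R^-1 * (N%:R^-1 * \sum_(i < N) \sum_(j < N) noise_row i k a * noise_row j l b * noise_cov sg a b s)).
    apply: eq_bigr => a _; apply: eq_bigr => b _; move: (noise_cov sg a b s) => h.
    transitivity (N%:R^-1 * (N%:R^-1 * ((\sum_(i < N) noise_row i k a) * ((\sum_(i < N) noise_row i l b) * h)))); first by ring.
    congr (_ * (_ * _)); rewrite mulr_suml; apply: eq_bigr => i _; rewrite mulr_suml mulr_sumr; apply: eq_bigr => j _; ring.
  under eq_bigr do rewrite -!mulr_sumr; rewrite -!mulr_sumr; congr (_ * (_ * _)).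
  transitivity (\sum_(a : I) \sum_(i < N) \sum_(b : I) \sum_(j < N) noise_row i k a * noise_row j l b * noise_cov sg a b s).
    by apply: eq_bigr => a _; exact: exchange_big.
  rewrite exchange_big; apply: eq_bigr => i _ /=.
  transitivity (\sum_(a : I) \sum_(j < N) \sum_(b : I) noise_row i k a * noise_row j l b * noise_cov sg a b s).
    by apply: eq_bigr => a _; exact: exchange_big.
  exact: exchange_big.
congr (_ * _); under eq_bigr do under eq_bigr do rewrite cov_rate_gd /noise_cov /=.
transitivity (N%:R^-1 * \sum_(i < N) (normal_m2 * (hp s * (sg s k 0 * sg s l 0)))).
  congr (_ * _); apply: eq_bigr => i _; rewrite (bigD1 i)//= eqxx mul1r big1 ?addr0// => j.
  by rewrite eq_sym => /negbTE ->; rewrite mul0r.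
rewrite sumr_const card_ord; move: (normal_m2 * _) => c.
by rewrite -(mulr_natl c) mulrA mulVf ?mul1r// pnatr_eq0 -lt0n.
Qed.

Lemma qform_sum2 (X : 'M[R]_n) (z : 'cV[R]_n) : \sum_(k < n) \sum_(l < n) X k l * (z k 0 * z l 0) = qform X z.
Proof.
rewrite qformE /dot; apply: eq_bigr => k _; rewrite mxE mulr_sumr; apply: eq_bigr => l _; ring.
Qed.
End Gam.

(** * Adapted versions *)

Section Version.
Context {d : measure_display} {T : measurableType d} {R : realType}.
Variable P : probability T R.
Implicit Types (G : set_system T) (X Y : T -> R).

(* The sigma-algebra generated by [G] is not completed, hence the almost sure equality. *)
Definition version G Y := exists2 Y', gmeas G Y' & {ae P, forall w, Y w = Y' w}.

Lemma gmeas_version G Y : gmeas G Y -> version G Y.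
Proof. by move=> h; exists Y => //; exact: aeW. Qed.

Lemma versionD G X Y : version G X -> version G Y -> version G (fun w => X w + Y w).
Proof.
move=> [X' gX eX] [Y' gY eY]; exists (fun w => X' w + Y' w); first exact: gmeasD.
by apply: filterS2 eX eY => w -> ->.
Qed.

Lemma versionZ G c X : version G X -> version G (fun w => c * X w).
Proof.
move=> [X' gX eX]; exists (fun w => c * X' w); first exact: gmeasZ.
by apply: filterS eX => w ->.
Qed.

Lemma version_cst G c : version G (fun=> c).
Proof. by apply: gmeas_version; exact: gmeas_cst. Qed.

Lemma version_sum G (J : Type) (r : seq J) (h : J -> T -> R) :
  (forall j, version G (h j)) -> version G (fun w => \sum_(j <- r) h j w).
Proof.
move=> H; elim: r => [|j r IH].
  by under eq_fun do rewrite big_nil; exact: version_cst.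
by under eq_fun do rewrite big_cons; exact: versionD.
Qed.

Lemma version_sub G G' X : <<s G>> `<=` <<s G'>> -> version G X -> version G' X.
Proof. by move=> sub [X' gX eX]; exists X' => //; exact: gmeas_sub gX. Qed.

(** The limit may fail to exist on a null set outside the sigma-algebra; the upper limit of the
    versions is measurable everywhere and equals the limit where it exists. *)
Lemma version_lim G (S : nat -> T -> R) Y : (forall m, version G (S m)) ->
  {ae P, forall w, (fun m => S m w) @ \oo --> Y w} -> version G Y.
Proof.
move=> H cv; pose S' m := sval (cid2 (H m)).
have gS m : gmeas G (S' m) by rewrite /S'; case: cid2.
have eS m : {ae P, forall w, S m w = S' m w} by rewrite /S'; case: cid2.
exists (fun w => fine (limn_esup (fun m => (S' m w)%:E))).
  apply/gmeasP; apply: (measurableT_comp (@fine_measurable _ setT measurableT)).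
  by apply: measurable_fun_limn_esup => m; apply/measurable_EFinP; exact/gmeasP.
have := ae_foralln eS; apply: filterS2 cv => w cv e.
have c : (fun m => (S' m w)%:E) @ \oo --> (Y w)%:E.
  by under eq_fun do rewrite -e; apply: cvg_EFin => //; exact: nearW.
by rewrite (cvg_limn_einf_sup c).2.
Qed.

(** Along a subsequence with squared errors at most 2^-(m + 1), the sum of the squared errors has
    finite expectation, so almost surely the errors tend to 0. *)
Lemma L2_cvg_ae (S : nat -> T -> R) Y : (forall m, L2 P (S m)) -> L2 P Y ->
  (fun m => ip P (fun w => Y w - S m w) (fun w => Y w - S m w)) @ \oo --> (0 : R) ->
  exists h : nat -> nat, {ae P, forall w, (fun m => S (h m) w) @ \oo --> Y w}.
Proof.
move=> hS hY /cvgrPdist_le cv.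
have ex m : exists N, ip P (fun w => Y w - S N w) (fun w => Y w - S N w) <= 1 / (2 ^ m.+1)%:R.
  have e0 : 0 < 1 / (2 ^ m.+1)%:R :> R by rewrite divr_gt0// ltr0n expn_gt0.
  have [N _ H] := cv _ e0; exists N; have := H N (leqnn N); rewrite sub0r normrN ger0_norm//; exact: ip_ge0.
pose h m := sval (cid (ex m)); have hh m : ip P (fun w => Y w - S (h m) w) (fun w => Y w - S (h m) w) <= 1 / (2 ^ m.+1)%:R.
  by rewrite /h; case: cid.
pose D m w := (Y w - S (h m) w) ^+ 2; have D0 m w : 0 <= D m w by rewrite sqr_ge0.
have iD m : intg P (D m) by exact: (L2B hY (hS (h m))).2.
exists h; have fin : (\int[P]_w (\sum_(m <oo) (D m w)%:E) < +oo)%E.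
  rewrite integral_nneseries//; last 2 first.
  - by move=> m; apply/measurable_EFinP; exact: intg_meas (iD m).
  - by move=> m w _; rewrite lee_fin.
  apply: (@le_lt_trans _ _ (1%:E)); last by rewrite ltry.
  apply: (le_trans _ (@epsilon_trick0 R 1 xpredT ler01)).
  apply: lee_nneseries => [m _ _|m _]; first by apply: integral_ge0 => w _; rewrite lee_fin.
  rewrite (intE_EFin (iD m)) lee_fin; apply: le_trans (hh m).
  by rewrite le_eqVlt; apply/orP; left; apply/eqP; apply: eq_Rintegral => w _; rewrite /D expr2.
have mD : measurable_fun setT (fun w => \sum_(m <oo) (D m w)%:E)%E.
  by apply: ge0_emeasurable_sum => [m w _ _|m _]; [rewrite lee_fin|apply/measurable_EFinP; exact: intg_meas (iD m)].
have iI : P.-integrable setT (fun w => \sum_(m <oo) (D m w)%:E)%E.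
  apply/integrableP; split => //; rewrite (eq_integral (fun w => \sum_(m <oo) (D m w)%:E)%E)// => w _.
  by rewrite gee0_abs//; apply: nneseries_ge0 => m _ _; rewrite lee_fin.
have := integrable_ae measurableT iI; apply: filterS => w /(_ I) /fineK fw.
have cD : cvgn (series (fun m => D m w)).
  apply: nondecreasing_is_cvgn.
    by apply/nondecreasing_seqP => m; rewrite /series /= big_nat_recr//= lerDl.
  exists (fine (\sum_(m <oo) (D m w)%:E)%E) => _ [m _ <-]; rewrite /series /= -lee_fin fw -sumEFin.
  by apply: nneseries_lim_ge => k _ _; rewrite lee_fin.
have c0 := cvg_series_cvg_0 cD.
apply/cvgrPdist_le => e e0; have /cvgrPdist_le/(_ (e ^+ 2)) := c0; rewrite exprn_gt0// => /(_ isT)[N _ HN].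
exists N => // m mN; have := HN m mN; rewrite sub0r normrN ger0_norm// /D -[X in X <= _]real_normK ?num_real//.
by rewrite ler_pXn2r ?nnegrE ?(ltW e0).
Qed.

Lemma version_L2lim G (S : nat -> T -> R) Y : (forall m, version G (S m)) -> (forall m, L2 P (S m)) -> L2 P Y ->
  (fun m => ip P (fun w => Y w - S m w) (fun w => Y w - S m w)) @ \oo --> (0 : R) -> version G Y.
Proof.
by move=> vS hS hY /(L2_cvg_ae hS hY)[h cv]; apply: version_lim cv => m; exact: vS.
Qed.
End Version.

Section Filtration.
Context {d : measure_display} {T : measurableType d} {R : realType} {n : nat}.
Variable P : probability T R.
Variables (x0 : nat -> T -> 'cV[R]_n) (W : nat -> R -> T -> R) (sg : R -> 'cV[R]_n).
Hypotheses (hW : forall i, brownian_motion P (W i))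
  (hWindep : mutually_independent P (fun i => sigma_rv `[0, +oo[ (W i)))
  (csg : {within `[0, +oo[, continuous sg}).
Variable N : nat.

Definition filtration_gen t : set_system T := \bigcup_(i in `I_N) agent_filtration x0 W i t.

Lemma filtration_gen_mono t t' : t <= t' -> <<s filtration_gen t>> `<=` <<s filtration_gen t'>>.
Proof.
move=> tt; apply: sub_sigma_algebra2 => E [i iN hE]; exists i => //.
move: E hE; apply: sub_sigma_algebra2 => E [hE|hE]; [by left|right].
move: E hE; apply: sub_sigma_algebra2 => E [s hs hE]; exists s => //.
by move: hs => /=; rewrite !in_itv/= => /andP[-> /le_trans->].
Qed.

Lemma W_filtration_gen (i : 'I_N) s t : 0 <= s -> s <= t -> gmeas (filtration_gen t) (W i s).
Proof.
move=> s0 st E mE; apply: sub_sigma_algebra; exists i => //=.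
apply: sub_sigma_algebra; right; apply: sub_sigma_algebra; exists s; first by rewrite /= in_itv/= s0.
by exists E => //; rewrite setTI.
Qed.

Lemma x0_filtration_gen (i : 'I_N) k t : gmeas (filtration_gen t) (fun w => x0 i w k 0).
Proof. by move=> E mE; exact: x0_filtration. Qed.

(** The step integrals up to [t] only involve values of [W i] at times up to [t], and the Ito
    integral is their L2 limit. *)
Lemma Z_version (i : 'I_N) t Y k : 0 <= t -> vmeas Y -> ito_integral P (W i) sg t Y ->
  version P (filtration_gen t) (fun w => Y w k 0).
Proof.
move=> t0 mY hY; have [L cv] := ito_apx hW csg mY hY k (lexx 0) t0.
apply: version_L2lim cv => // m.
  apply: gmeas_version; under eq_fun do rewrite step_integralE.
  apply: gmeas_sum => j; apply: gmeasZ.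
  have ok : okphi 0 t (riemann_steps sg 0 t m) by apply: riemann_steps_ok.
  have [a1 a2 a3] := ok_nth j ok.
  by apply: gmeasB; apply: W_filtration_gen => //; [exact: le_trans a2|exact: le_trans a3].
have ok : okphi 0 t (riemann_steps sg 0 t m) by apply: riemann_steps_ok.
exact: (L2_step_integral hW i k ok).
Qed.
End Filtration.

(** * Convergence of the explicit Euler scheme *)

Section Euler.
Context {R : realType} (A : finType).
Notation leb := (@lebesgue_measure R).
Variables (F : A -> A -> R).
Implicit Types (k g : R -> R).

(* The sum of the first [j] states of the explicit Euler scheme of x t = z t + F (int_0^t x). *)
Fixpoint euler_sum (z : nat -> A -> R) (h : R) (j : nat) (a : A) : R :=
  if j is i.+1 then euler_sum z h i a + (z i a + h * \sum_c F a c * euler_sum z h i c) else 0.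

Lemma loc1_within g : {within `[0, +oo[, continuous g} -> loc1 g.
Proof.
move=> cg t; have := loc1_cont cg t; congr (intg _ _); apply/funext => s.
by rewrite mulrA cut_hp.
Qed.

(** The local error of one Euler step. *)
Lemma It_incr_le k (a b c om : R) : 0 <= a -> a <= b -> loc1 k ->
  (forall s, a <= s <= b -> `|k s - c| <= om) -> `|(It b k - It a k) - (b - a) * c| <= (b - a) * om.
Proof.
move=> a0 ab lk H; have b0 := le_trans a0 ab.
have icut t : intg leb (cut t) by exact: intg_cut.
have iD : intg leb (fun s => cut b s - cut a s) by exact: intgB.
have vD : \int[leb]_s (cut b s - cut a s) = b - a by rewrite intE_B// !I_cst.
have iF : intg leb (fun s => (cut b s - cut a s) * (k s - c)).
  under eq_fun do rewrite mulrBr [_ * c]mulrC mulrBl.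
  by apply: intgB; [apply: intgB; exact: lk|exact: intgZ].
have -> : (It b k - It a k) - (b - a) * c = \int[leb]_s ((cut b s - cut a s) * (k s - c)).
  under eq_Rintegral do rewrite mulrBr [_ * c]mulrC mulrBl.
  rewrite intE_B; [|by apply: intgB; exact: lk|exact: intgZ].
  by rewrite intE_B; [|exact: lk|exact: lk]; rewrite intE_Z// vD [c * _]mulrC.
apply: le_trans (intE_abs iF) _; rewrite -vD mulrC -intE_Z//.
apply: intE_le; [exact: intg_abs|exact: intgZ|move=> s].
rewrite normrM mulrC; have [/andP[sa sb]|hs] := boolP (a <= s <= b).
  have d0 : 0 <= cut b s - cut a s.
    by rewrite subr_ge0 !cutE ler_nat; case: (0 <= s) => //=; case: (s <= a) / idP => // /le_trans ->.
  by rewrite [X in _ * X]ger0_norm// ler_wpM2r// H// sa.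
suff -> : cut b s - cut a s = 0 by rewrite normr0 !mulr0.
apply/eqP; rewrite subr_eq0 !cutE; apply/eqP; congr (_%:R); congr (nat_of_bool (_ && _)).
move: hs; rewrite negb_and -!ltNge => /orP[sa|bs].
  by rewrite (ltW sa) (ltW (lt_le_trans sa ab)).
by rewrite leNgt bs leNgt (le_lt_trans ab bs).
Qed.

(** A discrete Gronwall inequality, which accumulates the local errors. *)
Lemma geom_bound (D : nat -> R) (q c : R) j : 0 <= q -> 0 <= c -> D 0%N <= 0 ->
  (forall i, (i < j)%N -> D i.+1 <= (1 + q) * D i + c) -> D j <= j%:R * c * (1 + q) ^+ j.
Proof.
move=> q0 c0 D0; elim: j => [|j IH] H; first by rewrite !mul0r.
have q1 : 1 <= 1 + q by rewrite lerDl.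
apply: le_trans (H j (ltnSn j)) _.
have h1 := IH (fun i ij => H i (ltnW ij)).
have h2 : (1 + q) * D j <= j%:R * c * (1 + q) ^+ j.+1.
  by rewrite exprS mulrCA ler_wpM2l// (le_trans ler01).
have h3 : c <= c * (1 + q) ^+ j.+1 by rewrite ler_peMr// exprn_ege1.
have -> : j.+1%:R * c * (1 + q) ^+ j.+1 = j%:R * c * (1 + q) ^+ j.+1 + c * (1 + q) ^+ j.+1 by rewrite -natr1; ring.
exact: lerD.
Qed.

Variables (X z : A -> R -> R) (t : R).
Hypotheses (t0 : 0 <= t) (cX : forall a, {within `[0, +oo[, continuous (X a)})
  (XE : forall a s, 0 <= s -> X a s = z a s + \sum_c F a c * It s (X c)).

Let stp m : R := t / m.+1%:R.
Let tj m j : R := stp m * j%:R.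
Definition euler m a := z a t + stp m * \sum_c F a c * euler_sum (fun j a => z a (stp m * j%:R)) (stp m) m.+1 c.

Lemma euler_cvg a : (fun m => euler m a) @ \oo --> X a t.
Proof.
pose q := \sum_a \sum_c `|F a c|; have q0 : 0 <= q by apply: sumr_ge0 => ? _; apply: sumr_ge0.
have lX c : loc1 (X c) by exact: loc1_within.
(* [K * om] will bound the total error: the cardinal comes from the sum over components, [t] from
   the number of steps times their length, and the exponential from (1 + q t / (m + 1))^(m + 1). *)
pose K := q * (#|A|%:R * t * expR (q * t)).
have K0 : 0 <= K by rewrite !mulr_ge0 ?expR_ge0.
apply/cvgrPdist_le => e e0; pose om := e / (K + 1).
have K1 : 0 < K + 1 by rewrite ltr_wpDl.
have om0 : 0 < om by rewrite divr_gt0.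
have [M HM] : exists M, forall m, (M <= m)%N -> forall c j, (j <= m)%N ->
    forall s, tj m j <= s <= tj m j.+1 -> `|X c s - X c (tj m j)| <= om.
  suff [M _ HM] : \forall m \near \oo, forall c j, (j <= m)%N ->
    forall s, tj m j <= s <= tj m j.+1 -> `|X c s - X c (tj m j)| <= om by exists M.
  apply: filter_forall => c; have [h h0 H] := heine t (@cX c) om0.
  have t1 : 0 < t + 1 by rewrite ltr_wpDl.
  have ht : 0 < h / (t + 1) by rewrite divr_gt0.
  apply: filterS (near_infty_natSinv_lt (PosNum ht)) => m /= mh j jm s /andP[s1 s2].
  have m0 : 0 < (m.+1%:R : R) by rewrite ltr0n.
  have h0' : 0 <= stp m by rewrite divr_ge0.
  have tjt : tj m j.+1 <= t.
    rewrite /tj /stp mulrAC ler_pdivrMr// ler_wpM2l// ler_nat ltnS.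
    exact: jm.
  have s0 : 0 <= tj m j by rewrite mulr_ge0.
  apply: H; [by rewrite (le_trans s0 s1) (le_trans s2)|by rewrite s0 (le_trans s1 (le_trans s2 tjt))|].
  rewrite ger0_norm ?subr_ge0//; apply: (@le_lt_trans _ _ (stp m)).
    have -> : stp m = tj m j.+1 - tj m j by rewrite /tj -natr1; ring.
    by rewrite lerD2r.
  apply: (@le_lt_trans _ _ ((t + 1) * m.+1%:R^-1)); first by rewrite /stp ler_wpM2r ?invr_ge0// lerDl.
  by rewrite -ltr_pdivlMl// mulrC.
exists M => // m /= mM.
have h0 : 0 <= stp m by rewrite divr_ge0.
have tm : tj m m.+1 = t by rewrite /tj /stp -mulrA mulVf ?mulr1// pnatr_eq0.
pose E j c := euler_sum (fun j a => z a (tj m j)) (stp m) j c.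
(* The error is tracked on the integrals of the states: the values of [z] at the nodes cancel, and
   what is left is governed by the modulus of continuity of [X]. *)
pose D j c := stp m * E j c - It (tj m j) (X c).
pose dd j := \sum_c `|D j c|.
have tj0 j : 0 <= tj m j by rewrite mulr_ge0.
have FD j b : `|\sum_c F b c * D j c| <= \sum_c `|F b c| * `|D j c|.
  by apply: le_trans (ler_norm_sum _ _ _) _; apply: ler_sum => c _; rewrite normrM.
have FDD j b : \sum_c `|F b c| * `|D j c| <= (\sum_c `|F b c|) * dd j.
  rewrite mulr_suml; apply: ler_sum => c _; apply: ler_wpM2l => //.
  by rewrite /dd (bigD1 c)//= lerDl; apply: sumr_ge0.
have DS j c : D j.+1 c = D j c + stp m * (\sum_b F c b * D j b) + (stp m * X c (tj m j) - (It (tj m j.+1) (X c) - It (tj m j) (X c))).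
  rewrite /D /E /= -/(E j) -/(E j c) (XE _ (tj0 j)).
  have -> : \sum_b F c b * (stp m * E j b - It (tj m j) (X b)) = stp m * \sum_b F c b * E j b - \sum_b F c b * It (tj m j) (X b).
    by rewrite mulr_sumr -sumrB; apply: eq_bigr => b _; ring.
  ring.
have step j : (j < m.+1)%N -> dd j.+1 <= (1 + stp m * q) * dd j + #|A|%:R * (stp m * om).
  move=> jm; have ub c : `|D j.+1 c| <= `|D j c| + stp m * ((\sum_b `|F c b|) * dd j) + stp m * om.
    rewrite DS; apply: le_trans (ler_normD _ _) _; apply: lerD.
      apply: le_trans (ler_normD _ _) _; rewrite lerD2l normrM ger0_norm// ler_wpM2l//.
      exact: le_trans (FD j c) (FDD j c).
    have dt : tj m j.+1 - tj m j = stp m by rewrite /tj -natr1; ring.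
    have tt : tj m j <= tj m j.+1 by rewrite -subr_ge0 dt.
    by have := @It_incr_le (X c) (tj m j) (tj m j.+1) (X c (tj m j)) om (tj0 j) tt (lX c) (HM m mM c j jm); rewrite dt distrC.
  apply: le_trans (ler_sum _ (fun c _ => ub c)) _.
  have -> : \sum_c (`|D j c| + stp m * ((\sum_b `|F c b|) * dd j) + stp m * om) = dd j + stp m * (q * dd j) + #|A|%:R * (stp m * om).
    rewrite !big_split /=; congr (_ + _ + _); first by rewrite -mulr_sumr -mulr_suml.
    by rewrite mulr_natl -sumr_const.
  have -> : (1 + stp m * q) * dd j = dd j + stp m * (q * dd j) by ring.
  exact: lexx.
have D0 : dd 0%N <= 0.
  by rewrite /dd big1// => c _; rewrite /D /E /= mulr0 /tj mulr0 I0// subrr normr0.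
have cc0 : 0 <= #|A|%:R * (stp m * om) by rewrite mulr_ge0 ?(mulr_ge0 h0 (ltW om0)).
have Hd := geom_bound (mulr_ge0 h0 q0) cc0 D0 step.
have ex : (1 + stp m * q) ^+ m.+1 <= expR (q * t).
  apply: le_trans (_ : expR (stp m * q) ^+ m.+1 <= _).
    by rewrite lerXn2r ?nnegrE ?expR_ge0 ?expR_ge1Dx// addr_ge0// mulr_ge0.
  rewrite -expRM_natl ler_expR.
  have -> : m.+1%:R * (stp m * q) = q * tj m m.+1 by rewrite /tj; ring.
  by rewrite tm.
have HdK : q * dd m.+1 <= K * om.
  rewrite /K -mulrA ler_wpM2l//; apply: le_trans Hd _.
  have -> : m.+1%:R * (#|A|%:R * (stp m * om)) = #|A|%:R * tj m m.+1 * om by rewrite /tj; ring.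
  by rewrite tm mulrAC ler_wpM2r// ?(ltW om0)// ler_wpM2l// mulr_ge0.
have -> : X a t - euler m a = - \sum_c F a c * D m.+1 c.
  rewrite XE// /euler; have -> : \sum_c F a c * D m.+1 c = stp m * (\sum_c F a c * E m.+1 c) - \sum_c F a c * It t (X c).
    by rewrite mulr_sumr -sumrB; apply: eq_bigr => c _; rewrite /D tm; ring.
  by rewrite /E /tj; ring.
rewrite normrN; apply: le_trans (FD _ _) _; apply: le_trans (FDD _ _) _.
apply: le_trans (_ : _ <= q * dd m.+1) _.
  apply: ler_wpM2r; first exact: sumr_ge0.
  by rewrite /q [leRHS](bigD1 a)//= lerDl; apply: sumr_ge0 => b _; exact: sumr_ge0.
apply: le_trans HdK _; rewrite /om mulrCA ger_pMr// ler_pdivrMr// mul1r lerDl//.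
Qed.
End Euler.

Section SystemVersion.
Context {d : measure_display} {T : measurableType d} {R : realType}.
Variables (P : probability T R) (A : finType) (F : A -> A -> R).

Lemma version_euler_sum G (z : nat -> A -> T -> R) h j :
  (forall i a, (i < j)%N -> version P G (z i a)) ->
  forall a, version P G (fun w => euler_sum F (fun i a => z i a w) h j a).
Proof.
elim: j => [|j IH] H a /=; first exact: version_cst.
have {}IH b := IH (fun i a ij => H i a (ltnW ij)) b.
apply: versionD => //; apply: versionD; first exact: H.
by apply: versionZ; apply: version_sum => c; exact: versionZ.
Qed.

(** Each Euler value is a finite combination of values of [z] at times up to [t], so it has a
    version, and the limit keeps one by [version_lim]. *)
Lemma system_version G (X z : A -> R -> T -> R) t a : 0 <= t ->
  (forall a s, 0 <= s <= t -> version P G (z a s)) ->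
  {ae P, forall w, forall a, {within `[0, +oo[, continuous (X a ^~ w)}} ->
  {ae P, forall w, forall a s, 0 <= s -> X a s w = z a s w + \sum_c F a c * It s (X c ^~ w)} ->
  version P G (X a t).
Proof.
move=> t0 vz hc he; apply: (version_lim (S := fun m w => euler F (fun a s => z a s w) t m a)); last first.
  by apply: filterS2 hc he => w hc he; exact: (euler_cvg (X := fun a s => X a s w) (z := fun a s => z a s w) t0 hc he).
move=> m; have m0 : 0 < (m.+1%:R : R) by rewrite ltr0n.
apply: versionD; first by apply: vz; rewrite t0 lexx.
apply: versionZ; apply: version_sum => c; apply: versionZ.
apply: (@version_euler_sum G (fun j a w => z a (t / m.+1%:R * j%:R) w)) => i b im; apply: vz.
rewrite mulr_ge0 ?divr_ge0//= mulrAC ler_pdivrMr// ler_wpM2l// ler_nat; exact: ltnW.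
Qed.
End SystemVersion.

(** * Joint measurability together with adaptedness *)

Section Progressive.
Context {d : measure_display} {T : measurableType d} {R : realType}.
Variables (P : probability T R) (G : R -> set_system T).
Hypotheses (Gm : forall s t, s <= t -> <<s G s>> `<=` <<s G t>>) (Gs : forall t, <<s G t>> `<=` measurable).

Lemma progressive_version (X : R -> T -> R) : (forall t, 0 <= t -> version P (G t) (X t)) ->
  {ae P, forall w, {within `[0, +oo[, continuous (X ^~ w)}} ->
  exists X' : R -> T -> R, [/\ mproc X', forall t, 0 <= t -> gmeas (G t) (X' t) &
    {ae P, forall w, forall t, 0 <= t -> X t w = X' t w}].
Proof.
move=> vX cX; pose q m j : R := j%:R / m.+1%:R.
have q0 m j : 0 <= q m j by rewrite divr_ge0.
pose xi m j := s2val (cid2 (vX _ (q0 m j))).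
have gxi m j : gmeas (G (q m j)) (xi m j) by rewrite /xi; case: cid2.
have exi m j : {ae P, forall w, X (q m j) w = xi m j w} by rewrite /xi; case: cid2.
(* Cells of length 1 / (m + 1) cover [0, m + 1[. On a cell the value is that of its left endpoint,
   so at time [t] only nodes up to [t] contribute and adaptedness is kept. *)
pose b m t w := \sum_(j < m.+1 * m.+1) \1_(`[q m j, q m j.+1[%classic) t * xi m j w.
have mxi m j : measurable_fun setT (xi m j).
  move=> _ E mE; rewrite setTI; apply: (Gs (t := q m j)); exact: gxi.
exists (fun t w => fine (limn_esup (fun m => (b m t w)%:E))); split.
- apply: (measurableT_comp (@fine_measurable _ setT measurableT)).
  apply: (@measurable_fun_limn_esup _ _ _ setT (fun m (z : R * T) => (b m z.1 z.2)%:E)) => m; apply/measurable_EFinP.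
  apply: measurable_sum => j; apply: measurable_funM.
    have mI : measurable_fun setT (\1_(`[q m j, q m j.+1[%classic) : R -> R) by exact: measurable_indic.
    exact: (measurableT_comp mI).
  exact: (measurableT_comp (mxi m j)).
- move=> t t0; apply/gmeasP; apply: (measurableT_comp (@fine_measurable _ setT measurableT)).
  apply: measurable_fun_limn_esup => m; apply/measurable_EFinP; apply/gmeasP.
  apply: gmeas_sum => j; have [qt|tq] := leP (q m j) t.
    by apply: gmeasZ; apply: gmeas_sub (gxi m j); exact: Gm.
  rewrite (_ : (fun w => _) = fun=> 0); first exact: gmeas_cst.
  apply/funext => w; rewrite indicE memNset ?mul0r//= in_itv/= => /andP[].
  by rewrite leNgt tq.
(* The nodes are countably many, so one null set serves all times. *)
have := ae_foralln (fun m => ae_foralln (exi m)); apply: filterS2 cX => w cX e t t0.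
have c : (fun m => b m t w) @ \oo --> X t w.
  apply/cvgrPdist_le => eps eps0; have [h h0 H] := heine t cX eps0.
  have t1 : 0 < (t + 1)^-1 by rewrite invr_gt0 ltr_wpDl.
  apply: filterS2 (near_infty_natSinv_lt (PosNum h0)) (near_infty_natSinv_lt (PosNum t1)) => m /= mh mt.
  have m0 : 0 < (m.+1%:R : R) by rewrite ltr0n.
  have tm : t < m.+1%:R.
    by rewrite ltf_pV2 ?posrE// in mt; [apply: lt_trans mt; rewrite ltrDl|rewrite ltr_wpDl].
  pose j := Num.truncn (t * m.+1%:R).
  have /truncn_itv/andP[j1 j2] : 0 <= t * m.+1%:R by rewrite mulr_ge0.
  have jm : (j < m.+1 * m.+1)%N.
    by rewrite -(ltr_nat R) natrM (le_lt_trans j1)// ltr_pM2r.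
  have qj : q m j <= t < q m j.+1 by rewrite /q ler_pdivrMr// ltr_pdivlMr// j1.
  have -> : b m t w = xi m j w.
    rewrite /b (bigD1 (Ordinal jm))//= indicE mem_set ?mul1r; last by rewrite /= in_itv.
    rewrite big1 ?addr0// => i ij; rewrite indicE memNset ?mul0r//= in_itv/= => /andP[i1 i2].
    have [q1 q2] := andP qj; have h1 := le_lt_trans i1 q2; have h2 := le_lt_trans q1 i2.
    rewrite /q !ltr_pM2r ?invr_gt0// !ltr_nat in h1 h2.
    by case/eqP: ij; apply/val_inj => /=; apply/eqP; rewrite eqn_leq; rewrite ltnS in h1; rewrite ltnS in h2; rewrite h1 h2.
  have [q1 q2] := andP qj; rewrite -e; apply: H; rewrite ?t0 ?lexx ?q0//.
  rewrite ger0_norm ?subr_ge0// ltrBlDl (lt_trans q2)//.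
  by rewrite /q -natr1 mulrDl mul1r ltrD2l.
have c' : (fun m => (b m t w)%:E) @ \oo --> (X t w)%:E by apply: cvg_EFin => //; exact: nearW.
by rewrite (cvg_limn_einf_sup c').2.
Qed.
End Progressive.

Lemma meanD {R : realType} n N (y z : 'I_N -> 'cV[R]_n) : mean (fun i => y i + z i) = mean y + mean z.
Proof. by rewrite /mean -scalerDr big_split. Qed.

Lemma qform_bound {R : realType} n (X : 'M[R]_n) : exists2 CX, 0 <= CX & forall z, qform X z <= CX * sqn z.
Proof.
have [C C0 HC] := form_bound X; exists (C + C); first by rewrite addr_ge0.
by move=> z; rewrite qformE (le_trans (ler_norm _))// (le_trans (HC z z))// mulrDr mulrDl.
Qed.

(** * Comparison of costs *)

Section Est.
Context {d : measure_display} {T : measurableType d} {R : realType} {n r : nat}.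
Variable Pr : probability T R.
Variables (rho : R) (A G : 'M[R]_n) (B : 'M[R]_(n, r)) (Rm : 'M[R]_r)
  (f sg : R -> 'cV[R]_n) (x0 : nat -> T -> 'cV[R]_n) (xbar0 : 'cV[R]_n) (W : nat -> R -> T -> R) (C0 : R)
  (P Pi : 'M[R]_n) (s xbar : R -> 'cV[R]_n).
Hypotheses (rho0 : 0 < rho) (hf : Crho2 rho f) (hsg : Crho2 rho sg)
  (hW : forall i, brownian_motion Pr (W i))
  (hWindep : mutually_independent Pr (fun i => sigma_rv `[0, +oo[ (W i)))
  (hx0 : forall i (k : 'I_n), measurable_fun setT (fun w => x0 i w k 0))
  (hx0indep : mutually_independent Pr (sigma_init x0))
  (hx0mean : forall i (k : 'I_n), ('E_Pr[fun w => x0 i w k 0%R] = (xbar0 k 0%R)%:E)%E)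
  (hx0var : forall i, (\int[Pr]_w (sqn (x0 i w))%:E < C0%:E)%E)
  (hx0W : independent2 Pr (<<s \bigcup_i sigma_init x0 i >>)
                          (<<s \bigcup_i sigma_rv `[0, +oo[ (W i) >>))
  (hs : Crho2 rho s) (hxbar : Crho2 rho xbar) (hxbar0 : xbar 0 = xbar0)
  (hxbarode : forall t : R, 0 < t -> derivable xbar t 1 /\
    'D_1 xbar t = (A + G) *m xbar t - BRB B Rm *m (Pi *m xbar t + s t) + f t).

Let x0L2' := x0L2 hx0 hx0var.
Let csg := hsg.1.
Notation S := (BRB B Rm).
Notation leb := (@lebesgue_measure R).

Section Agents.
Variables (N : nat) (N0 : (0 < N)%N).
Notation futureN := (future W N).
Let I := ('I_N * 'I_n)%type.

Section Sys.
Variables (u : 'I_N -> R -> T -> 'cV[R]_r) (x : 'I_N -> R -> T -> 'cV[R]_n).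
Hypothesis hx : state_process Pr x0 W A G B f sg u x.
Variables (M1 M2 : 'M[R]_n) (v : 'I_N -> R -> T -> 'cV[R]_n).
Hypotheses (hv : forall i, vorthproc Pr futureN (v i))
  (hF : forall i t w, pos (drift A G B f u x i) t w =
    M1 *m pos (x i) t w + M2 *m mean (fun j => pos (x j) t w) + v i t w).

Let hF' (i : 'I_N) (k : 'I_n) (t : R) (w : T) : pos (drift A G B f u x i) t w k 0 =
  \sum_(c : I) ((i == c.1)%:R * M1 k c.2 + N%:R^-1 * M2 k c.2) * pos (x c.1) t w c.2 0 + v i t w k 0.
Proof. by rewrite hF mxE (lin_form M1 M2 (fun j => pos (x j) t w)). Qed.
Let FF (a c : I) : R := (a.1 == c.1)%:R * M1 a.2 c.2 + N%:R^-1 * M2 a.2 c.2.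
Let vv (a : I) t w := v a.1 t w a.2 0.
Let hvv (a : I) : orthproc Pr futureN (vv a).
Proof. exact: (hv a.1 a.2). Qed.

Lemma sys_innov_meas a : mproc (innov x0 A G B f u x a).
Proof. exact: (innov_meas hx0 hx (F := FF) hvv hF'). Qed.

Lemma sys_vsemimart Z (mZ : forall a : I, mproc (Z a))
  (Zito : forall (i : 'I_N) t, 0 <= t -> ito_integral Pr (W i) sg t (fun w => \col_k Z (i, k) t w)) i :
  vsemimart Pr futureN Z (pos (x i)) (x0 i) (pos (drift A G B f u x i)) (noise_row i).
Proof. exact: (state_vsemimart hW hWindep csg hx0 hx0W x0L2' hx (F := FF) hvv hF' mZ Zito). Qed.
End Sys.

Variable xh : 'I_N -> R -> T -> 'cV[R]_n.
Notation uh := (decentralized_law B Rm P Pi xbar s xh).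
Hypothesis hxh : state_process Pr x0 W A G B f sg uh xh.

Definition vhat t := f t + (- S) *m ((Pi - P) *m xbar t + s t).

Lemma vhat_Crho2 : Crho2 rho vhat.
Proof. by apply: Crho2D => //; apply: Crho2_mx => //; apply: Crho2D => //; exact: Crho2_mx. Qed.

Lemma mean_pos m (x : 'I_N -> R -> T -> 'cV[R]_m) t w : mean (fun j => pos (x j) t w) = hp t *: mean_state x t w.
Proof. by rewrite /mean /mean_state -scaler_sumr scalerA mulrC -scalerA. Qed.

Lemma drift_xh i t w : pos (drift A G B f uh xh i) t w =
  (A - S *m P) *m pos (xh i) t w + G *m mean (fun j => pos (xh j) t w) + det vhat t w.
Proof.
rewrite mean_pos {1}/pos /drift /decentralized_law; move: (mean_state xh t w) => m.
rewrite /det /pos -!scalemxAr -!scalerDr; congr (_ *: _); rewrite /vhat /BRB.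
rewrite mulmxN !mulNmx !mulmxBl !mulmxDr -!mulmxA.
repeat match goal with |- context [mulmx ?a ?b] => move: (mulmx a b) => ? end.
by apply/matrixP => k l; rewrite !mxE; ring.
Qed.

Let hvh (i : 'I_N) : vorthproc Pr futureN (det vhat).
Proof. by move=> k; exact: (det_orthproc rho0 hW N k vhat_Crho2). Qed.

(** The noise extracted from the closed loop serves as the common noise for the states of all
    controls. *)
Definition Zh : I -> R -> T -> R := innov x0 A G B f uh xh.
Lemma mZh a : mproc (Zh a).
Proof. exact: (sys_innov_meas hxh hvh drift_xh). Qed.
Lemma Zh_ito (i : 'I_N) t : 0 <= t -> ito_integral Pr (W i) sg t (fun w => \col_k Zh (i, k) t w).
Proof. exact: (innov_ito hxh). Qed.

Let tL2 := @futureL2 _ _ _ Pr W hW N.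
Let zl := Z_lproc hW hWindep csg mZh Zh_ito.
Let z2 := Z_L2 hW csg mZh Zh_ito.
Let zinv := Z_inv hW csg mZh Zh_ito.
Let z0 := Z_ip0 hW hWindep csg mZh Zh_ito.
Let zz := Z_cov hW hWindep csg mZh Zh_ito.
Let gl := @noise_cov_loc1 _ _ _ csg N.
Let gm := @noise_cov_meas _ _ _ csg N.
Definition sys_lyap := lyap_bound tL2 zl z2 zinv z0 zz gl gm rho0.
Definition sys_cross := vcross zl z2 zinv z0 zz gl gm rho0.

Lemma xh_vsemimart i : vsemimart Pr futureN Zh (pos (xh i)) (x0 i) (pos (drift A G B f uh xh i)) (noise_row i).
Proof. exact: (sys_vsemimart hxh hvh drift_xh mZh Zh_ito). Qed.

Definition xbar_drift t := (A + G) *m xbar t + (- S) *m (Pi *m xbar t + s t) + f t.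

Lemma xbar_drift_Crho2 : Crho2 rho xbar_drift.
Proof.
apply: Crho2D => //; apply: Crho2D => //; first exact: Crho2_mx.
by apply: Crho2_mx => //; apply: Crho2D => //; exact: Crho2_mx.
Qed.

Lemma xbar_vsemimart : vsemimart Pr futureN Zh (det xbar) (fun _ => xbar0) (det xbar_drift) (fun _ _ => 0).
Proof.
rewrite -hxbar0; apply: (det_vsemimart rho0 hW _ _ hxbar xbar_drift_Crho2) => t t0.
by have [d1 ->] := hxbarode t0; split => //; rewrite /xbar_drift mulNmx.
Qed.

Definition mean_err t w := mean (fun i => pos (xh i) t w) - det xbar t w.

Lemma mean_err_vsemimart : vsemimart Pr futureN Zh mean_err (fun w => mean (fun i : 'I_N => x0 i w) - xbar0)
  (fun t w => mean (fun i => pos (drift A G B f uh xh i) t w) - det xbar_drift t w)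
  (fun k a => N%:R^-1 * \sum_(i < N) noise_row i k a - 0).
Proof. by apply: (vsemimartB tL2 (vsemimart_mean tL2 xh_vsemimart) xbar_vsemimart). Qed.

(** [xbar] solves the averaged closed loop without noise, so all forcing terms cancel and the error
    is driven by the averaged noise alone, through the matrix of the Hurwitz assumption. *)
Lemma mean_err_lin t w : mean (fun i => pos (drift A G B f uh xh i) t w) - det xbar_drift t w = (A - S *m P + G) *m mean_err t w.
Proof.
pose m := mean (fun i => pos (xh i) t w).
have -> : mean (fun i => pos (drift A G B f uh xh i) t w) = (A - S *m P) *m m + G *m m + det vhat t w.
  transitivity (mean (fun i => ((A - S *m P) *m pos (xh i) t w + G *m m) + det vhat t w)).
    by congr mean; apply/funext => i; rewrite drift_xh.
  by rewrite meanD meanD mean_mul !mean_cst.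
rewrite /mean_err -/m /det /pos /vhat /xbar_drift; move: m (hp t) => m h.
rewrite !(mulmxDl, mulmxDr, mulmxBl, mulmxBr, mulNmx, mulmxN) -!scalemxAr -!mulmxA.
repeat match goal with |- context [mulmx ?a ?b] => move: (mulmx a b) => ? end.
by apply/matrixP => k l; rewrite !mxE; ring.
Qed.

Definition sigma_energy := \int[leb]_t (hp t * expR (- rho * t) * sqn (sg t)).

Lemma sigma_energy_ge0 : 0 <= sigma_energy.
Proof. by apply: intE_ge0 => t; rewrite !mulr_ge0 ?hp_ge0 ?expR_ge0 ?sqn_ge0. Qed.

Lemma zero_L2r p m (Y : R -> T -> 'cV[R]_m) : vL2r Pr rho (fun t w => (0 : 'M[R]_(p, m)) *m Y t w).
Proof. by under eq_fun do under eq_fun do rewrite mul0mx; exact: cst_L2r. Qed.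

Lemma ipr0l (b : R -> T -> R) : ipr Pr rho (fun _ _ => 0) b = 0.
Proof. by rewrite /ipr /ip /wb; under eq_fun do rewrite mulr0 mul0r; exact: intE_0. Qed.

Lemma iprv0 m : iprv Pr rho (fun (_ : R) (_ : T) => 0 : 'cV[R]_m) (fun _ _ => 0) = 0.
Proof. by rewrite /iprv big1// => k _; under eq_fun do under eq_fun do rewrite mxE; exact: ipr0l. Qed.

Section noise_bounds.
Variables (X : 'M[R]_n) (CX k0 : R).
Hypotheses (CX0 : 0 <= CX) (HCX : forall z, qform X z <= CX * sqn z) (k00 : 0 <= k0).
(** The factor [k0] is the noise level: N^-1 for the mean error, 1 for a single agent, 0 for
    differences of states. *)
Definition noise_bound t := k0 * (normal_m2 * (hp t * (CX * sqn (sg t)))).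
Lemma noise_bound_ge0 t : 0 <= noise_bound t.
Proof. by rewrite /noise_bound !mulr_ge0 ?hp_ge0 ?sqn_ge0 ?normal_m2_ge0. Qed.
Lemma noise_boundE : (fun t => hp t * expR (- rho * t) * noise_bound t) = fun t => k0 * normal_m2 * CX * (hp t * expR (- rho * t) * sqn (sg t)).
Proof.
apply/funext => t; rewrite /noise_bound -[in RHS](hp_idem t); ring.
Qed.
Lemma noise_bound_intg : intg leb (fun t => hp t * expR (- rho * t) * noise_bound t).
Proof. by rewrite noise_boundE; apply: intgZ; exact: Crho2_intg. Qed.
Lemma noise_bound_int : \int[leb]_t (hp t * expR (- rho * t) * noise_bound t) = k0 * normal_m2 * CX * sigma_energy.
Proof. by rewrite noise_boundE intE_Z//; exact: Crho2_intg. Qed.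
Lemma noise_bound_rate (g : 'I_n -> I -> R) t : (forall k l, cov_rate (noise_cov sg (N := N)) (g k) (g l) t = k0 * (normal_m2 * (hp t * (sg t k 0 * sg t l 0)))) ->
  \sum_(k < n) \sum_(l < n) X k l * cov_rate (noise_cov sg (N := N)) (g k) (g l) t <= noise_bound t.
Proof.
move=> h; have -> : \sum_(k < n) \sum_(l < n) X k l * cov_rate (noise_cov sg (N := N)) (g k) (g l) t = k0 * (normal_m2 * (hp t * qform X (sg t))).
  rewrite -qform_sum2 !mulr_sumr; apply: eq_bigr => k _; rewrite !mulr_sumr; apply: eq_bigr => l _.
  by rewrite h; ring.
by rewrite /noise_bound !ler_wpM2l ?normal_m2_ge0 ?hp_ge0.
Qed.
End noise_bounds.

(** Initial variance and noise covariance both carry the factor 1 / N, and there is neither input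
    nor output in the error equation. *)
Lemma mean_err_bound X c C CX : lyap_form (A - S *m P + G - (rho / 2)%:M) (0 : 'M[R]_n) X c C ->
  0 <= CX -> (forall z, qform X z <= CX * sqn z) ->
  vL2r Pr rho mean_err /\ c * iprv Pr rho mean_err mean_err <= (CX * C0 + normal_m2 * CX * sigma_energy) / N%:R.
Proof.
move=> hX CX0 HCX; have N1 : 0 <= (N%:R^-1 : R) by rewrite invr_ge0.
have v0 : vL2r Pr rho (fun (_ : R) (_ : T) => 0 : 'cV[R]_n) by exact: cst_L2r.
have lin t w : 0 <= t -> mean (fun i => pos (drift A G B f uh xh i) t w) - det xbar_drift t w = (A - S *m P + G) *m mean_err t w + 0.
  by rewrite mean_err_lin addr0.
have gE k l t : cov_rate (noise_cov sg (N := N)) (fun a : I => N%:R^-1 * \sum_(i < N) noise_row i k a - 0) (fun a : I => N%:R^-1 * \sum_(i < N) noise_row i l a - 0) t =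
    N%:R^-1 * (normal_m2 * (hp t * (sg t k 0 * sg t l 0))).
  by rewrite -cov_rate_mean//; congr cov_rate; apply/funext => a; rewrite subr0.
have [h1 h2] := sys_lyap hX mean_err_vsemimart lin v0 (zero_L2r _) (fun t _ => noise_bound_rate HCX N1 (fun k l => gE k l t))
  (fun t _ => noise_bound_ge0 CX0 N1 t) (noise_bound_intg CX N%:R^-1).
split => //; apply: le_trans h2 _.
have e0 : iprv Pr rho (fun t w => (0 : 'M[R]_n) *m mean_err t w) (fun t w => (0 : 'M[R]_n) *m mean_err t w) = 0.
  by under eq_fun do under eq_fun do rewrite mul0mx; exact: iprv0.
rewrite e0 iprv0 addr0 mulr0 addr0 noise_bound_int.
have [i1 i2] := x0_mean_dev hx0 hx0indep hx0mean hx0var N0.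
have i3 : \int[Pr]_w qform X (mean (fun i : 'I_N => x0 i w) - xbar0) <= CX * (C0 / N%:R).
  apply: le_trans (ler_wpM2l CX0 i2); rewrite -intE_Z//.
  have [[Xs Xp] _ _ _] := hX.
  have q0 w : 0 <= qform X (mean (fun i : 'I_N => x0 i w) - xbar0).
    by have [->|/Xp/ltW//] := eqVneq (mean (fun i : 'I_N => x0 i w) - xbar0) 0; rewrite qform0.
  have c1 : intg Pr (fun w => CX * sqn (mean (fun i : 'I_N => x0 i w) - xbar0)) by exact: intgZ.
  have mk (k : 'I_n) : measurable_fun setT (fun w => (mean (fun i : 'I_N => x0 i w) - xbar0) k 0).
    rewrite (_ : (fun w => _) = fun w => N%:R^-1 * \sum_(i < N) x0 i w k 0 - xbar0 k 0).
      apply: measurable_funB => //; apply: measurable_funM => //.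
      by apply: measurable_sum => i; exact: hx0.
    by apply/funext => w; rewrite /mean !mxE summxE.
  apply: intE_le => //; apply: (intg_le _ _ c1) => [|w]; last by rewrite ger0_norm.
  under eq_fun do rewrite -qform_sum2; apply: measurable_sum => k; apply: measurable_sum => l.
  by apply: measurable_funM => //; exact: measurable_funM.
apply: le_trans (lerD i3 (lexx _)) _.
have -> : CX * (C0 / N%:R) + N%:R^-1 * normal_m2 * CX * sigma_energy = (CX * C0 + normal_m2 * CX * sigma_energy) / N%:R by ring.
exact: lexx.
Qed.

(** The mean field is replaced by [mean_err] plus a deterministic function, both of finite
    discounted energy; what remains is a single agent governed by the matrix of [closed_lyap]. *)
Lemma xh_L2r X c C X' c' C' : lyap_form (A - S *m P + G - (rho / 2)%:M) (0 : 'M[R]_n) X c C ->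
  lyap_form (A - S *m P - (rho / 2)%:M) (0 : 'M[R]_n) X' c' C' -> forall i, vL2r Pr rho (pos (xh i)).
Proof.
move=> hX hX' i; have [CX CX0 HCX] := qform_bound X; have [CX' CX0' HCX'] := qform_bound X'.
have [eL _] := mean_err_bound hX CX0 HCX.
pose v t w := G *m mean_err t w + (G *m det xbar t w + det vhat t w).
have vL : vL2r Pr rho v.
  by do !(apply: vL2rD => // || apply: vL2r_mx => //); apply: det_L2r => //; exact: vhat_Crho2.
have lin t w : 0 <= t -> pos (drift A G B f uh xh i) t w = (A - S *m P) *m pos (xh i) t w + v t w.
  move=> _; rewrite drift_xh /v /mean_err mulmxBr -addrA; congr (_ + _).
  by rewrite addrA subrK.
have gE k l t : cov_rate (noise_cov sg (N := N)) (noise_row i k) (noise_row i l) t = 1 * (normal_m2 * (hp t * (sg t k 0 * sg t l 0))).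
  by rewrite cov_rate_gd /noise_cov /= eqxx !mul1r.
have [] := sys_lyap hX' (xh_vsemimart i) lin vL (zero_L2r _) (fun t _ => noise_bound_rate HCX' ler01 (fun k l => gE k l t))
  (fun t _ => noise_bound_ge0 CX0' ler01 t) (noise_bound_intg CX' 1).
by [].
Qed.

Section Comp.
Variables (Gam Q sQ : 'M[R]_n) (eta : 'cV[R]_n).
Hypotheses (Qs : Q^T = Q) (hR : posdefmx Rm) (hsQ : is_sqrtmx Q sQ) (hP : posdefmx P)
  (hPric : riccati rho A B Rm Q P) (hPi : posdefmx Pi)
  (hPiric : riccati rho (A + G) B Rm ((1%:M - Gam)^T *m Q *m (1%:M - Gam)) Pi)
  (hsode : forall t : R, 0 < t -> derivable s t 1 /\
    rho *: s t = 'D_1 s t + (A + G - BRB B Rm *m Pi)^T *m s t + Pi *m f t - etabar Gam Q eta).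
Hypothesis xhL : forall i, vL2r Pr rho (pos (xh i)).

Lemma L2r_of (y F : R -> T -> R) : mproc y -> rintg Pr rho F -> (forall t w, 0 <= t -> y t w ^+ 2 <= F t w) -> L2r Pr rho y.
Proof.
move=> my iF h; split => //; have mw : measurable_fun setT (wb rho y).
  by apply: measurable_funM; [apply: (measurableT_comp (measurable_hw rho))|exact: my].
split => //; apply: (intg_le _ _ iF) => [|[t w]]; first exact: measurable_funX.
rewrite ger0_norm ?sqr_ge0// /wb exprMn expr2 hw_sqr /=.
have [t0|t0] := boolP (0 <= t); first by rewrite ler_wpM2l ?h// mulr_ge0 ?hp_ge0 ?expR_ge0.
by rewrite /hp (negbTE t0) !mul0r.
Qed.

Lemma pos1 m (Y : R -> T -> 'cV[R]_m) t w : 0 <= t -> pos Y t w = Y t w.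
Proof. by move=> t0; rewrite /pos hp1// scale1r. Qed.

Lemma mproc_pos_sqn m (Y : R -> T -> 'cV[R]_m) : measurable_process Y ->
  measurable_fun setT (fun z : R * T => hp z.1 * sqn (Y z.1 z.2)).
Proof.
move=> mY; rewrite (_ : (fun z => _) = fun z : R * T => \sum_(k < m) pos Y z.1 z.2 k 0 * pos Y z.1 z.2 k 0).
  by apply: measurable_sum => k; apply: measurable_funM; exact: (mproc_pos k mY).
apply/funext => z; rewrite /sqn mulr_sumr; apply: eq_bigr => k _.
by rewrite !posE mulrACA hp_idem expr2.
Qed.

Section Any.
Variables (u : 'I_N -> R -> T -> 'cV[R]_r) (x : 'I_N -> R -> T -> 'cV[R]_n).
Hypothesis hx : state_process Pr x0 W A G B f sg u x.

Lemma drift_gen i t w : pos (drift A G B f u x i) t w =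
  A *m pos (x i) t w + G *m mean (fun j => pos (x j) t w) + (B *m pos (u i) t w + det f t w).
Proof.
rewrite mean_pos {1}/pos /drift; move: (mean_state x t w) => m.
rewrite /det /pos -!scalemxAr -!scalerDr; congr (_ *: _).
by rewrite !addrA -!addrA; congr (_ + _); rewrite addrCA.
Qed.

Lemma drift_L2r i : (forall i, vL2r Pr rho (pos (x i))) -> vL2r Pr rho (pos (u i)) -> vL2r Pr rho (pos (drift A G B f u x i)).
Proof.
move=> hX hU; rewrite (_ : pos _ = fun t w => A *m pos (x i) t w + G *m mean (fun j => pos (x j) t w) + (B *m pos (u i) t w + det f t w)).
  by do !(apply: vL2rD => // || apply: vL2r_mx => // || apply: vL2r_mean => //); exact: det_L2r.
by apply/funext => t; apply/funext => w; exact: drift_gen.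
Qed.

Definition run i t w := run_cost Gam Q Rm eta (fun j => pos (x j) t w) (fun j => pos (u j) t w) i.

Lemma run_ge0 i t w : 0 <= run i t w.
Proof.
rewrite /run /run_cost (qform_sQ hsQ) addr_ge0 ?sqn_ge0//.
by have [_ Rp] := hR; case: (eqVneq (pos (u i) t w) 0) => [->|/Rp/ltW//]; rewrite qform0.
Qed.

Hypothesis mu : forall i, measurable_process (u i).
Let mX i k : mproc (fun t w => pos (x i) t w k 0).
Proof. by have [mx _ _ _] := hx; exact: mproc_pos. Qed.
Let mU i k : mproc (fun t w => pos (u i) t w k 0).
Proof. exact: mproc_pos. Qed.

Lemma mproc_qform m (M : 'M[R]_m) (Y : R -> T -> 'cV[R]_m) : (forall k, mproc (fun t w => Y t w k 0)) ->
  mproc (fun t w => qform M (Y t w)).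
Proof.
move=> mY; rewrite (_ : (fun t w => _) = fun t w => \sum_(k < m) \sum_(l < m) M k l * (Y t w k 0 * Y t w l 0)).
  by apply: mproc_sum => k; apply: mproc_sum => l; apply: mprocZ; exact: mprocM.
by apply/funext => t; apply/funext => w; rewrite qform_sum2.
Qed.

Definition track i t w := pos (x i) t w - Gam *m mean (fun j => pos (x j) t w) - eta.

Lemma mproc_track i k : mproc (fun t w => track i t w k 0).
Proof.
rewrite (_ : (fun t w => _) = fun t w => pos (x i) t w k 0 +
   (-1 * (\sum_(l < n) Gam k l * (N%:R^-1 * \sum_(j < N) pos (x j) t w l 0)) + - eta k 0)).
  apply: mprocD => //; apply: mprocD; last exact: measurable_cst.
  apply: mprocZ; apply: mproc_sum => l; apply: mprocZ; apply: mprocZ; apply: mproc_sum => j; exact: mX.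
apply/funext => t; apply/funext => w; rewrite /track !mxE addrA mulN1r; congr (_ - _ - _).
by apply: eq_bigr => l _; rewrite /mean mxE summxE.
Qed.

Lemma mproc_run i : mproc (run i).
Proof.
apply: mprocD; [apply: mproc_qform; exact: mproc_track|apply: mproc_qform; exact: mU].
Qed.

Lemma agent_cost_LP i : agent_cost Pr rho Q Gam Rm eta u x i =
  (\int[(@lebesgue_measure R \x Pr)%E]_z (hp z.1 * expR (- rho * z.1) * run i z.1 z.2)%:E)%E.
Proof.
rewrite /agent_cost -running_LP; last 2 first.
- by apply: measurable_funM; [apply: (measurableT_comp measurable_hp)|exact: mproc_run].
- by move=> t w _; exact: run_ge0.
apply: eq_integral => w _; apply: eq_integral => t; rewrite inE /= in_itv /= andbT => t0.
rewrite /run /run_cost mean_pos !pos1//; rewrite hp1// scale1r.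
by [].
Qed.

Lemma agent_cost_fin i : (agent_cost Pr rho Q Gam Rm eta u x i < +oo)%E -> rintg Pr rho (run i).
Proof.
rewrite agent_cost_LP => h; apply: intg_ge0P => //.
  apply: measurable_funM; last exact: mproc_run.
  by apply: (measurableT_comp (exp_hp_meas rho)).
by move=> z; rewrite mulr_ge0 ?run_ge0// mulr_ge0 ?hp_ge0 ?expR_ge0.
Qed.

Lemma agent_cost_rint i : rintg Pr rho (run i) -> agent_cost Pr rho Q Gam Rm eta u x i = (rint Pr rho (run i))%:E.
Proof. by move=> h; rewrite agent_cost_LP (intE_EFin h). Qed.

Lemma agent_cost_ge0 i : (0 <= agent_cost Pr rho Q Gam Rm eta u x i)%E.
Proof.
rewrite agent_cost_LP; apply: integral_ge0 => z _.
by rewrite lee_fin mulr_ge0 ?run_ge0// mulr_ge0 ?hp_ge0 ?expR_ge0.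
Qed.

Lemma track_L2r i : rintg Pr rho (run i) -> vL2r Pr rho (fun t w => sQ *m track i t w).
Proof.
move=> h k; apply: (L2r_of _ h) => [|t w t0].
  rewrite (_ : (fun t w => _) = fun t w => \sum_(l < n) sQ k l * track i t w l 0).
    by apply: mproc_sum => l; apply: mprocZ; exact: mproc_track.
  by apply/funext => t; apply/funext => w; rewrite mxE.
rewrite /run /run_cost -/(track i t w) (qform_sQ hsQ); apply: (@le_trans _ _ (sqn (sQ *m track i t w))).
  by rewrite /sqn (bigD1 k)//= lerDl; apply: sumr_ge0 => j _; exact: sqr_ge0.
rewrite lerDl; have [_ Rp] := hR; case: (eqVneq (pos (u i) t w) 0) => [->|/Rp/ltW//]; by rewrite qform0.
Qed.

Lemma run_L2r i : (forall j, vL2r Pr rho (pos (x j))) -> vL2r Pr rho (pos (u i)) -> rintg Pr rho (run i).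
Proof.
move=> hX hU; have hT : vL2r Pr rho (track i).
  by apply: vL2rB; [apply: vL2rB => //; apply: vL2r_mx => //; exact: vL2r_mean|exact: cst_L2r].
apply: (rintg_eq (F := fun t w => dot (track i t w) (Q *m track i t w) + dot (pos (u i) t w) (Rm *m pos (u i) t w))).
  by move=> t w t0; rewrite /run /run_cost !qformE.
by apply: rintgD; [apply: (rint_dot hT _).1|apply: (rint_dot hU _).1]; exact: vL2r_mx.
Qed.
End Any.

Lemma uh_pos i t w : pos (uh i) t w = feedback B Rm P Pi (fun j => pos (xh j) t w) (det xbar t w) (det s t w) i.
Proof.
rewrite /feedback /adjoint /det /pos /decentralized_law scalerN; congr (- _).
by rewrite scalemxAr !scalerDr !scalemxAr.
Qed.

Definition adj i t w := adjoint P Pi (fun j => pos (xh j) t w) (det xbar t w) (det s t w) i.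

Lemma adj_L2r i : vL2r Pr rho (adj i).
Proof.
by apply: vL2rD; [apply: vL2rD; apply: vL2r_mx => //; exact: det_L2r|exact: det_L2r].
Qed.

Lemma uh_L2r i : vL2r Pr rho (pos (uh i)).
Proof.
rewrite (_ : pos _ = fun t w => (- (invmx Rm *m B^T)) *m adj i t w).
  by apply: vL2r_mx => //; exact: adj_L2r.
by apply/funext => t; apply/funext => w; rewrite uh_pos mulNmx.
Qed.

Notation law := (decentralized_law B Rm P Pi xbar s).

Lemma lawE N' (y : 'I_N' -> R -> T -> 'cV[R]_n) i t w k : law y i t w k 0 = \sum_(l < n) (- (invmx Rm *m B^T)) k l *
   ((\sum_(j < n) P l j * y i t w j 0 + \sum_(j < n) (Pi - P) l j * xbar t j 0) + s t l 0).
Proof.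
rewrite /decentralized_law -mulNmx mxE; apply: eq_bigr => l _.
congr (_ * _); rewrite [LHS]mxE; congr (_ + _); rewrite [LHS]mxE.
by congr (_ + _); rewrite [LHS]mxE.
Qed.

Lemma law_meas (y : 'I_N -> R -> T -> 'cV[R]_n) i : measurable_process (y i) -> measurable_process (law y i).
Proof.
move=> mx k.
have D m (g : R -> 'cV[R]_m) l : Crho2 rho g -> measurable_fun (`[(0 : R), +oo[ `*` [set: T]) (fun p : R * T => g p.1 l 0).
  move=> hg; apply: (eq_measurable_fun (fun p : R * T => det g p.1 p.2 l 0)).
    by move=> p; rewrite inE => -[/=]; rewrite in_itv/= andbT => p0 _; rewrite posE hp1// mul1r.
  apply: (@measurable_funS _ _ _ _ setT) => //.
  have [h _] : L2r Pr rho (fun t (w : T) => det g t w l 0) by exact: det_L2r.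
  exact: h.
rewrite (_ : (fun p => _) = fun p : R * T => \sum_(l < n) (- (invmx Rm *m B^T)) k l *
   ((\sum_(j < n) P l j * y i p.1 p.2 j 0 + \sum_(j < n) (Pi - P) l j * xbar p.1 j 0) + s p.1 l 0)); last first.
  by apply/funext => p; exact: lawE.
apply: measurable_sum => l; apply: measurable_funM => //; apply: measurable_funD; last exact: D.
apply: measurable_funD.
  by apply: measurable_sum => j; apply: measurable_funM => //; apply: mx.
by apply: measurable_sum => j; apply: measurable_funM => //; apply: D.
Qed.

Lemma uh_meas i : measurable_process (uh i).
Proof. by have [mx _ _ _] := hxh; exact: law_meas. Qed.

Definition sdrift t := rho *: s t + ((- (A + G - S *m Pi)^T) *m s t + ((- Pi) *m f t + etabar Gam Q eta)).

Lemma cst_Crho2 m (c : 'cV[R]_m) : Crho2 rho (fun _ => c).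
Proof.
apply: Crho2_of => //; first by move=> x; exact: cvg_cst.
by under eq_fun do rewrite mulrC; apply: intgZ; exact: exp_intg.
Qed.

Lemma sdrift_Crho2 : Crho2 rho sdrift.
Proof.
have e : (fun t => rho *: s t) = fun t => (rho%:M : 'M[R]_n) *m s t by apply/funext => t; rewrite mul_scalar_mx.
apply: Crho2D => //; first by rewrite e; exact: Crho2_mx.
by apply: Crho2D => //; [exact: Crho2_mx|apply: Crho2D => //; [exact: Crho2_mx|exact: cst_Crho2]].
Qed.

Lemma s_vsemimart : vsemimart Pr futureN Zh (det s) (fun _ => s 0) (det sdrift) (fun _ _ => 0).
Proof.
apply: (det_vsemimart rho0 hW _ _ hs sdrift_Crho2) => t t0; have [d1 d2] := hsode t0; split => //.
rewrite /sdrift d2 !mulNmx; move: ('D_1 s t) (_ *m s t) (Pi *m f t) (etabar _ _ _) => a b c e.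
by apply/matrixP => k l; rewrite !mxE; ring.
Qed.

Definition adj_drift i t w := P *m pos (drift A G B f uh xh i) t w + (Pi - P) *m det xbar_drift t w + det sdrift t w.

(** The initial value and the noise coefficients stay existential, since in [vcross] they meet a
    process that starts at 0 and carries no noise. *)
Lemma adj_vsemimart i : exists p0 g, vsemimart Pr futureN Zh (adj i) p0 (adj_drift i) g.
Proof.
by eexists; eexists; apply: (vsemimartD tL2 (vsemimartD tL2 (vsemimart_mx tL2 P (xh_vsemimart i)) (vsemimart_mx tL2 (Pi - P) xbar_vsemimart)) s_vsemimart).
Qed.

Lemma adj_drift_L2r i : vL2r Pr rho (adj_drift i).
Proof.
apply: vL2rD; last by apply: det_L2r => //; exact: sdrift_Crho2.
apply: vL2rD; apply: vL2r_mx => //; last by apply: det_L2r => //; exact: xbar_drift_Crho2.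
by apply: drift_L2r => //; exact: uh_L2r.
Qed.

Notation bpp i t w := (adjoint_rate A G Gam Q eta P Pi (fun j => pos (xh j) t w) (det xbar t w) (det s t w) i).

Lemma adj_drift_eq i t w : 0 <= t -> adj_drift i t w = rho *: adj i t w + bpp i t w.
Proof.
move=> t0; apply: (@adjoint_drift _ _ _ rho A G Gam Q B Rm eta P Pi hR hPric hPi hPiric _ _ _ _ _ _ _ (det f t w)).
- rewrite drift_gen uh_pos; move: (feedback _ _ _ _ _ _ _ _) => v; rewrite !addrA; congr (_ + _).
  by rewrite addrAC.
- by rewrite /det /xbar_drift !pos1// mulNmx.
- by rewrite /det /sdrift !pos1// !mulNmx !addrA.
Qed.

(** * Comparison with one admissible control *)

Section Versus.
Variables (u : 'I_N -> R -> T -> 'cV[R]_r) (x : 'I_N -> R -> T -> 'cV[R]_n).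
Hypotheses (hadm : admissible Pr x0 W rho u) (hx : state_process Pr x0 W A G B f sg u x).

Lemma adm_L2r i : vL2r Pr rho (pos (u i)).
Proof.
have [mu _ fin] := hadm i; have ms := mproc_pos_sqn mu.
have iF : rintg Pr rho (fun t w => sqn (u i t w)).
  apply: intg_ge0P.
  - rewrite (_ : (fun z => _) = fun z : R * T => expR (- rho * z.1) * (hp z.1 * sqn (u i z.1 z.2))).
      by apply: measurable_funM => //; apply: (measurableT_comp (measurable_expRZ _)).
    by apply/funext => z; ring.
  - by move=> z; rewrite mulr_ge0 ?sqn_ge0// mulr_ge0 ?hp_ge0 ?expR_ge0.
  - by move: fin; rewrite running_LP// => t w _; exact: sqn_ge0.
move=> k; apply: (L2r_of _ iF); first exact: mproc_pos.
move=> t w t0; rewrite pos1// /sqn (bigD1 k)//= lerDl.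
by apply: sumr_ge0 => j _; exact: sqr_ge0.
Qed.

(** This is where adaptedness of the control enters: its value at time [t] is independent of the
    increments after [t]. *)
Lemma adm_orthproc i : vorthproc Pr futureN (pos (u i)).
Proof.
move=> k; have hl := L2r_lproc rho0 (adm_L2r i k); split => //.
have [mu ad _] := hadm i.
apply: (@filterS _ (almost_everywhere leb) _ _ _ _ (lproc_L2_ae hl)) => t h t0; split; first exact: h.
move=> g [j [a [b [ta ab ->]]]].
apply: (filtration_perp hW hWindep hx0 hx0W t0 (h t0)) => // E mE.
rewrite (_ : (fun w => pos (u i) t w k 0) = fun w => u i t w k 0); first exact: ad.
by apply/funext => w; rewrite pos1.
Qed.

Let hvx (i : 'I_N) : vorthproc Pr futureN (fun t w => B *m pos (u i) t w + det f t w).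
Proof.
apply: (vorthprocD tL2); first by apply: (vorthproc_mx tL2); exact: adm_orthproc.
by move=> k; exact: (det_orthproc rho0 hW N k hf).
Qed.

(** The noise is the one extracted from [xh], which is what makes it cancel in [del_vsemimart]. *)
Lemma x_vsemimart i : vsemimart Pr futureN Zh (pos (x i)) (x0 i) (pos (drift A G B f u x i)) (noise_row i).
Proof. exact: (sys_vsemimart hx hvx (drift_gen u x) mZh Zh_ito). Qed.

Definition del i t w := pos (x i) t w - pos (xh i) t w.
Definition nu i t w := pos (u i) t w - pos (uh i) t w.
Definition del_drift i t w := pos (drift A G B f u x i) t w - pos (drift A G B f uh xh i) t w.
Definition dmean t w := mean (fun i => del i t w).
Definition nmean t w := mean (fun i => nu i t w).

Lemma nu_L2r i : vL2r Pr rho (nu i).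
Proof. by apply: vL2rB => //; [exact: adm_L2r|exact: uh_L2r]. Qed.

Lemma del_vsemimart i : vsemimart Pr futureN Zh (del i) (fun w => x0 i w - x0 i w) (del_drift i) (fun k a => noise_row i k a - noise_row i k a).
Proof. by apply: (vsemimartB tL2 (x_vsemimart i) (xh_vsemimart i)). Qed.

Lemma del_lin i t w : del_drift i t w = A *m del i t w + (B *m nu i t w + G *m dmean t w).
Proof.
rewrite /del_drift !drift_gen /del /nu /dmean /del meanB !mulmxBr.
repeat match goal with |- context [mulmx ?a ?b] => move: (mulmx a b) => ? end; move: (det f t w) => ?.
by apply/matrixP => k l; rewrite !mxE; ring.
Qed.

Lemma dmean_lin t w : mean (fun i => del_drift i t w) = (A + G) *m dmean t w + B *m nmean t w.
Proof.
transitivity (mean (fun i => A *m del i t w + (B *m nu i t w + G *m dmean t w))).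
  by congr mean; apply/funext => i; exact: del_lin.
by rewrite !meanD !mean_mul mean_cst// mulmxDl -!addrA [B *m _ + _]addrC.
Qed.

Hypothesis hfin : forall i, (agent_cost Pr rho Q Gam Rm eta u x i < +oo)%E.
Variables (X1 X2 : 'M[R]_n) (c1 C1 c2 C2 : R).
Hypotheses (hX1 : lyap_form (A - (rho / 2)%:M) sQ X1 c1 C1)
  (hX2 : lyap_form (A + G - (rho / 2)%:M) (sQ *m (1%:M - Gam)) X2 c2 C2).

Let mu' i : measurable_process (u i). Proof. by have [] := hadm i. Qed.

Lemma run_x_intg i : rintg Pr rho (run u x i).
Proof. by apply: (agent_cost_fin hx mu'). Qed.

(** A finite cost controls the tracking error only through the root of Q; the difference of two
    tracking errors no longer contains [eta]. *)
Lemma sdel_L2r i : vL2r Pr rho (fun t w => sQ *m (del i t w - Gam *m dmean t w)).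
Proof.
rewrite (_ : (fun t w => _) = fun t w => sQ *m track x i t w - sQ *m track xh i t w).
  apply: vL2rB => //; first exact: (track_L2r hx (run_x_intg i)).
  apply: vL2r_mx => //; apply: vL2rB; last exact: cst_L2r.
  by apply: vL2rB => //; apply: vL2r_mx => //; exact: vL2r_mean.
apply/funext => t; apply/funext => w; rewrite -mulmxBr; congr (_ *m _).
rewrite /track /dmean /del meanB mulmxBr; move: (Gam *m _) (Gam *m _) => a b.
by apply/matrixP => k l; rewrite !mxE; ring.
Qed.

Definition obs t w := sQ *m (1%:M - Gam) *m dmean t w.

Lemma obsE t w : obs t w = mean (fun i => sQ *m (del i t w - Gam *m dmean t w)).
Proof. by rewrite mean_mul meanB mean_cst// /obs -mulmxA mulmxBl mul1mx. Qed.

Lemma obs_L2r : vL2r Pr rho obs.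
Proof.
rewrite (_ : obs = fun t w => mean (fun i => sQ *m (del i t w - Gam *m dmean t w))).
  by apply: vL2r_mean => // i; exact: sdel_L2r.
by apply/funext => t; apply/funext => w; exact: obsE.
Qed.

Lemma nmean_L2r : vL2r Pr rho nmean.
Proof. by apply: vL2r_mean => // i; exact: nu_L2r. Qed.

Lemma cov_rate0 (g : 'I_n -> I -> R) k l t : (forall k a, g k a = 0) ->
  cov_rate (noise_cov sg (N := N)) (g k) (g l) t = 0 * (normal_m2 * (hp t * (sg t k 0 * sg t l 0))).
Proof.
by move=> h; rewrite mul0r /cov_rate big1// => a _; rewrite big1// => b _; rewrite h !mul0r.
Qed.

Lemma int_qform0 (X : 'M[R]_n) (Y : T -> 'cV[R]_n) : (forall w, Y w = 0) -> \int[Pr]_w qform X (Y w) = 0.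
Proof. by move=> h; under eq_fun do rewrite h qform0; exact: intE_0. Qed.

(** Averaging closes the equation: the mean difference is driven by [nmean] alone and observed
    through [obs], both of finite energy. It must come before [del_L2r], where it is an input. *)
Lemma dmean_bound : vL2r Pr rho dmean /\
  c2 * iprv Pr rho dmean dmean <= C2 * (iprv Pr rho obs obs + iprv Pr rho (fun t w => B *m nmean t w) (fun t w => B *m nmean t w)).
Proof.
have [CX CX0 HCX] := qform_bound X2.
have g0 (k : 'I_n) (a : I) : N%:R^-1 * \sum_(i < N) (noise_row i k a - noise_row i k a) = 0 :> R.
  by rewrite big1 ?mulr0// => i _; rewrite subrr.
have vL : vL2r Pr rho (fun t w => B *m nmean t w) by apply: vL2r_mx => //; exact: nmean_L2r.
have [h1 h2] := sys_lyap hX2 (vsemimart_mean tL2 del_vsemimart) (fun t w _ => dmean_lin t w) vL obs_L2r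
  (fun t _ => noise_bound_rate HCX (lexx 0) (fun k l => cov_rate0 k l t g0)) (fun t _ => noise_bound_ge0 CX0 (lexx 0) t) (noise_bound_intg CX 0).
split => //; apply: le_trans h2 _.
rewrite noise_bound_int !mul0r addr0 int_qform0 ?add0r// => w.
by rewrite (_ : (fun i : 'I_N => x0 i w - x0 i w) = fun _ => 0) ?mean_cst//; apply/funext => i; rewrite subrr.
Qed.

(** The output [sQ *m del i] is the one controlled by the cost plus a multiple of [dmean], already
    bounded. *)
Lemma del_L2r i : vL2r Pr rho (del i).
Proof.
have [CX CX0 HCX] := qform_bound X1; have [dL _] := dmean_bound.
have g0 (k : 'I_n) (a : I) : noise_row i k a - noise_row i k a = 0 :> R by rewrite subrr.
have vL : vL2r Pr rho (fun t w => B *m nu i t w + G *m dmean t w).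
  by apply: vL2rD; apply: vL2r_mx => //; exact: nu_L2r.
have oL : vL2r Pr rho (fun t w => sQ *m del i t w).
  rewrite (_ : (fun t w => _) = fun t w => sQ *m (del i t w - Gam *m dmean t w) + (sQ *m Gam) *m dmean t w).
    by apply: vL2rD; [exact: sdel_L2r|exact: vL2r_mx].
  by apply/funext => t; apply/funext => w; rewrite (mulmxBr sQ (del i t w)) mulmxA subrK.
by have [] := sys_lyap hX1 (del_vsemimart i) (fun t w _ => del_lin i t w) vL oL
  (fun t _ => noise_bound_rate HCX (lexx 0) (fun k l => cov_rate0 k l t g0)) (fun t _ => noise_bound_ge0 CX0 (lexx 0) t) (noise_bound_intg CX 0).
Qed.

Lemma x_L2r i : vL2r Pr rho (pos (x i)).
Proof.
rewrite (_ : pos _ = fun t w => del i t w + pos (xh i) t w); first by apply: vL2rD => //; exact: del_L2r.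
by apply/funext => t; apply/funext => w; rewrite /del subrK.
Qed.

Lemma del_drift_L2r i : vL2r Pr rho (del_drift i).
Proof.
apply: vL2rB; apply: drift_L2r => //; [exact: x_L2r|exact: adm_L2r|exact: uh_L2r].
Qed.

Definition crossr i t w := cross_rate A G Gam Q B Rm eta P Pi (fun j => pos (xh j) t w)
  (fun j => pos (x j) t w) (fun j => pos (u j) t w) (det xbar t w) (det s t w) i.

(** [vcross] for the adjoint state and del_i; by [adj_drift_eq] the terms in [rho] cancel. *)
Lemma crossr_rint i : rintg Pr rho (crossr i) /\ rint Pr rho (crossr i) = 0.
Proof.
have [p0 [g hp_]] := adj_vsemimart i.
have h := sys_cross hp_ (del_vsemimart i) (fun k w => _) (fun k a => subrr _) (adj_L2r i) (del_L2r i) (adj_drift_L2r i) (del_drift_L2r i).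
have {}h := h (fun k w => ltac:(by rewrite subrr mxE)).
have [i1 e1] := rint_dot (adj_L2r i) (del_L2r i).
have [i2 e2] := rint_dot (adj_drift_L2r i) (del_L2r i).
have [i3 e3] := rint_dot (adj_L2r i) (del_drift_L2r i).
have E t w : 0 <= t -> (dot (adj_drift i t w) (del i t w) + dot (adj i t w) (del_drift i t w)) + - rho * dot (adj i t w) (del i t w) = crossr i t w.
  move=> t0; rewrite adj_drift_eq// dotDl dotZl del_lin /crossr /cross_rate -!uh_pos -/(adj i t w) -/(del i t w).
  have -> : mean (fun j => pos (x j) t w) - mean (fun j => pos (xh j) t w) = dmean t w by rewrite -meanB.
  by rewrite -/(nu i t w) addrA; ring.
have i4 := rintgD (rintgD i2 i3) (rintgZ (- rho) i1).
split; first exact: (rintg_eq E i4).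
rewrite -(rint_eq Pr rho E) (rintD (rintgD i2 i3) (rintgZ (- rho) i1)) (rintD i2 i3) (rintZ _ i1) e1 e2 e3.
by rewrite mulNr h subrr.
Qed.

Lemma rint_iprv m (U : R -> T -> 'cV[R]_m) : vL2r Pr rho U ->
  rintg Pr rho (fun t w => sqn (U t w)) /\ rint Pr rho (fun t w => sqn (U t w)) = iprv Pr rho U U.
Proof.
by move=> hU; have := rint_dot hU hU; under eq_fun do under eq_fun do rewrite -sqnE.
Qed.

(** [kp] is the share of |dmean|^2 controlled by the quadratic functional: [kp1] and [kp2] turn
    [dmean_bound] into kp |dmean|^2 <= |obs|^2 + cR |nmean|^2 after integration. *)
Variables (cR CB CM kp : R).
Hypotheses (cR0 : 0 < cR) (hcR : forall z, cR * sqn z <= qform Rm z)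
  (hCB : forall z, sqn (B *m z) <= CB * sqn z)
  (hCM : forall z, sqn (gap_mx G Gam Q P *m z) <= CM * sqn z)
  (kp0 : 0 < kp) (kp1 : kp * C2 <= c2) (kp2 : kp * C2 * CB <= c2 * cR).

(** Integrating [cost_gap] removes the cross rates. Young's inequality splits the coupling term with
    weight [kp]: the part in [dmean] is absorbed by the quadratic functional, the part in [mean_err]
    is the loss. *)
Lemma cost_lower : vL2r Pr rho mean_err ->
  \sum_(i < N) rint Pr rho (run uh xh i) - N%:R * (kp^-1 * CM * iprv Pr rho mean_err mean_err) <= \sum_(i < N) rint Pr rho (run u x i).
Proof.
move=> eL; have [dL dB] := dmean_bound.
have nL := nmean_L2r; have oL := obs_L2r.
have [e1 E1] := rint_iprv oL; have [e2 E2] := rint_iprv nL; have [e3 E3] := rint_iprv dL; have [e4 E4] := rint_iprv eL.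
have rx i := run_x_intg i.
have rh i : rintg Pr rho (run uh xh i) by apply: run_L2r => //; exact: uh_L2r.
have cr i := crossr_rint i.
(* A pointwise lower bound for the cost gap; its negative term in [dmean] is compensated only after
   integration, by [kd] below. *)
pose F t w := N%:R * (sqn (obs t w) + cR * sqn (nmean t w) + (- kp) * sqn (dmean t w) + (- (kp^-1 * CM)) * sqn (mean_err t w)).
have iF : rintg Pr rho F by apply: rintgZ; apply: rintgD; [apply: rintgD; [apply: rintgD => //|]|]; exact: rintgZ.
have vF : rint Pr rho F = N%:R * (iprv Pr rho obs obs + cR * iprv Pr rho nmean nmean - kp * iprv Pr rho dmean dmean - kp^-1 * CM * iprv Pr rho mean_err mean_err).
  rewrite /F rintZ; last by apply: rintgD; [apply: rintgD; [apply: rintgD => //|]|]; exact: rintgZ.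
  rewrite rintD; [|by apply: rintgD; [apply: rintgD => //|]; exact: rintgZ|exact: rintgZ].
  rewrite rintD; [|by apply: rintgD => //; exact: rintgZ|exact: rintgZ].
  rewrite rintD//; last exact: rintgZ.
  by rewrite !rintZ// E1 E2 E3 E4 !mulNr.
pose G1 t w := \sum_(i < N) run u x i t w + (-1 * \sum_(i < N) run uh xh i t w + 2 * \sum_(i < N) crossr i t w).
have iG : rintg Pr rho G1.
  by apply: rintgD; [exact: rintg_sum|apply: rintgD; apply: rintgZ; apply: rintg_sum => // i; exact: (cr i).1].
have vG : rint Pr rho G1 = \sum_(i < N) rint Pr rho (run u x i) - \sum_(i < N) rint Pr rho (run uh xh i).
  have is1 : rintg Pr rho (fun t w => \sum_(i < N) run uh xh i t w) by exact: rintg_sum.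
  have is2 : rintg Pr rho (fun t w => \sum_(i < N) crossr i t w) by apply: rintg_sum => i; exact: (cr i).1.
  rewrite /G1 rintD; [|exact: rintg_sum|by apply: rintgD; exact: rintgZ].
  rewrite rintD; [|exact: rintgZ|exact: rintgZ].
  rewrite !rintZ// !rint_sum//; last by move=> i; exact: (cr i).1.
  by rewrite [X in _ + (_ + _ * X)]big1 ?mulr0 ?addr0 ?mulN1r// => i _; exact: (cr i).2.
have FG : rint Pr rho F <= rint Pr rho G1.
  apply: rint_le => // t w t0.
  have := cost_gap A G Gam B eta Pi hR Qs hP (fun j => pos (xh j) t w) (fun j => pos (x j) t w) (fun j => pos (u j) t w) (det xbar t w) (det s t w) N0.
  have := quad_lb Gam B P Pi hsQ (fun j => pos (xh j) t w) (fun j => pos (x j) t w) (fun j => pos (u j) t w) (det xbar t w) (det s t w) N0 cR0 hcR.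
  set q := \sum_(i < N) (_ + _).
  have -> : mean (fun j => pos (x j) t w) - mean (fun j => pos (xh j) t w) = dmean t w by rewrite -meanB.
  have -> : mean (fun i => pos (u i) t w - feedback B Rm P Pi (fun j => pos (xh j) t w) (det xbar t w) (det s t w) i) = nmean t w.
    by congr mean; apply/funext => i; rewrite /nu uh_pos.
  rewrite -/(mean_err t w) -/(obs t w) sumrB => hq hg.
  have -> : G1 t w = q + 2 * (N%:R * dot (gap_mx G Gam Q P *m mean_err t w) (dmean t w)).
    rewrite /G1 -hg mulN1r addrA; congr (_ - _ + _).
    apply: eq_bigr => i _; rewrite /run /run_cost; congr (_ + qform _ _); exact: uh_pos.
  have kpi : 0 < kp^-1 by rewrite invr_gt0.
  have y1 := dot_young (- (gap_mx G Gam Q P *m mean_err t w)) (dmean t w) kpi; rewrite dotNl sqnN invrK in y1.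
  have y2 : kp^-1 * sqn (gap_mx G Gam Q P *m mean_err t w) <= kp^-1 * CM * sqn (mean_err t w).
    by rewrite -mulrA ler_wpM2l// invr_ge0 ltW.
  have N1 : 0 <= (N%:R : R) by [].
  rewrite /F mulrDr; apply: le_trans (lerD hq (lexx _)).
  rewrite [2 * _]mulrCA -mulrDr -mulrDr ler_wpM2l//.
  move: y1 y2; move: (sqn _) (sqn _) (sqn _) (sqn _) (dot _ _) => a b c e g.
  move=> y1 y2; lra.
rewrite vF vG in FG.
have nB : iprv Pr rho (fun t w => B *m nmean t w) (fun t w => B *m nmean t w) <= CB * iprv Pr rho nmean nmean.
  have [e5 E5] := rint_iprv (vL2r_mx B nL).
  rewrite -E5 -E2 -rintZ//; apply: rint_le => //; first exact: rintgZ.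
have [_ c20 C20 _] := hX2.
have ob0 := iprv_ge0 Pr rho obs; have n0 := iprv_ge0 Pr rho nmean; have d0 := iprv_ge0 Pr rho dmean.
have kd : kp * iprv Pr rho dmean dmean <= iprv Pr rho obs obs + cR * iprv Pr rho nmean nmean.
  rewrite -(ler_pM2l c20) mulrCA; apply: le_trans (ler_wpM2l (ltW kp0) dB) _.
  apply: le_trans (_ : _ <= kp * C2 * iprv Pr rho obs obs + kp * C2 * CB * iprv Pr rho nmean nmean) _.
    rewrite mulrA mulrDr -[X in _ <= _ + X]mulrA lerD2l; apply: ler_wpM2l => //; apply: mulr_ge0 => //; exact: ltW.
  by rewrite mulrDr [X in _ <= _ + X]mulrA lerD// ler_wpM2r.
have N1 : 0 <= (N%:R : R) by [].
have : N%:R * (- (kp^-1 * CM * iprv Pr rho mean_err mean_err)) <= N%:R * (iprv Pr rho obs obs + cR * iprv Pr rho nmean nmean - kp * iprv Pr rho dmean dmean - kp^-1 * CM * iprv Pr rho mean_err mean_err).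
  rewrite ler_wpM2l//; move: kd; move: (kp * _) (cR * _) (_ * iprv _ _ mean_err mean_err) => a b c; lra.
move=> h; have {}h := le_trans h FG; rewrite mulrN in h.
by move: h; move: (N%:R * _) => a h; lra.
Qed.
End Versus.

(** * An adapted version of the decentralized control *)

Section Adapted.
Local Notation fil t := (filtration_gen x0 W N t).

Let Xr (a : I) t w := xh a.1 t w a.2 0.
Let za (a : I) t w := x0 a.1 w a.2 0 + (Zh a t w + It t (fun s => hp s * vhat s a.2 0)).
Let FF (a c : I) : R := (a.1 == c.1)%:R * (A - S *m P) a.2 c.2 + N%:R^-1 * G a.2 c.2.

Lemma za_version a t t' : 0 <= t' <= t -> version Pr (fil t) (za a t').
Proof.
move=> /andP[t'0 tt]; apply: (@version_sub _ _ _ Pr (fil t') (fil t) _ (filtration_gen_mono tt)).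
apply: versionD; first by apply: gmeas_version; exact: x0_filtration_gen.
apply: versionD; last exact: version_cst.
have h := Z_version x0 hW csg a.2 t'0 (colZ_meas mZh a.1 t') (Zh_ito a.1 t'0).
by rewrite (_ : Zh a t' = fun w => (\col_k Zh (a.1, k) t' w) a.2 0)//; apply/funext => w; rewrite mxE; case: (a).
Qed.

Lemma xh_cont : {ae Pr, forall w, forall a : I, {within `[0, +oo[, continuous (Xr a ^~ w)}}.
Proof. by have [_ c _ _] := hxh; apply: filterS c => w c a; exact: coord_within. Qed.

(** The closed loop in the form of [system_version]: initial state, noise and deterministic forcing
    are gathered in [za]. *)
Lemma xh_path : {ae Pr, forall w, forall (a : I) t, 0 <= t -> Xr a t w = za a t w + \sum_c FF a c * It t (Xr c ^~ w)}.
Proof.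
apply: filterS xh_cont => w cX a t t0.
have -> : Xr a t w = x0 a.1 w a.2 0 + (Zh a t w + It t (fun s => pos (drift A G B f uh xh a.1) s w a.2 0)).
  by rewrite /Zh /innov hp1// mul1r pos1// /Xr; ring.
rewrite /za -!addrA; congr (_ + (_ + _)).
have lX c : loc1 (fun s => pos (xh c.1) s w c.2 0).
  by under eq_fun do rewrite posE; apply: loc1_cont; exact: (cX c).
have lv : loc1 (fun s => hp s * vhat s a.2 0) by apply: loc1_cont; apply: coord_within; exact: vhat_Crho2.1.
transitivity (It t (fun s => \sum_c FF a c * pos (xh c.1) s w c.2 0 + hp s * vhat s a.2 0)).
  congr (It t _); apply/funext => s'; rewrite drift_xh mxE (lin_form _ _ (fun j => pos (xh j) s' w)).
  by congr (_ + _); rewrite /det posE.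
rewrite I_D//; last by apply: loc1_sum => c; exact: loc1Z.
rewrite addrC; congr (_ + _); rewrite I_sum; last by move=> c; exact: loc1Z.
by apply: eq_bigr => c _; rewrite I_Z// It_pos.
Qed.

Lemma xh_version (a : I) t : 0 <= t -> version Pr (fil t) (Xr a t).
Proof.
move=> t0; apply: (@system_version _ _ _ Pr _ FF _ Xr za t a t0 _ xh_cont xh_path).
by move=> b s' hs'; exact: za_version.
Qed.

Lemma xh_adapted : exists y : 'I_N -> R -> T -> 'cV[R]_n,
  [/\ forall i k, mproc (fun t w => y i t w k 0), forall i t k, 0 <= t -> gmeas (fil t) (fun w => y i t w k 0) &
      {ae Pr, forall w, forall i t, 0 <= t -> xh i t w = y i t w}].
Proof.
have Gs t : <<s fil t>> `<=` measurable by exact: (filtration_measurable hW hx0).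
have Gm t1 t2 : t1 <= t2 -> <<s fil t1>> `<=` <<s fil t2>> by exact: filtration_gen_mono.
have H a : exists X', [/\ mproc X', forall t, 0 <= t -> gmeas (fil t) (X' t) &
    {ae Pr, forall w, forall t, 0 <= t -> Xr a t w = X' t w}].
  apply: (progressive_version Gm Gs (X := Xr a)) => [t t0|]; first exact: xh_version.
  by apply: filterS xh_cont => w.
pose Y a := sval (cid (H a)).
have HY a := svalP (cid (H a)).
have mY a : mproc (Y a) by case: (HY a).
have gY a t : 0 <= t -> gmeas (fil t) (Y a t) by case: (HY a) => _ h _; exact: h.
have eY a : {ae Pr, forall w, forall t, 0 <= t -> Xr a t w = Y a t w} by case: (HY a).
exists (fun i t w => \col_k Y (i, k) t w); split.
- move=> i k; rewrite (_ : (fun t w => _) = Y (i, k))//; apply/funext => t; apply/funext => w; exact: mxE.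
- by move=> i t k t0; under eq_fun do rewrite mxE; exact: gY.
- have eYY : {ae Pr, forall w, forall a t, 0 <= t -> Xr a t w = Y a t w} by apply: filter_forall.
  apply: filterS eYY => w h i t t0; apply/matrixP => k j.
  by rewrite mxE ord1 -(h (i, k))// /Xr.
Qed.

Lemma LP_ae_eq (F F' : R -> T -> R) :
  measurable_fun setT (fun z : R * T => hp z.1 * expR (- rho * z.1) * F z.1 z.2) ->
  measurable_fun setT (fun z : R * T => hp z.1 * expR (- rho * z.1) * F' z.1 z.2) ->
  {ae Pr, forall w, forall t, 0 <= t -> F t w = F' t w} ->
  (\int[(@lebesgue_measure R \x Pr)%E]_z (hp z.1 * expR (- rho * z.1) * F z.1 z.2)%:E =
   \int[(@lebesgue_measure R \x Pr)%E]_z (hp z.1 * expR (- rho * z.1) * F' z.1 z.2)%:E)%E.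
Proof.
move=> mF mF' e; apply: ae_eq_integral => //; [exact/measurable_EFinP|exact/measurable_EFinP|].
apply: filterS (ae_prod2 (@lebesgue_measure R) e) => -[t w] /= h _.
by have [t0|t0] := boolP (0 <= t); [rewrite h|rewrite /hp (negbTE t0) !mul0r].
Qed.

Lemma ito_ae (i : 'I_N) t (Y Y' : T -> 'cV[R]_n) : vmeas Y -> vmeas Y' -> {ae Pr, forall w, Y w = Y' w} ->
  ito_integral Pr (W i) sg t Y -> ito_integral Pr (W i) sg t Y'.
Proof.
move=> mY mY' e H phi ok cv.
have mS m k : measurable_fun setT (fun w => step_integral (W i) (phi m) w k 0).
  have ok' : okphi 0 t (phi m) by move=> p pm; have [/andP[? ?] ?] := ok m p pm.
  exact: (L2_step_integral hW i k ok').1.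
have mq (V : T -> 'cV[R]_n) m : vmeas V -> measurable_fun setT (fun w => (sqn (V w - step_integral (W i) (phi m) w))%:E).
  move=> mV; apply/measurable_EFinP; apply: measurable_sum => k; apply: measurable_funX.
  by under eq_fun do rewrite !mxE; exact: measurable_funB.
rewrite (_ : (fun m => _) = fun m => (\int[Pr]_w (sqn (Y w - step_integral (W i) (phi m) w))%:E)%E); first exact: H.
apply/funext => m; apply/esym; by apply: ae_eq_integral => //; [exact: mq|exact: mq|apply: filterS e => w -> _].
Qed.

Lemma drift_int_eq (v v' : 'I_N -> R -> T -> 'cV[R]_r) i t w :
  (forall s', 0 <= s' -> drift A G B f v xh i s' w = drift A G B f v' xh i s' w) ->
  \col_k (\int[leb]_(s' in `[0, t]) drift A G B f v xh i s' w k 0) =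
  \col_k (\int[leb]_(s' in `[0, t]) drift A G B f v' xh i s' w k 0).
Proof.
move=> h; apply/matrixP => k j; rewrite [LHS]mxE [RHS]mxE; apply: eq_Rintegral => s'.
by rewrite inE/= in_itv/= => /andP[s0 _]; rewrite h.
Qed.

(** The infimum ranges over adapted controls. The law is evaluated on the adapted version of [xh],
    while the state remains [xh] itself: drift and cost change only on null sets. This bounds the
    infimum from above by the cost of [uh]. *)
Lemma adapted_law : exists u : 'I_N -> R -> T -> 'cV[R]_r, [/\ admissible Pr x0 W rho u,
  state_process Pr x0 W A G B f sg u xh &
  social_cost Pr rho Q Gam Rm eta u xh = social_cost Pr rho Q Gam Rm eta uh xh].
Proof.
have [u [mu gu eu]] : exists u : 'I_N -> R -> T -> 'cV[R]_r, [/\ forall i, measurable_process (u i),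
    forall i t k, 0 <= t -> gmeas (fil t) (fun w => u i t w k 0) &
    {ae Pr, forall w, forall i t, 0 <= t -> uh i t w = u i t w}].
  have [y [my gy ey]] := xh_adapted; exists (law y); split.
  - move=> i; apply: law_meas => k; apply: (@measurable_funS _ _ _ _ setT) => //; exact: my.
  - move=> i t k t0; have -> : (fun w => law y i t w k 0) = _ := funext (fun w => lawE y i t w k).
    apply: gmeas_sum => l; apply: gmeasZ; apply: gmeasD; last exact: gmeas_cst.
    apply: gmeasD; last exact: gmeas_cst.
    by apply: gmeas_sum => j; apply: gmeasZ; exact: gy.
  - by apply: filterS ey => w h i t t0; rewrite /decentralized_law h.
have ed : {ae Pr, forall w, forall i t, 0 <= t -> drift A G B f uh xh i t w = drift A G B f u xh i t w}.
  by apply: filterS eu => w h i t t0; rewrite /drift h.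
have [mx cx dx ix] := hxh.
have mexp : measurable_fun setT (fun z : R * T => hp z.1 * expR (- rho * z.1)) by apply: (measurableT_comp (exp_hp_meas rho)).
have msq (v : 'I_N -> R -> T -> 'cV[R]_r) i : measurable_process (v i) ->
    measurable_fun setT (fun z : R * T => hp z.1 * expR (- rho * z.1) * sqn (v i z.1 z.2)).
  move=> mv; rewrite (_ : (fun z => _) = fun z : R * T => expR (- rho * z.1) * (hp z.1 * sqn (v i z.1 z.2))).
    by apply: measurable_funM; [apply: (measurableT_comp (measurable_expRZ _))|exact: mproc_pos_sqn].
  by apply/funext => z; ring.
have mdr (v : 'I_N -> R -> T -> 'cV[R]_r) i k : measurable_process (v i) -> mproc (fun t w => pos (drift A G B f v xh i) t w k 0).
  move=> mv; rewrite (_ : (fun t w => _) = fun t w => \sum_(l < n) A k l * pos (xh i) t w l 0 +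
     (\sum_(l < n) G k l * (N%:R^-1 * \sum_(j < N) pos (xh j) t w l 0) + (\sum_(l < r) B k l * pos (v i) t w l 0 + hp t * f t k 0))).
    apply: mprocD; first by apply: mproc_sum => l; apply: mprocZ; exact: mproc_pos.
    apply: mprocD; first by apply: mproc_sum => l; apply: mprocZ; apply: mprocZ; apply: mproc_sum => j; exact: mproc_pos.
    apply: mprocD; first by apply: mproc_sum => l; apply: mprocZ; exact: mproc_pos.
    by apply: mproc_det; exact: within_coord_meas hf.1.
  apply/funext => t; apply/funext => w; rewrite drift_gen [LHS]mxE [X in X + _ = _]mxE [X in _ + X = _]mxE -addrA.
  congr (_ + (_ + (_ + _))); last (by rewrite /det posE); rewrite [LHS]mxE //.
  by apply: eq_bigr => l _; rewrite /mean mxE summxE.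
have sub3 (a b c : 'cV[R]_n) k : (a - b - c) k 0 = a k 0 - b k 0 - c k 0 by rewrite !mxE.
have hx' : state_process Pr x0 W A G B f sg u xh.
  split; [exact: mx|exact: cx| |].
    apply: filterS2 dx ed => w dx ed i t k t0.
    apply: eq_integrable (dx i t k t0) => // s'; rewrite inE/= in_itv/= => /andP[s0 _]; by rewrite ed.
  move=> i t t0; have colE (v : 'I_N -> R -> T -> 'cV[R]_r) w k : (\col_l (\int[leb]_(s' in `[0, t]) drift A G B f v xh i s' w l 0)) k 0 =
      It t (fun s' => pos (drift A G B f v xh i) s' w k 0).
    by rewrite mxE It_pos It_restrict.
  have mV (v : 'I_N -> R -> T -> 'cV[R]_r) : measurable_process (v i) -> vmeas (fun w => xh i t w - x0 i w -
      \col_k (\int[leb]_(s' in `[0, t]) drift A G B f v xh i s' w k 0)).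
    move=> mv k; rewrite (_ : (fun w => _) = fun w => pos (xh i) t w k 0 - x0 i w k 0 - It t (fun s' => pos (drift A G B f v xh i) s' w k 0)).
      apply: measurable_funB; last exact: (mproc1 t (mproc_It (mdr v i k mv))).
      by apply: measurable_funB => //; exact: (mproc1 t (mproc_pos k (mx i))).
    by apply/funext => w; rewrite sub3 colE pos1.
  apply: (ito_ae (mV _ (uh_meas i)) (mV _ (mu i)) _ (ix i t t0)).
  apply: filterS ed => w ed.
  by rewrite (drift_int_eq t (fun s' s0 => ed i s' s0)).
exists u; split; [|exact: hx'|].
- move=> i; split => //.
    by move=> t t0 k E mE; exact: gu.
  rewrite running_LP; [|exact: mproc_pos_sqn|by move=> *; exact: sqn_ge0].
  rewrite -(LP_ae_eq (F := fun t w => sqn (uh i t w)) (F' := fun t w => sqn (u i t w))); [|exact: msq (uh_meas i)|exact: msq (mu i)|]; last first.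
    by apply: filterS eu => w h t t0; rewrite h.
  have hU := uh_L2r i.
  have [i1 _] := rint_dot hU hU.
  have i2 : rintg Pr rho (fun t w => sqn (uh i t w)).
    by apply: rintg_eq i1 => t w t0; rewrite -sqnE pos1.
  by rewrite (intE_EFin i2) ltry.
- rewrite /social_cost; apply: eq_bigr => i _; rewrite (agent_cost_LP hx' mu) (agent_cost_LP hxh uh_meas).
  apply/esym; apply: LP_ae_eq.
  + by apply: measurable_funM => //; exact: (mproc_run hxh uh_meas).
  + by apply: measurable_funM => //; exact: (mproc_run hx' mu).
  + by apply: filterS eu => w h t t0; rewrite /run /run_cost !pos1// h.
Qed.
End Adapted.

Lemma social_gap X1 c1 C1 X2 c2 C2 cR CB CM kp M :
  lyap_form (A - (rho / 2)%:M) sQ X1 c1 C1 ->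
  lyap_form (A + G - (rho / 2)%:M) (sQ *m (1%:M - Gam)) X2 c2 C2 ->
  0 < cR -> (forall z, cR * sqn z <= qform Rm z) -> (forall z, sqn (B *m z) <= CB * sqn z) ->
  (forall z, sqn (gap_mx G Gam Q P *m z) <= CM * sqn z) ->
  0 < kp -> kp * C2 <= c2 -> kp * C2 * CB <= c2 * cR ->
  vL2r Pr rho mean_err -> N%:R * (kp^-1 * CM * iprv Pr rho mean_err mean_err) <= M ->
  (`| (N%:R^-1)%:E * social_cost Pr rho Q Gam Rm eta uh xh
     - (N%:R^-1)%:E * inf_social_cost Pr x0 W rho A G Gam Q B Rm eta f sg N | <= (M / N%:R)%:E)%E.
Proof.
move=> hX1 hX2 cR0 hcR hCB hCM kp0 kp1 kp2 eL eM.
have rh i : rintg Pr rho (run uh xh i) by apply: (run_L2r xhL); exact: uh_L2r.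
pose Jh := \sum_(i < N) rint Pr rho (run uh xh i).
have hJ : social_cost Pr rho Q Gam Rm eta uh xh = Jh%:E.
  by rewrite /social_cost /Jh -sumEFin; apply: eq_bigr => i _; exact: (agent_cost_rint hxh uh_meas).
have up : (inf_social_cost Pr x0 W rho A G Gam Q B Rm eta f sg N <= Jh%:E)%E.
  have [u [au su eu]] := adapted_law.
  rewrite -hJ -eu; apply: ereal_inf_lbound; exists u, xh; split; [exact: au|exact: su|reflexivity].
have lo : ((Jh - M)%:E <= inf_social_cost Pr x0 W rho A G Gam Q B Rm eta f sg N)%E.
  apply: le_ereal_inf_tmp => _ [u [x [au sx ->]]].
  have mu i : measurable_process (u i) by have [] := au i.
  (* If one agent has infinite cost the lower bound is trivial: the other costs are nonnegative, so
     the sum is infinite. *)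
  have [fin|] := pselect (forall i, (agent_cost Pr rho Q Gam Rm eta u x i < +oo)%E).
    have rx i : rintg Pr rho (run u x i) by apply: (agent_cost_fin sx mu); exact: fin.
    have -> : social_cost Pr rho Q Gam Rm eta u x = (\sum_(i < N) rint Pr rho (run u x i))%:E.
      by rewrite /social_cost -sumEFin; apply: eq_bigr => i _; exact: (agent_cost_rint sx mu).
    have h := cost_lower au sx fin hX1 hX2 cR0 hcR hCB hCM kp0 kp1 kp2 eL.
    by rewrite lee_fin; apply: (le_trans _ h); rewrite lerD2l lerN2.
  move/existsNP => [i /negP]; rewrite -leNgt leye_eq => /eqP hi.
  rewrite /social_cost (bigD1 i)//= hi addye ?leey// -ltNye.
  by apply: (@lt_le_trans _ _ 0%E) => //; apply: sume_ge0 => j _; exact: (agent_cost_ge0 sx mu).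
rewrite hJ; case: (inf_social_cost _ _ _ _ _ _ _ _ _ _ _ _ _ _) up lo => [m| |] //; rewrite !lee_fin => up lo.
rewrite -mulrBr normrM [X in X * _]ger0_norm ?invr_ge0// [X in X <= _]mulrC ler_wpM2r ?invr_ge0//.
by rewrite ger0_norm ?subr_ge0// lerBlDr -lerBlDl.
Qed.

End Comp.
End Agents.
End Est.

Theorem mainTheorem7 (K : realType) (d : measure_display)
  (T : measurableType d) (Pr : probability T K)
  (n r : nat) (rho : K)
  (A G Gam Q : 'M[K]_n) (B : 'M[K]_(n, r)) (R : 'M[K]_r) (eta : 'cV[K]_n)
  (f sigma : K -> 'cV[K]_n)
  (x0 : nat -> T -> 'cV[K]_n) (xbar0 : 'cV[K]_n) (W : nat -> K -> T -> K)
  (C0 : K)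
  (sqrtQ P Pi : 'M[K]_n) (s xbar : K -> 'cV[K]_n)
  (xhat : forall N : nat, 'I_N -> K -> T -> 'cV[K]_n)
  (hrho : 0 < rho) (hQsym : Q^T = Q) (hR : posdefmx R)
  (hf : Crho2 rho f) (hsigma : Crho2 rho sigma)
  (hW : forall i, brownian_motion Pr (W i))
  (hWindep : mutually_independent Pr (fun i => sigma_rv `[0, +oo[ (W i)))
  (hx0 : forall i (k : 'I_n), measurable_fun setT (fun w => x0 i w k 0))
  (hx0indep : mutually_independent Pr (sigma_init x0))
  (hx0mean : forall i (k : 'I_n),
    ('E_Pr[fun w => x0 i w k 0%R] = (xbar0 k 0%R)%:E)%E)
  (hx0var : forall i, (\int[Pr]_w (sqn (x0 i w))%:E < C0%:E)%E)
  (hx0W : independent2 Pr (<<s \bigcup_i sigma_init x0 i >>)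
                          (<<s \bigcup_i sigma_rv `[0, +oo[ (W i) >>))
  (hstab1 : stabilizable (A - (rho / 2)%:M) B)
  (hstab2 : stabilizable (A + G - (rho / 2)%:M) B)
  (hQ : possemidefmx Q) (hsqrtQ : is_sqrtmx Q sqrtQ)
  (hobs1 : observable (A - (rho / 2)%:M) sqrtQ)
  (hobs2 : observable (A + G - (rho / 2)%:M) (sqrtQ *m (1%:M - Gam)))
  (hP : posdefmx P) (hPric : riccati rho A B R Q P)
  (hHur : hurwitz (A - B *m invmx R *m B^T *m P + G - (rho / 2)%:M))
  (hPi : posdefmx Pi)
  (hPiric : riccati rho (A + G) B R ((1%:M - Gam)^T *m Q *m (1%:M - Gam)) Pi)
  (hs : Crho2 rho s)
  (hsode : forall t : K, 0 < t -> derivable s t 1 /\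
    rho *: s t = 'D_1 s t + (A + G - B *m invmx R *m B^T *m Pi)^T *m s t
                 + Pi *m f t - (Q *m eta - Gam^T *m Q *m eta))
  (hxbar : Crho2 rho xbar) (hxbar0 : xbar 0 = xbar0)
  (hxbarode : forall t : K, 0 < t -> derivable xbar t 1 /\
    'D_1 xbar t = (A + G) *m xbar t
                 - B *m invmx R *m B^T *m (Pi *m xbar t + s t) + f t)
  (hxhat : forall N, state_process Pr x0 W A G B f sigma
     (decentralized_law B R P Pi xbar s (@xhat N)) (@xhat N)) :
  exists C : K, \forall N \near \oo,
    (`| (N%:R^-1)%:E * social_cost Pr rho Q Gam R eta
             (decentralized_law B R P Pi xbar s (@xhat N)) (@xhat N)
        - (N%:R^-1)%:E *
            inf_social_cost Pr x0 W rho A G Gam Q B R eta f sigma N |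
      <= (C / Num.sqrt N%:R)%:E)%E.
Proof.
have [Xe [ce [Ce hXe]]] : exists X c C, lyap_form (A - BRB B R *m P + G - (rho / 2)%:M) (0 : 'M[K]_n) X c C.
  exact: hurwitz_lyap.
have [Xc [cc [Cc hXc]]] := closed_lyap hR hsqrtQ hP hPric hobs1.
have [X1 [c1 [C1 hX1]]] := observable_lyap hobs1.
have [X2 [c2 [C2 hX2]]] := observable_lyap hobs2.
have [CX CX0 HCX] := qform_bound Xe.
have [cR cR0 hcR] := posdef_lb hR.
have [CB CB0 hCB] := mx_bound B.
have [CM CM0 hCM] := mx_bound (gap_mx G Gam Q P).
have [_ ce0 _ _] := hXe; have [_ c20 C20 _] := hX2.
have C0_ge0 : 0 <= C0 by apply: le_trans (x0_sqn_le hx0 hx0var 0%N); apply: intE_ge0 => w; exact: sqn_ge0.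
have cBR : 0 <= CB / cR by rewrite divr_ge0// ltW.
(* [kp] = c2 / den has to satisfy kp C2 <= c2 and kp C2 CB <= c2 cR; each of the last two summands
   of [den] takes care of one of them, and the summand 1 keeps [den] positive. *)
pose den := 1 + C2 + C2 * (CB / cR).
have den1 : 1 <= den by rewrite /den -addrA lerDl addr_ge0// mulr_ge0.
have den0 : 0 < den by apply: lt_le_trans den1.
pose kp := c2 / den; have kp0 : 0 < kp by rewrite divr_gt0.
have q0 : 0 <= C2 * (CB / cR) by rewrite mulr_ge0.
have kp1 : kp * C2 <= c2.
  rewrite /kp mulrAC ler_pdivrMr// ler_wpM2l ?(ltW c20)// /den.
  by move: q0; move: (C2 * _) => y; lra.
have kp2 : kp * C2 * CB <= c2 * cR.
  have -> : kp * C2 * CB = c2 * (C2 * CB) / den by rewrite /kp; ring.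
  rewrite ler_pdivrMr// -mulrA ler_wpM2l ?(ltW c20)//.
  have -> : C2 * CB = cR * (C2 * (CB / cR)) by field; rewrite gt_eqF.
  rewrite ler_wpM2l ?(ltW cR0)// /den.
  by move: q0 C20; move: (C2 * _) => y; lra.
(* N times the bound of [mean_err_bound]; the factor N of the social cost cancels the 1 / N, so that
   [M] is independent of N. *)
pose D := CX * C0 + normal_m2 * CX * sigma_energy rho sigma.
have D0 : 0 <= D by rewrite addr_ge0 ?mulr_ge0 ?normal_m2_ge0 ?sigma_energy_ge0.
pose M := kp^-1 * CM * (D / ce).
have M0 : 0 <= M by rewrite !mulr_ge0 ?invr_ge0 ?(ltW kp0) ?(ltW ce0).
exists M; exists 1%N => // N /= N0.
have [eL eB] := mean_err_bound hrho hf hsigma hW hWindep hx0 hx0indep hx0mean hx0var hx0W hs hxbar hxbar0 hxbarode N0 (hxhat N) hXe CX0 HCX.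
have xhL := xh_L2r hrho hf hsigma hW hWindep hx0 hx0indep hx0mean hx0var hx0W hs hxbar hxbar0 hxbarode N0 (hxhat N) hXe hXc.
have NN : (0 : K) < N%:R by rewrite ltr0n.
have eM : N%:R * (kp^-1 * CM * iprv Pr rho (mean_err xbar (@xhat N)) (mean_err xbar (@xhat N))) <= M.
  rewrite mulrCA /M ler_wpM2l ?mulr_ge0 ?invr_ge0 ?(ltW kp0)// ler_pdivlMr// -mulrA mulrC -ler_pdivlMr//.
  by rewrite mulrC.
apply: le_trans (social_gap hrho hf hsigma hW hWindep hx0 hx0var hx0W hs hxbar hxbar0 hxbarode N0 (hxhat N)
  hQsym hR hsqrtQ hP hPric hPi hPiric hsode xhL hX1 hX2 cR0 hcR hCB hCM kp0 kp1 kp2 eL eM) _.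
have N1 : 1 <= (N%:R : K) by rewrite ler1n.
(* The gap is at most M / N, and sqrt N <= N for N >= 1. *)
rewrite lee_fin ler_wpM2l// lef_pV2 ?posrE ?sqrtr_gt0//.
rewrite -[leRHS](ger0_norm (ltW NN)) -sqrtr_sqr ler_wsqrtr// expr2 ler_peMr// ltW.
Qed.
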